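(* (A) If $\omega\in\mathcal{I}\cup\mathcal{R}$, then $\mathcal{C}^1(\omega^\star)\subset\bigcap_{0<p<\infty}A^p_\omega$. (B) If $\omega\in\mathcal{I}\cup\mathcal{R}$, then $\mathrm{BMOA}\subset\mathcal{C}^1(\omega^\star)\subset\mathcal{B}$. (C) If $\omega\in\mathcal{R}$, then $\mathcal{C}^1(\omega^\star)=\mathcal{B}$. (D) If $\omega\in\mathcal{I}$, then $\mathcal{C}^1(\omega^\star)\subsetneq\mathcal{B}$. (E) If $\omega\in\mathcal{I}$ and both $\omega(r)$ and $\frac{\psi_\omega(r)}{1-r}$ are essentially increasing on $[0,1)$, then $\mathrm{BMOA}\subsetneq\mathcal{C}^1(\omega^\star)$.
   Context: $\mathbb{D}$ is the open unit disc, $\mathbb{T}$ its boundary, $\mathcal{H}(\mathbb{D})$ the set of analytic functions in $\mathbb{D}$, $dA=\frac{dx\,dy}{\pi}$. A weight is a function $\omega:\mathbb{D}\to(0,\infty)$ integrable over $\mathbb{D}$; it is radial if $\omega(z)=\omega(|z|)$. For a radial weight put $\psi_\omega(r)=\frac{1}{\omega(r)}\int_r^1\omega(s)\,ds$. $\mathcal{R}$: continuous radial weights for which there is $C\ge1$ with $C^{-1}(1-r)\le\psi_\omega(r)\le C(1-r)$ for all $0\le r<1$. $\mathcal{I}$: continuous radial weights with $\lim_{r\to1^-}\frac{\psi_\omega(r)}{1-r}=\infty$. A function $h:[0,1)\to(0,\infty)$ is essentially increasing on $[0,1)$ if there is $C>0$ with $h(r)\le Ch(t)$ for all $0\le r\le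 t<1$. $A^p_\omega$ consists of $f\in\mathcal{H}(\mathbb{D})$ with $\int_{\mathbb{D}}|f|^p\omega\,dA<\infty$. $\omega^\star(z)=\int_{|z|}^1\omega(s)\log\frac{s}{|z|}\,s\,ds$, $z\in\mathbb{D}\setminus\{0\}$. For an interval $I\subset\mathbb{T}$ of Lebesgue measure $|I|$, $S(I)=\{re^{it}\in\mathbb{D}:e^{it}\in I,\ 1-|I|\le r<1\}$, and $\omega(E)=\int_E\omega\,dA$. $\mathcal{C}^1(\omega^\star)$ consists of $g\in\mathcal{H}(\mathbb{D})$ with $\sup_{I\subset\mathbb{T}}\frac{\int_{S(I)}|g'|^2\omega^\star\,dA}{\omega(S(I))}<\infty$. $\mathcal{B}$ (Bloch space) consists of $f\in\mathcal{H}(\mathbb{D})$ with $\sup_{z\in\mathbb{D}}|f'(z)|(1-|z|^2)<\infty$. $\mathrm{BMOA}$ is the space of functions in the Hardy space $H^1$ with bounded mean oscillation on $\mathbb{T}$; equivalently, of $g\in\mathcal{H}(\mathbb{D})$ with $\sup_{I\subset\mathbb{T}}\frac{1}{|I|}\int_{S(I)}|g'(z)|^2(1-|z|^2)\,dA(z)<\infty$. *)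

(* Defs.v *)
From HB Require Import structures.
From mathcomp Require Import all_boot all_order all_algebra.
From mathcomp Require Import all_classical all_reals all_analysis.
From mathcomp Require Export complex.

Set Implicit Arguments.
Unset Strict Implicit.
Unset Printing Implicit Defensive.

Import Order.TTheory GRing.Theory Num.Theory.
Import numFieldNormedType.Exports.
Import ComplexField.

Local Open Scope classical_set_scope.
Local Open Scope ring_scope.
Local Open Scope complex_scope.

Local Notation planeLebesgue R := (@lebesgue_measure R \x @lebesgue_measure R)%E.

(* It is the regular algebra R[i]^o, not R[i] itself, that carries the normed
   module structure (hence the topology) given by the modulus. *)
Definition cplane (R : realType) : normedModType R[i] := R[i]^o.

Section DiscAndArea.
Variable R : realType.
Local Notation C := (cplane R).

Definition cmod (z : C) : R := ComplexField.Normc.normc (z : R[i]).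

Definition of_plane (p : R * R) : C := (p.1 +i* p.2)%C.

Definition creal (r : R) : C := r%:C.

Definition cpolar (r t : R) : C := ((r * cos t) +i* (r * sin t))%C.

Definition disc : set C := [set z | cmod z < 1].

(* Integral of a nonnegative function against dA = dx dy / pi *)
Definition area_integral (E : set C) (F : C -> R) : \bar R :=
  ((pi^-1)%:E * \int[planeLebesgue R]_(p in of_plane @^-1` E) (F (of_plane p))%:E)%E.

(* Only the values on the disc are relevant: the values of a function of type
   C -> C outside the disc are unconstrained. *)
Definition analytic (f : C -> C) : Prop :=
  forall z, disc z -> derivable (f : R[i]^o -> C) z 1.

Definition cderiv (f : C -> C) : C -> C := derive1 (f : R[i]^o -> C).

(* The arc {e^(it) : a <= t <= b}, of length b - a in (0, 2 pi]. Including or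
   omitting endpoints only changes the Carleson squares by radial segments,
   which are Lebesgue-null. *)
Definition is_arc (I : R * R) : Prop := I.1 < I.2 <= I.1 + 2 * pi.

Definition arc_length (I : R * R) : R := I.2 - I.1.

Definition carleson_square (I : R * R) : set C :=
  [set z | exists r t, [/\ 0 <= r < 1, 1 - arc_length I <= r,
                           I.1 <= t <= I.2 & z = cpolar r t]].

End DiscAndArea.

Section Weights.
Variable R : realType.
Local Notation C := (cplane R).
Implicit Types (omega : C -> R) (f g : C -> C).

Definition weight omega : Prop :=
  (forall z, disc z -> 0 < omega z) /\
  (planeLebesgue R).-integrable (@of_plane R @^-1` @disc R)
    (fun p => (omega (of_plane p))%:E).

Definition radial omega : Prop :=
  forall z, disc z -> omega z = omega (creal (cmod z)).

Definition continuous_radial_weight omega : Prop :=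
  [/\ weight omega, radial omega & {in @disc R, continuous omega}].

(* For a continuous weight the integral is finite, so nothing is lost by taking
   it real-valued; the same applies to star below. *)
Definition psi omega (r : R) : R :=
  (omega (creal r))^-1 *
  \int[lebesgue_measure]_(s in `[r, 1[) omega (creal s).

Definition regular_weight : set (C -> R) :=
  [set omega | continuous_radial_weight omega /\
    exists2 K : R, 1 <= K & forall r, 0 <= r < 1 ->
      K^-1 * (1 - r) <= psi omega r <= K * (1 - r)].

Definition rapidly_increasing_weight : set (C -> R) :=
  [set omega | continuous_radial_weight omega /\
    psi omega r / (1 - r) @[r --> 1^'-] --> +oo].

Definition essentially_increasing (h : R -> R) : Prop :=
  exists2 K : R, 0 < K & forall r t, 0 <= r -> r <= t -> t < 1 -> h r <= K * h t.

(* At z = 0, where omega-star is undefined, this takes a junk value; it is only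
   ever integrated against area. *)
Definition star omega (z : C) : R :=
  \int[lebesgue_measure]_(s in `[cmod z, 1[)
    (omega (creal s) * ln (s / cmod z) * s).

Definition bergman (p : R) omega : set (C -> C) :=
  [set f | analytic f /\
    (area_integral (@disc R) (fun z => cmod (f z) `^ p * omega z)%R < +oo)%E].

Definition weighted_area omega (E : set C) : \bar R := area_integral E omega.

Definition C1star omega : set (C -> C) :=
  [set g | analytic g /\
    (ereal_sup [set area_integral (carleson_square I)
                      (fun z => cmod (cderiv g z) ^+ 2 * star omega z)%R
                    / weighted_area omega (carleson_square I)
               | I in @is_arc R] < +oo)%E].

Definition bloch : set (C -> C) :=
  [set f | analytic f /\
    has_ubound [set cmod (cderiv f z) * (1 - cmod z ^+ 2) | z in @disc R]].

(* BMOA, through the Carleson measure |g'|^2 (1 - |z|^2) dA rather than through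
   the mean oscillation of the boundary values of an H^1 function. *)
Definition BMOA : set (C -> C) :=
  [set g | analytic g /\
    (ereal_sup [set ((arc_length I)^-1)%:E *
                    area_integral (carleson_square I)
                      (fun z => cmod (cderiv g z) ^+ 2 * (1 - cmod z ^+ 2))%R
               | I in @is_arc R] < +oo)%E].

End Weights.

(* Main.v *)
Require Import Defs.
From mathcomp Require Import all_boot all_order all_algebra.
From mathcomp Require Import all_classical all_reals all_analysis.
From mathcomp Require Import measurable_realfun ring lra zify.

(** The theorem compares a Carleson condition for [|g'|^2] against the star weight
    with the Bloch condition, with BMOA and with integrability. Throughout,
    [w] is the radial profile of the weight and [W r] its integral over [[r, 1)].

    For weights in either class [w (1 - r) <= K W], so that [W] is doubling
    ([profile_le_tail], [tail_doubling]). Hence the star weight is comparable to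
    [(1 - r) W] ([star_le], [star_ge]) and the weight of a Carleson square to
    [|I| W (1 - |I|)]; all conditions are then rewritten in polar coordinates
    ([C1starP], [BMOAP]). As [W] decreases, the BMOA condition is the stronger
    one ([BMOA_C1star]). Testing a Carleson condition on hyperbolic discs, the
    sub-mean value property of [|g'|^2] gives the Bloch condition
    ([C1star_bloch]); it comes from Cauchy's formula, which is derived from
    Goursat's lemma applied in polar coordinates ([goursat], [cauchy_formula]).
    For regular weights a Bloch function satisfies [|g'|^2 (1 - r) W <= M w]
    pointwise, and this integrates to the Carleson condition.

    The strict inclusions are witnessed by lacunary series [sum a k z^(q^k)] with
    a large ratio, for which a single term of the derivative dominates on the
    annulus [1 - |z| ~ q^(-k)] ([dlacunary_lower]). With [a k = 1] the series is
    Bloch, but for a rapidly increasing weight [W] varies so slowly that its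
    Carleson integrals are too large ([rapid_bloch_not_C1star]). With
    [a k ^ 2 = (1 - r) / psi r] at [r = 1 - q^(-k)] it satisfies the Carleson
    condition while the sum of the [a k ^ 2] diverges
    ([rapid_C1star_not_BMOA]).

    For the inclusion in the Bergman spaces the mean oscillation of [g] on an arc of
    length [h] of the circle of radius [rho] is estimated by a Green formula
    localised with a cut-off ([local_oscillation]), started at the radius
    [1 - h]. The area term is an integral of [(1 - r) |g'|^2]; compared with the
    Carleson measure it misses a factor [W], and an integration by parts shows
    that restoring it costs only [1 + ln (W 0 / W rho)] ([carleson_log],
    [circle_oscillation]). A John-Nirenberg induction over dyadic arcs turns
    square oscillations into oscillations of any even order
    ([dyadic_moment]), so the moments of order [2 n] on the circle are at most
    a constant times the power [n] of [1 + ln (W 0 / W rho)] ([circle_moment]).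
    This is at most a multiple of [(W 0 / W rho)^(1/2)], and
    [w W^(-1/2) = (- 2 W^(1/2))'] is integrable ([weighted_growth_integral],
    [bergman_of_moments]). *)

Set Implicit Arguments.
Unset Strict Implicit.
Unset Printing Implicit Defensive.

Import Order.TTheory GRing.Theory Num.Theory.
Import numFieldNormedType.Exports.
Import ComplexField.

Local Open Scope classical_set_scope.
Local Open Scope ring_scope.
Local Notation Re := complex.Re.
Local Notation Im := complex.Im.

(** * Complex numbers and complex differentiability *)

Section ComplexModulus.
Variable R : realType.
Local Notation C := R[i].
Implicit Types (x y z : C).

Lemma cmod_ge0 z : 0 <= cmod z.
Proof. by case: z => a b; rewrite /cmod /= sqrtr_ge0. Qed.

Lemma cmodM x y : cmod (x * y) = cmod x * cmod y.
Proof. exact: Normc.normcM. Qed.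

Lemma cmodD_le x y : cmod (x + y) <= cmod x + cmod y.
Proof. exact: le_normcD. Qed.

Lemma cmodN x : cmod (- x) = cmod x.
Proof. exact: normcN. Qed.

Lemma cmodV x : cmod x^-1 = (cmod x)^-1.
Proof. exact: Normc.normcV. Qed.

Lemma cmod_norm (z : cplane R) : `|z| = (cmod z)%:C%C.
Proof. by []. Qed.

Lemma cmod0 : cmod (0 : C) = 0.
Proof. exact: Normc.normc0. Qed.

Lemma cmod1 : cmod (1 : C) = 1.
Proof. exact: Normc.normc1. Qed.

Lemma cmodX x n : cmod (x ^+ n) = cmod x ^+ n.
Proof. by elim: n => [|n ih]; rewrite ?expr0 ?cmod1 // !exprS cmodM ih. Qed.

Lemma cmod_eq0 z : (cmod z == 0) = (z == 0).
Proof.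
apply/eqP/eqP => [/Normc.eq0_normc//|->]; exact: cmod0.
Qed.

Lemma cmod_gt0 z : (0 < cmod z) = (z != 0).
Proof. by rewrite lt_neqAle cmod_ge0 andbT eq_sym cmod_eq0. Qed.

Lemma cmodB x y : cmod (x - y) = cmod (y - x).
Proof. by rewrite -cmodN opprB. Qed.

Lemma cmodB_le x y : cmod (x - y) <= cmod x + cmod y.
Proof. by rewrite (le_trans (cmodD_le _ _)) // cmodN. Qed.

Lemma cmod_lerB x y : cmod x - cmod y <= cmod (x - y).
Proof. by rewrite lerBlDr (le_trans _ (cmodD_le _ _)) // subrK. Qed.

Lemma cmod_sqr z : cmod z ^+ 2 = Re z ^+ 2 + Im z ^+ 2.
Proof. by case: z => a b; rewrite /cmod /= sqr_sqrtr // addr_ge0 // sqr_ge0. Qed.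

Lemma cmod_real (r : R) : cmod (r%:C%C : C) = `|r|.
Proof. by rewrite /cmod /= expr0n /= addr0 sqrtr_sqr. Qed.

Lemma norm_Re_cmod z : `|Re z| <= cmod z.
Proof.
by rewrite -sqrtr_sqr; case: z => a b; rewrite /cmod /= ler_wsqrtr // lerDl sqr_ge0.
Qed.

Lemma norm_Im_cmod z : `|Im z| <= cmod z.
Proof.
by rewrite -sqrtr_sqr; case: z => a b; rewrite /cmod /= ler_wsqrtr // lerDr sqr_ge0.
Qed.

Lemma cmod_le_ReIm z : cmod z <= `|Re z| + `|Im z|.
Proof.
rewrite -(ler_pXn2r (n := 2)) ?nnegrE ?cmod_ge0 ?addr_ge0 //.
rewrite cmod_sqr sqrrD !real_normK ?num_real // addrAC lerDl.
by rewrite mulrn_wge0 // mulr_ge0.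
Qed.

Lemma cReM x y : Re (x * y) = Re x * Re y - Im x * Im y.
Proof. by case: x y => [a b] [c d]. Qed.

Lemma cImM x y : Im (x * y) = Re x * Im y + Im x * Re y.
Proof. by case: x y => [a b] [c d]. Qed.

Lemma cReD x y : Re (x + y) = Re x + Re y.
Proof. by case: x y => [a b] [c d]. Qed.

Lemma cImD x y : Im (x + y) = Im x + Im y.
Proof. by case: x y => [a b] [c d]. Qed.

Lemma cReN x : Re (- x) = - Re x.
Proof. by case: x => [a b]. Qed.

Lemma cImN x : Im (- x) = - Im x.
Proof. by case: x => [a b]. Qed.

Lemma cReB x y : Re (x - y) = Re x - Re y.
Proof. by rewrite cReD cReN. Qed.

Lemma cImB x y : Im (x - y) = Im x - Im y.
Proof. by rewrite cImD cImN. Qed.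

Lemma complex_ext x y : Re x = Re y -> Im x = Im y -> x = y.
Proof. by case: x y => [a b] [c d] /= -> ->. Qed.

Lemma cmod_cpolar (r t : R) : 0 <= r -> cmod (cpolar r t) = r.
Proof.
move=> r0; rewrite /cmod /= !exprMn -mulrDr cos2Dsin2 mulr1 sqrtr_sqr ger0_norm //.
Qed.

End ComplexModulus.

Section ComplexDerivative.
Variable R : realType.
Local Notation C := R[i].
Implicit Types (f g : C -> C) (z d : C).

(** Complex differentiability stated with the real-valued modulus, so that
    estimates stay in [R] instead of the ordered subset of [R[i]]. *)
Definition cdiff_at f z d := forall e : R, 0 < e -> exists2 k : R, 0 < k &
  forall h : C, cmod h < k -> cmod (f (z + h) - f z - d * h) <= e * cmod h.

Lemma cdiff_atP f z d :
  cdiff_at f z d <-> is_derive (z : R[i]^o) (1 : R[i]^o) (f : R[i]^o -> R[i]^o) (d : R[i]^o).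
Proof.
split=> [fd|[fd fE] e e0]; last first.
  have : h^-1 *: ((f : R[i]^o -> R[i]^o) (h *: 1 + z) - f z) @[h --> (0:R[i]^o)^'] --> (d : R[i]^o).
    by rewrite -fE; exact: fd.
  move/cvgrPdist_le => /(_ e%:C%C); rewrite ltcR => /(_ e0).
  rewrite near_withinE => /nbhs_normP[k /= k0 kP].
  have [k' k'0 kk] : exists2 k' : R, 0 < k' & k = k'%:C%C.
    move: k0; rewrite ltcE /= => /andP[/eqP im0 re0]; exists (Re k) => //.
    by case: k im0 {re0 kP} => a b /= ->.
  exists k' => // h hk.
  have [->|h0] := eqVneq h 0; first by rewrite addr0 subrr mulr0 subrr cmod0 mulr0.
  have /kP/(_ h0) : ball_ Num.Def.normr (0 : R[i]^o) k h.
    by rewrite /ball_ /= sub0r normrN kk [`|_|]cmod_norm ltcR.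
  rewrite [`|_|]cmod_norm lecR.
  have -> : d - h^-1 *: ((f : R[i]^o -> R[i]^o) (h *: 1 + z) - f z) =
            - (h^-1 * (f (z + h) - f z - d * h)).
    by rewrite /GRing.scale /= mulr1 [h + z]addrC; field.
  by rewrite cmodN cmodM cmodV ler_pdivrMl ?cmod_gt0 // [cmod h * _]mulrC.
have H : h^-1 *: ((f : R[i]^o -> R[i]^o) (h *: 1 + z) - f z) @[h --> (0:R[i]^o)^'] --> (d : R[i]^o).
  apply/cvgrPdist_le => /= e e0.
  have [e' e'0 ee] : exists2 e' : R, 0 < e' & e = e'%:C%C.
    move: e0; rewrite ltcE /= => /andP[/eqP im0 re0]; exists (Re e) => //.
    by case: e im0 {re0} => a b /= ->.
  have [k k0 kP] := fd _ e'0.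
  rewrite near_withinE; apply/(@nbhs_normP R[i] R[i]^o); exists k%:C%C; first by rewrite /= ltcR.
  move=> h; rewrite /ball_ /= sub0r normrN [`|_|]cmod_norm ltcR => hk h0.
  rewrite [`|_|]cmod_norm ee lecR.
  have -> : d - h^-1 *: ((f : R[i]^o -> R[i]^o) (h *: 1 + z) - f z) =
            - (h^-1 * (f (z + h) - f z - d * h)).
    by rewrite /GRing.scale /= mulr1 [h + z]addrC; field.
  rewrite cmodN cmodM cmodV ler_pdivrMl ?cmod_gt0 // [cmod h * _]mulrC.
  exact: kP.
split; first by apply/cvg_ex; exists d.
exact/cvg_lim.
Qed.

Lemma cdiff_derivable f z d : cdiff_at f z d ->
  derivable (f : R[i]^o -> cplane R) z 1 /\ cderiv (f : cplane R -> cplane R) z = d.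
Proof.
by move/cdiff_atP => [fd fE]; split; [exact: fd|rewrite /cderiv derive1E; exact: fE].
Qed.

Lemma analytic_cdiff f z : analytic (f : cplane R -> cplane R) -> cmod z < 1 ->
  cdiff_at f z (cderiv (f : cplane R -> cplane R) z).
Proof.
move=> fa z1; apply/cdiff_atP; rewrite /cderiv derive1E; apply: DeriveDef; last by [].
exact: fa.
Qed.

Lemma cdiff_cst (c : C) z : cdiff_at (fun=> c) z 0.
Proof.
by move=> e e0; exists 1 => // h _; rewrite subrr mul0r subrr cmod0 mulr_ge0 ?cmod_ge0 // ltW.
Qed.

Lemma cdiff_id z : cdiff_at id z 1.
Proof.
move=> e e0; exists 1 => // h _.
have -> : z + h - z - 1 * h = 0 by ring.
by rewrite cmod0 mulr_ge0 ?cmod_ge0 // ltW.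
Qed.

Lemma cdiffD f g z d d' : cdiff_at f z d -> cdiff_at g z d' ->
  cdiff_at (fun x => f x + g x) z (d + d').
Proof. by move=> /cdiff_atP ? /cdiff_atP ?; apply/cdiff_atP; exact: is_deriveD. Qed.

Lemma cdiffM f g z d d' : cdiff_at f z d -> cdiff_at g z d' ->
  cdiff_at (fun x => f x * g x) z (f z * d' + g z * d).
Proof. by move=> /cdiff_atP ? /cdiff_atP ?; apply/cdiff_atP; exact: is_deriveM. Qed.

Lemma cdiffN f z d : cdiff_at f z d -> cdiff_at (fun x => - f x) z (- d).
Proof. by move=> /cdiff_atP ?; apply/cdiff_atP; exact: is_deriveN. Qed.

Lemma cdiffB f g z d d' : cdiff_at f z d -> cdiff_at g z d' ->
  cdiff_at (fun x => f x - g x) z (d - d').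
Proof. by move=> fd gd; apply: cdiffD => //; exact: cdiffN. Qed.

Lemma cdiffV f z d : f z != 0 -> cdiff_at f z d ->
  cdiff_at (fun x => (f x)^-1) z (- (f z) ^- 2 * d).
Proof. move=> f0 /cdiff_atP[fd fE]; apply/cdiff_atP; split; first exact: (derivableV f0 fd).
by rewrite (deriveV f0 fd) fE. Qed.

Lemma cdiff_shift f a z d : cdiff_at f (a + z) d -> cdiff_at (fun x => f (a + x)) z d.
Proof.
by move=> fd e /fd[k k0 kP]; exists k => // h /kP; rewrite addrA.
Qed.

Lemma cdiff_near f g z d r : 0 < r -> (forall x, cmod (x - z) < r -> f x = g x) ->
  cdiff_at f z d -> cdiff_at g z d.
Proof.
move=> r0 fg fd e /fd[k k0 kP]; exists (Num.min k r); first by rewrite lt_min k0.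
move=> h; rewrite lt_min => /andP[hk hr].
rewrite -!fg; first exact: kP.
- by rewrite subrr cmod0.
- by rewrite addrAC subrr add0r.
Qed.

Lemma cdiff_continuous f z d : cdiff_at f z d ->
  {for z, continuous (f : cplane R -> cplane R)}.
Proof.
move=> /cdiff_atP[fd _].
exact/differentiable_continuous/derivable1_diffP/fd.
Qed.

End ComplexDerivative.

(** * Integrals of continuous functions on segments *)

Section Rint.
Variable R : realType.
Notation mu := (@lebesgue_measure R).
Implicit Types (f g F G : R -> R) (a b c : R).

(** Two-sided continuity at every point of the closed segment, endpoints
    included: stronger than continuity within the segment, and it lets
    primitives be differentiated at the endpoints. *)
Definition cts_on f a b := forall x, a <= x <= b -> {for x, continuous f}.

Definition rint a b f : R := \int[mu]_(x in `[a, b]) f x.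

Lemma cts_on_within f a b : cts_on f a b -> {within `[a, b], continuous f}.
Proof.
move=> cf; apply: continuous_in_subspaceT => x; rewrite inE /= in_itv /= => /cf.
exact.
Qed.

Lemma cts_on_sub f a b c d : cts_on f a b -> a <= c -> d <= b -> cts_on f c d.
Proof.
by move=> cf ac db x /andP[cx xd]; apply: cf; rewrite (le_trans ac cx) (le_trans xd db).
Qed.

Lemma cts_on_cst a b c : cts_on (fun=> c) a b.
Proof. by move=> x _; exact: cst_continuous. Qed.

Lemma cts_onD f g a b : cts_on f a b -> cts_on g a b ->
  cts_on (fun x => f x + g x) a b.
Proof. by move=> cf cg x ab; apply: continuousD; [exact: cf|exact: cg]. Qed.

Lemma cts_onB f g a b : cts_on f a b -> cts_on g a b ->
  cts_on (fun x => f x - g x) a b.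
Proof. by move=> cf cg x ab; apply: continuousB; [exact: cf|exact: cg]. Qed.

Lemma cts_onM f g a b : cts_on f a b -> cts_on g a b ->
  cts_on (fun x => f x * g x) a b.
Proof. by move=> cf cg x ab; apply: continuousM; [exact: cf|exact: cg]. Qed.

Lemma cts_onX f a b n : cts_on f a b -> cts_on (fun x => f x ^+ n) a b.
Proof.
move=> cf; elim: n => [|n ih]; first by under [X in cts_on X]funext do rewrite expr0; exact: cts_on_cst.
under [X in cts_on X]funext do rewrite exprS.
exact: cts_onM.
Qed.

Lemma rint_integrable f a b : cts_on f a b -> mu.-integrable `[a, b] (EFin \o f).
Proof.
move=> cf; apply: continuous_compact_integrable; first exact: segment_compact.
exact: cts_on_within.
Qed.

Lemma eq_rint f g a b : (forall x, a <= x <= b -> f x = g x) -> rint a b f = rint a b g.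
Proof.
by move=> fg; apply: eq_Rintegral => x; rewrite inE /= in_itv /= => /fg.
Qed.

Lemma rintD f g a b : cts_on f a b -> cts_on g a b ->
  rint a b (fun x => f x + g x) = rint a b f + rint a b g.
Proof. by move=> cf cg; apply: RintegralD => //; exact: rint_integrable. Qed.

Lemma rintB f g a b : cts_on f a b -> cts_on g a b ->
  rint a b (fun x => f x - g x) = rint a b f - rint a b g.
Proof. by move=> cf cg; apply: RintegralB => //; exact: rint_integrable. Qed.

Lemma rintZ c f a b : cts_on f a b -> rint a b (fun x => c * f x) = c * rint a b f.
Proof. by move=> cf; apply: RintegralZl => //; exact: rint_integrable. Qed.

Lemma rint_cst c a b : a <= b -> rint a b (fun=> c) = c * (b - a).
Proof.
move=> ab; rewrite /rint Rintegral_cst //.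
rewrite [X in fine X](lebesgue_measure_itv `[a, b]) /= lte_fin.
by move: ab; rewrite le_eqVlt => /predU1P[->|->//]; rewrite ltxx subrr.
Qed.

Lemma le_rint f g a b : cts_on f a b -> cts_on g a b ->
  (forall x, a <= x <= b -> f x <= g x) -> rint a b f <= rint a b g.
Proof.
move=> cf cg fg; apply: le_Rintegral => //.
- exact: rint_integrable.
- exact: rint_integrable.
Qed.

Lemma rint_ge0 f a b : (forall x, a <= x <= b -> 0 <= f x) -> 0 <= rint a b f.
Proof. by move=> f0; apply: Rintegral_ge0 => x /=; rewrite in_itv; exact: f0. Qed.

Lemma rint_split f a b c : cts_on f a b -> a <= c <= b ->
  rint a b f = rint a c f + rint c b f.
Proof.
move=> cf /andP[ac cb].
have := @Rintegral_itvB _ f (BLeft a) (BRight b) c (rint_integrable cf).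
rewrite !bnd_simp => /(_ ac cb).
rewrite Rintegral_itv_obnd_cbnd; first by rewrite /rint => <-; rewrite addrC subrK.
apply: integrableS (rint_integrable cf) => //=.
by apply: subset_itvr; rewrite bnd_simp.
Qed.

(** The form in which integrals are compared with constants: it gives both
    the derivative of a primitive and the smallness of circulations in
    Goursat's argument. *)
Lemma rint_approx f a b c M : a <= b -> cts_on f a b ->
  (forall x, a <= x <= b -> `|f x - c| <= M) ->
  `|rint a b f - c * (b - a)| <= M * (b - a).
Proof.
move=> ab cf H; rewrite -(rint_cst c ab) ler_norml.
have cc k := @cts_on_cst a b k.
rewrite -mulNr -!(rint_cst _ ab) -rintB //; apply/andP; split.
- apply: le_rint => // [|x /H]; first exact: cts_onB.
  by rewrite ler_norml => /andP[].
- apply: le_rint => // [|x /H]; first exact: cts_onB.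
  by rewrite ler_norml => /andP[].
Qed.

Lemma rint_le_cst f a b M : a <= b -> cts_on f a b ->
  (forall x, a <= x <= b -> f x <= M) -> rint a b f <= M * (b - a).
Proof.
move=> ab cf H; rewrite -(rint_cst M ab); apply: le_rint => //.
exact: cts_on_cst.
Qed.

Lemma rint_ge_cst f a b M : a <= b -> cts_on f a b ->
  (forall x, a <= x <= b -> M <= f x) -> M * (b - a) <= rint a b f.
Proof.
move=> ab cf H; rewrite -(rint_cst M ab); apply: le_rint => //.
exact: cts_on_cst.
Qed.

Lemma is_derive_cts F x d : is_derive x (1 : R) F d -> {for x, continuous F}.
Proof.
by move=> [Fd _]; exact/differentiable_continuous/derivable1_diffP.
Qed.

Lemma rint_FTC f F a b : a <= b -> cts_on f a b ->
  (forall x, a <= x <= b -> is_derive x (1 : R) F (f x)) -> rint a b f = F b - F a.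
Proof.
rewrite le_eqVlt => /predU1P[-> _ _|ab cf dF].
  by rewrite /rint set_itv1 Rintegral_set1 subrr.
have cF x : a <= x <= b -> {for x, continuous F} by move=> /dF; exact: is_derive_cts.
rewrite /rint /Rintegral (@continuous_FTC2 _ _ F) //.
- exact: cts_on_within.
- split.
  + by move=> x; rewrite in_itv /= => /andP[ax xb]; case: (dF x) => //; rewrite !ltW.
  + by apply: cvg_at_right_filter; apply: cF; rewrite lexx ltW.
  + by apply: cvg_at_left_filter; apply: cF; rewrite lexx ltW.
- move=> x; rewrite in_itv /= => /andP[ax xb]; rewrite derive1E.
  by case: (dF x) => //; rewrite !ltW.
Qed.

(** Jensen's inequality: expand [(f - m)^2 >= 0] with [m] the mean of [f]. *)
Lemma rint_sqr_le f a b : a <= b -> cts_on f a b ->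
  rint a b f ^+ 2 <= (b - a) * rint a b (fun x => f x ^+ 2).
Proof.
rewrite le_eqVlt => /predU1P[-> _|ab cf].
  by rewrite /rint set_itv1 !Rintegral_set1 mulr0 expr0n.
have ba : 0 < b - a by rewrite subr_gt0.
have [m E] : exists m, rint a b f = m * (b - a).
  by exists (rint a b f / (b - a)); rewrite divfK ?gt_eqF.
have H : 0 <= rint a b (fun x => f x ^+ 2 - (2 * m * f x - m ^+ 2)).
  apply: rint_ge0 => x _.
  have -> : f x ^+ 2 - (2 * m * f x - m ^+ 2) = (f x - m) ^+ 2 by ring.
  exact: sqr_ge0.
have cf2 : cts_on (fun x => f x ^+ 2) a b by exact: cts_onX.
have cc k := @cts_on_cst a b k.
have cmf : cts_on (fun x => 2 * m * f x) a b by exact: cts_onM.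
move: H; rewrite rintB //; last exact: cts_onB.
rewrite rintB // rintZ // rint_cst ?(ltW ab) // E.
set S := rint _ _ _; move=> H.
have -> : (m * (b - a)) ^+ 2 = (b - a) * (m ^+ 2 * (b - a)) by ring.
rewrite ler_pM2l //; nra.
Qed.

End Rint.

Section TwoVariables.
Variable R : realType.
Notation mu := (@lebesgue_measure R).
Implicit Types (f : R * R -> R).

Lemma compact_box (a b c d : R) : compact (`[a, b] `*` `[c, d] : set (R * R)).
Proof. by apply: compact_setX; exact: segment_compact. Qed.

Lemma cts_box_bounded f (a b c d : R) :
  (forall p, a <= p.1 <= b -> c <= p.2 <= d -> {for p, continuous f}) ->
  exists2 M : R, 0 < M & forall p, a <= p.1 <= b -> c <= p.2 <= d -> `|f p| <= M.
Proof.
move=> cf.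
have cw : {within (`[a, b] `*` `[c, d] : set (R * R)), continuous f}.
  apply: continuous_in_subspaceT => p; rewrite inE => -[] /=.
  by rewrite !in_itv /=; exact: cf.
have /compact_bounded[M [_ HM]] := continuous_compact cw (@compact_box a b c d).
exists (`|M| + 1) => [|p pa pc]; first by rewrite ltr_wpDl.
apply: (HM (`|M| + 1)); first by rewrite (le_lt_trans (ler_norm _)) // ltrDl.
by exists p => //=; rewrite !in_itv.
Qed.

Lemma cts_pair1 f (x y : R) : {for (x, y), continuous f} ->
  {for x, continuous (fun u => f (u, y))}.
Proof.
move=> cf; apply: (@continuous_comp _ _ _ (fun u => (u, y)) f) => //.
by apply: (@cvg_pair _ _ _ (nbhs x) (nbhs x) (nbhs y) _ _ _ id (fun=> y)); [exact: cvg_id|exact: cvg_cst].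
Qed.

Lemma cts_pair2 f (x y : R) : {for (x, y), continuous f} ->
  {for y, continuous (fun u => f (x, u))}.
Proof.
move=> cf; apply: (@continuous_comp _ _ _ (fun u => (x, u)) f) => //.
by apply: (@cvg_pair _ _ _ (nbhs y) (nbhs x) (nbhs y) _ _ _ (fun=> x) id); [exact: cvg_cst|exact: cvg_id].
Qed.

Lemma rint_param_cts f (u v a b x : R) : u < x < v ->
  (forall p, u <= p.1 <= v -> a <= p.2 <= b -> {for p, continuous f}) ->
  {for x, continuous (fun y => rint a b (fun t => f (y, t)))}.
Proof.
move=> xuv cf.
have [M M0 HM] := cts_box_bounded cf.
apply: (@continuity_under_integral R _ _ mu (fun y t => f (y, t)) `[a, b] _ u v _ _ (cst M)) => //.
- move=> y /=; rewrite in_itv /= => /andP[uy yv]; apply: rint_integrable => t tab.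
  by apply: cts_pair2; apply: cf => //=; rewrite !ltW.
- apply: aeW => t /=; rewrite in_itv /= => tab y; rewrite inE /= in_itv /= => /andP[uy yv].
  by apply: (@cts_pair1 f); apply: cf => //=; rewrite !ltW.
- by apply: rint_integrable; exact: cts_on_cst.
- move=> y /=; rewrite in_itv /= => /andP[uy yv]; apply: aeW => t /=; rewrite in_itv /= => tab.
  by apply: HM => //=; rewrite !ltW.
- by rewrite inE /= in_itv.
Qed.

(** Dominated differentiation; the domination comes from the boundedness of
    the continuous partial derivative on a compact box. *)
Lemma rint_param_derive f (f' : R * R -> R) (u v a b x : R) : u < x < v -> a <= b ->
  (forall p, u <= p.1 <= v -> a <= p.2 <= b -> {for p, continuous f}) ->
  (forall p, u <= p.1 <= v -> a <= p.2 <= b -> {for p, continuous f'}) ->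
  (forall y t, u <= y <= v -> a <= t <= b ->
     is_derive y (1 : R) (fun y => f (y, t)) (f' (y, t))) ->
  is_derive x (1 : R) (fun y => rint a b (fun t => f (y, t))) (rint a b (fun t => f' (x, t))).
Proof.
move=> xuv ab cf cf' df.
have [M M0 HM] := cts_box_bounded cf'.
have I1 : forall y, `]u, v[%classic y -> mu.-integrable `[a, b] (EFin \o (fun t => f (y, t))).
  move=> y /=; rewrite in_itv /= => /andP[uy yv]; apply: rint_integrable => t tab.
  by apply: cts_pair2; apply: cf => //=; rewrite !ltW.
have I2 : forall y t, `]u, v[%classic y -> `[a, b]%classic t -> derivable (fun y => f (y, t)) y 1.
  move=> y t /=; rewrite !in_itv /= => /andP[uy yv] tab.
  by case: (df y t) => //; rewrite !ltW.
have I3 : forall y t, `]u, v[%classic y -> `[a, b]%classic t ->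
    `|partial1of2 (fun y t => f (y, t)) y t| <= cst M t.
  move=> y t /=; rewrite !in_itv /= => /andP[uy yv] tab.
  rewrite partial1of2E; case: (df y t) => // [|_ ->]; first by rewrite !ltW.
  by apply: HM => //=; rewrite !ltW.
have Ix : `]u, v[%classic x by rewrite /= in_itv.
have E : rint a b (fun t => f' (x, t)) = \int[mu]_(t in `[a, b]) partial1of2 (fun y t => f (y, t)) x t.
  apply: eq_Rintegral => t; rewrite inE /= in_itv /= => tab.
  have ux : u <= x <= v by case/andP: xuv => ? ?; rewrite !ltW.
  by rewrite partial1of2E; case: (df x t ux tab) => _ ->.
have M0' : forall t : R, 0 <= (cst M t : R) by move=> t /=; exact: ltW.
have IM : mu.-integrable `[a, b] (EFin \o (cst M : R -> R)).
  by apply: rint_integrable; exact: cts_on_cst.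
have mI : measurable (`[a, b]%classic : set R) by [].
split.
- exact: (@derivable_under_integral R _ _ mu (fun y t => f (y, t)) _ mI x u v Ix I1 I2 (cst M) M0' IM I3).
- rewrite -derive1E E.
  exact: (@differentiation_under_integral R _ _ mu (fun y t => f (y, t)) _ mI x u v Ix I1 I2 (cst M) M0' IM I3).
Qed.

End TwoVariables.

(** * Differentials in two real variables and polar coordinates *)

Section Frechet.
Variable R : realType.
Local Notation C := R[i].
Implicit Types (P Q : R -> R -> R) (G : R -> R -> C) (F : C -> C).

Lemma is_derive_epsP (f : R -> R) (x d : R) :
  is_derive x (1 : R) f d <-> forall e : R, 0 < e -> exists2 k : R, 0 < k &
    forall h, `|h| < k -> `|f (x + h) - f x - d * h| <= e * `|h|.
Proof.
have E h : h != 0 -> d - h^-1 *: (f (h *: (1 : R) + x) - f x) =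
                 - (h^-1 * (f (x + h) - f x - d * h)).
  by move=> h0; rewrite /GRing.scale /= mulr1 [h + x]addrC; field.
split=> [[fd fE] e e0|fd].
  have : h^-1 *: (f (h *: (1 : R) + x) - f x) @[h --> (0:R)^'] --> d by rewrite -fE; exact: fd.
  move/cvgrPdist_le => /(_ e e0).
  rewrite near_withinE => /nbhs_normP[k /= k0 kP].
  exists k => // h hk.
  have [->|h0] := eqVneq h 0; first by rewrite addr0 subrr mulr0 subrr normr0 mulr0.
  have /kP/(_ h0) : ball_ Num.Def.normr (0 : R) k h by rewrite /ball_ /= sub0r normrN.
  by rewrite E // normrN normrM normfV ler_pdivrMl ?normr_gt0 // [`|h| * _]mulrC.
have H : h^-1 *: (f (h *: (1 : R) + x) - f x) @[h --> (0:R)^'] --> d.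
  apply/cvgrPdist_le => /= e e0; have [k k0 kP] := fd _ e0.
  rewrite near_withinE; apply/nbhs_normP; exists k => // h.
  rewrite /ball_ /= sub0r normrN => hk h0.
  by rewrite E // normrN normrM normfV ler_pdivrMl ?normr_gt0 // [`|h| * _]mulrC; exact: kP.
by split; [apply/cvg_ex; exists d|exact/cvg_lim].
Qed.

(** Real Frechet differentiability with its two partial derivatives, in the
    epsilon form that composes without any continuity of the partials:
    Goursat's argument needs differentiability only. *)
Definition rdiff2 P s t a b := forall e : R, 0 < e -> exists2 k : R, 0 < k &
  forall x y, `|x| < k -> `|y| < k ->
    `|P (s + x) (t + y) - P s t - a * x - b * y| <= e * (`|x| + `|y|).

Definition crdiff2 G s t (A B : C) := forall e : R, 0 < e -> exists2 k : R, 0 < k &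
  forall x y, `|x| < k -> `|y| < k ->
    cmod (G (s + x) (t + y) - G s t - A * x%:C%C - B * y%:C%C) <= e * (`|x| + `|y|).

Lemma rdiff2_lip P s t a b : rdiff2 P s t a b ->
  exists2 k : R, 0 < k & exists2 M : R, 0 < M & forall x y, `|x| < k -> `|y| < k ->
    `|P (s + x) (t + y) - P s t| <= M * (`|x| + `|y|).
Proof.
move=> /(_ 1 ltr01)[k k0 kP]; exists k => //.
exists (`|a| + `|b| + 1) => [|x y xk yk]; first by rewrite ltr_wpDl // addr_ge0.
have H := kP x y xk yk.
have -> : P (s + x) (t + y) - P s t =
   (P (s + x) (t + y) - P s t - a * x - b * y) + (a * x + b * y) by ring.
apply: (le_trans (ler_normD _ _)); apply: (le_trans (lerD H (ler_normD _ _))).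
rewrite !normrM; have := normr_ge0 a; have := normr_ge0 b.
have := normr_ge0 x; have := normr_ge0 y; nra.
Qed.

Lemma rdiff2_derive1 P s t a b : rdiff2 P s t a b -> is_derive s (1 : R) (P^~ t) a.
Proof.
move=> dP; apply/is_derive_epsP => e /dP[k k0 H]; exists k => // h hk.
by have := H h 0 hk; rewrite normr0 !addr0 mulr0 subr0; apply.
Qed.

Lemma rdiff2_derive2 P s t a b : rdiff2 P s t a b -> is_derive t (1 : R) (P s) b.
Proof.
move=> dP; apply/is_derive_epsP => e /dP[k k0 H]; exists k => // h hk.
by have := H 0 h _ hk; rewrite normr0 !addr0 add0r mulr0 subr0; apply.
Qed.

Lemma rdiff2_fst (f : R -> R) s t d : is_derive s (1 : R) f d -> rdiff2 (fun s _ => f s) s t d 0.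
Proof.
move=> /is_derive_epsP df e e0; have [k k0 H] := df _ e0; exists k => // x y xk yk.
rewrite mul0r subr0 (le_trans (H x xk)) // ler_pM2l // lerDl //.
Qed.

Lemma rdiff2_snd (f : R -> R) s t d : is_derive t (1 : R) f d -> rdiff2 (fun _ t => f t) s t 0 d.
Proof.
move=> /is_derive_epsP df e e0; have [k k0 H] := df _ e0; exists k => // x y xk yk.
rewrite mul0r subr0 (le_trans (H y yk)) // ler_pM2l // lerDr //.
Qed.

Lemma rdiff2M P Q s t a b a' b' : rdiff2 P s t a b -> rdiff2 Q s t a' b' ->
  rdiff2 (fun s t => P s t * Q s t) s t (P s t * a' + Q s t * a) (P s t * b' + Q s t * b).
Proof.
move=> dP dQ e e0.
have [k1 k10 [M1 M10 L1]] := rdiff2_lip dP.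
have [k2 k20 [M2 M20 L2]] := rdiff2_lip dQ.
set p := P s t; set q := Q s t.
have D0 : 0 < 3 * (`|p| + `|q| + 1) by rewrite mulr_gt0 // ltr_wpDl // addr_ge0.
have [k3 k30 R1] := dP (e / (3 * (`|p| + `|q| + 1))) (divr_gt0 e0 D0).
have [k4 k40 R2] := dQ (e / (3 * (`|p| + `|q| + 1))) (divr_gt0 e0 D0).
have K0 : 0 < e / (6 * M1 * M2) by rewrite divr_gt0 // !mulr_gt0.
exists (Num.min (Num.min k1 k2) (Num.min (Num.min k3 k4) (e / (6 * M1 * M2)))).
  by rewrite !lt_min k10 k20 k30 k40.
move=> x y; rewrite !lt_min => /andP[/andP[x1 x2] /andP[/andP[x3 x4] x5]].
move=> /andP[/andP[y1 y2] /andP[/andP[y3 y4] y5]].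
have {}L1 := L1 x y x1 y1; have {}L2 := L2 x y x2 y2.
have {}R1 := R1 x y x3 y3; have {}R2 := R2 x y x4 y4.
move: L1 L2 R1 R2; rewrite -/p -/q.
set p' := P (s + x) _; set q' := Q (s + x) _ => L1 L2 R1 R2.
set n := `|x| + `|y|.
have n0 : 0 <= n by rewrite addr_ge0.
have -> : p' * q' - p * q - (p * a' + q * a) * x - (p * b' + q * b) * y =
   (p' - p) * (q' - q) + p * (q' - q - a' * x - b' * y) + q * (p' - p - a * x - b * y).
  by ring.
apply: (le_trans (ler_normD _ _)); apply: (le_trans (lerD (ler_normD _ _) (lexx _))).
rewrite !normrM.
have H1 : `|p' - p| * `|q' - q| <= e / 3 * n.
  apply: (le_trans (ler_pM _ _ L1 L2)) => //.
  have : n <= e / (3 * M1 * M2).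
    have -> : e / (3 * M1 * M2) = e / (6 * M1 * M2) + e / (6 * M1 * M2).
      by field; rewrite !gt_eqF.
    by rewrite lerD // ltW.
  rewrite ler_pdivlMr ?mulr_gt0 // => nM.
  have -> : M1 * (`|x| + `|y|) * (M2 * (`|x| + `|y|)) = (n * (3 * M1 * M2) / 3) * n.
    by rewrite /n; field.
  by rewrite ler_wpM2r // ler_pM2r.
have DD : 0 < `|p| + `|q| + 1 by rewrite ltr_wpDl // addr_ge0.
have H2 (u v : R) : 0 <= u -> u <= `|p| + `|q| + 1 -> v <= e / (3 * (`|p| + `|q| + 1)) * n ->
    u * v <= e / 3 * n.
  move=> u0 uD vD; apply: (le_trans (ler_wpM2l u0 vD)).
  rewrite mulrA ler_wpM2r // mulrCA ler_wpM2l ?(ltW e0) //.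
  by rewrite ler_pdivrMr // mulrA mulVf // mul1r.
have pD : `|p| <= `|p| + `|q| + 1 by have := normr_ge0 q; lra.
have qD : `|q| <= `|p| + `|q| + 1 by have := normr_ge0 p; lra.
have H3 := H2 _ _ (normr_ge0 p) pD R2; have H4 := H2 _ _ (normr_ge0 q) qD R1.
rewrite -/n in H3 H4.
have -> : e * n = e / 3 * n + e / 3 * n + e / 3 * n by field.
by rewrite !lerD.
Qed.

Lemma crdiff2_Re G s t A B : crdiff2 G s t A B ->
  rdiff2 (fun s t => Re (G s t)) s t (Re A) (Re B).
Proof.
move=> dG e e0; have [k k0 H] := dG e e0; exists k => // x y xk yk.
apply: le_trans (H x y xk yk).
have := norm_Re_cmod (G (s + x) (t + y) - G s t - A * x%:C%C - B * y%:C%C).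
by rewrite !cReB !cReM /= !mulr0 !subr0.
Qed.

Lemma crdiff2_Im G s t A B : crdiff2 G s t A B ->
  rdiff2 (fun s t => Im (G s t)) s t (Im A) (Im B).
Proof.
move=> dG e e0; have [k k0 H] := dG e e0; exists k => // x y xk yk.
apply: le_trans (H x y xk yk).
have := norm_Im_cmod (G (s + x) (t + y) - G s t - A * x%:C%C - B * y%:C%C).
by rewrite !cImB !cImM /= !mulr0 !add0r.
Qed.

Lemma crdiff2_mk P Q s t a b a' b' : rdiff2 P s t a b -> rdiff2 Q s t a' b' ->
  crdiff2 (fun s t => (P s t +i* Q s t)%C) s t (a +i* a')%C (b +i* b')%C.
Proof.
move=> dP dQ e e0; have e20 : 0 < e / 2 by rewrite divr_gt0.
have [k1 k10 H1] := dP _ e20; have [k2 k20 H2] := dQ _ e20.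
exists (Num.min k1 k2); first by rewrite lt_min k10.
move=> x y; rewrite !lt_min => /andP[x1 x2] /andP[y1 y2].
apply: (le_trans (cmod_le_ReIm _)).
rewrite !(cReB, cImB, cReM, cImM) /= !mulr0 !subr0 !add0r.
have {H1} := H1 x y x1 y1; have {H2} := H2 x y x2 y2; lra.
Qed.

Lemma crdiff2_comp F G s t A B D : crdiff2 G s t A B -> cdiff_at F (G s t) D ->
  crdiff2 (fun s t => F (G s t)) s t (D * A) (D * B).
Proof.
move=> dG dF e e0.
set N := cmod A + cmod B + 1.
have N0 : 0 < N by rewrite ltr_wpDl // addr_ge0 // cmod_ge0.
have D0 : 0 < cmod D + 1 by rewrite ltr_wpDl // cmod_ge0.
have [k1 k10 H1] := dF (e / (2 * N)) (divr_gt0 e0 (mulr_gt0 (ltr0Sn _ 1) N0)).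
have [k2 k20 H2] := dG _ ltr01.
have [k3 k30 H3] := dG (e / (2 * (cmod D + 1))) (divr_gt0 e0 (mulr_gt0 (ltr0Sn _ 1) D0)).
exists (Num.min (Num.min k2 k3) (k1 / (2 * N))).
  by rewrite !lt_min k20 k30 divr_gt0 // mulr_gt0.
move=> x y; rewrite !lt_min => /andP[/andP[x2 x3] x1] /andP[/andP[y2 y3] y1].
have {}H2 := H2 x y x2 y2; have {}H3 := H3 x y x3 y3.
set w := G s t in H1 H2 H3 *; set w' := G (s + x) (t + y) in H2 H3 *.
have n0 : 0 <= `|x| + `|y| by rewrite addr_ge0.
have wl : cmod (w' - w) <= N * (`|x| + `|y|).
  have -> : w' - w = (w' - w - A * x%:C%C - B * y%:C%C) + (A * x%:C%C + B * y%:C%C) by ring.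
  apply: (le_trans (cmodD_le _ _)); apply: (le_trans (lerD H2 (cmodD_le _ _))).
  rewrite !cmodM !cmod_real /N.
  have := cmod_ge0 A; have := cmod_ge0 B; have := normr_ge0 x; have := normr_ge0 y; nra.
have wk : cmod (w' - w) < k1.
  apply: (le_lt_trans wl).
  have : `|x| + `|y| < k1 / N.
    have -> : k1 / N = k1 / (2 * N) + k1 / (2 * N) by field; rewrite gt_eqF.
    exact: ltrD.
  by rewrite ltr_pdivlMr // mulrC.
have {}H1 := H1 _ wk; rewrite [w + _]addrC subrK in H1.
have -> : F w' - F w - D * A * x%:C%C - D * B * y%:C%C =
  (F w' - F w - D * (w' - w)) + D * (w' - w - A * x%:C%C - B * y%:C%C) by ring.
apply: (le_trans (cmodD_le _ _)); rewrite cmodM.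
have -> : e * (`|x| + `|y|) = e / 2 * (`|x| + `|y|) + e / 2 * (`|x| + `|y|) by field.
apply: lerD.
  apply: (le_trans H1); apply: (le_trans (ler_wpM2l _ wl)).
    by rewrite ltW // divr_gt0 // mulr_gt0.
  by rewrite mulrA ler_wpM2r // -mulrA le_eqVlt; apply/orP; left; apply/eqP; field; rewrite gt_eqF.
apply: (le_trans (ler_wpM2l (cmod_ge0 _) H3)); rewrite mulrA ler_wpM2r //.
rewrite mulrCA ler_pM2l // ler_pdivrMr ?mulr_gt0 //; lra.
Qed.

Lemma rdiff2_cos s t : rdiff2 (fun r t => r * cos t) s t (cos t) (- (s * sin t)).
Proof.
have := rdiff2M (rdiff2_fst t (is_derive_id s (1 : R))) (rdiff2_snd s (is_derive_cos t)).
by rewrite mulr0 add0r !mulr1 mulr0 addr0 mulrN.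
Qed.

Lemma rdiff2_sin s t : rdiff2 (fun r t => r * sin t) s t (sin t) (s * cos t).
Proof.
have := rdiff2M (rdiff2_fst t (is_derive_id s (1 : R))) (rdiff2_snd s (is_derive_sin t)).
by rewrite mulr0 add0r !mulr1 mulr0 addr0.
Qed.

(** The unit vector in direction [t]. *)
Definition cis (t : R) : C := (cos t +i* sin t)%C.

Lemma cpolarE (r t : R) : cpolar r t = r%:C%C * cis t.
Proof. by apply: complex_ext; rewrite !(cReM, cImM) /= mul0r ?subr0 ?addr0. Qed.

Lemma cmod_cis t : cmod (cis t) = 1.
Proof. by rewrite /cmod /= cos2Dsin2 sqrtr1. Qed.

Lemma cmod_cpolar_norm (r t : R) : cmod (cpolar r t) = `|r|.
Proof. by rewrite cpolarE cmodM cmod_cis mulr1 cmod_real. Qed.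

(** The second partial derivative is [i] times the radius times the first:
    this proportionality is the Cauchy-Riemann equation in polar form. *)
Lemma crdiff2_cpolar (r t : R) :
  crdiff2 (@cpolar R) r t (cis t) ('i%C * (r%:C%C * cis t)).
Proof.
have := crdiff2_mk (rdiff2_cos r t) (rdiff2_sin r t).
congr crdiff2.
by apply: complex_ext; rewrite !(cReM, cImM) /=; ring.
Qed.

End Frechet.

(** * Goursat's lemma for closed forms *)

Section Goursat.
Variable R : realType.

Lemma nested_point (X l : nat -> R) : (forall n, X n <= X n.+1) ->
  (forall n, X n.+1 + l n.+1 <= X n + l n) -> (forall n, 0 <= l n) ->
  exists x, forall n, X n <= x <= X n + l n.
Proof.
move=> Xi Xd l0.
have mX m n : X m <= X (m + n)%N.
  by elim: n => [|n ih]; rewrite ?addn0 // addnS (le_trans ih).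
have mZ m n : X (m + n)%N + l (m + n)%N <= X m + l m.
  by elim: n => [|n ih]; rewrite ?addn0 // addnS (le_trans (Xd _)).
have XZ m n : X m <= X n + l n.
  apply: (le_trans (mX m n)); rewrite addnC; apply: le_trans (mZ n m).
  by rewrite lerDl.
have S : has_sup (range X).
  split; first by exists (X 0%N); exists 0%N.
  by exists (X 0%N + l 0%N) => _ [m _ <-]; exact: XZ.
exists (sup (range X)) => n; apply/andP; split.
  by apply: sup_upper_bound => //; exists n.
by apply: ge_sup => [|_ [m _ <-]]; [case: S|exact: XZ].
Qed.

Variables (P Q : R -> R -> R) (lo hi : R).
Hypothesis closedPQ : forall s t, lo < s < hi ->
  exists a b d, rdiff2 P s t a b /\ rdiff2 Q s t b d.

Let ctsQ s t1 t2 : lo < s < hi -> cts_on (Q s) t1 t2.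
Proof.
move=> sb t _; have [a [b [d [_ dQ]]]] := closedPQ t sb.
exact: is_derive_cts (rdiff2_derive2 dQ).
Qed.

Let ctsP s1 s2 t : lo < s1 -> s2 < hi -> cts_on (P^~ t) s1 s2.
Proof.
move=> s1l s2h s /andP[s1s ss2].
have sb : lo < s < hi by rewrite (lt_le_trans s1l) // (le_lt_trans ss2).
have [a [b [d [dP _]]]] := closedPQ t sb.
exact: is_derive_cts (rdiff2_derive1 dP).
Qed.

(* The circulation of the form P ds + Q dt around a rectangle. *)
Let J s1 s2 t1 t2 := (rint t1 t2 (Q s2) - rint t1 t2 (Q s1))
                   - (rint s1 s2 (P^~ t2) - rint s1 s2 (P^~ t1)).

Let J_split1 s1 s s2 t1 t2 : lo < s1 -> s2 < hi -> s1 <= s <= s2 ->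
  J s1 s2 t1 t2 = J s1 s t1 t2 + J s s2 t1 t2.
Proof.
move=> s1l s2h sb.
by rewrite /J !(@rint_split _ (P^~ _) s1 s2 s) //; [ring|exact: ctsP..].
Qed.

Let J_split2 s1 s2 t1 t t2 : lo < s1 < hi -> lo < s2 < hi -> t1 <= t <= t2 ->
  J s1 s2 t1 t2 = J s1 s2 t1 t + J s1 s2 t t2.
Proof.
move=> s1l s2h sb.
by rewrite /J !(@rint_split _ (Q _) t1 t2 t) //; [ring|exact: ctsQ..].
Qed.

(* Differentiability at one point makes the circulation around small
   rectangles containing it negligible with respect to their area. *)
Let J_local x y e : lo < x < hi -> 0 < e -> exists2 k : R, 0 < k &
  forall s1 s2 t1 t2, lo < s1 -> s1 <= x <= s2 -> s2 < hi -> t1 <= y <= t2 ->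
  s2 - s1 < k -> t2 - t1 < k ->
  `|J s1 s2 t1 t2| <= e * 2 * ((s2 - s1) + (t2 - t1)) ^+ 2.
Proof.
move=> xb e0; have [a [b [d [dP dQ]]]] := closedPQ y xb.
have [k1 k10 H1] := dP _ e0; have [k2 k20 H2] := dQ _ e0.
exists (Num.min k1 k2); first by rewrite lt_min k10.
move=> s1 s2 t1 t2 s1l /andP[s1x xs2] s2h /andP[t1y yt2].
rewrite !lt_min => /andP[l1 l2] /andP[u1 u2].
set D := (s2 - s1) + (t2 - t1).
have nx s : s1 <= s <= s2 -> `|s - x| <= s2 - s1.
  by move=> /andP[? ?]; rewrite ler_norml; apply/andP; split; lra.
have ny t : t1 <= t <= t2 -> `|t - y| <= t2 - t1.
  by move=> /andP[? ?]; rewrite ler_norml; apply/andP; split; lra.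
have RP s t : s1 <= s <= s2 -> t1 <= t <= t2 ->
    `|P s t - P x y - a * (s - x) - b * (t - y)| <= e * D.
  move=> sb tb; have := H1 (s - x) (t - y).
  rewrite ![_ + (_ - _)]addrC !subrK => H; apply: le_trans (H _ _) _.
  - exact: le_lt_trans (nx _ sb) _.
  - exact: le_lt_trans (ny _ tb) _.
  - by rewrite ler_pM2l // lerD // ?nx ?ny.
have RQ s t : s1 <= s <= s2 -> t1 <= t <= t2 ->
    `|Q s t - Q x y - b * (s - x) - d * (t - y)| <= e * D.
  move=> sb tb; have := H2 (s - x) (t - y).
  rewrite ![_ + (_ - _)]addrC !subrK => H; apply: le_trans (H _ _) _.
  - exact: le_lt_trans (nx _ sb) _.
  - exact: le_lt_trans (ny _ tb) _.
  - by rewrite ler_pM2l // lerD // ?nx ?ny.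
have s12 : s1 <= s2 by lra.
have t12 : t1 <= t2 by lra.
have s1b : lo < s1 < hi by rewrite s1l (le_lt_trans s12).
have s2b : lo < s2 < hi by rewrite s2h (lt_le_trans s1l).
have IQ : `|rint t1 t2 (fun t => Q s2 t - Q s1 t) - b * (s2 - s1) * (t2 - t1)| <=
    e * D * 2 * (t2 - t1).
  apply: rint_approx => // [|t tb]; first by apply: cts_onB; exact: ctsQ.
  have /ler_normlP[A1 A2] := RQ s1 t (introT andP (conj (lexx s1) s12)) tb.
  have /ler_normlP[B1 B2] := RQ s2 t (introT andP (conj s12 (lexx s2))) tb.
  by rewrite ler_norml; apply/andP; split; lra.
have IP : `|rint s1 s2 (fun s => P s t2 - P s t1) - b * (t2 - t1) * (s2 - s1)| <=
    e * D * 2 * (s2 - s1).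
  apply: rint_approx => // [|s sb]; first by apply: cts_onB; exact: ctsP.
  have /ler_normlP[A1 A2] := RP s t1 sb (introT andP (conj (lexx t1) t12)).
  have /ler_normlP[B1 B2] := RP s t2 sb (introT andP (conj t12 (lexx t2))).
  by rewrite ler_norml; apply/andP; split; lra.
move: IQ IP; rewrite rintB; [|exact: ctsQ..]; rewrite rintB; [|exact: ctsP..].
rewrite -/D /J => IQ IP.
have -> : e * 2 * D ^+ 2 = e * D * 2 * (t2 - t1) + e * D * 2 * (s2 - s1) by rewrite /D; ring.
move/ler_normlP: IQ => [A1 A2]; move/ler_normlP: IP => [B1 B2].
by rewrite ler_norml; apply/andP; split; lra.
Qed.

(** Bisection: if the circulation around a rectangle were not zero, repeated
    halving of the sides would produce nested rectangles each keeping its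
    share of it; at the point common to all of them this contradicts
    differentiability. *)
Lemma goursat s1 s2 t1 t2 : lo < s1 -> s1 <= s2 -> s2 < hi -> t1 <= t2 ->
  rint t1 t2 (Q s2) - rint t1 t2 (Q s1) = rint s1 s2 (P^~ t2) - rint s1 s2 (P^~ t1).
Proof.
move=> s1l s12 s2h t12.
suff : `|J s1 s2 t1 t2| <= 0 by rewrite normr_le0 subr_eq0 => /eqP.
pose h n : R := 2^-1 ^+ n.
have h0 n : 0 < h n by rewrite exprn_gt0 // invr_gt0.
have hS n : h n = h n.+1 + h n.+1 by rewrite /h exprS; field.
set L := s2 - s1; set T := t2 - t1.
have L0 : 0 <= L by rewrite subr_ge0.
have T0 : 0 <= T by rewrite subr_ge0.
pose Jn n x y := J x (x + L * h n) y (y + T * h n).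
have step (p : nat * (R * R)) : exists z : R * R, let: (n, (x, y)) := p in
    s1 <= x -> x + L * h n <= s2 ->
    [/\ z.1 = x \/ z.1 = x + L * h n.+1, z.2 = y \/ z.2 = y + T * h n.+1 &
        `|Jn n x y| <= 4 * `|Jn n.+1 z.1 z.2| ].
  case: p => n [x y]; apply: contrapT => /forallNP H.
  have [xb1 xb2] : s1 <= x /\ x + L * h n <= s2.
    by split; apply: contrapT => N; apply: (H (x, y)).
  have Hn z : (z.1 = x \/ z.1 = x + L * h n.+1) -> (z.2 = y \/ z.2 = y + T * h n.+1) ->
      4 * `|Jn n.+1 z.1 z.2| < `|Jn n x y|.
    move=> H1 H2; rewrite ltNge; apply/negP => H3; apply: (H z) => _ _.
    by split.
  have A1 := Hn (x, y) (or_introl erefl) (or_introl erefl).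
  have A2 := Hn (x + L * h n.+1, y) (or_intror erefl) (or_introl erefl).
  have A3 := Hn (x, y + T * h n.+1) (or_introl erefl) (or_intror erefl).
  have A4 := Hn (x + L * h n.+1, y + T * h n.+1) (or_intror erefl) (or_intror erefl).
  have l0 : 0 <= L * h n.+1 by rewrite mulr_ge0 // ltW.
  have u0 : 0 <= T * h n.+1 by rewrite mulr_ge0 // ltW.
  have EL : x + L * h n = x + L * h n.+1 + L * h n.+1 by rewrite (hS n) mulrDr addrA.
  have ET : y + T * h n = y + T * h n.+1 + T * h n.+1 by rewrite (hS n) mulrDr addrA.
  rewrite EL in xb2.
  have E : Jn n x y = Jn n.+1 x y + Jn n.+1 x (y + T * h n.+1) +
     (Jn n.+1 (x + L * h n.+1) y + Jn n.+1 (x + L * h n.+1) (y + T * h n.+1)).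
    rewrite /Jn EL ET (@J_split1 x (x + L * h n.+1)) //; [|lra..].
    by congr (_ + _); rewrite (@J_split2 _ _ y (y + T * h n.+1)) //; lra.
  rewrite /= in A1 A2 A3 A4; move: A1 A2 A3 A4.
  have := ler_normD (Jn n.+1 x y + Jn n.+1 x (y + T * h n.+1))
     (Jn n.+1 (x + L * h n.+1) y + Jn n.+1 (x + L * h n.+1) (y + T * h n.+1)).
  have := ler_normD (Jn n.+1 x y) (Jn n.+1 x (y + T * h n.+1)).
  have := ler_normD (Jn n.+1 (x + L * h n.+1) y) (Jn n.+1 (x + L * h n.+1) (y + T * h n.+1)).
  by rewrite -E; lra.
have {step}[f fP] := choice step.
pose Z := fix Z n := if n is n'.+1 then f (n', Z n') else (s1, t1).
have inv n : s1 <= (Z n).1 /\ (Z n).1 + L * h n <= s2.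
  elim: n => [|n [i1 i2]]; first by rewrite /= /h expr0 mulr1 /L; lra.
  have := fP (n, Z n); rewrite [Z n]surjective_pairing => /(_ i1 i2)[].
  rewrite -surjective_pairing -/(Z n.+1).
  have l0 : 0 <= L * h n.+1 by rewrite mulr_ge0 // ltW.
  rewrite hS in i2; rewrite mulrDr in i2.
  by case=> -> _ _; split; lra.
have stepZ n : [/\ (Z n.+1).1 = (Z n).1 \/ (Z n.+1).1 = (Z n).1 + L * h n.+1,
    (Z n.+1).2 = (Z n).2 \/ (Z n.+1).2 = (Z n).2 + T * h n.+1 &
    `|Jn n (Z n).1 (Z n).2| <= 4 * `|Jn n.+1 (Z n.+1).1 (Z n.+1).2| ].
  have [i1 i2] := inv n.
  have := fP (n, Z n); rewrite [Z n]surjective_pairing => /(_ i1 i2).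
  by rewrite -surjective_pairing.
have growth n : `|J s1 s2 t1 t2| <= 4 ^+ n * `|Jn n (Z n).1 (Z n).2|.
  elim: n => [|n ih].
    by rewrite expr0 mul1r /Jn /= /h expr0 !mulr1 /L /T ![_ + (_ - _)]addrC !subrK.
  have [_ _ H] := stepZ n; apply: (le_trans ih); rewrite exprSr -mulrA.
  by rewrite ler_pM2l // exprn_gt0.
have [x xP] := @nested_point (fun n => (Z n).1) (fun n => L * h n)
  (fun n => ltac:(have [[->|->] _ _] := stepZ n; rewrite ?lerDl // mulr_ge0 // ltW //))
  (fun n => ltac:(have [[->|->] _ _] := stepZ n; rewrite (hS n) mulrDr addrA // lerDl mulr_ge0 // ltW //))
  (fun n => mulr_ge0 L0 (ltW (h0 n))).
have [y yP] := @nested_point (fun n => (Z n).2) (fun n => T * h n)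
  (fun n => ltac:(have [_ [->|->] _] := stepZ n; rewrite ?lerDl // mulr_ge0 // ltW //))
  (fun n => ltac:(have [_ [->|->] _] := stepZ n; rewrite (hS n) mulrDr addrA // lerDl mulr_ge0 // ltW //))
  (fun n => mulr_ge0 T0 (ltW (h0 n))).
have xb : lo < x < hi.
  have /andP[x1 x2] := xP 0%N; have [i1 i2] := inv 0%N; lra.
apply/ler_addgt0Pr => e e0; rewrite add0r.
set D := (L + T) ^+ 2 + 1.
have D0 : 0 < D by rewrite ltr_wpDl // sqr_ge0.
have [k k0 kP] := J_local y xb (divr_gt0 e0 (mulr_gt0 (ltr0Sn R 1) D0)).
have [n nk] : exists n, (L + T + 1) * h n < k.
  have B0 : 0 < L + T + 1 by lra.
  have [n /andP[_ nP]] : exists n, (n <= n)%N && ((L + T + 1) / k < n%:R).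
    have := archi_boundP (ltW (divr_gt0 B0 k0)).
    by exists (Num.bound ((L + T + 1) / k)); rewrite leqnn.
  exists n; rewrite /h exprVn ltr_pdivrMr ?exprn_gt0 //.
  rewrite ltr_pdivrMr // in nP; apply: (lt_trans nP).
  rewrite mulrC ltr_pM2l // -natrX ltr_nat.
  exact: ltn_expl.
have [i1 i2] := inv n; have xn := xP n; have yn := yP n.
have l0 : 0 <= L * h n by rewrite mulr_ge0 // ltW.
have u0 : 0 <= T * h n by rewrite mulr_ge0 // ltW.
have hn := h0 n.
have nk' : L * h n + T * h n + h n < k by rewrite mulrDl mulrDl mul1r in nk.
have := kP (Z n).1 ((Z n).1 + L * h n) (Z n).2 ((Z n).2 + T * h n).
rewrite -/(Jn n (Z n).1 (Z n).2) => /(_ _ xn _ yn) => H.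
have {}H : `|Jn n (Z n).1 (Z n).2| <= e / (2 * D) * 2 * (L * h n + T * h n) ^+ 2.
  apply: le_trans (H _ _ _ _) _; [lra|lra|lra|lra|].
  by rewrite le_eqVlt; apply/orP; left; apply/eqP; congr (_ * _ ^+ 2); ring.
apply: (le_trans (growth n)).
have p4 : 0 <= 4 ^+ n :> R by exact: exprn_ge0.
apply: (le_trans (ler_wpM2l p4 H)).
have E4 : 4 ^+ n * (h n * h n) = 1.
  have q : 4 * (2^-1 * 2^-1) = 1 :> R by field.
  by rewrite /h -exprMn -exprMn q expr1n.
apply: (@le_trans _ _ ((4 ^+ n * (h n * h n)) * (e * ((L + T) ^+ 2 / D)))).
  by rewrite le_eqVlt; apply/orP; left; apply/eqP; field; rewrite gt_eqF.
rewrite E4 mul1r ler_piMr ?(ltW e0) // ler_pdivrMr // mul1r /D; lra.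
Qed.

End Goursat.

(** * Cauchy's theory on circles *)

Section CircleMeans.
Variable R : realType.
Local Notation C := R[i].
Implicit Types (F G f : C -> C) (z : C).

Lemma ccontP F z : {for z, continuous (F : cplane R -> cplane R)} <->
  forall e : R, 0 < e -> exists2 k : R, 0 < k &
    forall h : C, cmod h < k -> cmod (F (z + h) - F z) <= e.
Proof.
split=> [cF e e0|H].
  have /cvgrPdist_le/(_ e%:C%C) : (F : cplane R -> cplane R) x @[x --> (z : cplane R)] --> (F z : cplane R).
    exact: cF.
  rewrite ltcR => /(_ e0)/(@nbhs_normP R[i] R[i]^o)[k /= k0 kP].
  have [k' k'0 kk] : exists2 k' : R, 0 < k' & k = k'%:C%C.
    move: k0; rewrite ltcE /= => /andP[/eqP im0 re0]; exists (Re k) => //.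
    by case: k im0 {re0 kP} => a b /= ->.
  exists k' => // h hk.
  have /kP : ball_ Num.Def.normr (z : R[i]^o) k (z + h).
    by rewrite /ball_ /= opprD addrA subrr sub0r normrN kk [`|_|]cmod_norm ltcR.
  by rewrite [`|_|]cmod_norm lecR cmodB.
suff : (F : cplane R -> cplane R) x @[x --> (z : cplane R)] --> (F z : cplane R) by [].
apply/(@cvgrPdist_le _ _ _ _ (nbhs_filter (z : cplane R))) => /= e e0.
have [e' e'0 ee] : exists2 e' : R, 0 < e' & e = e'%:C%C.
  move: e0; rewrite ltcE /= => /andP[/eqP im0 re0]; exists (Re e) => //.
  by case: e im0 {re0} => a b /= ->.
have [k k0 kP] := H _ e'0.
apply/(@nbhs_normP R[i] R[i]^o); exists k%:C%C; first by rewrite /= ltcR.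
move=> x; rewrite /ball_ /= [`|_|]cmod_norm ltcR => zx.
rewrite cmodB in zx; have := kP _ zx; rewrite [z + _]addrC subrK cmodB.
by rewrite ee [`|_|]cmod_norm lecR.
Qed.

Lemma ccont_polar F r t : {for cpolar r t, continuous (F : cplane R -> cplane R)} ->
  forall e : R, 0 < e -> exists2 k : R, 0 < k & forall x y : R, `|x - r| < k -> `|y - t| < k ->
    cmod (F (cpolar x y) - F (cpolar r t)) <= e.
Proof.
move=> /ccontP cF e e0; have [k k0 kP] := cF _ e0.
have [l l0 lP] := crdiff2_cpolar r t ltr01.
set A := cis t in lP; set B := 'i%C * _ in lP.
have N0 : 0 < cmod A + cmod B + 1 by rewrite ltr_wpDl // addr_ge0 // cmod_ge0.
exists (Num.min l (k / (2 * (cmod A + cmod B + 1)))).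
  by rewrite lt_min l0 divr_gt0 // mulr_gt0.
move=> x y; rewrite !lt_min => /andP[xl xk] /andP[yl yk].
have := lP (x - r) (y - t) xl yl; rewrite ![_ + (_ - _)]addrC !subrK mul1r => H.
have := kP (cpolar x y - cpolar r t); rewrite [cpolar r t + _]addrC subrK; apply.
have -> : cpolar x y - cpolar r t =
  (cpolar x y - cpolar r t - A * (x - r)%:C%C - B * (y - t)%:C%C) +
  (A * (x - r)%:C%C + B * (y - t)%:C%C) by ring.
apply: (le_lt_trans (cmodD_le _ _)); apply: (le_lt_trans (lerD H (cmodD_le _ _))).
rewrite (cmodM A) (cmodM B) !cmod_real.
apply: (@le_lt_trans _ _ ((cmod A + cmod B + 1) * (`|x - r| + `|y - t|))).
  have := cmod_ge0 A; have := cmod_ge0 B; have := normr_ge0 (x - r).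
  have := normr_ge0 (y - t); nra.
rewrite mulrC -ltr_pdivlMr //.
have -> : k / (cmod A + cmod B + 1) =
  k / (2 * (cmod A + cmod B + 1)) + k / (2 * (cmod A + cmod B + 1)).
  by field; rewrite gt_eqF.
exact: ltrD.
Qed.

Lemma cts2_eps (g : R * R -> R) (r t : R) :
  (forall e : R, 0 < e -> exists2 k : R, 0 < k & forall x y : R, `|x - r| < k -> `|y - t| < k ->
    `|g (x, y) - g (r, t)| <= e) -> {for (r, t), continuous g}.
Proof.
move=> H; apply/cvgrPdist_le => /= e e0; have [k k0 kP] := H _ e0.
exists (ball r k, ball t k); first by split; exact: nbhsx_ballx.
move=> [x y] /= []; rewrite /ball /= => xk yk.
by rewrite distrC; apply: kP; rewrite distrC.
Qed.

Lemma cts2_Re F r t : {for cpolar r t, continuous (F : cplane R -> cplane R)} ->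
  {for (r, t), continuous (fun p : R * R => Re (F (cpolar p.1 p.2)))}.
Proof.
move=> /ccont_polar H; apply: cts2_eps => e /H[k k0 kP]; exists k => // x y xk yk /=.
by rewrite -cReB; apply: (le_trans (norm_Re_cmod _)); exact: kP.
Qed.

Lemma cts2_Im F r t : {for cpolar r t, continuous (F : cplane R -> cplane R)} ->
  {for (r, t), continuous (fun p : R * R => Im (F (cpolar p.1 p.2)))}.
Proof.
move=> /ccont_polar H; apply: cts2_eps => e /H[k k0 kP]; exists k => // x y xk yk /=.
by rewrite -cImB; apply: (le_trans (norm_Im_cmod _)); exact: kP.
Qed.

Lemma cpolar_period (r t : R) : cpolar r (t + 2 * pi) = cpolar r t.
Proof. by rewrite /cpolar [2 * _]mulrC mulr_natr cosD2pi sinD2pi. Qed.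

Lemma pi2_gt0 : 0 < 2 * pi :> R.
Proof. by rewrite mulr_gt0 // pi_gt0. Qed.

(** The form [F(r e^(i t)) / r dr + i F(r e^(i t)) dt] is closed because [F]
    is complex differentiable; Goursat's lemma on the rectangle of radii
    times a full turn, whose two radial sides cancel by periodicity, shows
    that the mean over a circle does not depend on its radius. *)
Lemma circle_mean_const F (lo hi r1 r2 : R) : 0 <= lo ->
  (forall z, lo < cmod z < hi -> exists d, cdiff_at F z d) ->
  lo < r1 -> r1 <= r2 -> r2 < hi ->
  rint 0 (2 * pi) (fun t => Re (F (cpolar r1 t))) =
  rint 0 (2 * pi) (fun t => Re (F (cpolar r2 t))).
Proof.
move=> lo0 dF r1l r12 r2h.
apply/eqP; rewrite eq_sym -subr_eq0; apply/eqP.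
rewrite (@goursat _ (fun r t => r^-1 * Im (F (cpolar r t))) (fun r t => Re (F (cpolar r t))) lo hi) //.
- have E (r : R) : cpolar r (2 * pi) = cpolar r 0 by rewrite -(cpolar_period r 0) add0r.
  by under [in X in X - _]eq_rint do rewrite E; rewrite subrr.
- move=> r t /andP[rl rh].
  have r0 : 0 < r by exact: le_lt_trans rl.
  have [|d dz] := dF (cpolar r t); first by rewrite cmod_cpolar ?rl // ltW.
  have D := crdiff2_comp (crdiff2_cpolar r t) dz.
  have DQ := crdiff2_Re D.
  have dinv : is_derive r (1 : R) (fun x : R => x^-1) (- r ^- 2 * 1).
    have -> : (- r ^- 2 * 1 : R) = - r ^- 2 *: (1 : R) by [].
    by apply: (@is_deriveV _ id); rewrite ?gt_eqF //; exact: is_derive_id.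
  have DP := rdiff2M (rdiff2_fst t dinv) (crdiff2_Im D).
  do 3 eexists; split; last exact: DQ.
  have -> : Re (d * cis t) =
    r^-1 * Im (d * ('i%C * (r%:C%C * cis t))) + Im (F (cpolar r t)) * 0.
    by rewrite !(cReM, cImM) /=; field; rewrite gt_eqF.
  exact: DP.
- exact: ltW pi2_gt0.
Qed.

Lemma cts_limit_right (m : R -> R) (x c d : R) : x < d -> {for x, continuous m} ->
  (forall y, x < y < d -> m y = c) -> m x = c.
Proof.
move=> xd cm H; apply/eqP; rewrite -subr_eq0 -normr_le0; apply/ler_addgt0Pr => e e0.
rewrite add0r; have /cvgrPdist_le/(_ e e0)/nbhs_normP[k /= k0 kP] : m y @[y --> x] --> m x by exact: cm.
set y := x + Num.min (k / 2) ((d - x) / 2).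
have y0 : 0 < Num.min (k / 2) ((d - x) / 2) by rewrite lt_min !divr_gt0 // subr_gt0.
rewrite -(H y).
  apply: kP; rewrite /ball_ /= /y opprD addrA subrr sub0r normrN gtr0_norm //.
  by rewrite gt_min; apply/orP; left; lra.
rewrite /y ltrDl y0 /= -ltrBrDl gt_min; apply/orP; right; lra.
Qed.

Lemma cts_limit_left (m : R -> R) (x c d : R) : d < x -> {for x, continuous m} ->
  (forall y, d < y < x -> m y = c) -> m x = c.
Proof.
move=> xd cm H; apply/eqP; rewrite -subr_eq0 -normr_le0; apply/ler_addgt0Pr => e e0.
rewrite add0r; have /cvgrPdist_le/(_ e e0)/nbhs_normP[k /= k0 kP] : m y @[y --> x] --> m x by exact: cm.
set y := x - Num.min (k / 2) ((x - d) / 2).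
have y0 : 0 < Num.min (k / 2) ((x - d) / 2) by rewrite lt_min !divr_gt0 // subr_gt0.
rewrite -(H y).
  apply: kP; rewrite /ball_ /= /y opprB addrCA subrr addr0 gtr0_norm //.
  by rewrite gt_min; apply/orP; left; lra.
rewrite /y ltrBlDr ltrDl y0 andbT ltrBrDr -ltrBrDl gt_min; apply/orP; right; lra.
Qed.

(** Circular means are constant on either side of the radius [|z|] and
    continuous in the radius, hence constant down to the radius 0. The
    exceptional point is the one that the difference quotient in Cauchy's
    formula needs. *)
Lemma mean_value_Re G z (rho r : R) : 0 <= r < rho ->
  (forall w, cmod w < rho -> {for w, continuous (G : cplane R -> cplane R)}) ->
  (forall w, cmod w < rho -> w != z -> exists d, cdiff_at G w d) ->
  rint 0 (2 * pi) (fun t => Re (G (cpolar r t))) = 2 * pi * Re (G 0).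
Proof.
move=> /andP[r0 rr] cG dG.
set m := fun r : R => rint 0 (2 * pi) (fun t => Re (G (cpolar r t))).
have cm x : `|x| < rho -> {for x, continuous m}.
  move=> xr; set u := (`|x| + rho) / 2.
  have ux : - u < x < u by rewrite -ltr_norml /u; lra.
  have ur : u < rho by rewrite /u; lra.
  apply: (@rint_param_cts _ (fun p : R * R => Re (G (cpolar p.1 p.2))) _ _ _ _ _ ux) => -[a b] /= ab _.
  by apply: cts2_Re; apply: cG; rewrite cmod_cpolar_norm (le_lt_trans _ ur) // ler_norml.
have m0 : m 0 = 2 * pi * Re (G 0).
  rewrite /m (@eq_rint _ _ (fun=> Re (G 0))) => [|t _].
    by rewrite rint_cst ?ltW ?pi2_gt0 // subr0 mulrC.
  by rewrite cpolarE mul0r.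
have mcst lo hi r1 r2 : 0 <= lo -> hi <= rho -> (forall w, lo < cmod w < hi -> w != z) ->
    lo < r1 -> r1 < hi -> lo < r2 -> r2 < hi -> m r1 = m r2.
  move=> lo0 hir H.
  wlog r12 : r1 r2 / r1 <= r2.
    by move=> W; case: (leP r1 r2) => [/W//|/ltW/W {}W *]; rewrite W.
  move=> r1l r1h r2l r2h; apply: (circle_mean_const lo0 _ r1l r12 r2h) => w wb.
  by apply: dG; [case/andP: wb => _ /lt_le_trans; apply|exact: H].
set a := cmod z; have a0 : 0 <= a := cmod_ge0 z.
have ma x : 0 <= x -> x < a -> x < rho -> m x = m 0.
  rewrite le_eqVlt => /predU1P[<-//|x0 xa xr].
  apply/esym; apply: (@cts_limit_right _ _ _ x) => //; first by apply: cm; rewrite normr0 (lt_trans x0).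
  move=> y /andP[y0 yx]; apply: (mcst 0 (Num.min a rho)) => //; rewrite ?lt_min ?xa ?ge_min ?lexx ?orbT //.
  + by move=> w; rewrite lt_min => /andP[_ /andP[wa _]]; apply: contraTneq wa => ->; rewrite ltxx.
  + by rewrite (lt_trans yx) // (lt_trans yx).
have mA : a < rho -> m a = m 0.
  move=> ar; move: a0; rewrite le_eqVlt => /predU1P[<-//|a0'].
  apply: (@cts_limit_left _ _ _ 0) => //; first by apply: cm; rewrite ger0_norm // ltW.
  by move=> y /andP[y0 ya]; apply: ma => //; [exact: ltW|exact: lt_trans ar].
rewrite -/(m r) -m0.
case: (ltgtP r a) => [ra|ar|ra]; first exact: ma.
  have aR : a < rho by exact: lt_trans rr.
  rewrite -(mA aR).
  apply/esym; apply: (@cts_limit_right _ _ _ r) => //.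
    by apply: cm; rewrite ger0_norm.
  move=> y /andP[ay yr]; apply: (mcst a rho) => //; last exact: lt_trans rr.
  by move=> w /andP[aw _]; apply: contraTneq aw => ->; rewrite ltxx.
by rewrite ra; apply: mA; rewrite -ra.
Qed.

Lemma Re_Ni (w : C) : Re (- 'i%C * w) = Im w.
Proof. by rewrite cReM /=; ring. Qed.

Lemma mean_value_Im G z (rho r : R) : 0 <= r < rho ->
  (forall w, cmod w < rho -> {for w, continuous (G : cplane R -> cplane R)}) ->
  (forall w, cmod w < rho -> w != z -> exists d, cdiff_at G w d) ->
  rint 0 (2 * pi) (fun t => Im (G (cpolar r t))) = 2 * pi * Im (G 0).
Proof.
move=> rr cG dG.
have cG' w : cmod w < rho -> {for w, continuous ((fun w => - 'i%C * G w) : cplane R -> cplane R)}.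
  by move=> wr; apply: (@continuousM R[i] R[i]^o (fun=> - 'i%C) G); [exact: cst_continuous|exact: cG].
have dG' w : cmod w < rho -> w != z -> exists d, cdiff_at (fun w => - 'i%C * G w) w d.
  move=> wr wz; have [d dd] := dG w wr wz.
  by exists (- 'i%C * d + G w * 0); exact: (cdiffM (cdiff_cst _ w) dd).
rewrite -Re_Ni -(mean_value_Re rr cG' dG').
by apply: eq_rint => t _; rewrite Re_Ni.
Qed.

(** Integral over a full circle of a complex-valued function of the angle. *)
Definition cint (u : R -> C) : C :=
  (rint 0 (2 * pi) (fun t => Re (u t)) +i* rint 0 (2 * pi) (fun t => Im (u t)))%C.

Definition ccts (u : R -> C) := forall t, {for t, continuous (fun t => Re (u t))} /\
  {for t, continuous (fun t => Im (u t))}.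

Lemma cctsM u v : ccts u -> ccts v -> ccts (fun t => u t * v t).
Proof.
move=> cu cv t; have [? ?] := cu t; have [? ?] := cv t.
have -> : (fun t => Re (u t * v t)) = (fun t => Re (u t) * Re (v t) - Im (u t) * Im (v t)).
  by apply: funext => x; rewrite cReM.
have -> : (fun t => Im (u t * v t)) = (fun t => Re (u t) * Im (v t) + Im (u t) * Re (v t)).
  by apply: funext => x; rewrite cImM.
split; first by apply: continuousB; exact: continuousM.
by apply: continuousD; exact: continuousM.
Qed.

Lemma cctsB u v : ccts u -> ccts v -> ccts (fun t => u t - v t).
Proof.
move=> cu cv t; have [? ?] := cu t; have [? ?] := cv t.
have -> : (fun t => Re (u t - v t)) = (fun t => Re (u t) - Re (v t)).
  by apply: funext => x; rewrite cReB.
have -> : (fun t => Im (u t - v t)) = (fun t => Im (u t) - Im (v t)).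
  by apply: funext => x; rewrite cImB.
by split; exact: continuousB.
Qed.

Lemma ccts_cst (c : C) : ccts (fun=> c).
Proof. by move=> t; split; exact: cst_continuous. Qed.

Lemma ccts_circle F r : (forall t, {for cpolar r t, continuous (F : cplane R -> cplane R)}) ->
  ccts (fun t => F (cpolar r t)).
Proof.
move=> cF t; split.
- exact: (@cts_pair2 _ (fun p : R * R => Re (F (cpolar p.1 p.2))) r t (cts2_Re (cF t))).
- exact: (@cts_pair2 _ (fun p : R * R => Im (F (cpolar p.1 p.2))) r t (cts2_Im (cF t))).
Qed.

Lemma eq_cint u v : (forall t, u t = v t) -> cint u = cint v.
Proof. by move=> uv; congr cint; apply: funext. Qed.

Lemma cintB u v : ccts u -> ccts v -> cint (fun t => u t - v t) = cint u - cint v.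
Proof.
move=> cu cv; apply: complex_ext; rewrite ?cReB ?cImB /= -rintB.
- by apply: eq_rint => t _; rewrite cReB.
- by move=> t _; have [] := cu t.
- by move=> t _; have [] := cv t.
- by apply: eq_rint => t _; rewrite cImB.
- by move=> t _; have [] := cu t.
- by move=> t _; have [] := cv t.
Qed.

Lemma cintZ (c : C) u : ccts u -> cint (fun t => c * u t) = c * cint u.
Proof.
move=> cu.
have c1 : cts_on (fun t => Re (u t)) 0 (2 * pi) by move=> t _; have [] := cu t.
have c2 : cts_on (fun t => Im (u t)) 0 (2 * pi) by move=> t _; have [] := cu t.
have cc k := @cts_on_cst R 0 (2 * pi) k.
apply: complex_ext; rewrite ?cReM ?cImM /= -!rintZ //.
- by rewrite -rintB; [apply: eq_rint => t _; rewrite cReM|exact: cts_onM..].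
- by rewrite -rintD; [apply: eq_rint => t _; rewrite cImM|exact: cts_onM..].
Qed.

Lemma cint_bound u (M : R) : ccts u -> (forall t, 0 <= t <= 2 * pi -> cmod (u t) <= M) ->
  cmod (cint u) <= 4 * pi * M.
Proof.
move=> cu uM; apply: (le_trans (cmod_le_ReIm _)) => /=.
have c1 : cts_on (fun t => Re (u t)) 0 (2 * pi) by move=> t _; have [] := cu t.
have c2 : cts_on (fun t => Im (u t)) 0 (2 * pi) by move=> t _; have [] := cu t.
have p0 : 0 <= 2 * pi :> R by exact: ltW pi2_gt0.
have := @rint_approx R _ 0 (2 * pi) 0 M p0 c1.
have := @rint_approx R _ 0 (2 * pi) 0 M p0 c2.
rewrite !mul0r !subr0 => H2 H1.
have {}H1 := H1 (fun t tb => ltac:(rewrite subr0; exact: le_trans (norm_Re_cmod _) (uM t tb))).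
have {}H2 := H2 (fun t tb => ltac:(rewrite subr0; exact: le_trans (norm_Im_cmod _) (uM t tb))).
lra.
Qed.

Lemma cint_mean_value G z (rho r : R) : 0 <= r < rho ->
  (forall w, cmod w < rho -> {for w, continuous (G : cplane R -> cplane R)}) ->
  (forall w, cmod w < rho -> w != z -> exists d, cdiff_at G w d) ->
  cint (fun t => G (cpolar r t)) = (2 * pi)%:C%C * G 0.
Proof.
move=> rr cG dG; apply: complex_ext; rewrite ?cReM ?cImM /= mul0r ?subr0 ?addr0.
- exact: (mean_value_Re rr cG dG).
- exact: (mean_value_Im rr cG dG).
Qed.

Lemma cmod_circle_sub_ge z r t : r - cmod z <= cmod (cpolar r t - z).
Proof.
apply: le_trans (cmod_lerB _ _); rewrite cmod_cpolar_norm lerD2r.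
exact: ler_norm.
Qed.

Lemma circle_neq z r t : cmod z < r -> cpolar r t - z != 0.
Proof.
by move=> zr; rewrite -cmod_gt0 (lt_le_trans _ (cmod_circle_sub_ge _ _ _)) // subr_gt0.
Qed.

(** The mean of [w / (w - z)] does not depend on the radius beyond [|z|],
    and it tends to 1 as the radius grows. *)
Lemma cint_winding z (r : R) : cmod z < r ->
  cint (fun t => cpolar r t / (cpolar r t - z)) = (2 * pi)%:C%C.
Proof.
move=> zr.
pose F (w : C) := w / (w - z).
have dF w : cmod z < cmod w -> exists d, cdiff_at F w d.
  move=> zw; have wz : w - z != 0.
    by rewrite subr_eq0; apply: contraTneq zw => ->; rewrite ltxx.
  eexists; apply: cdiffM (cdiff_id w) _.
  by apply: cdiffV => //; exact: cdiffB (cdiff_id w) (cdiff_cst z w).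
have a0 := cmod_ge0 z.
have cF r' : cmod z < r' -> ccts (fun t => F (cpolar r' t)).
  move=> zr'; apply: ccts_circle => t.
  have [|d] := dF (cpolar r' t); first by rewrite cmod_cpolar // ltW // (le_lt_trans a0).
  exact: cdiff_continuous.
have step r' : r < r' -> cint (fun t => F (cpolar r t)) = cint (fun t => F (cpolar r' t)).
  move=> rr'; apply: complex_ext => /=.
    apply: (@circle_mean_const _ (cmod z) (r' + 1)) => //; [|exact: ltW|by rewrite ltrDl].
    by move=> w /andP[zw _]; exact: dF.
  under eq_rint do rewrite -Re_Ni; under [RHS]eq_rint do rewrite -Re_Ni.
  apply: (@circle_mean_const (fun w => - 'i%C * F w) (cmod z) (r' + 1)) => //; [|exact: ltW|by rewrite ltrDl].
  move=> w /andP[zw _]; have [d dd] := dF w zw.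
  by eexists; exact: (cdiffM (cdiff_cst _ w) dd).
have bnd r' : r < r' -> cmod (cint (fun t => F (cpolar r t)) - (2 * pi)%:C%C) <=
    4 * pi * (cmod z / (r' - cmod z)).
  move=> rr'; have zr' : cmod z < r' by exact: lt_trans rr'.
  have -> : (2 * pi)%:C%C = cint (fun=> 1) :> C.
    apply: complex_ext => /=; rewrite rint_cst ?(ltW pi2_gt0) //; ring.
  rewrite (step r') // -cintB; [|exact: cF|exact: ccts_cst].
  apply: cint_bound => [|t _]; first by apply: cctsB; [exact: cF|exact: ccts_cst].
  have N := circle_neq t zr'.
  have -> : F (cpolar r' t) - 1 = z / (cpolar r' t - z) by rewrite /F; field.
  rewrite cmodM cmodV ler_pM // ?invr_ge0 ?cmod_ge0 // lef_pV2 ?posrE ?cmod_gt0 ?subr_gt0 //.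
  exact: cmod_circle_sub_ge.
apply/eqP; rewrite -subr_eq0 -cmod_eq0 eq_le cmod_ge0 andbT leNgt; apply/negP => X0.
set X := cmod _ in X0.
have q0 : 0 <= 8 * pi * cmod z / X.
  by rewrite divr_ge0 // ?mulr_ge0 // ?pi_ge0 // ltW.
have := bnd (r + 1 + 8 * pi * cmod z / X); rewrite -/X => H.
have : X <= 4 * pi * (cmod z / (r + 1 + 8 * pi * cmod z / X - cmod z)).
  by apply: H; lra.
rewrite mulrA ler_pdivlMr; last lra.
have -> : X * (r + 1 + 8 * pi * cmod z / X - cmod z) = X * (r + 1 - cmod z) + 8 * pi * cmod z.
  by field; rewrite gt_eqF.
apply/negP; rewrite -ltNge.
have : 0 < X * (r + 1 - cmod z) by rewrite mulr_gt0 //; lra.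
have : 0 <= pi * cmod z by rewrite mulr_ge0 // pi_ge0.
lra.
Qed.

(** The difference quotient [(f w - f z) / (w - z)], extended by continuity
    at [z], satisfies the mean value property after multiplication by [w],
    which vanishes at the centre. *)
Lemma cauchy_formula f (rho r : R) z : cmod z < r -> r < rho ->
  (forall w, cmod w < rho -> exists d, cdiff_at f w d) ->
  cint (fun t => f (cpolar r t) * (cpolar r t / (cpolar r t - z))) = (2 * pi)%:C%C * f z.
Proof.
move=> zr rr df.
have a0 := cmod_ge0 z; have r0 : 0 < r by exact: le_lt_trans zr.
have [d dz] := df z (lt_trans zr rr).
pose q (w : C) := if w == z then d else (f w - f z) / (w - z).
have dq w : cmod w < rho -> w != z -> exists d, cdiff_at q w d.
  move=> wr wz; have [dw dfw] := df w wr.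
  have wz' : w - z != 0 by rewrite subr_eq0.
  eexists; apply: (@cdiff_near _ (fun w => (f w - f z) * (w - z)^-1) _ _ _ (cmod (w - z))).
  - by rewrite cmod_gt0.
  - move=> x xw; rewrite /q; case: eqP => // xz; move: xw.
    by rewrite xz cmodB ltxx.
  - apply: cdiffM; first exact: cdiffB dfw (cdiff_cst _ _).
    by apply: cdiffV => //; exact: cdiffB (cdiff_id w) (cdiff_cst z w).
have cq w : cmod w < rho -> {for w, continuous (q : cplane R -> cplane R)}.
  have [->|wz] := eqVneq w z => wr; last first.
    by have [? /cdiff_continuous] := dq w wr wz.
  apply/ccontP => e e0; have [k k0 kP] := dz e e0; exists k => // h hk.
  rewrite /q eqxx; case: eqP => [_|/eqP hz]; first by rewrite subrr cmod0 ltW.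
  have h0 : h != 0 by apply: contraNneq hz => ->; rewrite addr0.
  have -> : (f (z + h) - f z) / (z + h - z) - d = (f (z + h) - f z - d * h) / h.
    by rewrite [z + h]addrC addrK; field.
  by rewrite cmodM cmodV ler_pdivrMr ?cmod_gt0 //; exact: kP.
have cqG w : cmod w < rho -> {for w, continuous ((fun w => q w * w) : cplane R -> cplane R)}.
  by move=> wr; apply: (@continuousM R[i] R[i]^o q id); [exact: cq|exact: cvg_id].
have dqG w : cmod w < rho -> w != z -> exists d, cdiff_at (fun w => q w * w) w d.
  move=> wr wz; have [e de] := dq w wr wz.
  by eexists; exact: (cdiffM de (cdiff_id w)).
have I0 : cint (fun t => q (cpolar r t) * cpolar r t) = 0.
  have rr' : 0 <= r < rho by rewrite ltW.
  by have := cint_mean_value rr' cqG dqG; rewrite !mulr0.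
have circ t : cmod (cpolar r t) < rho by rewrite cmod_cpolar // ltW.
have c1 : ccts (fun t => f (cpolar r t) * (cpolar r t / (cpolar r t - z))).
  apply: (@ccts_circle (fun w => f w * (w / (w - z)))) => t.
  have [e de] := df _ (circ t).
  apply: (cdiff_continuous (cdiffM de (cdiffM (cdiff_id _) (cdiffV _ (cdiffB (cdiff_id _) (cdiff_cst z _)))))).
  exact: circle_neq.
have c2 : ccts (fun t => cpolar r t / (cpolar r t - z)).
  apply: (@ccts_circle (fun w => w / (w - z))) => t.
  apply: (cdiff_continuous (cdiffM (cdiff_id _) (cdiffV _ (cdiffB (cdiff_id _) (cdiff_cst z _))))).
  exact: circle_neq.
rewrite mulrC -(cint_winding zr) -cintZ //; apply/eqP; rewrite -subr_eq0 -cintB //; last first.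
  exact: cctsM (ccts_cst _) c2.
rewrite -I0; apply/eqP/eq_cint => t.
have N := circle_neq t zr.
rewrite /q ifF; first by field.
by apply/negbTE; rewrite -subr_eq0.
Qed.

(** Differentiation under the integral sign, for kernels with a uniform
    quadratic remainder. *)
Lemma cdiff_cint (k k' : C -> R -> C) z (M rho : R) : 0 < rho -> 0 <= M ->
  (forall h, cmod h < rho -> ccts (k (z + h))) -> ccts (k' z) ->
  (forall h t, cmod h < rho -> 0 <= t <= 2 * pi ->
     cmod (k (z + h) t - k z t - k' z t * h) <= M * cmod h ^+ 2) ->
  cdiff_at (fun w => cint (k w)) z (cint (k' z)).
Proof.
move=> rho0 M0 ck ck' H e e0.
have pM : 0 < 4 * pi * M + 1 by rewrite ltr_wpDl // !mulr_ge0 // pi_ge0.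
exists (Num.min rho (e / (4 * pi * M + 1))); first by rewrite lt_min rho0 divr_gt0.
move=> h; rewrite lt_min => /andP[hr he].
have ck0 : ccts (k z) by rewrite -[z]addr0; apply: ck; rewrite cmod0.
have c1 := ck _ hr.
have c2 : ccts (fun t => k (z + h) t - k z t) by exact: cctsB.
have c3 : ccts (fun t => h * k' z t) by exact: cctsM (ccts_cst h) ck'.
rewrite [cint (k' z) * h]mulrC -cintZ // -cintB // -cintB //.
have := cint_bound (cctsB c2 c3) (M := M * cmod h ^+ 2).
move=> /(_ (fun t tb => ltac:(rewrite [h * _]mulrC; exact: H))) B; apply: (le_trans B).
have -> : 4 * pi * (M * cmod h ^+ 2) = (4 * pi * M * cmod h) * cmod h by ring.
rewrite ler_wpM2r ?cmod_ge0 //.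
have : (4 * pi * M + 1) * cmod h <= e.
  by rewrite mulrC -ler_pdivlMr // ltW.
have := cmod_ge0 h; lra.
Qed.

Lemma cauchy_kernel1 (w h : C) (delta : R) : 0 < delta -> delta <= cmod w ->
  cmod h <= delta / 2 -> cmod ((w - h)^-1 - w^-1 - (w ^+ 2)^-1 * h) <= 2 / delta ^+ 3 * cmod h ^+ 2.
Proof.
move=> d0 wd hd.
have w0 : w != 0 by rewrite -cmod_gt0 (lt_le_trans d0).
have whd : delta / 2 <= cmod (w - h) by have := cmod_lerB w h; lra.
have wh0 : w - h != 0 by rewrite -cmod_gt0 (lt_le_trans _ whd) // divr_gt0.
have -> : (w - h)^-1 - w^-1 - (w ^+ 2)^-1 * h = h ^+ 2 / (w ^+ 2 * (w - h)).
  by field; rewrite w0 wh0.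
rewrite cmodM cmodV cmodM !cmodX mulrC ler_wpM2r ?exprn_ge0 ?cmod_ge0 //.
have -> : 2 / delta ^+ 3 = (delta ^+ 2 * (delta / 2))^-1 by field; rewrite gt_eqF.
rewrite lef_pV2 ?posrE ?mulr_gt0 ?exprn_gt0 ?cmod_gt0 ?divr_gt0 //.
by apply: ler_pM => //; rewrite ?exprn_ge0 ?divr_ge0 ?(ltW d0) // lerXn2r ?nnegrE ?cmod_ge0 // ltW.
Qed.

Lemma cauchy_kernel2 (w h : C) (delta : R) : 0 < delta -> delta <= cmod w ->
  cmod h <= delta / 2 ->
  cmod ((w - h) ^- 2 - w ^- 2 - (2 * w ^- 3) * h) <= 16 / delta ^+ 4 * cmod h ^+ 2.
Proof.
move=> d0 wd hd.
have w0 : w != 0 by rewrite -cmod_gt0 (lt_le_trans d0).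
have whd : delta / 2 <= cmod (w - h) by have := cmod_lerB w h; lra.
have wh0 : w - h != 0 by rewrite -cmod_gt0 (lt_le_trans _ whd) // divr_gt0.
have -> : (w - h) ^- 2 - w ^- 2 - (2 * w ^- 3) * h =
    h ^+ 2 * ((w + w + w - (h + h)) / w) / (w ^+ 2 * (w - h) ^+ 2).
  by field; rewrite w0 wh0.
rewrite cmodM (cmodM (h ^+ 2)) cmodV (cmodM (w ^+ 2)) !cmodX.
have h0 := cmod_ge0 h; have cw0 : 0 < cmod w by rewrite cmod_gt0.
have B1 : cmod ((w + w + w - (h + h)) / w) <= 4.
  rewrite cmodM cmodV ler_pdivrMr //.
  apply: (le_trans (cmodB_le _ _)); apply: (le_trans (lerD (cmodD_le _ _) (cmodD_le _ _))).
  have := cmodD_le w w; lra.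
have B2 : (cmod w ^+ 2 * cmod (w - h) ^+ 2)^-1 <= 4 / delta ^+ 4.
  have -> : 4 / delta ^+ 4 = (delta ^+ 2 * (delta / 2) ^+ 2)^-1 by field; rewrite gt_eqF.
  rewrite lef_pV2 ?posrE ?mulr_gt0 ?exprn_gt0 ?cmod_gt0 ?divr_gt0 //.
  by apply: ler_pM => //; rewrite ?exprn_ge0 ?divr_ge0 ?(ltW d0) // lerXn2r ?nnegrE ?cmod_ge0 ?divr_ge0 // ltW.
have -> : 16 / delta ^+ 4 * cmod h ^+ 2 = (cmod h ^+ 2 * 4) * (4 / delta ^+ 4) by ring.
apply: ler_pM => //; rewrite ?mulr_ge0 ?exprn_ge0 ?cmod_ge0 ?invr_ge0 ?mulr_ge0 ?exprn_ge0 ?cmod_ge0 //.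
by rewrite ler_wpM2l ?exprn_ge0.
Qed.

Lemma ccts_bounded u : ccts u -> exists2 M : R, 0 < M &
  forall t, 0 <= t <= 2 * pi -> cmod (u t) <= M.
Proof.
move=> cu.
have B (g : R -> R) : (forall t, {for t, continuous g}) -> exists2 M : R, 0 < M &
    forall t, 0 <= t <= 2 * pi -> `|g t| <= M.
  move=> cg; have [|M M0 HM] := @cts_box_bounded R (fun p => g p.2) 0 0 0 (2 * pi).
    move=> p _ _; apply: (@continuous_comp _ _ _ snd g); [exact: cvg_snd|exact: cg].
  by exists M => // t tb; apply: (HM (0, t)) => //=; rewrite lexx.
have [M1 M10 H1] := B _ (fun t => (cu t).1).
have [M2 M20 H2] := B _ (fun t => (cu t).2).
exists (M1 + M2) => [|t tb]; first exact: addr_gt0.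
by apply: (le_trans (cmod_le_ReIm _)); apply: lerD; [exact: H1|exact: H2].
Qed.


Lemma ccts_cauchy f (rho r : R) z n : cmod z < r -> r < rho ->
  (forall w, cmod w < rho -> exists d, cdiff_at f w d) ->
  ccts (fun t => f (cpolar r t) * cpolar r t * (cpolar r t - z) ^- n).
Proof.
move=> zr rr df; have r0 : 0 < r by exact: le_lt_trans (cmod_ge0 z) zr.
apply: cctsM.
  apply: (@ccts_circle (fun w => f w * w)) => t.
  have [|e de] := df (cpolar r t); first by rewrite cmod_cpolar // ltW.
  exact: (cdiff_continuous (cdiffM de (cdiff_id _))).
have c1 : ccts (fun t => (cpolar r t - z)^-1).
  apply: (@ccts_circle (fun w => (w - z)^-1)) => t.
  apply: (cdiff_continuous (cdiffV _ (cdiffB (cdiff_id _) (cdiff_cst z _)))).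
  exact: circle_neq.
elim: n => [|n ih]; first by under eq_fun do rewrite expr0 invr1; exact: ccts_cst.
by under eq_fun do rewrite exprS invfM; exact: cctsM.
Qed.

(** Cauchy's formula is differentiated twice under the integral sign: the
    first derivative is again given by a kernel of the same kind. *)
Lemma cdiff_cderiv f (rho : R) : (forall w, cmod w < rho -> exists d, cdiff_at f w d) ->
  forall z, cmod z < rho ->
    cdiff_at f z (cderiv (f : cplane R -> cplane R) z) /\
    exists d, cdiff_at (cderiv (f : cplane R -> cplane R) : C -> C) z d.
Proof.
move=> df z zrho.
set r := (cmod z + rho) / 2.
have zr : cmod z < r by rewrite /r; lra.
have rr : r < rho by rewrite /r; lra.
pose phi (t : R) := f (cpolar r t) * cpolar r t.
have cphi w n : cmod w < r -> ccts (fun t => phi t * (cpolar r t - w) ^- n).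
  by move=> wr; exact: ccts_cauchy df.
have [M M0 phiM] : exists2 M : R, 0 < M & forall t, 0 <= t <= 2 * pi -> cmod (phi t) <= M.
  apply: ccts_bounded; have := cphi z 0%N zr; congr ccts; apply: funext => t.
  by rewrite expr0 invr1 mulr1.
pose K n w := cint (fun t => phi t * (cpolar r t - w) ^- n).
have dK1 w : cmod w < r -> cdiff_at (K 1%N) w (K 2%N w).
  move=> wr; have d0 : 0 < r - cmod w by rewrite subr_gt0.
  apply: (@cdiff_cint (fun w t => phi t * (cpolar r t - w) ^- 1)
     (fun w t => phi t * (cpolar r t - w) ^- 2) w (M * (2 / (r - cmod w) ^+ 3)) ((r - cmod w) / 2)).
  - by rewrite divr_gt0.
  - by rewrite mulr_ge0 ?divr_ge0 ?exprn_ge0 ?(ltW d0) ?(ltW M0).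
  - by move=> h hr; apply: cphi; have := cmodD_le w h; lra.
  - exact: cphi.
  - move=> h t hr tb; have := phiM t tb.
    have -> : phi t * (cpolar r t - (w + h)) ^- 1 - phi t * (cpolar r t - w) ^- 1
        - phi t * (cpolar r t - w) ^- 2 * h =
      phi t * ((cpolar r t - w - h)^-1 - (cpolar r t - w)^-1 - ((cpolar r t - w) ^+ 2)^-1 * h).
      by rewrite opprD addrA !expr1; ring.
    move=> pM; rewrite cmodM -[leRHS]mulrA; apply: ler_pM => //; rewrite ?cmod_ge0 //.
    by apply: cauchy_kernel1 => //; [exact: cmod_circle_sub_ge|exact: ltW].
have dK2 w : cmod w < r -> exists d, cdiff_at (K 2%N) w d.
  move=> wr; have d0 : 0 < r - cmod w by rewrite subr_gt0.
  exists (cint (fun t => phi t * (2 * (cpolar r t - w) ^- 3))).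
  apply: (@cdiff_cint (fun w t => phi t * (cpolar r t - w) ^- 2)
     (fun w t => phi t * (2 * (cpolar r t - w) ^- 3)) w (M * (16 / (r - cmod w) ^+ 4)) ((r - cmod w) / 2)).
  - by rewrite divr_gt0.
  - by rewrite mulr_ge0 ?divr_ge0 ?exprn_ge0 ?(ltW d0) ?(ltW M0).
  - by move=> h hr; apply: cphi; have := cmodD_le w h; lra.
  - have := cctsM (ccts_cst 2) (cphi w 3%N wr); congr ccts; apply: funext => t; ring.
  - move=> h t hr tb; have := phiM t tb.
    have -> : phi t * (cpolar r t - (w + h)) ^- 2 - phi t * (cpolar r t - w) ^- 2
        - phi t * (2 * (cpolar r t - w) ^- 3) * h =
      phi t * ((cpolar r t - w - h) ^- 2 - (cpolar r t - w) ^- 2 - 2 * (cpolar r t - w) ^- 3 * h).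
      by rewrite opprD addrA; ring.
    move=> pM; rewrite cmodM -[leRHS]mulrA; apply: ler_pM => //; rewrite ?cmod_ge0 //.
    by apply: cauchy_kernel2 => //; [exact: cmod_circle_sub_ge|exact: ltW].
pose c : C := (2 * pi)^-1%:C%C.
have fK w : cmod w < r -> f w = c * K 1%N w.
  move=> wr; rewrite /K (@eq_cint _ (fun t => f (cpolar r t) * (cpolar r t / (cpolar r t - w)))).
    rewrite (cauchy_formula wr rr df) mulrA /c -rmorphM mulVf ?gt_eqF ?pi2_gt0 //.
    by rewrite mul1r.
  by move=> t; rewrite /phi expr1 mulrA.
have df' w : cmod w < r -> cdiff_at f w (c * K 2%N w).
  move=> wr; apply: (@cdiff_near _ (fun w => c * K 1%N w) _ _ _ (r - cmod w)).
  - by rewrite subr_gt0.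
  - move=> x xw; rewrite fK //; have := cmodD_le (x - w) w; rewrite subrK; lra.
  - by have := cdiffM (cdiff_cst c w) (dK1 w wr); rewrite mulr0 addr0.
have E w : cmod w < r -> cderiv (f : cplane R -> cplane R) w = c * K 2%N w.
  by move=> wr; have [_ ->] := cdiff_derivable (df' w wr).
split; first by rewrite E //; exact: df'.
have [d dd] := dK2 z zr.
exists (c * d + K 2%N z * 0).
apply: (@cdiff_near _ (fun w => c * K 2%N w) _ _ _ (r - cmod z)).
- by rewrite subr_gt0.
- move=> x xw; rewrite E //; have := cmodD_le (x - z) z; rewrite subrK; lra.
- exact: (cdiffM (cdiff_cst c z) dd).
Qed.

Lemma analytic_cderiv f : analytic (f : cplane R -> cplane R) ->
  analytic (cderiv (f : cplane R -> cplane R)).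
Proof.
move=> fa z z1.
have [|_ [d dd]] := @cdiff_cderiv f 1 _ z z1.
  by move=> w w1; eexists; exact: analytic_cdiff.
by have [] := cdiff_derivable dd.
Qed.

(** Jensen's inequality for the squares of the real and imaginary parts,
    whose circular means are their values at the centre. *)
Lemma cmod_sqr_submean f (a : C) (r rho : R) : 0 <= r < rho ->
  (forall w, cmod w < rho -> exists d, cdiff_at f (a + w) d) ->
  2 * pi * cmod (f a) ^+ 2 <= rint 0 (2 * pi) (fun t => cmod (f (a + cpolar r t)) ^+ 2).
Proof.
move=> rr df.
pose G w := f (a + w).
have dG w : cmod w < rho -> exists d, cdiff_at G w d.
  by move=> /df[d dd]; exists d; exact: cdiff_shift.
have cG w : cmod w < rho -> {for w, continuous (G : cplane R -> cplane R)}.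
  by move=> /dG[d dd]; exact: cdiff_continuous dd.
have dG' w : cmod w < rho -> w != 0 -> exists d, cdiff_at G w d by move=> /dG.
have H1 := mean_value_Re rr cG dG'; have H2 := mean_value_Im rr cG dG'.
have G0 : G 0 = f a by rewrite /G addr0.
have cts t : cmod (cpolar r t) < rho by case/andP: rr => r0 ?; rewrite cmod_cpolar.
have c1 : cts_on (fun t => Re (G (cpolar r t))) 0 (2 * pi).
  by move=> t _; have [] := ccts_circle (fun t => cG _ (cts t)) t.
have c2 : cts_on (fun t => Im (G (cpolar r t))) 0 (2 * pi).
  by move=> t _; have [] := ccts_circle (fun t => cG _ (cts t)) t.
have p0 : 0 <= 2 * pi :> R by exact: ltW pi2_gt0.
have := rint_sqr_le p0 c1; have := rint_sqr_le p0 c2; rewrite H1 H2 G0 subr0 => S2 S1.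
under eq_rint do rewrite cmod_sqr.
rewrite rintD; [|exact: cts_onX..].
rewrite cmod_sqr -(ler_pM2l pi2_gt0).
have -> : 2 * pi * (2 * pi * (Re (f a) ^+ 2 + Im (f a) ^+ 2)) =
  (2 * pi * Re (f a)) ^+ 2 + (2 * pi * Im (f a)) ^+ 2 :> R by ring.
by rewrite (mulrDr (2 * pi)); apply: lerD.
Qed.

End CircleMeans.

(** * Integration in polar coordinates: change of variables *)

Section ChangeOfVariables.
Variable R : realType.
Notation mu := (@lebesgue_measure R).
Notation plane := (@lebesgue_measure R \x @lebesgue_measure R)%E.
Local Open Scope ereal_scope.

Lemma rint_EFin (f : R -> R) (a b : R) : cts_on f a b ->
  \int[mu]_(x in `[a, b]) (f x)%:E = (rint a b f)%:E.
Proof.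
move=> cf; rewrite /rint /Rintegral fineK //.
exact: integrable_fin_num (rint_integrable cf).
Qed.

Lemma ge0_integral_mrestr d (T : measurableType d) (m : {measure set T -> \bar R})
    (D : set T) (mD : measurable D) (f : T -> \bar R) :
  measurable_fun setT f -> (forall x, 0 <= f x) ->
  \int[mrestr m mD]_x f x = \int[m]_(x in D) f x.
Proof.
move=> mf f0; rewrite -(setvU D) ge0_integral_setU //=; last 3 first.
- exact: measurableC.
- by rewrite setvU.
- by rewrite disj_set2E setICl.
have -> : \int[mrestr m mD]_(x in ~` D) f x = 0.
  rewrite (@eq_measure_integral _ _ _ _ mzero) ?integral_measure_zero // => A mA AD.
  transitivity (m (A `&` D)); first by [].
  rewrite (_ : A `&` D = set0) ?measure0 //.
  by apply/seteqP; split => // x [/AD].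
rewrite add0e; apply: eq_measure_integral => A mA AD.
transitivity (m (A `&` D)); first by [].
by congr (m _); apply/seteqP; split => [x []//|x Ax]; split => //; exact: AD.
Qed.

(** Two measures on the line which agree on half-open intervals agree; the
    substitution formula for indicator functions of intervals therefore
    extends to all nonnegative measurable functions. *)
Lemma ge0_change_of_variable (phi w : R -> R) (F : R -> \bar R) :
  measurable_fun setT phi -> measurable_fun setT w -> (forall t, (0 <= w t)%R) ->
  (forall a b : R, (a <= b)%R -> \int[mu]_(t in phi @^-1` `]a, b]) (w t)%:E = (b - a)%:E) ->
  measurable_fun setT F -> (forall y, 0 <= F y) ->
  \int[mu]_y F y = \int[mu]_t (F (phi t) * (w t)%:E).
Proof.
move=> mphi mw w0 Hphi mF F0.
pose D : set (R * R) := [set p | (0 < p.2)%R && (p.2 < w p.1)%R].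
have mD : measurable D.
  have m1 : measurable_fun [set: R * R] (fun p : R * R => (0 < p.2)%R && (p.2 < w p.1)%R).
    apply: measurable_and; apply: measurable_fun_ltr.
    - exact: measurable_cst.
    - exact: measurable_snd.
    - exact: measurable_snd.
    - exact: measurableT_comp mw measurable_fst.
  have := m1 measurableT [set true] I; rewrite setTI.
  by rewrite (_ : _ @^-1` _ = D) //; apply/seteqP; split.
have secD t : xsection D t = `]0%R, w t[%classic.
  by apply/seteqP; split => u; rewrite /xsection /= inE /D /= in_itv.
have mphi1 : measurable_fun setT (fun p : R * R => phi p.1).
  exact: measurableT_comp mphi measurable_fst.
pose T : R * R -> measurableTypeR R := fun p => phi p.1.
have mT : measurable_fun [set: R * R] T := mphi1.
pose nu : {measure set (measurableTypeR R) -> \bar R} :=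
  measure_function_pushforward__canonical__measure_function_Measure
    (measure_function_mrestr__canonical__measure_function_Measure plane mD) mT.
have muw t : mu `]0%R, w t[ = (w t)%:E.
  rewrite lebesgue_measure_itv /= lte_fin sube0.
  by case: ltP => // ww; congr EFin; apply/eqP; rewrite eq_le w0 ww.
have nuE X : measurable X -> nu X = \int[mu]_(t in phi @^-1` X) (w t)%:E.
  move=> mX; transitivity (\int[mu]_t mu (xsection (T @^-1` X `&` D) t)); first by [].
  rewrite [RHS]integral_mkcond; apply: eq_integral => t _; rewrite patchE.
  case: ifPn => tX.
    rewrite -muw -secD; congr (mu _); apply/seteqP; split => u; rewrite /xsection /= !inE.
      by case.
    by move=> H; split => //; rewrite inE in tX.
  rewrite (_ : xsection _ _ = set0) ?measure0 //; apply/seteqP; split => u //.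
  rewrite /xsection /= inE => -[Xt _]; move: tX; rewrite notin_setE.
  by case.
have nu_mu X : measurable X -> mu X = nu X.
  move=> mX; apply: lebesgue_measure_unique => // _ [[a b]] /= ab <-.
  rewrite nuE; last exact: measurable_itv.
  have [{}ab|ba] := leP a b.
    rewrite Hphi // [LHS](lebesgue_measure_itv `]a, b]) /= lte_fin.
    by move: ab; rewrite le_eqVlt => /predU1P[->|->//]; rewrite ltxx subrr.
  rewrite set_itv_ge ?bnd_simp -?leNgt ?ltW //.
  by rewrite preimage_set0 measure0 integral_set0.
transitivity (\int[nu]_y F y).
  by apply: eq_measure_integral => A mA _; exact: nu_mu.
rewrite ge0_integral_pushforward //=.
rewrite ge0_integral_mrestr //; last exact: measurableT_comp mF mphi1.
rewrite integral_mkcond.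
rewrite fubini_tonelli1 /=; last 2 first.
- apply/(measurable_restrict _ mD measurableT); rewrite ?setTI ?setIT.
  exact: measurable_funTS (measurableT_comp mF mphi1).
- by move=> p; apply: erestrict_ge0.
apply: eq_integral => t _; rewrite /fubini_F /=.
rewrite -muw -secD -integral_cst; last by rewrite secD; exact: measurable_itv.
rewrite [RHS]integral_mkcond; apply: eq_integral => u _; rewrite !patchE.
by rewrite mem_xsection.
Qed.

Lemma integral_itv_cst (b1 b2 : bool) (x y k : R) : (x <= y)%R ->
  \int[mu]_(_ in [set` Interval (BSide b1 x) (BSide b2 y)]) k%:E = (k * (y - x))%:E.
Proof.
move=> xy; rewrite (integral_cst mu (measurable_itv (Interval (BSide b1 x) (BSide b2 y))) k%:E).
rewrite [X in _ * X](lebesgue_measure_itv (Interval (BSide b1 x) (BSide b2 y))) /= lte_fin.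
move: xy; rewrite le_eqVlt => /predU1P[->|->]; last by rewrite -EFinB -EFinM.
by rewrite ltxx mule0 subrr mulr0.
Qed.

Lemma lebesgue_affine (c d : R) (F : R -> \bar R) : c != 0%R ->
  measurable_fun setT F -> (forall y, 0 <= F y) ->
  \int[mu]_y F y = \int[mu]_t (F (c * t + d)%R * `|c|%:E).
Proof.
move=> c0 mF F0; apply: (@ge0_change_of_variable _ (fun=> `|c|%R)) => //.
- by apply: measurable_funD => //; apply: measurable_funM.
- move=> a b ab; case: (ltgtP c 0%R) c0 => // cc _.
    rewrite (_ : _ @^-1` _ = `[(b - d) / c, (a - d) / c[%classic)%R; last first.
      apply/seteqP; split => t; rewrite /= !in_itv /= ler_ndivrMr // ltr_ndivlMr //;
      by move=> /andP[? ?]; apply/andP; split; lra.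
    rewrite integral_itv_cst ?ler_nM2r ?invr_lt0 ?lerD2r //.
    by rewrite ltr0_norm //; congr EFin; field; rewrite lt_eqF.
  rewrite (_ : _ @^-1` _ = `](a - d) / c, (b - d) / c]%classic)%R; last first.
    apply/seteqP; split => t; rewrite /= !in_itv /= ler_pdivlMr // ltr_pdivrMr //;
    by move=> /andP[? ?]; apply/andP; split; lra.
  rewrite integral_itv_cst ?ler_pM2r ?invr_gt0 ?lerD2r //.
  by rewrite gtr0_norm //; congr EFin; field; rewrite gt_eqF.
Qed.

Lemma cts_inv_cos2 (x t : R) : cos t != 0%R -> {for t, continuous (fun t => x / cos t ^+ 2)%R}.
Proof.
move=> c0; apply: continuousM; first exact: cst_continuous.
apply: continuousV; first by rewrite expf_neq0.
by apply: (@continuousM R R (@cos R) (@cos R)); exact: continuous_cos.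
Qed.

(** For fixed [x > 0] the vertical line is parametrised by [y = x tan t],
    whose derivative is [x / cos^2 t]. *)
Lemma lebesgue_tan (x : R) (F : R -> \bar R) : (0 < x)%R ->
  measurable_fun setT F -> (forall y, 0 <= F y) ->
  \int[mu]_y F y =
  \int[mu]_(t in `](- (pi / 2))%R, (pi / 2)%R[) (F (x * tan t)%R * (x / cos t ^+ 2)%:E).
Proof.
move=> x0 mF F0.
pose I := `](- (pi / 2))%R, (pi / 2)%R[%classic : set R.
have mI : measurable I by exact: measurable_itv.
have cosI t : I t -> (0 < cos t)%R by rewrite /I /= in_itv /=; exact: cos_gt0_pihalf.
have oI : open I by exact: itv_open.
have mtan : measurable_fun I (@tan R).
  apply: open_continuous_measurable_fun => // t; rewrite inE => /cosI c0.
  by apply: continuous_tan; rewrite gt_eqF.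
have mcos : measurable_fun I (fun t : R => x / cos t ^+ 2)%R.
  apply: open_continuous_measurable_fun => // t; rewrite inE => /cosI c0.
  by apply: cts_inv_cos2; rewrite gt_eqF.
pose phi t := if t \in I then (x * tan t)%R else 0%R.
pose w t := if t \in I then (x / cos t ^+ 2)%R else 0%R.
have mphi : measurable_fun setT phi.
  have -> : phi = (fun t => x * tan t)%R \_ I by apply: funext => t; rewrite patchE.
  by apply/(measurable_restrict _ mI measurableT); rewrite setTI; apply: measurable_funM.
have mw : measurable_fun setT w.
  have -> : w = (fun t => x / cos t ^+ 2)%R \_ I by apply: funext => t; rewrite patchE.
  by apply/(measurable_restrict _ mI measurableT); rewrite setTI.
have w0 t : (0 <= w t)%R.
  by rewrite /w; case: ifPn => // _; rewrite divr_ge0 ?sqr_ge0 // ltW.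
rewrite (@ge0_change_of_variable phi w) //.
  rewrite [RHS]integral_mkcond; apply: eq_integral => t _; rewrite patchE /phi /w.
  by case: ifPn => // _; rewrite mule0.
move=> a b ab.
have aI (c : R) : I (atan c) by rewrite /I /= in_itv /= atan_gtNpi2 atan_ltpi2.
have monotan (u v : R) : I u -> I v -> (tan u < tan v)%R = (u < v)%R.
  by move=> Iu Iv; apply: ltr_tan.
transitivity (\int[mu]_(t in `]atan (a / x), atan (b / x)]) (x / cos t ^+ 2)%:E).
  rewrite integral_mkcond [RHS]integral_mkcond; apply: eq_integral => t _.
  rewrite !patchE; have [tI|tI] := boolP (t \in I); last first.
    rewrite [in LHS]/w (negbTE tI) if_same ifF //; apply/negbTE; rewrite notin_setE /= in_itv /=.
    move=> /andP[h1 h2]; move/negP: tI; apply; rewrite inE.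
    have := aI (a / x)%R; have := aI (b / x)%R; rewrite /I /= !in_itv /=.
    move=> /andP[_ h3] /andP[h4 _]; rewrite (lt_trans h4 h1) /=.
    exact: le_lt_trans h2 h3.
  rewrite /w tI; congr (if _ then _ else _).
  apply/idP/idP; rewrite !inE /= !in_itv /= /phi tI; rewrite inE in tI.
    move=> /andP[h1 h2]; rewrite -monotan // atanK ltr_pdivrMr // mulrC h1 /=.
    by rewrite leNgt -monotan // atanK -leNgt ler_pdivlMr // mulrC.
  move=> /andP[h1 h2]; rewrite -ltr_pdivrMl // mulrC -[X in (X < _)%R]atanK monotan // h1 /=.
  by rewrite mulrC -ler_pdivlMr // -[X in (_ <= X)%R]atanK leNgt monotan // -leNgt.
have aab : (atan (a / x) <= atan (b / x))%R.
  by rewrite leNgt -monotan // !atanK -leNgt ler_pM2r // invr_gt0.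
have sub : cts_on (fun t : R => x / cos t ^+ 2)%R (atan (a / x)) (atan (b / x)).
  move=> t /andP[h1 h2].
  have /cosI c0 : I t.
    have := aI (a / x)%R; have := aI (b / x)%R; rewrite /I /= !in_itv /=.
    by move=> /andP[_ h3] /andP[h4 _]; rewrite (lt_le_trans h4 h1) (le_lt_trans h2 h3).
  by apply: cts_inv_cos2; rewrite gt_eqF.
rewrite integral_itv_obnd_cbnd; last first.
  apply: measurable_funS (measurable_int _ (rint_integrable sub)) => //.
  by apply: subset_itvr; rewrite bnd_simp.
have D t : (atan (a / x) <= t <= atan (b / x))%R ->
    is_derive t (1%R : R) (fun t : R => x * tan t)%R (x / cos t ^+ 2)%R.
  move=> /andP[h1 h2]; have /cosI c0 : I t.
    have := aI (a / x)%R; have := aI (b / x)%R; rewrite /I /= !in_itv /=.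
    by move=> /andP[_ h3] /andP[h4 _]; rewrite (lt_le_trans h4 h1) (le_lt_trans h2 h3).
  have dt : is_derive t (1%R : R) (@tan R) (cos t ^- 2)%R.
    by apply: is_derive_tan; rewrite gt_eqF.
  have -> : (x / cos t ^+ 2 = x *: (cos t ^- 2))%R by [].
  exact: is_deriveZ.
rewrite rint_EFin // (rint_FTC aab sub D).
by rewrite !atanK; congr EFin; field; rewrite gt_eqF.
Qed.

Lemma measurable_polar_map (F : R * R -> \bar R) : measurable_fun setT F ->
  measurable_fun [set: R * R] (fun p : R * R => F (p.2 * cos p.1, p.2 * sin p.1)%R).
Proof.
move=> mF; apply: measurableT_comp mF _ => /=.
apply: measurable_fun_pair; apply: measurable_funM.
- exact: measurable_snd.
- by apply: measurableT_comp measurable_fst; apply: continuous_measurable_fun; exact: continuous_cos.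
- exact: measurable_snd.
- by apply: measurableT_comp measurable_fst; apply: continuous_measurable_fun; exact: continuous_sin.
Qed.

(** For fixed [x] put [y = x tan t], exchange the integrals, and for fixed
    [t] put [x = r cos t]: the two Jacobians combine into [r]. *)
Lemma polar_right (F : R * R -> \bar R) : measurable_fun setT F -> (forall p, 0 <= F p) ->
  \int[mu]_(x in `]0%R, +oo[) \int[mu]_y F (x, y) =
  \int[mu]_(t in `](- (pi / 2))%R, (pi / 2)%R[)
    \int[mu]_(r in `]0%R, +oo[) (F (r * cos t, r * sin t)%R * r%:E).
Proof.
move=> mF F0.
pose I := `](- (pi / 2))%R, (pi / 2)%R[%classic : set R.
pose P := `]0%R, +oo[%classic : set R.
have mI : measurable I by exact: measurable_itv.
have mP : measurable P by exact: measurable_itv.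
have cosI t : I t -> (0 < cos t)%R by rewrite /I /= in_itv /=; exact: cos_gt0_pihalf.
pose tanI := (@tan R) \_ I; pose wI := (fun t : R => 1 / cos t ^+ 2)%R \_ I.
have mtanI : measurable_fun setT tanI.
  apply/(measurable_restrict _ mI measurableT); rewrite setTI.
  apply: open_continuous_measurable_fun; first exact: itv_open.
  by move=> t; rewrite inE => /cosI c0; apply: continuous_tan; rewrite gt_eqF.
have mwI : measurable_fun setT wI.
  apply/(measurable_restrict _ mI measurableT); rewrite setTI.
  apply: open_continuous_measurable_fun; first exact: itv_open.
  by move=> t; rewrite inE => /cosI c0; apply: cts_inv_cos2; rewrite gt_eqF.
have wI0 t : (0 <= wI t)%R.
  by rewrite /wI patchE; case: ifPn => // _; rewrite divr_ge0 // sqr_ge0.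
pose iP := (\1_P : R -> R).
have miP : measurable_fun setT iP by exact: measurable_indic.
pose H (p : R * R) := F (p.1, p.1 * tanI p.2)%R * (iP p.1 * p.1 * wI p.2)%:E.
have xP x : (0 <= iP x * x)%R.
  rewrite /iP indicE; case: (boolP (x \in P)); rewrite ?mul0r // mul1r inE /P /= in_itv /= andbT.
  exact: ltW.
have H0 p : 0 <= H p by rewrite mule_ge0 // lee_fin mulr_ge0.
have mH : measurable_fun setT H.
  apply: emeasurable_funM.
    apply: measurableT_comp mF _; apply: measurable_fun_pair; first exact: measurable_fst.
    by apply: measurable_funM; [exact: measurable_fst|exact: measurableT_comp mtanI measurable_snd].
  apply/measurable_EFinP; apply: measurable_funM; last exact: measurableT_comp mwI measurable_snd.
  by apply: measurable_funM; [exact: measurableT_comp miP measurable_fst|exact: measurable_fst].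
transitivity (\int[mu]_x \int[mu]_t H (x, t)).
  rewrite integral_mkcond; apply: eq_integral => x _; rewrite patchE /H /= /iP.
  case: ifPn => xPos; last first.
    rewrite -[LHS](integral0 mu setT); apply: eq_integral => t _.
    by rewrite indicE (negbTE xPos) !mul0r mule0.
  have xPm := xPos; rewrite inE /P /= in_itv /= andbT in xPos.
  rewrite (lebesgue_tan xPos); last 2 first.
  - by apply: measurableT_comp mF _; apply: measurable_fun_pair.
  - by move=> y.
  rewrite integral_mkcond; apply: eq_integral => t _; rewrite patchE /tanI /wI !patchE -/I.
  rewrite indicE xPm !mul1r.
  by case: ifPn => _ //; rewrite mulr0 mule0.
transitivity (\int[mu]_t \int[mu]_x H (x, t)); first exact: fubini_tonelli.
rewrite [RHS]integral_mkcond; apply: eq_integral => t _.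
rewrite patchE /H /= -/I; case: ifPn => tI; last first.
  rewrite -[RHS](integral0 mu setT); apply: eq_integral => x _.
  by rewrite /wI patchE (negbTE tI) mulr0 mule0.
have c0 : (0 < cos t)%R by apply: cosI; rewrite inE in tI.
have tanE : tanI t = tan t by rewrite /tanI patchE tI.
have wE : wI t = (1 / cos t ^+ 2)%R by rewrite /wI patchE tI.
rewrite tanE wE.
rewrite (@lebesgue_affine (cos t) 0%R) ?gt_eqF //; last 2 first.
- apply: emeasurable_funM.
    apply: measurableT_comp mF _; apply: measurable_fun_pair => //.
    by apply: measurable_funM.
  by apply/measurable_EFinP; apply: measurable_funM => //; apply: measurable_funM.
- by move=> x; rewrite mule_ge0 // lee_fin mulr_ge0 // divr_ge0 // sqr_ge0.
rewrite [RHS]integral_mkcond; apply: eq_integral => r _; rewrite patchE addr0 -/P.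
have -> : iP (cos t * r)%R = iP r.
  by rewrite /iP !indicE; congr ((_ : bool)%:R)%R; apply/idP/idP; rewrite !inE /P /= !in_itv /= !andbT pmulr_rgt0.
rewrite /iP indicE; case: ifPn => rP; last by rewrite !mul0r mule0 mul0e.
rewrite mul1r (gtr0_norm c0) -muleA -EFinM; congr (F (_, _) * _%:E).
- by rewrite mulrC.
- by rewrite /tan; field; rewrite gt_eqF.
- by rewrite (_ : (true%:R : R) = 1%R) //; field; rewrite gt_eqF.
Qed.

Lemma integral_shift (G : R -> \bar R) (a b d : R) : measurable_fun setT G ->
  (forall t, 0 <= G t) ->
  \int[mu]_(t in `[a, b[) G (t + d)%R = \int[mu]_(t in `[(a + d)%R, (b + d)%R[) G t.
Proof.
move=> mG G0; rewrite integral_mkcond [RHS]integral_mkcond.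
rewrite [RHS](@lebesgue_affine 1%R d) ?oner_eq0 //.
- apply: eq_integral => t _; rewrite normr1 mule1 mul1r !patchE; congr (if _ then _ else _).
  by apply/idP/idP; rewrite !inE /= !in_itv /= lerD2r ltrD2r.
- by apply/(measurable_restrict _ (measurable_itv _) measurableT); rewrite setTI; exact: measurable_funTS.
- by move=> y; apply: erestrict_ge0.
Qed.

Lemma integral_itv_cat (G : R -> \bar R) (a b c : R) : measurable_fun setT G ->
  (forall t, 0 <= G t) -> (a <= b)%R -> (b <= c)%R ->
  \int[mu]_(t in `[a, c[) G t = \int[mu]_(t in `[a, b[) G t + \int[mu]_(t in `[b, c[) G t.
Proof.
move=> mG G0 ab bc.
rewrite (@itv_bndbnd_setU _ _ (BLeft a) (BLeft b) (BLeft c)) ?bnd_simp //.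
rewrite ge0_integral_setU //=; first exact: measurable_funTS.
rewrite disj_set2E; apply/eqP/seteqP; split => // t [] /=; rewrite !in_itv /=.
by move=> /andP[_ tb] /andP[/le_lt_trans/(_ tb)]; rewrite ltxx.
Qed.

Lemma integral_period (G : R -> \bar R) (T a b : R) : (0 < T)%R -> measurable_fun setT G ->
  (forall t, 0 <= G t) -> (forall t, G (t + T)%R = G t) ->
  \int[mu]_(t in `[a, (a + T)%R[) G t = \int[mu]_(t in `[b, (b + T)%R[) G t.
Proof.
move=> T0 mG G0 GT.
wlog ab : a b / (a <= b)%R.
  by move=> W; case: (leP a b) => [/W//|/ltW/W ->].
have shiftT u v : \int[mu]_(t in `[(u + T)%R, (v + T)%R[) G t = \int[mu]_(t in `[u, v[) G t.
  by rewrite -integral_shift //; apply: eq_integral => t _; rewrite GT.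
have [n nb] : exists n, (b <= a + n%:R * T)%R.
  exists (Num.bound ((b - a) / T)); rewrite -lerBlDl -ler_pdivrMr // ltW //.
  by apply: archi_boundP; rewrite divr_ge0 ?subr_ge0 // ltW.
elim: n a ab nb => [|n ih] a ab nb.
  by rewrite (_ : b = a) //; apply/eqP; rewrite eq_le ab andbT -[a]addr0 -(mul0r T).
have [bT|Tb] := leP b (a + T)%R; last first.
  rewrite -(ih (a + T)%R); [|exact: ltW|].
    by rewrite shiftT.
  by rewrite (le_trans nb) // -natr1 mulrDl mul1r addrAC addrA.
rewrite (@integral_itv_cat G a b) // [RHS](@integral_itv_cat G b (a + T)%R) ?lerD2r //.
by rewrite shiftT addeC.
Qed.

Lemma integral_fold (K : R -> \bar R) : measurable_fun setT K -> (forall x, 0 <= K x) ->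
  \int[mu]_x K x = \int[mu]_(x in `]0%R, +oo[) K (- x)%R + \int[mu]_(x in `]0%R, +oo[) K x.
Proof.
move=> mK K0.
have mKN : measurable_fun setT (fun x : R => K (- x)%R) by exact: measurableT_comp.
have E : [set: R] = `]-oo, 0%R] `|` `]0%R, +oo[.
  by rewrite -(@itv_bndbnd_setU _ _ -oo%O (BRight 0%R) +oo%O) ?set_itvNyy.
rewrite [in LHS]E ge0_integral_setU //=; last 2 first.
- by rewrite -E.
- rewrite disj_set2E; apply/eqP/seteqP; split => // t [] /=; rewrite !in_itv /= andbT.
  by move=> /le_lt_trans H /H; rewrite ltxx.
congr (_ + _).
rewrite integral_itv_obnd_cbnd; last exact: measurable_funTS.
rewrite (@ge0_integration_by_substitution0 _ (fun x => K (- x)%R)) //.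
by apply: eq_integral => x _; rewrite opprK.
Qed.

Section PolarCoordinates.
Variables (F : R * R -> \bar R) (mF : measurable_fun setT F) (F0 : forall p, 0 <= F p).

Definition ray_integral (t : R) : \bar R :=
  \int[mu]_(r in `]0%R, +oo[) (F (r * cos t, r * sin t)%R * r%:E).

Lemma ray_integral_ge0 t : 0 <= ray_integral t.
Proof.
apply: integral_ge0 => r /=; rewrite in_itv /= andbT => r0.
by rewrite mule_ge0 // lee_fin ltW.
Qed.

Lemma measurable_ray_integral : measurable_fun setT ray_integral.
Proof.
pose P := `]0%R, +oo[%classic : set R.
have mP : measurable P by exact: measurable_itv.
pose H (p : R * R) := F (p.2 * cos p.1, p.2 * sin p.1)%R * (\1_P p.2 * p.2)%:E.
have -> : ray_integral = fubini_F mu H.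
  apply: funext => t; rewrite /ray_integral /fubini_F [LHS]integral_mkcond.
  apply: eq_integral => r _; rewrite patchE /H /= indicE.
  by case: ifPn => _; rewrite ?mul1r // mul0r mule0.
apply: measurable_fun_fubini_tonelli_F => [|p].
  apply: emeasurable_funM; first exact: measurable_polar_map.
  apply/measurable_EFinP; apply: measurable_funM; last exact: measurable_snd.
  by apply: measurableT_comp measurable_snd; exact: measurable_indic.
rewrite mule_ge0 // lee_fin indicE; case: (boolP (_ \in _)); rewrite ?mul0r // mul1r.
by rewrite inE /P /= in_itv /= andbT => /ltW.
Qed.

(** The right half-plane gives angles in [(-pi/2, pi/2)]; a reflection gives
    the other half-plane, and periodicity moves the resulting full turn to
    any starting angle. *)
Lemma polar_coordinates (a : R) :
  \int[plane]_p F p = \int[mu]_(t in `[a, (a + 2 * pi)%R[) ray_integral t.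
Proof.
have mK : measurable_fun setT (fun x => \int[mu]_y F (x, y)).
  by have := @measurable_fun_fubini_tonelli_F _ _ _ _ _ mu F mF F0.
have K0 x : 0 <= \int[mu]_y F (x, y) by exact: integral_ge0.
have mF' : measurable_fun setT (fun p : R * R => F (- p.1, - p.2)%R).
  apply: measurableT_comp mF _; apply: measurable_fun_pair.
  - by apply: measurableT_comp => //; exact: measurable_fst.
  - by apply: measurableT_comp => //; exact: measurable_snd.
have rp t : ray_integral (t + 2 * pi)%R = ray_integral t.
  rewrite /ray_integral; apply: eq_integral => r _.
  by rewrite [(2 * pi)%R]mulrC mulr_natr cosD2pi sinD2pi.
rewrite (integral_period a (- (pi / 2))%R (pi2_gt0 R) measurable_ray_integral ray_integral_ge0 rp).
have -> : (- (pi / 2) + 2 * pi = pi / 2 + pi :> R)%R by field.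
rewrite (@integral_itv_cat _ (- (pi / 2))%R (pi / 2)%R); last 4 first.
- exact: measurable_ray_integral.
- exact: ray_integral_ge0.
- by have := pi_gt0 R; lra.
- by have := pi_gt0 R; lra.
have -> : `[(pi / 2)%R, (pi / 2 + pi)%R[%classic = `[(- (pi / 2) + pi)%R, (pi / 2 + pi)%R[%classic :> set R.
  by have -> : (- (pi / 2) + pi = pi / 2 :> R)%R by field.
rewrite -integral_shift; [|exact: measurable_ray_integral|exact: ray_integral_ge0].
transitivity (\int[mu]_x \int[mu]_y F (x, y)); first exact: fubini_tonelli1.
rewrite (integral_fold mK K0) (polar_right mF F0) addeC; congr (_ + _).
  by rewrite integral_itv_obnd_cbnd //; exact: measurable_funTS measurable_ray_integral.
transitivity (\int[mu]_(x in `]0%R, +oo[) \int[mu]_y F (- x, - y)%R).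
  apply: eq_integral => x _.
  have m1 : measurable_fun setT (fun y => F (- x, y)%R).
    by apply: measurableT_comp mF _; exact: measurable_fun_pair.
  have n1 : (-1 : R)%R != 0%R by rewrite oppr_eq0 oner_eq0.
  rewrite (lebesgue_affine 0%R n1 m1) //.
  by apply: eq_integral => y _; rewrite normrN1 mule1 mulN1r addr0.
have F'0 p : 0 <= F (- p.1, - p.2)%R by [].
rewrite (polar_right mF' F'0) /= integral_itv_obnd_cbnd.
  apply: eq_integral => t _; apply: eq_integral => r _.
  by rewrite cosDpi sinDpi !mulrN.
apply: measurable_funTS; have mN : measurable_fun setT (fun t : R => ray_integral (t + pi)%R).
  by apply: measurableT_comp measurable_ray_integral _; exact: measurable_funD.
congr measurable_fun: mN; apply: funext => t; apply: eq_integral => r _.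
by rewrite cosDpi sinDpi !mulrN.
Qed.

End PolarCoordinates.

End ChangeOfVariables.

(** * Integrals over sectors and discs *)

Section PlaneMeasure.
Variable R : realType.
Notation mu := (@lebesgue_measure R).
Notation plane := (@lebesgue_measure R \x @lebesgue_measure R)%E.

Lemma open_measurable_plane (A : set (R * R)) : open A -> measurable A.
Proof.
move=> oA.
pose box (i : rat * rat * nat) : set (R * R) :=
  ball (ratr i.1.1 : R) (i.2.+1%:R^-1) `*` ball (ratr i.1.2 : R) (i.2.+1%:R^-1).
pose B i : set (R * R) := if pselect (box i `<=` A) then box i else set0.
have -> : A = \bigcup_i B i.
  apply/seteqP; split => [[x y] Axy|p [i _]]; last first.
    by rewrite /B; case: pselect => [sub /sub|].
  have /nbhs_ballP[e /= e0 eA] : nbhs (x, y) A by exact: open_nbhs_nbhs.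
  have [n ne] : exists n : nat, n.+1%:R^-1 < e / 2.
    exists (Num.bound (e / 2)^-1); rewrite invf_plt ?posrE ?divr_gt0 //.
    apply: lt_trans (archi_boundP _) _; first by rewrite invr_ge0 divr_ge0 // ltW.
    by rewrite ltr_nat.
  have n0 : 0 < n.+1%:R^-1 :> R by rewrite invr_gt0.
  have [q1 q1P] : exists q : rat, ratr q \in `]x - n.+1%:R^-1, x + n.+1%:R^-1[.
    by apply: rat_in_itvoo; rewrite ltrD2l gtrN.
  have [q2 q2P] : exists q : rat, ratr q \in `]y - n.+1%:R^-1, y + n.+1%:R^-1[.
    by apply: rat_in_itvoo; rewrite ltrD2l gtrN.
  rewrite !in_itv /= in q1P q2P.
  have H1 : `|ratr q1 - x| < n.+1%:R^-1 by rewrite ltr_distl.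
  have H2 : `|ratr q2 - y| < n.+1%:R^-1 by rewrite ltr_distl.
  exists (q1, q2, n) => //; rewrite /B; case: pselect => [H|nH]; first by split.
  exfalso; apply: nH.
  move=> [u v] [] /=; rewrite /ball /= => uq vq; apply: eA; split; rewrite /ball /=.
    rewrite (splitr e); apply: le_lt_trans (ler_distD (ratr q1) x u) (ltrD _ _).
      by rewrite distrC; exact: lt_trans H1 ne.
    exact: lt_trans uq ne.
  rewrite (splitr e); apply: le_lt_trans (ler_distD (ratr q2) y v) (ltrD _ _).
    by rewrite distrC; exact: lt_trans H2 ne.
  exact: lt_trans vq ne.
apply: countable_bigcupT_measurable; first exact: countableP.
move=> i; rewrite /B; case: pselect => [H|H] /=; last exact: measurable0.
by apply: measurableX; exact: measurable_ball.
Qed.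

Lemma cts_measurable_plane (D : set (R * R)) (g : R * R -> R) : open D ->
  (forall p, D p -> {for p, continuous g}) -> measurable_fun D g.
Proof.
move=> oD cg; apply: (measurability _ (RGenOInfty.measurableE R)) => _ [_ [a ->] <-].
apply: open_measurable_plane; rewrite openE => p [Dp /=]; rewrite in_itv /= andbT => ap.
have nD : nbhs p D by apply: open_nbhs_nbhs.
have : \forall q \near p, a < g q by exact: (cvgr_gt (g p) (cg p Dp)).
move=> ng; near=> q; split; first by near: q.
by rewrite /= in_itv /= andbT; near: q.
Unshelve. all: by end_near. Qed.

Local Open Scope ereal_scope.

Lemma plane_shift (F : R * R -> \bar R) (a b : R) : measurable_fun setT F -> (forall p, 0 <= F p) ->
  \int[plane]_p F p = \int[plane]_p F (a + p.1, b + p.2)%R.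
Proof.
move=> mF F0.
have mF' : measurable_fun setT (fun p : R * R => F (a + p.1, b + p.2)%R).
  apply: measurableT_comp mF _; apply: measurable_fun_pair.
  - by apply: measurable_funD => //; exact: measurable_fst.
  - by apply: measurable_funD => //; exact: measurable_snd.
have mK : measurable_fun setT (fun x => \int[mu]_y F (x, y)).
  by have := @measurable_fun_fubini_tonelli_F _ _ _ _ _ mu F mF F0.
have K0 x : 0 <= \int[mu]_y F (x, y) by exact: integral_ge0.
transitivity (\int[mu]_x \int[mu]_y F (x, y)); first exact: fubini_tonelli1.
transitivity (\int[mu]_x \int[mu]_y F (a + x, b + y)%R); last first.
  by apply/esym; exact: fubini_tonelli1.
rewrite (lebesgue_affine a (oner_neq0 R) mK K0); apply: eq_integral => x _.
rewrite normr1 mule1 mul1r [in RHS]addrC.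
have m1 : measurable_fun setT (fun y => F (x + a, y)%R).
  by apply: measurableT_comp mF _; exact: measurable_fun_pair.
have m10 y : 0 <= F (x + a, y)%R by [].
rewrite (lebesgue_affine b (oner_neq0 R) m1 m10); apply: eq_integral => y _.
by rewrite normr1 mule1 mul1r [(b + y)%R]addrC.
Qed.

Section Sector.
Variables (E : set (R * R)) (F : R * R -> \bar R).
Hypotheses (mE : measurable E) (mF : measurable_fun E F) (F0 : forall p, E p -> 0 <= F p).

Let FE := F \_ E.
Let mFE : measurable_fun setT FE.
Proof. by apply/(measurable_restrict _ mE measurableT); rewrite setTI. Qed.
Let FE0 p : 0 <= FE p.
Proof. exact: erestrict_ge0. Qed.

(** The starting angle of the full turn is chosen to be that of the sector,
    so that the indicator of the sector becomes a product of indicators in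
    polar coordinates. *)
Lemma polar_sector (a b lo hi : R) : (a < b)%R -> (b <= a + 2 * pi)%R -> (0 <= lo)%R ->
  (forall t r, (a <= t < a + 2 * pi)%R -> (0 < r)%R ->
     E (r * cos t, r * sin t)%R <-> (t <= b)%R /\ (lo <= r < hi)%R) ->
  \int[plane]_(p in E) F p =
  \int[mu]_(t in `[a, b]) \int[mu]_(r in `[lo, hi[) (F (r * cos t, r * sin t)%R * r%:E).
Proof.
move=> ab b2 lo0 HE.
rewrite integral_mkcond (polar_coordinates mFE FE0 a).
have eqin t : (a <= t < a + 2 * pi)%R -> ray_integral FE t =
    if (t <= b)%R then \int[mu]_(r in `[lo, hi[) (F (r * cos t, r * sin t)%R * r%:E) else 0.
  move=> ta; rewrite /ray_integral [LHS]integral_mkcond.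
  case: ifPn => tb; last first.
    rewrite -[RHS](integral0 mu setT); apply: eq_integral => r _; rewrite patchE.
    case: ifPn => //; rewrite inE /= in_itv /= andbT => r0.
    rewrite /FE patchE ifF ?mul0e //; apply/negbTE; rewrite notin_setE => /(HE t r ta r0)[].
    by move: tb => /negP.
  rewrite [RHS]integral_mkcond; apply: eq_integral => r _; rewrite !patchE.
  case: ifPn; rewrite ?notin_setE ?inE /= in_itv /= andbT => r0.
    have {}HE := HE t r ta r0; rewrite /FE patchE; case: ifPn; rewrite ?notin_setE ?inE => Er.
      have [_ rl] := (HE.1 Er); rewrite ifT //.
      by rewrite inE /= in_itv.
    rewrite ifF ?mul0e //; apply/negbTE; rewrite notin_setE /= in_itv /= => rl.
    by apply: Er; apply/HE.
  case: ifPn => //; rewrite inE /= in_itv /= => /andP[lr _].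
  have -> : r = 0%R by apply/eqP; rewrite eq_le (le_trans lo0 lr) andbT leNgt; apply/negP.
  by rewrite mule0.
transitivity (\int[mu]_(t in `[a, b]) ray_integral FE t).
  have mr := measurable_ray_integral mFE FE0; have r0 := ray_integral_ge0 FE0.
  rewrite (integral_itv_cat mr r0 (ltW ab) b2).
  rewrite [X in _ + X](_ : _ = 0) ?adde0.
    by rewrite integral_itv_bndo_bndc //; exact: measurable_funTS.
  have [bb|bb] := ltP b (a + 2 * pi)%R; last by rewrite set_itv_ge ?bnd_simp -?leNgt // integral_set0.
  rewrite -integral_itv_obnd_cbnd; last exact: measurable_funTS.
  apply: integral0_eq => t /=; rewrite in_itv /= => /andP[bt ta].
  by rewrite eqin ?ta ?(ltW (lt_trans ab bt)) // leNgt bt.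
have rep t : (a <= t <= b)%R -> ray_integral FE t =
    \int[mu]_(r in `[lo, hi[) (F (r * cos t, r * sin t)%R * r%:E).
  move=> /andP[ta tb]; have [t2|t2] := ltP t (a + 2 * pi)%R; first by rewrite eqin ?ta // tb.
  have -> : t = (a + 2 * pi)%R by apply/eqP; rewrite eq_le t2 (le_trans tb).
  have := eqin a; rewrite lexx ltrDl pi2_gt0 (ltW ab) => /(_ isT).
  rewrite [(2 * pi)%R]mulrC mulr_natr; under [X in _ = X -> _]eq_integral do rewrite -cosD2pi -sinD2pi.
  by move=> <-; apply: eq_integral => r _; rewrite cosD2pi sinD2pi.
by apply: eq_integral => t; rewrite inE /= in_itv /= => /rep.
Qed.

(** Integral over a centred disc, circle by circle. *)
Lemma polar_disc (hi : R) :
  (forall t r, (0 < r)%R -> E (r * cos t, r * sin t)%R <-> (r < hi)%R) ->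
  \int[plane]_(p in E) F p =
  \int[mu]_(r in `]0%R, hi[) \int[mu]_(t in `[0%R, (2 * pi)%R[) (F (r * cos t, r * sin t)%R * r%:E).
Proof.
move=> HE.
rewrite integral_mkcond (polar_coordinates mFE FE0 0%R) add0r.
pose iP := \1_(`]0%R, +oo[%classic) : R -> R.
pose iT := \1_(`[0%R, (2 * pi)%R[%classic) : R -> R.
pose H (p : R * R) := FE (p.2 * cos p.1, p.2 * sin p.1)%R * (iT p.1 * (iP p.2 * p.2))%:E.
have pP r : (0 <= iP r * r)%R.
  rewrite /iP indicE; case: (boolP (_ \in _)); rewrite ?mul0r // mul1r inE /= in_itv /= andbT.
  exact: ltW.
have H0 p : 0 <= H p by rewrite mule_ge0 // lee_fin mulr_ge0 // /iT indicE.
have mH : measurable_fun setT H.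
  apply: emeasurable_funM; first exact: measurable_polar_map.
  apply/measurable_EFinP; apply: measurable_funM.
    by apply: measurableT_comp measurable_fst; exact: measurable_indic.
  apply: measurable_funM; last exact: measurable_snd.
  by apply: measurableT_comp measurable_snd; exact: measurable_indic.
transitivity (\int[mu]_t \int[mu]_r H (t, r)).
  rewrite integral_mkcond; apply: eq_integral => t _; rewrite patchE /H /= /iT indicE.
  case: ifPn => tI; last first.
    by rewrite -[LHS](integral0 mu setT); apply: eq_integral => r _; rewrite mul0r mule0.
  rewrite /ray_integral integral_mkcond; apply: eq_integral => r _; rewrite patchE mul1r /iP indicE.
  by case: ifPn => _; rewrite ?mul1r // mul0r mule0.
transitivity (\int[mu]_r \int[mu]_t H (t, r)); first exact: fubini_tonelli.
rewrite [RHS]integral_mkcond; apply: eq_integral => r _; rewrite patchE /H /= /iP indicE.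
case: (boolP (r \in _)) => rP; last first.
  rewrite ifF; last first.
    apply/negbTE; rewrite notin_setE /= in_itv /=; rewrite notin_setE /= in_itv /= andbT in rP.
    by move=> /andP[].
  by rewrite -[RHS](integral0 mu setT); apply: eq_integral => t _; rewrite mul0r mulr0 mule0.
rewrite inE /= in_itv /= andbT in rP.
case: ifPn; rewrite ?notin_setE ?inE /= in_itv /= rP /= => rh; last first.
  rewrite -[RHS](integral0 mu setT); apply: eq_integral => t _; rewrite /FE patchE ifF ?mul0e //.
  by apply/negbTE; rewrite notin_setE => /(HE t r rP).
rewrite [RHS]integral_mkcond; apply: eq_integral => t _; rewrite patchE /iT indicE mul1r.
rewrite /FE patchE ifT; last by rewrite inE; apply/HE.
by case: ifPn => _; rewrite ?mul1r // mul0r mule0.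
Qed.

End Sector.

End PlaneMeasure.

(** * The disc, Carleson squares and area integrals *)

Section PlaneRegions.
Variable R : realType.
Local Notation C := R[i].
Notation mu := (@lebesgue_measure R).
Notation plane := (@lebesgue_measure R \x @lebesgue_measure R)%E.
Implicit Types (f F : C -> C) (I : R * R).

Definition plane_disc : set (R * R) := @of_plane R @^-1` @disc R.

Lemma ccont_plane F (p : R * R) : {for of_plane p, continuous (F : cplane R -> cplane R)} ->
  forall e : R, 0 < e -> exists2 k : R, 0 < k & forall x y : R, `|x - p.1| < k -> `|y - p.2| < k ->
    cmod (F (of_plane (x, y)) - F (of_plane p)) <= e.
Proof.
move=> /ccontP cF e e0; have [k k0 kP] := cF _ e0.
exists (k / 2); first by rewrite divr_gt0.
move=> x y xk yk; have := kP (of_plane (x, y) - of_plane p : C).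
rewrite [of_plane p + _]addrC subrK; apply.
by apply: (le_lt_trans (cmod_le_ReIm _)); rewrite cReB cImB /= (splitr k) ltrD.
Qed.

Lemma cts_plane_Re F (p : R * R) : {for of_plane p, continuous (F : cplane R -> cplane R)} ->
  {for p, continuous (fun p => Re (F (of_plane p)))}.
Proof.
case: p => a b /ccont_plane H; apply: cts2_eps => e /H[k k0 kP]; exists k => // x y xk yk /=.
by rewrite -cReB; apply: (le_trans (norm_Re_cmod _)); exact: kP.
Qed.

Lemma cts_plane_Im F (p : R * R) : {for of_plane p, continuous (F : cplane R -> cplane R)} ->
  {for p, continuous (fun p => Im (F (of_plane p)))}.
Proof.
case: p => a b /ccont_plane H; apply: cts2_eps => e /H[k k0 kP]; exists k => // x y xk yk /=.
by rewrite -cImB; apply: (le_trans (norm_Im_cmod _)); exact: kP.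
Qed.

Lemma cts_plane_cmod_sqr F (p : R * R) : {for of_plane p, continuous (F : cplane R -> cplane R)} ->
  {for p, continuous (fun p => cmod (F (of_plane p)) ^+ 2)}.
Proof.
move=> cF; have c1 := cts_plane_Re cF; have c2 := cts_plane_Im cF.
have -> : (fun p => cmod (F (of_plane p)) ^+ 2) =
    (fun p => Re (F (of_plane p)) * Re (F (of_plane p)) + Im (F (of_plane p)) * Im (F (of_plane p))).
  by apply: funext => q; rewrite cmod_sqr !expr2.
by apply: continuousD; exact: continuousM.
Qed.

Lemma of_plane_polar (r t : R) : of_plane (r * cos t, r * sin t) = cpolar r t.
Proof. by []. Qed.

Lemma open_plane_ball (rho : R) : open [set p : R * R | cmod (of_plane p) < rho].
Proof.
rewrite openE => -[a b] ab0; have ab : cmod (of_plane (a, b)) < rho := ab0.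
have d0 : 0 < (rho - cmod (of_plane (a, b))) / 2 by rewrite divr_gt0 // subr_gt0.
have [k k0 kP] := ccont_plane (p := (a, b)) (cdiff_continuous (@cdiff_id R _)) d0.
exists (ball a k, ball b k); first by split; exact: nbhsx_ballx.
move=> [x y] [/=]; rewrite /ball /= => xk yk.
have := kP x y; rewrite distrC => /(_ xk); rewrite distrC => /(_ yk) H.
suff : cmod (of_plane (x, y)) < rho by [].
have T := cmodD_le (of_plane (x, y) - of_plane (a, b) : C) (of_plane (a, b)).
have E : (of_plane (x, y) - of_plane (a, b) : C) + of_plane (a, b) = of_plane (x, y) by rewrite subrK.
rewrite E in T; apply: (le_lt_trans T); apply: (le_lt_trans (lerD H (lexx _))); lra.
Qed.

Lemma open_plane_disc : open plane_disc.
Proof. exact: open_plane_ball. Qed.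

Lemma measurable_plane_disc : measurable plane_disc.
Proof. exact: open_measurable_plane open_plane_disc. Qed.

(** An arc may be longer than 1; the lower bound on the radius is then void,
    hence the maximum with 0. *)
Definition arc_radius I : R := Num.max 0 (1 - arc_length I).

Lemma arc_radius_ge0 I : 0 <= arc_radius I.
Proof. by rewrite le_max lexx. Qed.

Lemma arc_radius_lt1 I : is_arc I -> arc_radius I < 1.
Proof.
by move=> /andP[I12 _]; rewrite gt_max ltr01 /= /arc_length; lra.
Qed.

Lemma cos_eq1 (x : R) : 0 <= x -> x < 2 * pi -> cos x = 1 -> x = 0.
Proof.
rewrite le_eqVlt => /predU1P[<-//|x0 x2 cx].
have E2 : (x / 2) *+ 2 = x by rewrite -mulr_natr divfK.
have := cos_mulr2n (x / 2); rewrite E2 cx => H.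
have s0 : 0 < sin (x / 2) by apply: sin_gt0_pi; rewrite divr_gt0 //= ltr_pdivrMr // mulrC.
have := cos2Dsin2 (x / 2); nra.
Qed.

Lemma cpolar_inj (r r' t t' : R) : 0 < r -> 0 <= r' -> cpolar r t = cpolar r' t' ->
  r = r' /\ cos (t - t') = 1.
Proof.
move=> r0 r'0 E; have rr' : r = r'.
  by have := congr1 (@cmod R) E; rewrite !cmod_cpolar // ltW.
split => //; subst r'; case: E => /(mulfI (lt0r_neq0 r0)) Ec /(mulfI (lt0r_neq0 r0)) Es.
by rewrite cosB Ec Es -!expr2 cos2Dsin2.
Qed.

Lemma carleson_squareP I (t r : R) : is_arc I -> I.1 <= t < I.1 + 2 * pi -> 0 < r ->
  carleson_square I (cpolar r t) <-> t <= I.2 /\ arc_radius I <= r < 1.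
Proof.
move=> /andP[I12 I2p] /andP[t1 t2] r0; split=> [[r' [t' [/andP[r'0 r'1] hr /andP[t'1 t'2]]]]|[tI]].
  move=> /(cpolar_inj r0 r'0)[rr' ct]; rewrite rr' /arc_radius ge_max r'0 r'1 hr; split => //.
  have [tt'|tt'] := leP t' t.
    have -> : t = t'; last by [].
    by apply/eqP; rewrite -subr_eq0; apply/eqP; apply: cos_eq1 => //; lra.
  by rewrite (le_trans (ltW tt')).
rewrite /arc_radius ge_max => /andP[/andP[r00 hr] r1].
by exists r, t; split; rewrite ?r00 ?t1.
Qed.

Lemma disc_polar (r t : R) : 0 <= r -> disc (cpolar r t) <-> r < 1.
Proof. by move=> r0; rewrite -[X in _ <-> X < 1](cmod_cpolar t r0). Qed.

Lemma carleson_square_disc I : carleson_square I `<=` @disc R.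
Proof. by move=> _ [r [t [/andP[r0 r1] _ _ ->]]]; apply/disc_polar. Qed.

Lemma measurable_carleson_square I : measurable (@of_plane R @^-1` carleson_square I).
Proof.
pose pol (p : R * R) : R * R := (p.1 * cos p.2, p.1 * sin p.2).
have cpol : continuous pol.
  move=> p; apply: (@cvg_pair _ _ _ (nbhs p) (nbhs (pol p).1) (nbhs (pol p).2)) => /=.
    apply: (@continuousM R _ fst (fun p => cos p.2)); first exact: cvg_fst.
    by apply: (@continuous_comp _ _ _ snd cos); [exact: cvg_snd|exact: continuous_cos].
  apply: (@continuousM R _ fst (fun p => sin p.2)); first exact: cvg_fst.
  by apply: (@continuous_comp _ _ _ snd sin); [exact: cvg_snd|exact: continuous_sin].
pose K n := pol @` (`[arc_radius I, 1 - n.+1%:R^-1] `*` `[I.1, I.2] : set (R * R)).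
have -> : @of_plane R @^-1` carleson_square I = \bigcup_n K n.
  apply/seteqP; split => [p [r [t [/andP[r0 r1] hr It E]]]|p [n _ [[r t] [/= rn It] <-]]].
    have [n ne] : exists n : nat, n.+1%:R^-1 < 1 - r.
      exists (Num.bound (1 - r)^-1); rewrite invf_plt ?posrE ?subr_gt0 //.
      apply: lt_trans (archi_boundP _) _; first by rewrite invr_ge0 subr_ge0 ltW.
      by rewrite ltr_nat.
    exists n => //; exists (r, t) => /=; last first.
      by case: p E => x y [-> ->].
    split; rewrite /= in_itv //= /arc_radius ge_max r0 hr /=.
    by rewrite lerBrDr -lerBrDl ltW.
  move: rn It; rewrite !in_itv /= => /andP[r0 r1] It.
  exists r, t; split => //.
  - rewrite (le_trans (arc_radius_ge0 I) r0) (le_lt_trans r1) // gtrDl oppr_lt0 invr_gt0 //.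
  - by apply: le_trans r0; rewrite /arc_radius le_max lexx orbT.
apply: bigcupT_measurable => n.
have cK : compact (K n).
  by apply: continuous_compact; [exact: continuous_subspaceT|exact: compact_box].
rewrite -[K n]setCK; apply: measurableC; apply: open_measurable_plane.
by apply: closed_openC; apply: compact_closed cK; exact: norm_hausdorff.
Qed.

Lemma is_derive_scaled_sqr (c x : R) : is_derive x (1 : R) (fun r => c * r ^+ 2) (2 * c * x).
Proof.
apply/is_derive_epsP => e e0; exists (e / (`|c| + 1)).
  by rewrite divr_gt0 // ltr_wpDl.
move=> h; rewrite ltr_pdivlMr ?ltr_wpDl // => hk.
have -> : c * (x + h) ^+ 2 - c * x ^+ 2 - 2 * c * x * h = c * h * h by ring.
rewrite !normrM ler_wpM2r //; have := normr_ge0 h; lra.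
Qed.

Local Open Scope ereal_scope.

Lemma ge0_le_integral_sub d (T : measurableType d) (m : {measure set T -> \bar R})
    (A B : set T) (f1 f2 : T -> \bar R) : A `<=` B -> (forall x, B x -> 0 <= f2 x) ->
  (forall x, A x -> 0 <= f1 x <= f2 x) ->
  \int[m]_(x in A) f1 x <= \int[m]_(x in B) f2 x.
Proof.
move=> AB f20 f12; rewrite integral_mkcond [leRHS]integral_mkcond.
have g10 x : 0 <= (f1 \_ A) x by apply: erestrict_ge0 => y /f12/andP[].
have g20 x : 0 <= (f2 \_ B) x by apply: erestrict_ge0 => y /f20.
rewrite !ge0_integralTE //; apply: le_ereal_sup => _ [h /= hf <-]; exists h => //= x.
apply: (le_trans (hf x)); rewrite !patchE; case: ifPn => [|_].
  by rewrite inE => Ax; rewrite ifT ?inE; [case/andP: (f12 _ Ax)|exact: AB].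
by case: ifPn => //; rewrite inE => /f20.
Qed.

Lemma ge0_le_integral_same d (T : measurableType d) (m : {measure set T -> \bar R})
    (A : set T) (f1 f2 : T -> \bar R) : (forall x, A x -> 0 <= f1 x <= f2 x) ->
  \int[m]_(x in A) f1 x <= \int[m]_(x in A) f2 x.
Proof.
move=> H; apply: ge0_le_integral_sub => // x /H/andP[]; exact: le_trans.
Qed.

Lemma area_carleson I (F : C -> R) : is_arc I ->
  measurable_fun plane_disc (fun p => F (of_plane p)) ->
  (forall z, disc z -> (0 <= F z)%R) ->
  area_integral (carleson_square I) F =
  (pi^-1)%:E * \int[mu]_(t in `[I.1, I.2]) \int[mu]_(r in `[arc_radius I, 1%R[)
     (F (cpolar r t) * r)%:E.
Proof.
move=> Ia mF F0; have /andP[I12 I2p] := Ia.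
have mS := measurable_carleson_square I.
congr (_ * _).
have mF' : measurable_fun (@of_plane R @^-1` carleson_square I) (fun p => (F (of_plane p))%:E).
  apply/measurable_EFinP; apply: measurable_funS mF; first exact: measurable_plane_disc.
  by move=> p; exact: carleson_square_disc.
have F0' p : (@of_plane R @^-1` carleson_square I) p -> 0 <= (F (of_plane p))%:E.
  by move=> Sp; rewrite lee_fin; apply: F0; exact: carleson_square_disc Sp.
rewrite (polar_sector mS mF' F0' I12 I2p (arc_radius_ge0 I) (hi := 1%R)); last first.
  by move=> t r ta r0; exact: carleson_squareP.
by apply: eq_integral => t _; apply: eq_integral => r _; rewrite EFinM.
Qed.

(** The half-open turn counts every point of the punctured disc once. *)
Lemma area_disc (F : C -> R) :
  measurable_fun plane_disc (fun p => F (of_plane p)) ->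
  (forall z, disc z -> (0 <= F z)%R) ->
  area_integral (@disc R) F =
  (pi^-1)%:E * \int[mu]_(r in `]0%R, 1%R[) \int[mu]_(t in `[0%R, (2 * pi)%R[)
     (F (cpolar r t) * r)%:E.
Proof.
move=> mF F0; congr (_ * _).
have mF' : measurable_fun (@of_plane R @^-1` @disc R) (fun p => (F (of_plane p))%:E).
  exact/measurable_EFinP.
have F0' p : (@of_plane R @^-1` @disc R) p -> 0 <= (F (of_plane p))%:E.
  by move=> Sp; rewrite lee_fin; apply: F0.
rewrite (polar_disc measurable_plane_disc mF' F0' (hi := 1%R)); last first.
  by move=> t r r0; apply: disc_polar; exact: ltW.
by apply: eq_integral => r _; apply: eq_integral => t _; rewrite EFinM.
Qed.

(** Integrate the sub-mean value property over circles against [r dr]. *)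
Lemma disc_submean f (a : C) (rho : R) : (0 < rho)%R ->
  (forall w, (cmod w < rho)%R -> exists d, cdiff_at f (a + w)%R d) ->
  (pi * rho ^+ 2 * cmod (f a) ^+ 2)%:E <=
  \int[plane]_(p in [set p | (cmod ((of_plane p : C) - a)%R < rho)%R]) (cmod (f (of_plane p)) ^+ 2)%:E.
Proof.
move=> rho0 df.
pose E := [set p : R * R | (cmod (of_plane p) < rho)%R].
have oE : open E by exact: open_plane_ball.
have mE : measurable E by exact: open_measurable_plane.
pose g (w : C) := f (a + w)%R.
have cg p : E p -> {for of_plane p, continuous (g : cplane R -> cplane R)}.
  by move=> /df[d /cdiff_shift/cdiff_continuous].
have mg : measurable_fun E (fun p => cmod (g (of_plane p)) ^+ 2)%R.
  by apply: cts_measurable_plane => // p Ep; apply: cts_plane_cmod_sqr; exact: cg.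
pose Fg := (fun p => (cmod (g (of_plane p)) ^+ 2)%:E) \_ E.
have mFg : measurable_fun setT Fg.
  by apply/(measurable_restrict _ mE measurableT); rewrite setTI; exact/measurable_EFinP.
have Fg0 p : 0 <= Fg p by apply: erestrict_ge0 => q _; rewrite lee_fin exprn_ge0 // cmod_ge0.
have EE p : ((of_plane p : C) - a)%R = of_plane (- Re a + p.1, - Im a + p.2)%R.
  by apply: complex_ext; rewrite ?cReB ?cImB /= addrC.
have -> : \int[plane]_(p in [set p | (cmod ((of_plane p : C) - a)%R < rho)%R]) (cmod (f (of_plane p)) ^+ 2)%:E
   = \int[plane]_(p in E) (cmod (g (of_plane p)) ^+ 2)%:E.
  rewrite [RHS]integral_mkcond (plane_shift (- Re a) (- Im a) mFg Fg0) integral_mkcond.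
  apply: eq_integral => p _; rewrite /Fg !patchE.
  have -> : (p \in [set p | (cmod ((of_plane p : C) - a)%R < rho)%R]) = ((- Re a + p.1, - Im a + p.2)%R \in E).
    by apply/idP/idP; rewrite !inE /E /= EE.
  by case: ifPn => // _; rewrite -EE /g addrC subrK.
rewrite (polar_disc mE _ _ (hi := rho)); last 3 first.
- exact/measurable_EFinP.
- by move=> p _; rewrite lee_fin exprn_ge0 // cmod_ge0.
- by move=> t r r0; rewrite -[X in _ <-> (X < rho)%R](cmod_cpolar t (ltW r0)).
have c1 : cts_on (fun r : R => 2 * pi * cmod (f a) ^+ 2 * r)%R 0 rho.
  by apply: cts_onM; [exact: cts_on_cst|move=> x _; exact: cvg_id].
have -> : (pi * rho ^+ 2 * cmod (f a) ^+ 2)%:E =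
    \int[mu]_(r in `]0%R, rho[) (2 * pi * cmod (f a) ^+ 2 * r)%:E.
  have mm : measurable_fun setT (fun r : R => (2 * pi * cmod (f a) ^+ 2 * r)%:E).
    by apply/measurable_EFinP; exact: measurable_funM.
  rewrite integral_itv_obnd_cbnd; last exact: measurable_funTS.
  rewrite integral_itv_bndo_bndc; last exact: measurable_funTS.
  have D x : (0 <= x <= rho)%R ->
      is_derive x (1%R : R) (fun r => pi * cmod (f a) ^+ 2 * r ^+ 2)%R (2 * pi * cmod (f a) ^+ 2 * x)%R.
    by move=> _; have := is_derive_scaled_sqr (pi * cmod (f a) ^+ 2)%R x; rewrite mulrA.
  rewrite rint_EFin // (rint_FTC (ltW rho0) c1 D).
  by congr EFin; ring.
apply: ge0_le_integral_same => r /=; rewrite in_itv /= => /andP[r0 rr].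
have cr : (cmod (cpolar r _ : C) < rho)%R by move=> t; rewrite cmod_cpolar // ltW.
have cgr : cts_on (fun t => cmod (g (cpolar r t)) ^+ 2)%R 0 (2 * pi).
  move=> t _; have := @cts2_Re _ g r t (cg (r * cos t, r * sin t)%R (cr t)).
  have := @cts2_Im _ g r t (cg (r * cos t, r * sin t)%R (cr t)).
  move=> /cts_pair2 /= c2 /cts_pair2 /= c3.
  have -> : (fun t => cmod (g (cpolar r t)) ^+ 2)%R =
    (fun t => Re (g (cpolar r t)) * Re (g (cpolar r t)) + Im (g (cpolar r t)) * Im (g (cpolar r t)))%R.
    by apply: funext => u; rewrite cmod_sqr !expr2.
  by apply: continuousD; exact: continuousM.
apply/andP; split.
  by rewrite lee_fin mulr_ge0 ?(ltW r0) // !mulr_ge0 ?exprn_ge0 ?cmod_ge0 ?pi_ge0.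
have crr : cts_on (fun t => r * cmod (g (cpolar r t)) ^+ 2)%R 0 (2 * pi).
  by apply: cts_onM; [exact: cts_on_cst|exact: cgr].
rewrite [leRHS](_ : _ = \int[mu]_(t in `[0%R, (2 * pi)%R]) (r * cmod (g (cpolar r t)) ^+ 2)%:E).
  rewrite rint_EFin // rintZ // lee_fin mulrC ler_pM2l //.
  by apply: (@cmod_sqr_submean _ f a r rho) => //; rewrite ltW.
rewrite -integral_itv_bndo_bndc; last first.
  apply: measurable_funS (measurable_int _ (rint_integrable crr)) => //.
  by apply: subset_itvl; rewrite bnd_simp.
by apply: eq_integral => t _; rewrite of_plane_polar -EFinM mulrC.
Qed.

End PlaneRegions.

(** * Radial profile and tail of a weight *)

Section RadialProfile.
Variable R : realType.
Local Notation C := R[i].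
Notation mu := (@lebesgue_measure R).
Notation plane := (@lebesgue_measure R \x @lebesgue_measure R)%E.
Variable omega : cplane R -> R.
Hypothesis omega_crw : continuous_radial_weight omega.

Definition profile (r : R) : R := omega (creal r).
Local Notation w := profile.

(** The tail integral of the weight. *)
Definition tail (r : R) : R := \int[mu]_(s in `[r, 1[) w s.
Local Notation W := tail.

Lemma cmod_creal (r : R) : cmod (creal r) = `|r|.
Proof. exact: cmod_real. Qed.

Lemma profile_gt0 r : 0 <= r < 1 -> 0 < w r.
Proof.
move=> /andP[r0 r1]; have [[H _] _ _] := omega_crw; apply: H.
suff : cmod (creal r) < 1 by []. 
by rewrite cmod_creal ger0_norm.
Qed.

Lemma profileE z : disc z -> omega z = w (cmod z).
Proof. by have [_ H _] := omega_crw; exact: H. Qed.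

Lemma profile_cts r : - 1 < r < 1 -> {for r, continuous w}.
Proof.
move=> r1; have [_ _ /(_ (creal r))] := omega_crw.
have dr : disc (creal r).
  suff : cmod (creal r) < 1 by [].
  by rewrite cmod_creal ltr_norml.
rewrite inE => /(_ dr) co; apply/cvgrPdist_le => e e0.
have : omega z @[z --> creal r] --> omega (creal r) by exact: co.
move=> /cvgrPdist_le/(_ e e0)/(@nbhs_normP R[i] R[i]^o)[k /= k0 kP].
have [k' k'0 kk] : exists2 k' : R, 0 < k' & k = k'%:C%C.
  move: k0; rewrite ltcE /= => /andP[/eqP im0 re0]; exists (Re k) => //.
  by case: k im0 {re0 kP} => a b /= ->.
apply/nbhs_normP; exists k' => // y; rewrite /ball_ /= => ry; apply: kP.
rewrite /ball_ /= kk [`|_|]cmod_norm ltcR.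
have -> : (creal r - creal y : C) = creal (r - y) :> C.
  by apply: complex_ext; rewrite ?cReB ?cImB //= subrr.
by rewrite cmod_creal.
Qed.

Lemma profile_cts_on a b : 0 <= a -> b < 1 -> cts_on w a b.
Proof.
move=> a0 b1 x /andP[ax xb]; apply: profile_cts.
by rewrite (le_lt_trans xb b1) andbT (lt_le_trans _ (le_trans a0 ax)) // oppr_lt0.
Qed.

Lemma measurable_profile : measurable_fun (`[0, 1[%classic : set R) w.
Proof.
apply: (@measurable_funS _ _ _ _ (`]- 1, 1[%classic : set R)) => //.
  by move=> x /=; rewrite !in_itv /= => /andP[x0 ->]; rewrite andbT (lt_le_trans _ x0) // oppr_lt0.
apply: open_continuous_measurable_fun; first exact: itv_open.
by move=> x; rewrite inE /= in_itv /=; exact: profile_cts.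
Qed.

Lemma measurable_omega : measurable_fun (@plane_disc R) (fun p => omega (of_plane p)).
Proof.
have [[_ io] _ _] := omega_crw.
by apply/measurable_EFinP; exact: measurable_int io.
Qed.

Lemma omega_ge0 z : disc z -> 0 <= omega z.
Proof. by have [[H _] _ _] := omega_crw; move=> /H/ltW. Qed.

Local Open Scope ereal_scope.

Lemma circle_profile (r : R) : (0 < r < 1)%R ->
  \int[mu]_(t in `[0%R, (2 * pi)%R[) (omega (cpolar r t) * r)%:E = (2 * pi * (w r * r))%:E.
Proof.
move=> /andP[r0 r1].
have E t : omega (cpolar r t) = w r.
  by rewrite profileE ?cmod_cpolar ?(ltW r0) //; apply/disc_polar => //; exact: ltW.
under eq_integral do rewrite E.
by rewrite integral_itv_cst ?(ltW (pi2_gt0 R)) // subr0 mulrC.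
Qed.

Lemma profile_half_integrable : \int[mu]_(r in `[2^-1%R, 1%R[) (w r)%:E < +oo.
Proof.
have [[_ io] _ _] := omega_crw.
have fin : \int[plane]_(p in @plane_disc R) (omega (of_plane p))%:E < +oo.
  have /integrableP[_] := io; apply: le_lt_trans.
  by apply: ge0_le_integral_same => p dp; rewrite /= ?lee_fin ?ler_norm ?omega_ge0.
have := area_disc measurable_omega omega_ge0; rewrite /area_integral => /(congr1 (fun x => (pi%:E * x))).
rewrite !muleA -EFinM mulfV ?gt_eqF ?pi_gt0 // !mul1e => E.
apply: le_lt_trans fin; rewrite [leRHS]E.
apply: ge0_le_integral_sub.
- by move=> x /=; rewrite !in_itv /= => /andP[x1 ->]; rewrite andbT (lt_le_trans _ x1) // invr_gt0.
- move=> r /=; rewrite in_itv /= => rb; rewrite circle_profile // lee_fin.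
  case/andP: rb => r0 r1.
  by rewrite !mulr_ge0 ?pi_ge0 ?(ltW r0) // ltW // profile_gt0 // ltW.
- move=> r /=; rewrite in_itv /= => /andP[r2 r1].
  have r0 : (0 < r)%R by apply: lt_le_trans r2; rewrite invr_gt0.
  have wr : (0 < w r)%R by apply: profile_gt0; rewrite ltW.
  rewrite circle_profile ?r0 // !lee_fin (ltW wr) /=.
  have -> : (2 * pi * (w r * r) = w r * (pi * (2 * r)))%R by ring.
  rewrite ler_pMr // -[leLHS]mulr1 ler_pM //; last by rewrite mulrC -ler_pdivrMr // mul1r.
  by have := pi_ge2 R; lra.
Qed.

Lemma profile_integrable : mu.-integrable `[0%R, 1%R[ (EFin \o w).
Proof.
apply/integrableP; split; first by apply/measurable_EFinP; exact: measurable_profile.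
have -> : \int[mu]_(x in `[0%R, 1%R[) `|(EFin \o w) x| = \int[mu]_(x in `[0%R, 1%R[) (w x)%:E.
  by apply: eq_integral => x; rewrite inE /= in_itv /= => xb; rewrite gtr0_norm // profile_gt0.
have h0 : (0 <= 2^-1 :> R)%R by rewrite invr_ge0.
have h1 : (2^-1 <= 1 :> R)%R by lra.
have E : (`[0%R, 1%R[%classic : set R) = (`[0%R, 2^-1%R[%classic : set R) `|` (`[2^-1%R, 1%R[%classic : set R).
  by rewrite -(@itv_bndbnd_setU _ _ (BLeft 0%R) (BLeft 2^-1%R) (BLeft 1%R)) ?bnd_simp.
rewrite E ge0_integral_setU //=.
- apply: lte_add_pinfty; last exact: profile_half_integrable.
  have cw : cts_on w 0 2^-1 by apply: profile_cts_on => //; rewrite invf_lt1 // ltr1n.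
  have iw := rint_integrable cw.
  rewrite integral_itv_bndo_bndc; last first.
    apply: measurable_funS (measurable_int _ iw) => //.
    by apply: subset_itvl; rewrite bnd_simp.
  by rewrite rint_EFin // ltry.
- by rewrite -E; apply/measurable_EFinP; exact: measurable_profile.
- move=> x; rewrite !in_itv /= => xb; rewrite lee_fin ltW // profile_gt0 //.
  by case: xb => /andP[xa xc]; apply/andP; split=> //; lra.
- rewrite disj_set2E; apply/eqP/seteqP; split => // t [] /=; rewrite !in_itv /=.
  by move=> /andP[_ tb] /andP[/le_lt_trans/(_ tb)]; rewrite ltxx.
Qed.

Lemma profile_integrable_sub r : (0 <= r)%R -> mu.-integrable `[r, 1%R[ (EFin \o w).
Proof.
move=> r0; apply: integrableS profile_integrable => //.
by apply: subset_itvr; rewrite bnd_simp.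
Qed.

Lemma profile_integrable_closed : mu.-integrable `[0%R, 1%R] (EFin \o w).
Proof.
have /integrableP[m1 i1] := profile_integrable.
have mc : measurable_fun (`[0%R, 1%R]%classic : set R) (EFin \o w).
  have -> : (`[0%R, 1%R]%classic : set R) = (`[0%R, 1%R[%classic : set R) `|` [set 1%R] by rewrite setUitv1 ?bnd_simp.
  by apply/measurable_funU => //; split => //; exact: measurable_fun_set1.
apply/integrableP; split => //.
rewrite -integral_itv_bndo_bndc //; exact: measurableT_comp.
Qed.

Local Close Scope ereal_scope.

Lemma tail_split r t : 0 <= r -> r <= t -> t < 1 -> W r = rint r t w + W t.
Proof.
move=> r0 rt t1.
have := @Rintegral_itvB _ w (BLeft r) (BLeft 1) t (profile_integrable_sub r0).
rewrite !bnd_simp => /(_ rt t1) E; rewrite /W /rint.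
rewrite -(Rintegral_itv_obnd_cbnd (r := t)); first by rewrite -E addrC subrK.
apply: integrableS (profile_integrable_sub (le_trans r0 rt)) => //.
by apply: subset_itvr; rewrite bnd_simp.
Qed.

Lemma tail_ge0 r : 0 <= r -> 0 <= W r.
Proof.
move=> r0; apply: Rintegral_ge0 => x /=; rewrite in_itv /= => /andP[rx x1].
by rewrite ltW // profile_gt0 // (le_trans r0).
Qed.

Lemma tail_mono r t : 0 <= r -> r <= t -> t < 1 -> W t <= W r.
Proof.
move=> r0 rt t1; rewrite (tail_split r0 rt t1) lerDr; apply: rint_ge0 => x /andP[rx xt].
by rewrite ltW // profile_gt0 // (le_trans r0) // (le_lt_trans xt).
Qed.

(** On a slightly smaller interval the weight is continuous and positive,
    hence has a positive minimum. *)
Lemma tail_gt0 r : 0 <= r -> r < 1 -> 0 < W r.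
Proof.
move=> r0 r1; set t := (r + 1) / 2.
have rt : r < t by rewrite /t; lra.
have t1 : t < 1 by rewrite /t; lra.
rewrite (tail_split r0 (ltW rt) t1) ltr_wpDr ?tail_ge0 ?(le_trans r0 (ltW rt)) //.
have cw := profile_cts_on r0 t1.
have [c c_in cP] := EVT_min (ltW rt) (cts_on_within cw).
rewrite in_itv /= in c_in; have {cP} cP x : r <= x <= t -> w c <= w x.
  by move=> xb; apply: cP; rewrite in_itv.
have wc : 0 < w c.
  by case/andP: c_in => rc ct; apply: profile_gt0; rewrite (le_trans r0 rc) (le_lt_trans ct).
apply: lt_le_trans (rint_ge_cst (ltW rt) cw cP).
by rewrite mulr_gt0 // subr_gt0.
Qed.

(** The continuity of an integral of an integrable function in its endpoint. *)
Lemma tail_cvg0 e : 0 < e -> exists2 r, 0 <= r < 1 & forall t, r <= t < 1 -> W t <= e.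
Proof.
move=> e0.
have H := @parameterized_integral_cvg_at_left R 0 1 w ltr01 profile_integrable_closed.
have tot : \int[mu]_(x in `[0, 1]) w x = W 0.
  by rewrite /W Rintegral_itv_bndo_bndc //; exact: profile_integrable.
move: H; rewrite /parameterized_integral tot => /cvgrPdist_le/(_ e e0).
rewrite near_withinE => /nbhs_normP[k /= k0 kP].
exists (Num.max 0 (1 - k / 2)).
  by rewrite le_max lexx gt_max ltr01 /= gtrBl divr_gt0.
move=> t /andP[]; rewrite ge_max => /andP[t0 tk] t1.
have := kP t; rewrite /ball_ /= => /(_ _ t1); rewrite gtr0_norm ?subr_gt0 //.
have lk : 1 - t < k by lra.
move=> /(_ lk).
have -> : W 0 - \int[mu]_(x in `[0, t]) w x = W t by rewrite (tail_split (lexx 0) t0 t1) /rint addrC addKr.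
by rewrite ger0_norm ?tail_ge0.
Qed.


(** The upper bound on the weight, with the largest value of the tail, is
    integrated over [[r, t]]. *)
Lemma tail_drop (K r t : R) : 0 <= K -> 0 <= r -> r <= t -> t < 1 ->
  (forall s : R, r <= s <= t -> w s * (1 - s) <= K * W s) ->
  (W r - W t) * (1 - t) <= K * W r * (t - r).
Proof.
move=> K0 r0 rt t1 wK; have r1 := le_lt_trans rt t1.
rewrite (tail_split r0 rt t1) addrK -(tail_split r0 rt t1) mulrC -ler_pdivlMl ?subr_gt0 //.
rewrite mulrA; apply: rint_le_cst => //; first exact: profile_cts_on.
move=> s sb; have /andP[rs st] := sb.
rewrite ler_pdivlMl ?subr_gt0 // mulrC.
have w0 : 0 < w s by apply: profile_gt0; rewrite (le_trans r0 rs) (le_lt_trans st).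
apply: le_trans (_ : w s * (1 - s) <= _); first by rewrite ler_pM2l //; lra.
apply: le_trans (wK _ sb) _; apply: ler_wpM2l => //.
by apply: tail_mono => //; exact: le_lt_trans t1.
Qed.

Lemma tail_step (K r t : R) : 1 <= K ->
  (forall s : R, 0 <= s < 1 -> w s * (1 - s) <= K * W s) ->
  0 <= r -> r <= t -> t < 1 -> 2 * K * (t - r) <= 1 - t -> W r <= 2 * W t.
Proof.
move=> K1 wK r0 rt t1 Kt; have K0 : 0 <= K by apply: le_trans K1.
have := tail_drop K0 r0 rt t1.
have H : forall s : R, r <= s <= t -> w s * (1 - s) <= K * W s.
  by move=> s /andP[rs st]; apply: wK; rewrite (le_trans r0 rs) (le_lt_trans st).
move=> /(_ H) D; have Wr := tail_gt0 r0 (le_lt_trans rt t1).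
have t1' : 0 < 1 - t by rewrite subr_gt0.
have : (W r - W t) * (1 - t) <= W r / 2 * (1 - t).
  apply: le_trans D _.
  have -> : K * W r * (t - r) = W r / 2 * (2 * K * (t - r)) by field.
  by rewrite ler_pM2l // divr_gt0.
by rewrite ler_pM2r //; lra.
Qed.

(** Moving towards the boundary by a fixed proportion of the remaining
    distance at most halves the tail; a bounded number of such steps halves
    the distance to the boundary. *)
Lemma tail_doubling (K : R) : 1 <= K ->
  (forall s : R, 0 <= s < 1 -> w s * (1 - s) <= K * W s) ->
  exists2 D : R, 1 <= D & forall r : R, 0 <= r < 1 -> W r <= D * W ((1 + r) / 2).
Proof.
move=> K1 wK; have K0 : 0 < K by apply: lt_le_trans K1.
(* With this step, [tail_step] costs exactly a factor 2. *)
pose x := (2 * K)^-1; have x0 : 0 < x by rewrite invr_gt0 mulr_gt0.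
have iter n r : 0 <= r < 1 -> W r <= 2 ^+ n * W (1 - (1 - r) / (1 + x) ^+ n).
  move=> /andP[r0 r1]; elim: n => [|n IH].
    by rewrite !expr0 mul1r divr1 subKr.
  apply: le_trans IH _; rewrite exprSr -mulrA ler_wpM2l ?exprn_ge0 //.
  have p0 : 0 < (1 + x) ^+ n by rewrite exprn_gt0 // addr_gt0.
  have p1 : 1 <= (1 + x) ^+ n by rewrite exprn_ege1 // lerDl ltW.
  have q0 : 0 < 1 + x by rewrite addr_gt0.
  set d := (1 - r) / (1 + x) ^+ n.
  have d1 : d <= 1 by rewrite ler_pdivrMr // mul1r; lra.
  have d0 : 0 < d by rewrite divr_gt0 // subr_gt0.
  have -> : (1 - r) / (1 + x) ^+ n.+1 = d / (1 + x).
    by rewrite exprSr /d; field; rewrite !gt_eqF.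
  have dx : d = (1 + x) * (d / (1 + x)) by field; rewrite gt_eqF.
  have e0 : 0 < d / (1 + x) by rewrite divr_gt0.
  move: e0 dx; set e := d / (1 + x) => e0 dx.
  have Kx : 2 * K * x = 1 by rewrite mulfV // gt_eqF // mulr_gt0.
  have xe : 0 <= x * e by rewrite ltW // mulr_gt0.
  apply: (tail_step K1 wK); rewrite ?subr_ge0 ?ltrBlDr ?ltrDl //; try by rewrite dx; lra.
  have -> : 2 * K * (1 - e - (1 - d)) = 2 * K * x * e by rewrite dx; ring.
  by rewrite Kx; lra.
have [n nK] : exists n : nat, 2 * K <= n%:R.
  by exists (Num.truncn (2 * K)).+1; rewrite ltW // truncnS_gt.
exists (2 ^+ n); first by rewrite exprn_ege1 // ler1n.
move=> r rb; have /andP[r0 r1] := rb.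
apply: le_trans (iter n r rb) _; rewrite ler_wpM2l ?exprn_ge0 //.
have bern : 1 + n%:R * x <= (1 + x) ^+ n.
  elim: n {nK} => [|n IH]; first by rewrite mul0r addr0 expr0.
  rewrite exprS; apply: le_trans (ler_wpM2l _ IH); last by rewrite ltW // addr_gt0.
  rewrite -natr1 -subr_ge0.
  have -> : (1 + x) * (1 + n%:R * x) - (1 + (n%:R + 1) * x) = n%:R * (x * x) by ring.
  by rewrite mulr_ge0 // mulr_ge0 // ltW.
have two : 2 <= (1 + x) ^+ n.
  apply: le_trans bern; rewrite -[leLHS]/(1 + 1) lerD2l /x ler_pdivlMr ?mul1r //.
  by rewrite mulr_gt0.
have p0 : 0 < (1 + x) ^+ n by apply: lt_le_trans two.
have : (1 - r) / (1 + x) ^+ n <= (1 - r) / 2.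
  by rewrite ler_wpM2l ?subr_ge0 ?(ltW r1) // lef_pV2 ?posrE.
have := divr_gt0 (_ : 0 < 1 - r) p0; rewrite subr_gt0 => /(_ r1).
move: (_ / _) => d d0 d2; apply: tail_mono; lra.
Qed.

End RadialProfile.

Section WeightClasses.
Variable R : realType.
Variable omega : cplane R -> R.
Local Notation w := (profile omega).
Local Notation W := (tail omega).

Lemma regular_profile : regular_weight omega -> exists2 K : R, 1 <= K &
  forall r : R, 0 <= r < 1 -> w r * (1 - r) <= K * W r /\ W r <= K * ((1 - r) * w r).
Proof.
move=> [crw [K K1 HK]]; exists K => // r rb; have K0 : 0 < K by apply: lt_le_trans K1.
have w0 := profile_gt0 crw rb.
have /andP[] := HK r rb; rewrite -[psi omega r]/((w r)^-1 * W r) => h1 h2; split.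
  move: h1; rewrite mulrC [leRHS]mulrC ler_pdivlMr // mulrAC ler_pdivrMr //.
  by rewrite mulrC [leRHS]mulrC.
by move: h2; rewrite ler_pdivrMl // mulrCA [w r * _]mulrC.
Qed.

Lemma rapid_profile (M : R) : rapidly_increasing_weight omega ->
  exists2 r0 : R, 0 <= r0 < 1 & forall r : R, r0 <= r < 1 -> M * (w r * (1 - r)) <= W r.
Proof.
move=> [crw /cvgryPge/(_ M)]; rewrite near_withinE => /nbhs_normP[k /= k0 kP].
exists (Num.max 0 (1 - k / 2)).
  by rewrite le_max lexx gt_max ltr01 /= gtrBl divr_gt0.
move=> t /andP[]; rewrite ge_max => /andP[t0 tk] t1.
have w0 : 0 < w t by apply: profile_gt0 => //; rewrite t0.
have := kP t; rewrite /ball_ /= => /(_ _ t1); rewrite gtr0_norm ?subr_gt0 //.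
have lk : 1 - t < k by lra.
move=> /(_ lk); rewrite -[psi omega t]/((w t)^-1 * W t) ler_pdivlMr ?subr_gt0 //.
by rewrite ler_pdivlMl // mulrCA.
Qed.

(** For a regular weight this is half of the definition. For a rapidly
    increasing one it holds near the boundary, and on the remaining compact
    interval the weight is bounded above and the tail bounded below. *)
Lemma profile_le_tail : (@rapidly_increasing_weight R `|` @regular_weight R) omega ->
  exists2 K : R, 1 <= K & forall r : R, 0 <= r < 1 -> w r * (1 - r) <= K * W r.
Proof.
case=> [rapid|/regular_profile[K K1 H]]; last by exists K => // r /H[].
have [crw _] := rapid.
have [r0 /andP[r00 r01] H] := rapid_profile 1 rapid.
have [B BP] : exists B, forall r : R, 0 <= r <= r0 -> w r <= B.
  have cw := profile_cts_on crw (lexx 0) r01.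
  have [c c_in cP] := EVT_max r00 (cts_on_within cw).
  by exists (w c) => r rb; apply: cP; rewrite in_itv.
have W0 := tail_gt0 crw r00 r01.
exists (Num.max 1 (B / W r0)); first by rewrite le_max lexx.
move=> r /andP[ra rb]; have Wr := tail_gt0 crw ra rb.
have [rr0|r0r] := leP r r0.
  have wB : w r <= B by apply: BP; rewrite ra.
  have w0 : 0 < w r by apply: profile_gt0; rewrite // ra.
  apply: le_trans (_ : B / W r0 * W r <= _); last by rewrite ler_pM2r // le_max lexx orbT.
  apply: le_trans (_ : B <= _).
    by apply: le_trans wB; rewrite ler_piMr // ?(ltW w0) //; lra.
  rewrite mulrAC ler_pdivlMr // ler_wpM2l //; first exact: le_trans (ltW w0) wB.
  by apply: tail_mono.
apply: le_trans (_ : 1 * W r <= _); last by rewrite ler_pM2r // le_max lexx.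
by have := H r; rewrite (ltW r0r) rb !mul1r => /(_ isT).
Qed.

End WeightClasses.

(** * The radial profile of the star weight *)

Section StarProfile.
Variable R : realType.
Local Notation C := R[i].
Notation mu := (@lebesgue_measure R).
Variable omega : cplane R -> R.
Hypothesis omega_crw : continuous_radial_weight omega.
Local Notation w := (profile omega).
Local Notation W := (tail omega).

Definition star_profile (r : R) : R := \int[mu]_(s in `[r, 1[) (w s * ln (s / r) * s).
Local Notation S := star_profile.

Lemma starE z : star omega z = S (cmod z). Proof. by []. Qed.

(** From [1 - 1/x <= log x <= x - 1] at [x = s / r]. *)
Lemma star_kernel_bounds (r s : R) : 0 < r -> r <= s -> s < 1 ->
  [/\ 0 <= w s * ln (s / r) * s, w s * (s - r) <= w s * ln (s / r) * s
    & w s * ln (s / r) * s <= w s * ((1 - r) / r)].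
Proof.
move=> r0 rs s1; have s0 : 0 < s := lt_le_trans r0 rs.
have w0 : 0 < w s by apply: profile_gt0 => //; rewrite ltW.
have x0 : 0 < s / r by rewrite divr_gt0.
have lo : s - r <= ln (s / r) * s.
  rewrite -ler_pdivrMr // -lerN2 -lnV ?posrE // invf_div.
  have -> : - ((s - r) / s) = r / s - 1 by field; rewrite gt_eqF.
  have := @le_ln1Dx R (r / s - 1); rewrite addrCA subrr addr0; apply.
  by rewrite ltrDr divr_gt0.
have hi : ln (s / r) * s <= (1 - r) / r.
  apply: le_trans (_ : (s / r - 1) * s <= _).
    rewrite ler_pM2r //; have := @le_ln1Dx R (s / r - 1).
    by rewrite addrCA subrr addr0; apply; rewrite ltrDr.
  have -> : s / r - 1 = (s - r) / r by field; rewrite gt_eqF.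
  rewrite mulrAC ler_pM2r ?invr_gt0 //.
  have : 0 <= (s - r) * (1 - s) by rewrite mulr_ge0 //; lra.
  by lra.
have k0 : 0 <= ln (s / r) * s by apply: le_trans lo; rewrite subr_ge0.
by rewrite -!mulrA !ler_pM2l //; split => //; exact: mulr_ge0 (ltW w0) k0.
Qed.

Lemma measurable_star_kernel (r : R) : 0 < r ->
  measurable_fun (`[r, 1[%classic : set R) (fun s => w s * ln (s / r) * s).
Proof.
move=> r0; apply: measurable_funM => //; apply: measurable_funM.
  apply: measurable_funS (measurable_profile omega_crw) => //.
  by apply: subset_itvr; rewrite bnd_simp ltW.
apply: measurableT_comp; first exact: measurable_ln.
exact: measurable_funM.
Qed.

Lemma star_kernel_integrable (r : R) : 0 < r ->
  mu.-integrable `[r, 1[ (fun s => (w s * ln (s / r) * s)%:E).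
Proof.
move=> r0.
have iw : mu.-integrable `[r, 1[ (fun s => ((1 - r) / r)%:E * (EFin \o w) s)%E.
  by apply: (@integrableZl _ _ R mu) (profile_integrable_sub omega_crw (ltW r0)).
apply: le_integrable iw => //.
  by apply/measurable_EFinP; exact: measurable_star_kernel.
move=> s /=; rewrite in_itv /= => /andP[rs s1].
have [h0 _ h1] := star_kernel_bounds r0 rs s1.
by rewrite lee_fin !ger0_norm 1?[_ / _ * _]mulrC // (le_trans h0).
Qed.

Lemma star_EFin (r : R) : 0 < r ->
  (\int[mu]_(s in `[r, 1%R[) (w s * ln (s / r) * s)%:E = (S r)%:E)%E.
Proof.
move=> r0; rewrite /S /Rintegral fineK //.
by apply: integrable_fin_num => //; exact: star_kernel_integrable.
Qed.

Lemma tail_EFin (r : R) : 0 <= r -> (\int[mu]_(s in `[r, 1%R[) (w s)%:E = (W r)%:E)%E.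
Proof.
move=> r0; rewrite /W /Rintegral fineK //.
by apply: integrable_fin_num => //; exact: profile_integrable_sub.
Qed.

Lemma star_ge0 (r : R) : 0 <= r -> 0 <= S r.
Proof.
rewrite le_eqVlt => /orP[/eqP <-|r0]; apply: Rintegral_ge0 => s /=; rewrite in_itv /= => /andP[rs s1].
  by rewrite invr0 mulr0 ln0 // mulr0 mul0r.
by have [] := star_kernel_bounds r0 rs s1.
Qed.

Lemma star_le (r : R) : 0 < r -> r < 1 -> r * S r <= (1 - r) * W r.
Proof.
move=> r0 r1; rewrite mulrC -ler_pdivlMr // mulrAC -lee_fin -star_EFin // EFinM.
rewrite -tail_EFin ?(ltW r0) //.
rewrite -ge0_integralZl_EFin //; first last.
- by rewrite divr_ge0 ?subr_ge0 ?ltW.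
- apply/measurable_EFinP; apply: measurable_funS (measurable_profile omega_crw) => //.
  by apply: subset_itvr; rewrite bnd_simp ltW.
- move=> s /=; rewrite in_itv /= => /andP[rs s1].
  by rewrite lee_fin ltW // profile_gt0 // (le_trans (ltW r0)).
apply: ge0_le_integral_same => s /=; rewrite in_itv /= => /andP[rs s1].
have [h0 _ h1] := star_kernel_bounds r0 rs s1.
by rewrite -EFinM !lee_fin h0 /= [leRHS]mulrC.
Qed.

(** On [s >= (1 + r) / 2] the kernel is at least [(1 - r) / 2]. With the
    doubling of the tail, the star weight is comparable to [(1 - r) W]. *)
Lemma star_ge (r : R) : 0 < r -> r < 1 -> (1 - r) / 2 * W ((1 + r) / 2) <= S r.
Proof.
move=> r0 r1; rewrite -lee_fin -star_EFin // EFinM.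
have m0 : 0 <= (1 + r) / 2 by lra.
rewrite -tail_EFin // -ge0_integralZl_EFin //; first last.
- by rewrite divr_ge0 ?subr_ge0 ?ltW.
- apply/measurable_EFinP; apply: measurable_funS (measurable_profile omega_crw) => //.
  by apply: subset_itvr; rewrite bnd_simp.
- move=> s /=; rewrite in_itv /= => /andP[rs s1].
  by rewrite lee_fin ltW // profile_gt0 // (le_trans m0).
apply: ge0_le_integral_sub.
- by apply: subset_itvr; rewrite bnd_simp; lra.
- move=> s /=; rewrite in_itv /= => /andP[rs s1].
  by have [h0 _ _] := star_kernel_bounds r0 rs s1.
move=> s /=; rewrite in_itv /= => /andP[rs s1]; have rs' : r <= s by lra.
have w0 : 0 < w s by apply: profile_gt0 => //; rewrite s1 andbT; lra.
have [_ h1 _] := star_kernel_bounds r0 rs' s1.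
have h0 : 0 <= (1 - r) / 2 by lra.
rewrite -EFinM !lee_fin mulr_ge0 ?(ltW w0) //=.
by apply: le_trans h1; rewrite mulrC ler_pM2l //; lra.
Qed.

Lemma star_mono (r1 r2 : R) : 0 < r1 -> r1 <= r2 -> S r2 <= S r1.
Proof.
move=> r10 r12; have r20 := lt_le_trans r10 r12.
rewrite -lee_fin -!star_EFin //; apply: ge0_le_integral_sub.
- by apply: subset_itvr; rewrite bnd_simp.
- move=> s /=; rewrite in_itv /= => /andP[rs s1].
  by have [h0 _ _] := star_kernel_bounds r10 rs s1.
move=> s /=; rewrite in_itv /= => /andP[rs s1].
have [h0 _ _] := star_kernel_bounds r20 rs s1.
have s0 := lt_le_trans r20 rs.
have w0 : 0 < w s by apply: profile_gt0 => //; rewrite ltW.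
rewrite !lee_fin h0 /= ler_pM2r // ler_pM2l // ler_ln ?posrE ?divr_gt0 //.
by rewrite ler_pM2l // lef_pV2 ?posrE.
Qed.

Lemma measurable_star_profile : measurable_fun (`[0, 1[%classic : set R) S.
Proof.
pose E (n : nat) := (`[n.+1%:R^-1, 1[%classic : set R).
have mE : measurable_fun (\bigcup_n E n) S.
  apply/measurable_fun_bigcup => n; first by rewrite /E.
  have n0 : 0 < n.+1%:R^-1 :> R by rewrite invr_gt0.
  have m1 : measurable_fun (E n) (fun r : R => S (Num.max r n.+1%:R^-1)).
    apply: nonincreasing_measurable; first by rewrite /E.
    move=> r1 r2 r12; apply: star_mono.
      by rewrite lt_max n0 orbT.
    by rewrite ge_max !le_max r12 lexx !orbT.
  apply: eq_measurable_fun m1 => r.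
  by rewrite inE /E /= in_itv /= => /andP[nr _]; congr S; exact/max_idPl.
have m0 : measurable_fun ([set 0] `|` \bigcup_n E n) S.
  apply/measurable_funU => //; first by apply: bigcup_measurable => n _; rewrite /E.
  by split => //; exact: measurable_fun_set1.
apply: measurable_funS m0; first by apply: measurableU => //; apply: bigcup_measurable => n _; rewrite /E.
move=> r /=; rewrite in_itv /= le_eqVlt => /andP[/orP[/eqP <-|r0] r1]; [by left|right].
have [n _ nP] := near_infty_natSinv_lt (PosNum r0).
exists n => //; rewrite /E /= in_itv /= r1 andbT.
by apply: ltW; exact: (nP n (leqnn n)).
Qed.

Lemma measurable_star : measurable_fun (@plane_disc R) (fun p => star omega (of_plane p)).
Proof.
apply: (@measurable_comp _ _ _ _ _ _ (`[0, 1[%classic : set R) S _ (fun p => cmod (of_plane p))) => //.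
- move=> _ [p dp <-]; suff : 0 <= cmod (of_plane p) < 1 by [].
  by rewrite cmod_ge0.
- exact: measurable_star_profile.
apply: cts_measurable_plane; first exact: open_plane_disc.
move=> p _.
have -> : (fun p : R * R => cmod (of_plane p)) = (fun p => Num.sqrt (cmod (of_plane p) ^+ 2)).
  by apply/funext => q; rewrite sqrtr_sqr ger0_norm ?cmod_ge0.
apply: (@continuous_comp _ _ _ (fun p : R * R => cmod (of_plane p) ^+ 2) Num.sqrt); last exact: sqrt_continuous.
exact: (@cts_plane_cmod_sqr R id p (fun A => id)).
Qed.

End StarProfile.

(** * Carleson conditions in polar form *)

Section PolarBoxes.
Variable R : realType.
Local Notation C := R[i].
Notation mu := (@lebesgue_measure R).
Notation plane := (@lebesgue_measure R \x @lebesgue_measure R)%E.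
Implicit Types (I : R * R) (F G H : C -> R).

Lemma polar_form (z : C) : exists2 t : R, 0 <= t <= 2 * pi & z = cpolar (cmod z) t.
Proof.
have [->|z0] := eqVneq z 0.
  exists 0; first by rewrite lexx ltW // pi2_gt0.
  by rewrite cpolarE cmod0 mul0r.
have m0 : 0 < cmod z by rewrite cmod_gt0.
set c := Re z / cmod z; set s := Im z / cmod z.
have cs : c ^+ 2 + s ^+ 2 = 1.
  rewrite /c /s !expr_div_n -mulrDl -cmod_sqr mulfV // expf_neq0 // gt_eqF //.
have c1 : -1 <= c <= 1 by move: (sqr_ge0 s) => ?; apply/andP; split; nra.
have zE t : cos t = c -> sin t = s -> z = cpolar (cmod z) t.
  by move=> ct st; apply: complex_ext => /=; rewrite ?ct ?st /c /s mulrC divfK // gt_eqF.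
have sa : sin (acos c) = Num.sqrt (1 - c ^+ 2) by apply: sin_acos.
have /andP[a0 api] : 0 <= acos c <= pi by rewrite acos_ge0 // acos_lepi.
have s2 : 1 - c ^+ 2 = s ^+ 2 by lra.
rewrite s2 sqrtr_sqr in sa.
have [s0|s0] := leP 0 s.
  exists (acos c); first by rewrite a0; have := pi_ge0 R; lra.
  by apply: zE; rewrite ?acosK // sa ger0_norm.
exists (2 * pi - acos c); first by apply/andP; split; lra.
have E2 : 2 * pi - acos c = - acos c + pi *+ 2 by rewrite addrC [2 * _]mulrC mulr_natr.
apply: zE; rewrite E2 ?cosD2pi ?sinD2pi ?cosN ?sinN ?acosK //.
by rewrite sa ltr0_norm // opprK.
Qed.

Lemma analytic_bounded f (rho : R) : analytic (f : cplane R -> cplane R) -> rho < 1 ->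
  exists2 B : R, 0 < B & forall z, cmod z <= rho -> cmod (f z) <= B.
Proof.
move=> fa rho1.
have cf (p : R * R) : 0 <= p.1 <= rho ->
    {for cpolar p.1 p.2, continuous (f : cplane R -> cplane R)}.
  move=> /andP[p0 p1]; apply: cdiff_continuous (analytic_cdiff fa _).
  by apply/disc_polar => //; exact: le_lt_trans p1 rho1.
have [|M1 M10 H1] := @cts_box_bounded R (fun p => Re (f (cpolar p.1 p.2))) 0 rho 0 (2 * pi).
  by case=> r t p1 p2; apply: cts2_Re; exact: (cf (r, t)).
have [|M2 M20 H2] := @cts_box_bounded R (fun p => Im (f (cpolar p.1 p.2))) 0 rho 0 (2 * pi).
  by case=> r t p1 p2; apply: cts2_Im; exact: (cf (r, t)).
exists (M1 + M2) => [|z zr]; first exact: addr_gt0.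
have [t tp ->] := polar_form z.
apply: le_trans (cmod_le_ReIm _) _; apply: lerD.
  by apply: (H1 (cmod z, t)); rewrite //= cmod_ge0.
by apply: (H2 (cmod z, t)); rewrite //= cmod_ge0.
Qed.

Lemma ereal_sup_bounded (A : set (\bar R)) :
  (ereal_sup A < +oo)%E <-> exists2 M : R, 0 <= M & forall x, A x -> (x <= M%:E)%E.
Proof.
split=> [|[M M0 H]]; last first.
  by apply: le_lt_trans (ltry M); apply: ge_ereal_sup.
case E : (ereal_sup A) => [r||] // _.
  exists (Num.max 0 r) => [|x Ax]; first by rewrite le_max lexx.
  apply: le_trans (ereal_sup_ubound Ax) _.
  by rewrite E lee_fin le_max lexx orbT.
exists 0 => // x Ax; apply: le_trans (ereal_sup_ubound Ax) _.
by rewrite E leNye.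
Qed.

(** An iterated integral rather than an area integral: all estimates below
    bound the inner integral at a fixed angle or exchange the order by
    Tonelli. *)
Definition polar_box I (h : R -> R -> R) : \bar R :=
  (\int[mu]_(t in `[I.1, I.2]) \int[mu]_(r in `[arc_radius I, 1%R[) (h r t)%:E)%E.

Local Open Scope ereal_scope.

Lemma polar_box_ge0 I (h : R -> R -> R) :
  (forall r t : R, (arc_radius I <= r < 1)%R -> (I.1 <= t <= I.2)%R -> (0 <= h r t)%R) ->
  0 <= polar_box I h.
Proof.
move=> h0; apply: integral_ge0 => t /=; rewrite in_itv /= => tb.
by apply: integral_ge0 => r /=; rewrite in_itv /= => rb; rewrite lee_fin h0.
Qed.

Lemma le_polar_box I (h k : R -> R -> R) :
  (forall r t : R, (arc_radius I <= r < 1)%R -> (I.1 <= t <= I.2)%R -> (0 <= h r t <= k r t)%R) ->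
  polar_box I h <= polar_box I k.
Proof.
move=> hk; apply: ge0_le_integral_same => t /=; rewrite in_itv /= => tb.
apply/andP; split.
  apply: integral_ge0 => r /=; rewrite in_itv /= => rb.
  by rewrite lee_fin; case/andP: (hk r t rb tb).
apply: ge0_le_integral_same => r /=; rewrite in_itv /= => rb.
by rewrite !lee_fin hk.
Qed.

(** A radial integrand contributes the length of the arc as a factor. *)
Lemma polar_box_radial I (v : R -> R) (V : R) : is_arc I ->
  \int[mu]_(r in `[arc_radius I, 1%R[) (v r)%:E = V%:E ->
  polar_box I (fun r _ => v r) = (V * arc_length I)%:E.
Proof.
move=> /andP[I12 _] E; rewrite /polar_box; under eq_integral do rewrite E.
by rewrite integral_itv_cst ?ltW.
Qed.

Lemma area_le_add (E : set (cplane R)) F G H : measurable (@of_plane R @^-1` E) -> E `<=` @disc R ->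
  measurable_fun (@plane_disc R) (fun p => G (of_plane p)) ->
  measurable_fun (@plane_disc R) (fun p => H (of_plane p)) ->
  (forall z, disc z -> (0 <= G z)%R) -> (forall z, disc z -> (0 <= H z)%R) ->
  (forall z, E z -> (0 <= F z <= G z + H z)%R) ->
  area_integral E F <= area_integral E G + area_integral E H.
Proof.
move=> mE Ed mG mH G0 H0 FGH; rewrite /area_integral.
have pi0 : 0 <= (pi^-1 : R)%:E by rewrite lee_fin invr_ge0 pi_ge0.
have mr K : measurable_fun (@plane_disc R) (fun p => K (of_plane p)) ->
    measurable_fun (@of_plane R @^-1` E) (fun p => (K (of_plane p) : R)%:E).
  move=> mK; apply/measurable_EFinP; apply: measurable_funS mK => [|p]; last exact: Ed.
  exact: measurable_plane_disc.
have pos K : (forall z, disc z -> (0 <= K z)%R) ->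
    forall p, (@of_plane R @^-1` E) p -> 0 <= (K (of_plane p) : R)%:E.
  by move=> K0 p Ep; rewrite lee_fin; apply: K0; exact: Ed.
rewrite -ge0_muleDr; first last.
- by apply: integral_ge0; exact: pos.
- by apply: integral_ge0; exact: pos.
rewrite -(ge0_integralD plane mE (pos _ G0) (mr _ mG) (pos _ H0) (mr _ mH)).
apply: lee_wpmul2l => //; apply: ge0_le_integral_same => p Ep.
by rewrite -EFinD !lee_fin FGH.
Qed.

Lemma area_polar_box I F : is_arc I ->
  measurable_fun (@plane_disc R) (fun p => F (of_plane p)) ->
  (forall z, disc z -> (0 <= F z)%R) ->
  area_integral (carleson_square I) F = (pi^-1)%:E * polar_box I (fun r t => F (cpolar r t) * r)%R.
Proof. exact: area_carleson. Qed.

End PolarBoxes.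

Section CarlesonNormalForms.
Variable R : realType.
Local Notation C := R[i].
Notation mu := (@lebesgue_measure R).
Notation plane := (@lebesgue_measure R \x @lebesgue_measure R)%E.
Variable omega : cplane R -> R.
Hypothesis omega_crw : continuous_radial_weight omega.
Local Notation w := (profile omega).
Local Notation W := (tail omega).
Local Notation S := (star_profile omega).
Implicit Types (I : R * R).

Lemma measurable_cmod_sqr f : analytic (f : cplane R -> cplane R) ->
  measurable_fun (@plane_disc R) (fun p => cmod (f (of_plane p)) ^+ 2).
Proof.
move=> fa; apply: cts_measurable_plane; first exact: open_plane_disc.
move=> p dp; apply: cts_plane_cmod_sqr; exact: cdiff_continuous (analytic_cdiff fa dp).
Qed.

Lemma measurable_cderiv_star g : analytic (g : cplane R -> cplane R) ->
  measurable_fun (@plane_disc R)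
    (fun p => (cmod (cderiv (g : cplane R -> cplane R) (of_plane p)) ^+ 2 * star omega (of_plane p))%R).
Proof.
move=> ga; apply: measurable_funM; last exact: measurable_star.
by apply: measurable_cmod_sqr; exact: analytic_cderiv.
Qed.

Lemma disc_ge0_star (z : C) : 0 <= star omega z.
Proof. by rewrite starE star_ge0 // cmod_ge0. Qed.

Lemma cderiv_star_ge0 g (z : C) :
  0 <= cmod (cderiv (g : cplane R -> cplane R) z) ^+ 2 * star omega z.
Proof. by rewrite mulr_ge0 ?disc_ge0_star // exprn_ge0 // cmod_ge0. Qed.

(** The Jacobian [r] is at most 1, and at least [1/2] on the outer half of
    the square. *)
Lemma weighted_area_carleson I : is_arc I -> exists V : R,
  [/\ weighted_area omega (carleson_square I) = (pi^-1 * (V * arc_length I))%:E,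
      V <= W (arc_radius I) & W ((1 + arc_radius I) / 2) / 2 <= V].
Proof.
move=> Ia; have r0 := arc_radius_ge0 I; have r1 := arc_radius_lt1 Ia.
set rho := arc_radius I in r0 r1 *.
have mw r : 0 <= r -> measurable_fun (`[r, 1[%classic : set R) w.
  move=> rr; apply: measurable_funS (measurable_profile omega_crw) => //.
  by apply: subset_itvr; rewrite bnd_simp.
have w0 s : 0 <= s < 1 -> 0 < w s by exact: profile_gt0.
pose V := (\int[mu]_(r in `[rho, 1%R[) (w r * r)%:E)%E.
have up : (V <= (W rho)%:E)%E.
  rewrite -tail_EFin //; apply: ge0_le_integral_same => r /=; rewrite in_itv /= => /andP[rr rr1].
  have rr0 := le_trans r0 rr; have wr : 0 < w r by apply: w0; rewrite rr0.
  by rewrite !lee_fin mulr_ge0 ?(ltW wr) //= ler_piMr // ltW.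
have V0 : (0 <= V)%E.
  apply: integral_ge0 => r /=; rewrite in_itv /= => /andP[rr rr1].
  by rewrite lee_fin mulr_ge0 ?(le_trans r0 rr) // ltW // w0 // (le_trans r0 rr).
have VE : V = (fine V)%:E.
  rewrite fineK // ge0_fin_numE //; exact: le_lt_trans up (ltry _).
exists (fine V); split.
- rewrite /weighted_area area_polar_box //; last 2 first.
  + exact: measurable_omega.
  + exact: omega_ge0.
  rewrite EFinM -(polar_box_radial Ia VE); congr (_ * _)%E.
  apply: eq_integral => t _; apply: eq_integral => r; rewrite inE /= in_itv /= => /andP[rr rr1].
  have rr0 := le_trans r0 rr.
  by rewrite profileE ?cmod_cpolar //; apply/disc_polar.
- by rewrite -lee_fin -VE.
rewrite -lee_fin -VE mulrC EFinM.
have m0 : 0 <= (1 + rho) / 2 by lra.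
rewrite -tail_EFin // -ge0_integralZl_EFin //; first last.
- by apply/measurable_EFinP; exact: mw.
- move=> s /=; rewrite in_itv /= => /andP[rs s1].
  by rewrite lee_fin ltW // w0 // (le_trans m0).
apply: ge0_le_integral_sub.
- by apply: subset_itvr; rewrite bnd_simp; lra.
- move=> s /=; rewrite in_itv /= => /andP[rs s1].
  by rewrite lee_fin mulr_ge0 ?(le_trans r0 rs) // ltW // w0 // (le_trans r0 rs).
move=> s /=; rewrite in_itv /= => /andP[rs s1].
have ws : 0 < w s by apply: w0; rewrite s1 andbT (le_trans m0).
rewrite -EFinM !lee_fin mulr_ge0 ?invr_ge0 ?(ltW ws) //= [leRHS]mulrC ler_pM2r //; lra.
Qed.

(** By doubling, the weighted area of the square over [I] is comparable to
    [|I| W (1 - |I|)], so the condition can be tested against this quantity,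
    in polar coordinates and with a real constant. *)
Lemma C1starP (D : R) g : 1 <= D -> (forall r : R, 0 <= r < 1 -> W r <= D * W ((1 + r) / 2)) ->
  C1star omega g <-> analytic (g : cplane R -> cplane R) /\
   exists2 M : R, 0 <= M & forall I, is_arc I ->
    (polar_box I (fun r t => cmod (cderiv g (cpolar r t)) ^+ 2 * S r * r)%R
       <= (M * (W (arc_radius I) * arc_length I))%:E)%E.
Proof.
move=> D1 dbl; have D0 : 0 < D by apply: lt_le_trans D1.
have pi0 := pi_gt0 R.
pose box I := polar_box I (fun r t => cmod (cderiv (g : cplane R -> cplane R) (cpolar r t)) ^+ 2 * S r * r).
have key I : analytic (g : cplane R -> cplane R) -> is_arc I -> exists V : R,
  [/\ 0 < V, V <= W (arc_radius I), W (arc_radius I) <= 2 * D * V &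
   (area_integral (carleson_square I)
       (fun z => cmod (cderiv g z) ^+ 2 * star omega z)%R / weighted_area omega (carleson_square I)
     = box I * ((V * arc_length I)^-1)%:E)%E].
  move=> ga Ia; have [V [VE V1 V2]] := weighted_area_carleson Ia.
  have r0 := arc_radius_ge0 I; have r1 := arc_radius_lt1 Ia.
  have Wm : 0 < W ((1 + arc_radius I) / 2) by apply: tail_gt0 => //; lra.
  have V0 : 0 < V by lra.
  have L0 : 0 < arc_length I by case/andP: Ia => a _; rewrite /arc_length subr_gt0.
  exists V; split => //.
    have := dbl (arc_radius I); rewrite r0 r1 => /(_ isT) /le_trans; apply.
    by rewrite [2 * D]mulrC -mulrA ler_pM2l //; lra.
  rewrite VE area_polar_box //; last 2 first.
  - exact: measurable_cderiv_star.
  - by move=> z _; exact: cderiv_star_ge0.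
  rewrite inver gt_eqF ?mulr_gt0 ?invr_gt0 // invfM invrK EFinM.
  rewrite (_ : polar_box I _ = box I); last first.
    apply: eq_integral => t _; apply: eq_integral => r; rewrite inE /= in_itv /= => /andP[rr rr1].
    by rewrite starE cmod_cpolar // (le_trans r0).
  by move: (box I) => X; rewrite muleACA -EFinM mulVf ?gt_eqF // mul1e.
split=> [[ga /ereal_sup_bounded[M M0 H]]|[ga [M M0 H]]].
  split => //; exists M => // I Ia; have [V [V0 V1 V2 E]] := key I ga Ia.
  have L0 : 0 < arc_length I by case/andP: Ia => a _; rewrite /arc_length subr_gt0.
  have := H _ (ex_intro2 _ _ I Ia erefl); rewrite E lee_pdivrMr ?mulr_gt0 // => /le_trans; apply.
  by rewrite -EFinM lee_fin ler_wpM2l // ler_pM2r.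
split => //; apply/ereal_sup_bounded; exists (M * (2 * D)).
  by rewrite !mulr_ge0 // ltW.
move=> _ [I Ia <-]; have [V [V0 V1 V2 E]] := key I ga Ia.
have L0 : 0 < arc_length I by case/andP: Ia => a _; rewrite /arc_length subr_gt0.
rewrite E lee_pdivrMr ?mulr_gt0 //; apply: le_trans (H I Ia) _.
by rewrite -EFinM lee_fin -mulrA ler_wpM2l // mulrA ler_pM2r.
Qed.

(** The condition on each arc separately, with a real constant; the
    normalisation of the area measure is absorbed in it. *)
Lemma BMOAP g : @BMOA R g <-> analytic (g : cplane R -> cplane R) /\
   exists2 M : R, 0 <= M & forall I, is_arc I ->
    (polar_box I (fun r t => cmod (cderiv g (cpolar r t)) ^+ 2 * (1 - r ^+ 2) * r)%R
       <= (M * arc_length I)%:E)%E.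
Proof.
have pi0 := pi_gt0 R.
have key I : analytic (g : cplane R -> cplane R) -> is_arc I ->
   (((arc_length I)^-1)%:E * area_integral (carleson_square I)
       (fun z => cmod (cderiv g z) ^+ 2 * (1 - cmod z ^+ 2))%R
     = polar_box I (fun r t => cmod (cderiv g (cpolar r t)) ^+ 2 * (1 - r ^+ 2) * r)%R
       * ((pi * arc_length I)^-1)%:E)%E.
  move=> ga Ia; have r0 := arc_radius_ge0 I.
  rewrite area_polar_box //; first last.
  - move=> z zd; rewrite mulr_ge0 ?exprn_ge0 ?cmod_ge0 // subr_ge0 exprn_ile1 ?cmod_ge0 //.
    exact: ltW.
  - apply: measurable_funM; first by apply: measurable_cmod_sqr; exact: analytic_cderiv.
    apply: measurable_funB => //; apply: cts_measurable_plane; first exact: open_plane_disc.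
    by move=> p _; exact: (@cts_plane_cmod_sqr R id p (fun A => id)).
  rewrite (_ : polar_box I _ = polar_box I (fun r t => cmod (cderiv g (cpolar r t)) ^+ 2 * (1 - r ^+ 2) * r)%R).
    by move: (polar_box I _) => X; rewrite muleA -EFinM -invfM [(pi * _)%R]mulrC muleC.
  apply: eq_integral => t _; apply: eq_integral => r; rewrite inE => /andP[rr rr1].
  by rewrite cmod_cpolar // (le_trans r0).
split=> [[ga /ereal_sup_bounded[M M0 H]]|[ga [M M0 H]]].
  split => //; exists (M * pi) => [|I Ia]; first by rewrite mulr_ge0 // ltW.
  have L0 : 0 < arc_length I by case/andP: Ia => a _; rewrite /arc_length subr_gt0.
  have := H _ (ex_intro2 _ _ I Ia erefl); rewrite key // lee_pdivrMr ?mulr_gt0 //.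
  by rewrite -EFinM mulrA.
split => //; apply/ereal_sup_bounded; exists (M / pi).
  by rewrite divr_ge0 // ltW.
move=> _ [I Ia <-].
have L0 : 0 < arc_length I by case/andP: Ia => a _; rewrite /arc_length subr_gt0.
rewrite key // lee_pdivrMr ?mulr_gt0 //; apply: le_trans (H I Ia) _.
by rewrite -EFinM lee_fin mulrA divfK ?gt_eqF.
Qed.

End CarlesonNormalForms.

(** * BMOA, the Carleson class and the Bloch space *)

Section CarlesonInclusions.
Variable R : realType.
Local Notation C := R[i].
Notation mu := (@lebesgue_measure R).
Notation plane := (@lebesgue_measure R \x @lebesgue_measure R)%E.

Lemma atan_norm_le (x : R) : `|atan x| <= `|x|.
Proof.
wlog x0 : x / 0 <= x => [H|].
  have [x0|/ltW x0] := leP 0 x; first exact: H.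
  by rewrite -normrN -atanN -[leRHS]normrN; apply: H; rewrite oppr_ge0.
have [|c _] := MVT_segment x0 (fun y _ => is_derive1_atan y).
  by apply: continuous_subspaceT => y; exact: (is_derive_cts (is_derive1_atan y)).
rewrite atan0 !subr0 => ->; rewrite normrM ler_piMl //.
have h : 0 < 1 + c ^+ 2 by rewrite ltr_pwDl // sqr_ge0.
by rewrite ger0_norm ?invr_ge0 ?(ltW h) // invf_le1 // lerDl sqr_ge0.
Qed.

Lemma cisD (s t : R) : cis (s + t) = cis s * cis t :> C.
Proof. by apply: complex_ext; rewrite ?(cReM, cImM) /= ?cosD ?sinD //; ring. Qed.

(** A point close to [rho e^(i theta)] has an argument close to [theta]:
    rotate to the positive axis and use [|atan x| <= |x|]. *)
Lemma polar_near (rho theta eta : R) (z : C) : 0 <= eta -> eta < rho ->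
  cmod (z - cpolar rho theta) <= eta ->
  exists2 t : R, `|t - theta| <= eta / (rho - eta) & z = cpolar (cmod z) t.
Proof.
move=> e0 er zr; have d0 : 0 < rho - eta by rewrite subr_gt0.
pose q := z * cis (- theta).
have zq : z = q * cis theta.
  by rewrite /q -mulrA -cisD addNr /cis cos0 sin0 mulr1.
have cq : cmod z = cmod q by rewrite /q cmodM cmod_cis mulr1.
clearbody q.
have qh : cmod (q - rho%:C%C) <= eta.
  apply: le_trans zr; rewrite [in leRHS]zq cpolarE -mulrBl cmodM cmod_cis mulr1.
  exact: lexx.
have Req : rho - eta <= Re q.
  have := le_trans (norm_Re_cmod _) qh; rewrite cReB /= ler_norml; lra.
have Imq : `|Im q| <= eta.
  by have := le_trans (norm_Im_cmod _) qh; rewrite cImB /= subr0.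
have u0 : 0 < Re q := lt_le_trans d0 Req.
pose x := Im q / Re q.
exists (theta + atan x).
  rewrite [theta + _]addrC addrK; apply: le_trans (atan_norm_le _) _.
  rewrite /x normrM normfV (gtr0_norm u0); apply: ler_pM => //.
    by rewrite invr_ge0 ltW.
  by rewrite lef_pV2 ?posrE.
have qc : q = (cmod z)%:C%C * cis (atan x).
  have h : 0 < 1 + x ^+ 2 by rewrite ltr_pwDl // sqr_ge0.
  have sx : Num.sqrt (1 + x ^+ 2) != 0 by rewrite gt_eqF // sqrtr_gt0.
  have cz : cmod z = Re q * Num.sqrt (1 + x ^+ 2).
    rewrite cq; apply/eqP; rewrite -(@eqrXn2 _ 2) ?cmod_ge0 ?mulr_ge0 ?sqrtr_ge0 ?(ltW u0) //.
    rewrite cmod_sqr exprMn sqr_sqrtr ?(ltW h) // /x; apply/eqP; field.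
    by rewrite gt_eqF.
  have ca := cos_atan x.
  have sa : sin (atan x) = x * cos (atan x).
    by rewrite -[X in X * _](atanK x) /tan divfK // ca invr_neq0.
  apply: complex_ext; rewrite ?(cReM, cImM) /= ?mul0r ?subr0 ?addr0 cz ?sa ca.
    by rewrite mulfK.
  have -> : Im q = Re q * x by rewrite /x mulrC divfK // gt_eqF.
  by move: (Num.sqrt _) sx => v v0; field.
by rewrite cpolarE addrC cisD mulrA -qc.
Qed.

Variable omega : cplane R -> R.
Local Notation w := (profile omega).
Local Notation W := (tail omega).
Local Notation S := (star_profile omega).
Hypothesis omega_crw : continuous_radial_weight omega.
Variable D : R.
Hypothesis D1 : 1 <= D.
Hypothesis dbl : forall r : R, 0 <= r < 1 -> W r <= D * W ((1 + r) / 2).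
Implicit Types (I : R * R).

Lemma star_le0 (r : R) : 0 <= r < 1 -> r * S r <= (1 - r) * W r.
Proof.
move=> /andP[]; rewrite le_eqVlt => /predU1P[<- _|]; last exact: star_le.
by rewrite mul0r subr0 mul1r; exact: tail_ge0.
Qed.

Lemma polar_box_le_add I (F G H : C -> R) : is_arc I ->
  measurable_fun (@plane_disc R) (fun p => F (of_plane p)) ->
  measurable_fun (@plane_disc R) (fun p => G (of_plane p)) ->
  measurable_fun (@plane_disc R) (fun p => H (of_plane p)) ->
  (forall z, disc z -> 0 <= F z) -> (forall z, disc z -> 0 <= G z) ->
  (forall z, disc z -> 0 <= H z) ->
  (forall z, carleson_square I z -> F z <= G z + H z) ->
  (polar_box I (fun r t => F (cpolar r t) * r)%R <=
   polar_box I (fun r t => G (cpolar r t) * r)%R + polar_box I (fun r t => H (cpolar r t) * r)%R)%E.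
Proof.
move=> Ia mF mG mH F0 G0 H0 FGH.
have Sd := @carleson_square_disc R I.
have := area_le_add (measurable_carleson_square I) Sd mG mH G0 H0
  (F := F) (fun z Sz => introT andP (conj (F0 z (Sd z Sz)) (FGH z Sz))).
rewrite !area_polar_box // -ge0_muleDr.
- by rewrite lee_pmul2l // ?lte_fin ?invr_gt0 ?pi_gt0.
- apply: polar_box_ge0 => r t /andP[r0 r1] _; have r00 := le_trans (arc_radius_ge0 I) r0.
  by rewrite mulr_ge0 // G0 //; apply/disc_polar.
- apply: polar_box_ge0 => r t /andP[r0 r1] _; have r00 := le_trans (arc_radius_ge0 I) r0.
  by rewrite mulr_ge0 // H0 //; apply/disc_polar.
Qed.

Lemma polar_box_scale I (F : C -> R) (k : R) : is_arc I -> 0 <= k ->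
  measurable_fun (@plane_disc R) (fun p => F (of_plane p)) -> (forall z, disc z -> 0 <= F z) ->
  (polar_box I (fun r t => k * F (cpolar r t) * r)%R =
   k%:E * polar_box I (fun r t => F (cpolar r t) * r)%R)%E.
Proof.
move=> Ia k0 mF F0; have pi0 : (0 < (pi^-1 : R)%:E)%E by rewrite lte_fin invr_gt0 pi_gt0.
have Sd := @carleson_square_disc R I.
have mk : measurable_fun (@plane_disc R) (fun p => k * F (of_plane p)) by exact: measurable_funM.
have kF0 z : disc z -> 0 <= k * F z by move=> /F0; exact: mulr_ge0.
have E : (area_integral (carleson_square I) (fun z => k * F z)%R =
    k%:E * area_integral (carleson_square I) F)%E.
  rewrite /area_integral muleCA; congr (_ * _)%E.
  rewrite -ge0_integralZl_EFin //.
  - exact: measurable_carleson_square.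
  - by move=> p Sp; rewrite lee_fin; apply: F0; exact: Sd.
  - apply/measurable_EFinP; apply: measurable_funS mF => [|p]; last exact: Sd.
    exact: measurable_plane_disc.
move: E; rewrite !area_polar_box // muleCA.
move=> /(congr1 (fun x => pi%:E * x)%E).
by rewrite !muleA -!EFinM mulfV ?gt_eqF ?pi_gt0 // !mul1e mul1r.
Qed.

Lemma polar_box_cst I (k : R) : is_arc I -> 0 <= k ->
  (polar_box I (fun _ _ => k) <= (k * arc_length I)%:E)%E.
Proof.
move=> Ia k0; have r0 := arc_radius_ge0 I; have r1 := arc_radius_lt1 Ia.
rewrite (@polar_box_radial _ _ _ (k * (1 - arc_radius I))) //; last first.
  by rewrite integral_itv_cst // ltW.
rewrite lee_fin -mulrA ler_wpM2l // ler_piMl //; last lra.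
by case/andP: Ia => a _; rewrite /arc_length subr_ge0 ltW.
Qed.

(** As [r S <= (1 - r) W] and the tail decreases, [r S <= (1 - r) W (1 -
    |I|)] on the square over [I], and the tail comes out of the integral.
    Near the origin, where a factor [r] is missing, the derivative is
    bounded. *)
Lemma BMOA_C1star : @BMOA R `<=` C1star omega.
Proof.
move=> g /BMOAP[ga [M M0 HM]]; apply/(C1starP omega_crw g D1 dbl); split => //.
set g' := cderiv g in HM *.
have g'a : analytic g' by exact: analytic_cderiv.
have [|B B0 HB] := @analytic_bounded R g' 2^-1 g'a; first by lra.
exists (2 * M + B ^+ 2); first by rewrite addr_ge0 ?mulr_ge0 ?exprn_ge0 // ltW.
move=> I Ia; have r0 := arc_radius_ge0 I; have r1 := arc_radius_lt1 Ia.
set rho := arc_radius I in r0 r1 *.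
have Wr := tail_gt0 omega_crw r0 r1.
have L0 : 0 < arc_length I by case/andP: Ia => a _; rewrite /arc_length subr_gt0.
have one_sub (z : C) : disc z -> 0 <= 1 - cmod z ^+ 2.
  by move=> zd; rewrite subr_ge0 exprn_ile1 ?cmod_ge0 //; exact: ltW.
pose G0 z := cmod (g' z) ^+ 2 * (1 - cmod z ^+ 2).
have mG0 : measurable_fun (@plane_disc R) (fun p => G0 (of_plane p)).
  apply: measurable_funM; first exact: measurable_cmod_sqr.
  apply: measurable_funB => //; apply: cts_measurable_plane; first exact: open_plane_disc.
  by move=> p _; exact: (@cts_plane_cmod_sqr R id p (fun A => id)).
have G00 z : disc z -> 0 <= G0 z by move=> /one_sub; apply: mulr_ge0; rewrite exprn_ge0 // cmod_ge0.
pose F z := cmod (g' z) ^+ 2 * star omega z.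
pose G z := 2 * W rho * G0 z.
pose H z := B ^+ 2 * star omega z.
have W2 : 0 <= 2 * W rho by rewrite mulr_ge0 // ltW.
have hF : (polar_box I (fun r t => cmod (g' (cpolar r t)) ^+ 2 * S r * r)%R <=
   polar_box I (fun r t => F (cpolar r t) * r)%R)%E.
  apply: le_polar_box => r t /andP[rr rr1] _; have rr0 := le_trans r0 rr.
  rewrite /F starE cmod_cpolar // lexx andbT.
  by rewrite mulr_ge0 // mulr_ge0 ?exprn_ge0 ?cmod_ge0 ?star_ge0.
have hG : (polar_box I (fun r t => G (cpolar r t) * r)%R <= (2 * W rho * (M * arc_length I))%:E)%E.
  rewrite /G polar_box_scale // [X in (_ <= X)%E]EFinM; apply: lee_wpmul2l; first by rewrite lee_fin.
  apply: le_trans (HM I Ia); apply: le_polar_box => r t /andP[rr rr1] _; have rr0 := le_trans r0 rr.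
  rewrite /G0 cmod_cpolar // lexx andbT mulr_ge0 // mulr_ge0 ?exprn_ge0 ?cmod_ge0 //.
  by rewrite subr_ge0 exprn_ile1 // ltW.
have hH : (polar_box I (fun r t => H (cpolar r t) * r)%R <= (B ^+ 2 * W rho * arc_length I)%:E)%E.
  apply: le_trans (polar_box_cst Ia _); last by rewrite mulr_ge0 ?exprn_ge0 // ltW.
  apply: le_polar_box => r t /andP[rr rr1] _; have rr0 := le_trans r0 rr.
  rewrite /H starE cmod_cpolar // -mulrA mulr_ge0 ?exprn_ge0 ?(ltW B0) ?mulr_ge0 ?star_ge0 //=.
  rewrite ler_wpM2l ?exprn_ge0 ?(ltW B0) // mulrC; apply: le_trans (star_le0 _) _; first by rewrite rr0.
  apply: le_trans (_ : 1 * W r <= _); last by rewrite mul1r; exact: tail_mono.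
  by rewrite ler_wpM2r ?tail_ge0 //; lra.
apply: le_trans hF _; apply: le_trans (@polar_box_le_add I F G H Ia _ _ _ _ _ _ _) _.
- exact: measurable_cderiv_star.
- by apply: measurable_funM.
- by apply: measurable_funM => //; exact: measurable_star.
- by move=> z _; exact: cderiv_star_ge0.
- by move=> z /G00; exact: mulr_ge0.
- by move=> z _; rewrite mulr_ge0 ?disc_ge0_star // exprn_ge0 // ltW.
- move=> _ [r [t [/andP[rr0 rr1] rr _ ->]]].
  have rr' : rho <= r by rewrite ge_max rr0.
  have [h|h] := leP 2^-1 r.
    apply: ler_wpDr; first by rewrite mulr_ge0 ?disc_ge0_star // exprn_ge0 // ltW.
    rewrite /G /G0 mulrCA /F starE cmod_cpolar // ler_wpM2l ?exprn_ge0 ?cmod_ge0 //.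
    have rpos : 0 < r by lra.
    have h1 := star_le omega_crw rpos rr1.
    have h2 := tail_mono omega_crw r0 rr' rr1.
    have h3 := star_ge0 omega_crw rr0.
    have h4 : (1 - r) * W r <= (1 - r) * W rho by rewrite ler_wpM2l //; lra.
    have h5 : 2^-1 * S r <= r * S r by rewrite ler_wpM2r.
    have h6 : (1 - r) * W rho <= (1 - r ^+ 2) * W rho by rewrite ler_wpM2r ?(ltW Wr) //; nra.
    by lra.
  apply: ler_wpDl; first by rewrite mulr_ge0 // G00 //; apply/disc_polar.
  rewrite /F /H ler_wpM2r ?disc_ge0_star // ler_pXn2r ?nnegrE ?cmod_ge0 ?(ltW B0) //.
  by apply: HB; rewrite cmod_cpolar // ltW.
apply: le_trans (leeD hG hH) _.
by rewrite -EFinD lee_fin le_eqVlt; apply/orP; left; apply/eqP; ring.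
Qed.

Lemma le_of_sqr_le (x p k : R) : 0 <= x -> 2 <= p -> 0 <= k -> p * x ^+ 2 <= k -> x <= 1 + k.
Proof.
move=> x0 p2 k0 pk; have [x1|x1] := leP x 1; first by lra.
have : x <= x * x by rewrite ler_peMl // ltW.
have : 0 <= (p - 2) * x ^+ 2 by rewrite mulr_ge0 ?exprn_ge0 // subr_ge0.
by rewrite expr2 in pk *; lra.
Qed.

(** The star weight dominates [(1 - |z|) W], so a Carleson condition on the
    square around a hyperbolic disc of fixed radius controls the derivative
    at the centre by the sub-mean value property. *)
Lemma C1star_bloch : C1star omega `<=` @bloch R.
Proof.
move=> g /(C1starP omega_crw g D1 dbl)[ga [M M0 HM]]; split => //.
set g' := cderiv g in HM *.
have g'a : analytic g' by exact: analytic_cderiv.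
have [|B B0 HB] := @analytic_bounded R g' 2^-1 g'a; first by lra.
have D0 : 0 < D by apply: lt_le_trans D1.
have pi0 := pi_gt0 R.
pose K := 512 * D ^+ 3 * M.
have D3 : 0 < D ^+ 3 by exact: exprn_gt0.
have K0 : 0 <= K.
  apply: mulr_ge0 M0; apply: mulr_ge0 (ltW D3); exact: ler0n.
exists (B + 2 * (1 + K)) => _ [a ad <-].
have a1 : cmod a < 1 by exact: ad.
have a0 := cmod_ge0 a.
have [ah|ah] := leP (cmod a) 2^-1.
  apply: le_trans (_ : B * 1 <= _); last by lra.
  apply: ler_pM => //; first exact: cmod_ge0.
  - by rewrite subr_ge0 exprn_ile1 // ltW.
  - exact: HB.
  - by rewrite gerBl exprn_ge0.
pose d := 1 - cmod a; have d0 : 0 < d by rewrite subr_gt0.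
have [th _ aE] := polar_form a.
pose I : R * R := (th - d, th + d).
have LI : arc_length I = 2 * d by rewrite /arc_length /=; lra.
have Ia : is_arc I.
  by rewrite /is_arc /=; apply/andP; split; [|have := pi_ge2 R]; rewrite /d; lra.
have rI : arc_radius I = 1 - 2 * d.
  by rewrite /arc_radius LI; apply/max_idPr; rewrite /d; lra.
pose Q : set (R * R) := [set p | cmod ((of_plane p : C) - a) < d / 8].
have QS : Q `<=` @of_plane R @^-1` carleson_square I.
  move=> p Qp; have [|||t tt zE] := @polar_near (cmod a) th (d / 8) (of_plane p).
  - by rewrite divr_ge0 // ltW.
  - by rewrite /d; lra.
  - by rewrite -aE; exact: ltW.
  have zlo := cmod_lerB a (of_plane p); have zhi := cmod_lerB (of_plane p) a.
  have Qp' : cmod ((of_plane p : C) - a) < d / 8 by exact: Qp.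
  rewrite cmodB in zlo.
  exists (cmod (of_plane p)), t; split => //.
  - by rewrite cmod_ge0; rewrite /d in Qp' *; lra.
  - by rewrite LI; rewrite /d in Qp' *; lra.
  have : d / 8 / (cmod a - d / 8) <= d.
    rewrite ler_pdivrMr; last by rewrite /d; lra.
    have : 0 < d * (cmod a - d / 8 - 8^-1) by rewrite mulr_gt0 // /d; lra.
    by lra.
  by move=> /(le_trans tt); rewrite ler_norml /I /=; lra.
pose sigma := d / 4 * (D ^- 3 * W (1 - 2 * d)).
have d2 : d < 2^-1 by rewrite /d; lra.
have Wd : 0 < W (1 - 2 * d) by apply: tail_gt0 => //; lra.
have sigma0 : 0 < sigma by rewrite /sigma mulr_gt0 ?divr_gt0 // mulr_gt0 ?invr_gt0.
have sle p : Q p -> sigma <= star omega (of_plane p).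
  move=> Qp; have zhi := cmod_lerB (of_plane p) a; have zlo := cmod_lerB a (of_plane p).
  have Qp' : cmod ((of_plane p : C) - a) < d / 8 by exact: Qp.
  rewrite cmodB in zlo.
  have zl : cmod (of_plane p) <= 1 - 7 / 8 * d by rewrite /d in Qp' *; lra.
  have zpos : 0 < cmod (of_plane p) by rewrite /d in Qp' *; lra.
  rewrite starE; apply: le_trans (star_mono omega_crw zpos zl).
  apply: le_trans (star_ge omega_crw _ _); [|by lra|by lra].
  have dbl3 : W (1 - 2 * d) <= D ^+ 3 * W (1 - d / 4).
    have /dbl h1 : 0 <= 1 - 2 * d < 1 by apply/andP; split; lra.
    have /dbl h2 : 0 <= 1 - d < 1 by apply/andP; split; lra.
    have /dbl h3 : 0 <= 1 - d / 2 < 1 by apply/andP; split; lra.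
    rewrite (_ : (1 + (1 - 2 * d)) / 2 = 1 - d) in h1; last by lra.
    rewrite (_ : (1 + (1 - d)) / 2 = 1 - d / 2) in h2; last by lra.
    rewrite (_ : (1 + (1 - d / 2)) / 2 = 1 - d / 4) in h3; last by lra.
    apply: (le_trans h1); rewrite !exprS expr0 mulr1 -!mulrA ler_pM2l //.
    by apply: (le_trans h2); rewrite ler_pM2l.
  have W4 : D ^- 3 * W (1 - 2 * d) <= W (1 - d / 4) by rewrite ler_pdivrMl ?exprn_gt0.
  have W5 : W (1 - d / 4) <= W ((1 + (1 - 7 / 8 * d)) / 2) by apply: tail_mono => //; lra.
  have W0 : 0 <= D ^- 3 * W (1 - 2 * d) by rewrite mulr_ge0 ?invr_ge0 ?exprn_ge0 // ltW.
  by apply: ler_pM => //; lra.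
have sub : ((pi * (d / 8) ^+ 2 * cmod (g' a) ^+ 2)%:E <= (sigma^-1)%:E *
   \int[plane]_(p in @of_plane R @^-1` carleson_square I)
      (cmod (g' (of_plane p)) ^+ 2 * star omega (of_plane p))%:E)%E.
  apply: le_trans (disc_submean (f := g') _ _) _; first by rewrite divr_gt0.
    move=> z zd; exists (cderiv g' (a + z)); apply: analytic_cdiff => //.
    have za : cmod (a + z) < 1 by have := cmodD_le a z; rewrite /d in zd; lra.
    exact: za.
  rewrite -ge0_integralZl_EFin ?invr_ge0 ?(ltW sigma0) //.
  - apply: ge0_le_integral_sub => // p.
      by move=> _; rewrite -EFinM lee_fin mulr_ge0 ?invr_ge0 ?(ltW sigma0) ?cderiv_star_ge0.
    move=> Qp; rewrite -EFinM !lee_fin exprn_ge0 ?cmod_ge0 //= ler_pdivlMl // mulrC.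
    by rewrite ler_wpM2l ?exprn_ge0 ?cmod_ge0 // sle.
  - exact: measurable_carleson_square.
  - by move=> p _; rewrite lee_fin cderiv_star_ge0.
  - apply/measurable_EFinP; apply: measurable_funS (measurable_cderiv_star omega_crw ga).
      exact: measurable_plane_disc.
    by move=> p; exact: carleson_square_disc.
have area : (\int[plane]_(p in @of_plane R @^-1` carleson_square I)
      (cmod (g' (of_plane p)) ^+ 2 * star omega (of_plane p))%:E
    <= (M * (W (1 - 2 * d) * (2 * d)))%:E)%E.
  have := area_polar_box Ia (measurable_cderiv_star omega_crw ga) (fun z _ => cderiv_star_ge0 omega_crw g z).
  rewrite /area_integral => /(congr1 (fun x => pi%:E * x)%E).
  rewrite !muleA -EFinM mulfV ?gt_eqF // !mul1e => ->.
  have := HM I Ia; rewrite rI LI; apply: le_trans.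
  apply: le_polar_box => r t /andP[rr rr1] _; have rr0 := le_trans (arc_radius_ge0 I) rr.
  rewrite starE cmod_cpolar // lexx andbT.
  by rewrite mulr_ge0 // mulr_ge0 ?exprn_ge0 ?cmod_ge0 ?star_ge0.
have fin : pi * (d / 8) ^+ 2 * cmod (g' a) ^+ 2 <= sigma^-1 * (M * (W (1 - 2 * d) * (2 * d))).
  rewrite -lee_fin; apply: le_trans sub _; rewrite [X in (_ <= X)%E]EFinM.
  by apply: lee_wpmul2l area; rewrite lee_fin invr_ge0 ltW.
have {fin} fin : pi * (d * cmod (g' a)) ^+ 2 <= K.
  have -> : K = 64 * (sigma^-1 * (M * (W (1 - 2 * d) * (2 * d)))).
    by rewrite /K /sigma; field; rewrite !gt_eqF.
  by lra.
have x0 : 0 <= d * cmod (g' a) by rewrite mulr_ge0 ?cmod_ge0 // ltW.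
have xK : d * cmod (g' a) <= 1 + K := le_of_sqr_le x0 (pi_ge2 R) K0 fin.
have : cmod (g' a) * (1 - cmod a ^+ 2) <= 2 * (d * cmod (g' a)).
  have -> : 1 - cmod a ^+ 2 = d * (1 + cmod a) by rewrite /d; ring.
  have -> : 2 * (d * cmod (g' a)) = cmod (g' a) * (d * 2) by ring.
  by rewrite !ler_wpM2l ?cmod_ge0 ?(ltW d0) //; lra.
clearbody K; lra.
Qed.

(** A pointwise bound by the weight itself integrates to exactly [|I| W]. *)
Lemma C1star_of_radial_bound g (M : R) : analytic g -> 0 <= M ->
  (forall r t : R, 0 <= r < 1 -> cmod (cderiv g (cpolar r t)) ^+ 2 * S r * r <= M * w r) ->
  C1star omega g.
Proof.
move=> ga M0 HM; apply/(C1starP omega_crw g D1 dbl); split => //; exists M => //.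
move=> I Ia; have r0 := arc_radius_ge0 I; have r1 := arc_radius_lt1 Ia.
have E : (\int[mu]_(r in `[arc_radius I, 1%R[) (M * w r)%:E = (M * W (arc_radius I))%:E)%E.
  rewrite EFinM -tail_EFin // -ge0_integralZl_EFin //.
  - move=> s /=; rewrite in_itv /= => /andP[rs s1].
    by rewrite lee_fin ltW // profile_gt0 // (le_trans r0 rs).
  - apply/measurable_EFinP; apply: measurable_funS (measurable_profile omega_crw) => //.
    by apply: subset_itvr; rewrite bnd_simp.
rewrite mulrA -(polar_box_radial Ia E); apply: le_polar_box => r t /andP[rr rr1] _.
have rr0 := le_trans r0 rr; rewrite HM ?rr0 // andbT mulr_ge0 // mulr_ge0 ?star_ge0 //.
by rewrite exprn_ge0 // cmod_ge0.
Qed.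

(** For a Bloch function [r |g'|^2 S <= B^2 W / (1 - r)], and for a regular
    weight this is bounded by a multiple of the weight. *)
Lemma regular_bloch_C1star (K : R) : 0 <= K ->
  (forall r : R, 0 <= r < 1 -> W r <= K * ((1 - r) * w r)) -> @bloch R `<=` C1star omega.
Proof.
move=> K0 WK g [ga [B HB]]; apply: (@C1star_of_radial_bound g (B ^+ 2 * K)) => //.
  by rewrite mulr_ge0 // sqr_ge0.
move=> r t rb; have /andP[r0 r1] := rb.
have gp := cmod_ge0 (cderiv g (cpolar r t)).
have h1 := star_le0 rb; have h2 := WK r rb.
have w0 := profile_gt0 omega_crw rb.
have gB : cmod (cderiv g (cpolar r t)) * (1 - r) <= B.
  apply: le_trans (_ : cmod (cderiv g (cpolar r t)) * (1 - r ^+ 2) <= _).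
    by rewrite ler_wpM2l //; nra.
  apply: HB; exists (cpolar r t); first exact/disc_polar.
  by rewrite cmod_cpolar.
rewrite -mulrA; apply: le_trans (_ : cmod (cderiv g (cpolar r t)) ^+ 2 * ((1 - r) * (K * ((1 - r) * w r))) <= _).
  rewrite ler_wpM2l ?exprn_ge0 // mulrC; apply: (le_trans h1).
  by rewrite ler_wpM2l // subr_ge0 ltW.
have -> : cmod (cderiv g (cpolar r t)) ^+ 2 * ((1 - r) * (K * ((1 - r) * w r))) =
   (cmod (cderiv g (cpolar r t)) * (1 - r)) ^+ 2 * K * w r by ring.
rewrite !ler_wpM2r ?(ltW w0) // lerXn2r ?nnegrE ?mulr_ge0 ?subr_ge0 ?(ltW r1) //.
by apply: le_trans gB; rewrite mulr_ge0 ?subr_ge0 ?(ltW r1).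
Qed.

End CarlesonInclusions.

(** * Dominated complex series and powers *)

Section ComplexSeries.
Variable R : realType.
Local Notation C := R[i].

Lemma geometric_tail (u : nat -> R) (c0 x0 c x : R) n :
  0 <= x0 <= 2^-1 -> (forall k, `|u k| <= c0 * x0 ^+ k) ->
  0 <= x <= 2^-1 -> (forall k, (n <= k)%N -> `|u k| <= c * x ^+ k) ->
  `|limn (series u) - \sum_(0 <= k < n) u k| <= 2 * c * x ^+ n.
Proof.
move=> /andP[x00 x01] u0 /andP[xp x1] ux.
have cu : cvgn (series u).
  apply: normed_cvg; apply: (@series_le_cvg _ _ (geometric c0 x0)) => [k|k|k|].
  - exact: normr_ge0.
  - by apply: le_trans (u0 k); exact: normr_ge0.
  - exact: u0.
  - by apply: is_cvg_geometric_series; rewrite ger0_norm //; lra.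
have c_ge0 k : (n <= k)%N -> 0 <= c * x ^+ k by move=> /ux; apply: le_trans.
have part N : `|series u (n + N)%N - series u n| + 2 * c * x ^+ (n + N) <= 2 * c * x ^+ n.
  elim: N => [|N IH]; first by rewrite addn0 subrr normr0 add0r.
  apply: le_trans IH; rewrite addnS seriesSr.
  have h1 := ux (n + N)%N (leq_addr _ _); have h0 := c_ge0 (n + N)%N (leq_addr _ _).
  have -> : series u (n + N)%N + u (n + N)%N - series u n = series u (n + N)%N - series u n + u (n + N)%N by ring.
  have h2 := ler_normD (series u (n + N)%N - series u n) (u (n + N)%N).
  have h3 : c * x ^+ (n + N).+1 <= c * x ^+ (n + N) * 2^-1.
    by rewrite exprSr mulrA ler_wpM2l.
  by lra.
apply/ler_addgt0Pr => e e0.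
have /cvgrPdist_le/(_ e e0)[N _ HN] := cu.
have := HN (n + N)%N (leq_addl _ _) => /= hN.
have h1 := part N; have h0 := c_ge0 (n + N)%N (leq_addr _ _).
have -> : limn (series u) - \sum_(0 <= k < n) u k =
  (limn (series u) - series u (n + N)%N) + (series u (n + N)%N - series u n).
  by rewrite addrA subrK.
apply: le_trans (ler_normD _ _) _; lra.
Qed.

(** Built from the real series of real and imaginary parts; it is used only
    for terms dominated by a geometric sequence, where it is the sum. *)
Definition csum (u : nat -> C) : C :=
  (limn (series (fun k => Re (u k))) +i* limn (series (fun k => Im (u k))))%C.

Lemma Re_sum (u : nat -> C) n : Re (\sum_(0 <= k < n) u k) = \sum_(0 <= k < n) Re (u k).
Proof. by elim: n => [|n IH]; [rewrite !big_geq | rewrite !big_nat_recr //= cReD IH]. Qed.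

Lemma Im_sum (u : nat -> C) n : Im (\sum_(0 <= k < n) u k) = \sum_(0 <= k < n) Im (u k).
Proof. by elim: n => [|n IH]; [rewrite !big_geq | rewrite !big_nat_recr //= cImD IH]. Qed.

Lemma cmod_sum_le (u : nat -> C) m n : cmod (\sum_(m <= k < n) u k) <= \sum_(m <= k < n) cmod (u k).
Proof.
apply: (big_ind2 (fun (z : C) (r : R) => cmod z <= r)) => //; first by rewrite cmod0.
by move=> z r z' r' h h'; apply: le_trans (cmodD_le _ _) _; exact: lerD.
Qed.

Lemma csum_tail (u : nat -> C) (c0 x0 c x : R) n :
  0 <= x0 <= 2^-1 -> (forall k, cmod (u k) <= c0 * x0 ^+ k) ->
  0 <= x <= 2^-1 -> (forall k, (n <= k)%N -> cmod (u k) <= c * x ^+ k) ->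
  cmod (csum u - \sum_(0 <= k < n) u k) <= 4 * c * x ^+ n.
Proof.
move=> x01 u0 xp ux; apply: le_trans (cmod_le_ReIm _) _.
rewrite cReB cImB Re_sum Im_sum /csum /=.
have hr : `|limn (series (fun k => Re (u k))) - \sum_(0 <= k < n) Re (u k)| <= 2 * c * x ^+ n.
  apply: (@geometric_tail _ c0 x0) => // k.
    by apply: le_trans (u0 k); exact: norm_Re_cmod.
  by move=> /ux; apply: le_trans; exact: norm_Re_cmod.
have hi : `|limn (series (fun k => Im (u k))) - \sum_(0 <= k < n) Im (u k)| <= 2 * c * x ^+ n.
  apply: (@geometric_tail _ c0 x0) => // k.
    by apply: le_trans (u0 k); exact: norm_Im_cmod.
  by move=> /ux; apply: le_trans; exact: norm_Im_cmod.
lra.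
Qed.

Lemma geometric_small (c x e : R) : 0 <= x <= 2^-1 -> 0 < e -> exists n, c * x ^+ n <= e.
Proof.
move=> /andP[x0 x1] e0.
have x1' : `|x| < 1 by rewrite ger0_norm //; lra.
have /cvgrPdist_le/(_ e e0)[N _ /(_ N (leqnn N))] := cvg_geometric c x1'.
by rewrite /= sub0r normrN => h; exists N; apply: le_trans (ler_norm _) h.
Qed.

Lemma sum_geometric_le (x : R) n : 0 <= x <= 2^-1 -> \sum_(0 <= k < n) x ^+ k <= 2.
Proof.
move=> /andP[x0 x1].
have : \sum_(0 <= k < n) x ^+ k + 2 * x ^+ n <= 2.
  elim: n => [|n IH]; first by rewrite big_geq // expr0; lra.
  rewrite big_nat_recr //=; apply: le_trans IH.
  have : x ^+ n.+1 <= x ^+ n * 2^-1 by rewrite exprSr ler_wpM2l // exprn_ge0.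
  by lra.
have := exprn_ge0 n x0; lra.
Qed.

Lemma sub1_ge_expR (y : R) : 0 <= y <= 2^-1 -> expR (- (2 * y)) <= 1 - y.
Proof.
move=> /andP[y0 y1]; rewrite expRN -[leRHS]invrK lef_pV2 ?posrE ?expR_gt0 ?invr_gt0; try lra.
apply: le_trans (expR_ge1Dx (2 * y)); rewrite -[leLHS]mul1r ler_pdivrMr; last lra.
have h : 0 <= y * (1 - 2 * y) by apply: mulr_ge0 => //; lra.
lra.
Qed.

Lemma expR_natM (n : nat) (x : R) : expR (n%:R * x) = expR x ^+ n.
Proof. exact: expRM_natl. Qed.

(** From [r^n <= e^(-n (1 - r))] and the decay of the exponential against a
    cubic power. *)
Lemma pow_decay : exists2 c : R, 0 < c & forall (r : R) (n : nat), 0 <= r <= 1 -> (0 < n)%N ->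
  r ^+ n.-1 * (n%:R * (1 - r)) ^+ 3 <= c.
Proof.
have D (r : R) (n : nat) : 0 <= r <= 1 -> r ^+ n * (n%:R * (1 - r)) ^+ 3 <= 27.
  move=> /andP[r0 r1]; set y := n%:R * (1 - r).
  have y0 : 0 <= y by rewrite mulr_ge0 // subr_ge0.
  have rn : r ^+ n <= expR (- y).
    rewrite /y -mulrN expR_natM lerXn2r ?nnegrE ?expR_ge0 //.
    by have := expR_ge1Dx (- (1 - r)); lra.
  have y3 : y ^+ 3 <= 27 * expR y.
    have h : y <= 3 * expR (y / 3) by have := expR_ge1Dx (y / 3); lra.
    have -> : expR y = expR (y / 3) ^+ 3 by rewrite -expR_natM; congr expR; field.
    have -> : 27 * expR (y / 3) ^+ 3 = (3 * expR (y / 3)) ^+ 3 by ring.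
    by rewrite lerXn2r ?nnegrE // mulr_ge0 ?expR_ge0.
  apply: le_trans (ler_pM _ _ rn y3) _; rewrite ?exprn_ge0 //.
  by rewrite mulrCA -expRD addNr expR0 mulr1.
exists (8 * 27) => [|r [//|[|n]] rb _ /=]; first by rewrite mulr_gt0.
  have /andP[r0 r1] := rb; rewrite expr0 !mul1r.
  have : (1 - r) ^+ 3 <= 1 by rewrite exprn_ile1 //; lra.
  by lra.
have /andP[r0 r1] := rb; have h := D r n.+1 rb.
have h2 : (n.+2%:R * (1 - r)) ^+ 3 <= 8 * (n.+1%:R * (1 - r)) ^+ 3.
  have -> : 8 * (n.+1%:R * (1 - r)) ^+ 3 = (2 * n.+1%:R * (1 - r)) ^+ 3 by ring.
  have n2 : n.+2%:R <= 2 * n.+1%:R :> R by rewrite -natrM ler_nat; lia.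
  rewrite lerXn2r ?nnegrE ?mulr_ge0 ?subr_ge0 //.
  by rewrite ler_wpM2r // subr_ge0.
have : r ^+ n.+1 * (n.+2%:R * (1 - r)) ^+ 3 <= r ^+ n.+1 * (8 * (n.+1%:R * (1 - r)) ^+ 3).
  by rewrite ler_wpM2l // exprn_ge0.
by lra.
Qed.

(** The remainder of order [n + 1] is [z + h] times that of order [n] plus
    one explicit term. The dependence of the constant on the degree matters,
    as the degrees in a lacunary series are unbounded. *)
Lemma monomial_taylor (z h : C) (rho : R) n : cmod z <= rho -> cmod (z + h) <= rho ->
  rho ^+ 2 * cmod ((z + h) ^+ n - z ^+ n - n%:R * z ^+ n.-1 * h) <=
  n%:R ^+ 2 * rho ^+ n * cmod h ^+ 2.
Proof.
move=> zr zhr; have r0 : 0 <= rho := le_trans (cmod_ge0 _) zr.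
case: n => [|n]; first by rewrite !expr0 subrr !mul0r subrr cmod0 mulr0 expr2 !mul0r.
elim: n => [|n IH] /=.
  have -> : (z + h) ^+ 1 - z ^+ 1 - 1%:R * z ^+ 0 * h = 0 :> C by rewrite !expr1 expr0; ring.
  by rewrite cmod0 mulr0 !mulr_ge0 ?exprn_ge0 ?cmod_ge0.
pose E := (z + h) ^+ n.+1 - z ^+ n.+1 - n.+1%:R * z ^+ n * h.
have -> : (z + h) ^+ n.+2 - z ^+ n.+2 - n.+2%:R * z ^+ n.+1 * h =
    (z + h) * E + n.+1%:R * z ^+ n * h ^+ 2.
  by rewrite /E !exprS -[n.+2]addn1 natrD; ring.
move: IH; rewrite -/E => IH.
have e1 : cmod ((z + h) * E + n.+1%:R * z ^+ n * h ^+ 2) <=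
    rho * cmod E + n.+1%:R * rho ^+ n * cmod h ^+ 2.
  apply: le_trans (cmodD_le _ _) _; rewrite !cmodM !cmodX; apply: lerD.
    by rewrite ler_wpM2r ?cmod_ge0.
  rewrite ler_wpM2r ?mulr_ge0 ?cmod_ge0 //.
  have -> : n.+1%:R = (n.+1%:R : R)%:C%C :> C by rewrite rmorph_nat.
  rewrite cmod_real ger0_norm // ler_wpM2l //.
  by rewrite lerXn2r ?nnegrE ?cmod_ge0.
apply: le_trans (_ : rho ^+ 2 * (rho * cmod E + n.+1%:R * rho ^+ n * cmod h ^+ 2) <= _).
  by rewrite ler_wpM2l // exprn_ge0.
have -> : rho ^+ 2 * (rho * cmod E + n.+1%:R * rho ^+ n * cmod h ^+ 2) =
  rho * (rho ^+ 2 * cmod E) + n.+1%:R * rho ^+ n.+2 * cmod h ^+ 2 by rewrite !exprS; ring.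
apply: le_trans (_ : rho * (n.+1%:R ^+ 2 * rho ^+ n.+1 * cmod h ^+ 2) + n.+1%:R * rho ^+ n.+2 * cmod h ^+ 2 <= _).
  by rewrite lerD2r ler_wpM2l.
have -> : rho * (n.+1%:R ^+ 2 * rho ^+ n.+1 * cmod h ^+ 2) + n.+1%:R * rho ^+ n.+2 * cmod h ^+ 2 =
  (n.+1%:R ^+ 2 + n.+1%:R) * (rho ^+ n.+2 * cmod h ^+ 2) by rewrite [rho ^+ n.+2]exprS; ring.
rewrite -mulrA ler_wpM2r //; first by rewrite mulr_ge0 ?exprn_ge0 ?cmod_ge0.
by rewrite -!natrX -natrD ler_nat; lia.
Qed.

End ComplexSeries.

(** * Lacunary series *)

Section Lacunary.
Variable R : realType.
Local Notation C := R[i].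
Variables (dc : R) (q : nat) (a : nat -> R) (A : R).
Hypothesis dc0 : 0 < dc.
Hypothesis dcP : forall (r : R) (n : nat), 0 <= r <= 1 -> (0 < n)%N ->
  r ^+ n.-1 * (n%:R * (1 - r)) ^+ 3 <= dc.
Hypothesis q2 : (1 < q)%N.
Hypothesis aA : forall k, 0 < a k <= A.
Local Notation Q := (q%:R : R).

Definition lterm (z : C) k : C := (a k)%:C%C * z ^+ (q ^ k).
Definition dlterm (z : C) k : C := (a k * Q ^+ k)%:C%C * z ^+ (q ^ k).-1.
Definition lacunary (z : C) : C := csum (lterm z).
Definition dlacunary (z : C) : C := csum (dlterm z).

Let Q0 : 0 < Q. Proof. by rewrite ltr0n; lia. Qed.
Let Q1 k : 1 <= Q ^+ k. Proof. by rewrite exprn_ege1 // ler1n; lia. Qed.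
Let n_gt0 k : (0 < q ^ k)%N. Proof. by rewrite expn_gt0 ltnW. Qed.
Let a_gt0 k : 0 < a k. Proof. by have /andP[] := aA k. Qed.
Let A0 : 0 <= A. Proof. by have /andP[/ltW/le_trans] := aA 0%N; apply. Qed.

Let invQ2 : 0 <= Q ^- 2 <= 2^-1.
Proof.
rewrite invr_ge0 exprn_ge0 ?(ltW Q0) //= lef_pV2 ?posrE ?exprn_gt0 //.
have : 2 <= Q by rewrite ler_nat.
by have := Q1 1; rewrite expr1 expr2 => h1 h2; rewrite -[leLHS]mulr1 ler_pM.
Qed.

Lemma cmod_dlterm z k : cmod (dlterm z k) = a k * Q ^+ k * cmod z ^+ (q ^ k).-1.
Proof.
rewrite cmodM cmodX cmod_real ger0_norm //.
by rewrite mulr_ge0 ?exprn_ge0 ?(ltW Q0) // ltW.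
Qed.

Lemma pow_decay_lac (rho : R) k : 0 <= rho < 1 ->
  rho ^+ (q ^ k).-1 <= dc / (1 - rho) ^+ 3 * Q ^- k ^+ 3.
Proof.
move=> /andP[r0 r1]; have rp : 0 < 1 - rho by rewrite subr_gt0.
have nk := n_gt0 k.
have := @dcP rho (q ^ k)%N; rewrite r0 (ltW r1) => /(_ isT nk).
rewrite natrX exprMn -ler_pdivlMr ?mulr_gt0 ?exprn_gt0 // => /le_trans; apply.
by rewrite invfM exprVn mulrA mulrAC lexx.
Qed.

Lemma dlterm_le (z : C) (rho : R) k : cmod z <= rho -> rho < 1 ->
  cmod (dlterm z k) <= a k * (dc / (1 - rho) ^+ 3) * Q ^- 2 ^+ k.
Proof.
move=> zr r1; have r0 : 0 <= rho := le_trans (cmod_ge0 z) zr.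
rewrite cmod_dlterm -!mulrA ler_pM2l //.
have h : cmod z ^+ (q ^ k).-1 <= rho ^+ (q ^ k).-1 by rewrite lerXn2r ?nnegrE ?cmod_ge0.
have h2 := pow_decay_lac k (introT andP (conj r0 r1)).
apply: le_trans (ler_wpM2l (exprn_ge0 k (ltW Q0)) (le_trans h h2)) _.
have Qk : Q ^+ k != 0 by rewrite expf_neq0 // gt_eqF.
have -> : Q ^- 2 ^+ k = (Q ^+ k) ^- 2 by rewrite !exprVn -!exprM mulnC.
rewrite le_eqVlt; apply/orP; left; apply/eqP; move: Qk; set y := Q ^+ k => Qk.
by field; rewrite Qk /= gt_eqF // subr_gt0.
Qed.

Lemma lterm_le (z : C) (rho : R) k : cmod z <= rho -> rho < 1 ->
  cmod (lterm z k) <= a k * (dc / (1 - rho) ^+ 3) * Q ^- 2 ^+ k.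
Proof.
move=> zr r1; apply: le_trans (dlterm_le k zr r1).
rewrite cmod_dlterm cmodM cmodX cmod_real ger0_norm ?(ltW (a_gt0 k)) // -mulrA ler_pM2l //.
have nk := n_gt0 k.
have h : cmod z ^+ (q ^ k) <= cmod z ^+ (q ^ k).-1.
  by rewrite -[in leLHS](prednK nk) exprS ler_piMl ?exprn_ge0 ?cmod_ge0 // (le_trans zr) // ltW.
by apply: le_trans h _; rewrite ler_peMl ?exprn_ge0 ?cmod_ge0.
Qed.

Let cA (rho : R) := A * (dc / (1 - rho) ^+ 3).

Let cA_le rho k x : rho < 1 -> x <= a k * (dc / (1 - rho) ^+ 3) * Q ^- 2 ^+ k ->
  x <= cA rho * Q ^- 2 ^+ k.
Proof.
move=> r1 /le_trans; apply; have /andP[i0 _] := invQ2.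
rewrite ler_wpM2r ?exprn_ge0 // ler_wpM2r //; last by have /andP[] := aA k.
by rewrite divr_ge0 ?(ltW dc0) // exprn_ge0 // subr_ge0 ltW.
Qed.

Lemma dlacunary_tail (z : C) (rho K am : R) n : cmod z <= rho -> rho < 1 ->
  (forall k, (n <= k)%N -> a k <= K * am) ->
  cmod (dlacunary z - \sum_(0 <= k < n) dlterm z k) <=
  4 * (K * am * (dc / (1 - rho) ^+ 3)) * Q ^- 2 ^+ n.
Proof.
move=> zr r1 aK; apply: (@csum_tail _ _ (cA rho) (Q ^- 2)) => // k.
  by apply: cA_le => //; exact: dlterm_le.
move=> /aK h; apply: le_trans (dlterm_le k zr r1) _; have /andP[i0 _] := invQ2.
rewrite ler_wpM2r ?exprn_ge0 // ler_wpM2r //.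
by rewrite divr_ge0 ?(ltW dc0) // exprn_ge0 // subr_ge0 ltW.
Qed.

Lemma lacunary_taylor (z h : C) (rho : R) : 0 < rho -> rho < 1 -> cmod z <= rho ->
  cmod (z + h) <= rho ->
  cmod (lacunary (z + h) - lacunary z - dlacunary z * h) <=
  2 * (cA rho / rho ^+ 2) * cmod h ^+ 2.
Proof.
move=> r0 r1 zr zhr; apply/ler_addgt0Pr => e e0.
have h0 := cmod_ge0 h.
have [n nP] := geometric_small (4 * cA rho * (2 + cmod h)) invQ2 e0.
pose P := \sum_(0 <= k < n) lterm z k; pose Ph := \sum_(0 <= k < n) lterm (z + h) k.
pose Pd := \sum_(0 <= k < n) dlterm z k.
have t (w : C) : cmod w <= rho -> cmod (lacunary w - \sum_(0 <= k < n) lterm w k) <= 4 * cA rho * Q ^- 2 ^+ n.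
  by move=> wr; apply: (@csum_tail _ _ (cA rho) (Q ^- 2)) => // k *; apply: cA_le => //; exact: lterm_le.
have t1 := t _ zr; have t2 := t _ zhr.
have t3 : cmod (dlacunary z - Pd) <= 4 * cA rho * Q ^- 2 ^+ n.
  by apply: (@csum_tail _ _ (cA rho) (Q ^- 2)) => // k *; apply: cA_le => //; exact: dlterm_le.
have E k : cmod (lterm (z + h) k - lterm z k - dlterm z k * h) <= cA rho / rho ^+ 2 * Q^-1 ^+ k * cmod h ^+ 2.
  have -> : lterm (z + h) k - lterm z k - dlterm z k * h =
     (a k)%:C%C * ((z + h) ^+ (q ^ k) - z ^+ (q ^ k) - (q ^ k)%:R * z ^+ (q ^ k).-1 * h).
    have -> : (q ^ k)%:R = (Q ^+ k)%:C%C :> C by rewrite -natrX rmorph_nat.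
    by rewrite /lterm /dlterm rmorphM; ring.
  rewrite cmodM cmod_real ger0_norm ?(ltW (a_gt0 k)) //.
  have T := monomial_taylor (q ^ k) zr zhr.
  have nk := n_gt0 k.
  have rr : rho ^+ (q ^ k) <= dc / (1 - rho) ^+ 3 * Q ^- k ^+ 3.
    apply: le_trans (pow_decay_lac k _); last by rewrite ltW.
    by rewrite -[in leLHS](prednK nk) exprS ler_piMl ?exprn_ge0 ?(ltW r0) // ltW.
  have T2 : rho ^+ 2 * cmod ((z + h) ^+ (q ^ k) - z ^+ (q ^ k) - (q ^ k)%:R * z ^+ (q ^ k).-1 * h) <=
     dc / (1 - rho) ^+ 3 * Q^-1 ^+ k * cmod h ^+ 2.
    apply: le_trans T _; rewrite natrX ler_wpM2r ?sqr_ge0 //.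
    apply: le_trans (ler_wpM2l (sqr_ge0 _) rr) _.
    have Qk : Q ^+ k != 0 by rewrite expf_neq0 // gt_eqF.
    rewrite [Q^-1 ^+ k]exprVn; rewrite le_eqVlt; apply/orP; left; apply/eqP; move: Qk; set y := Q ^+ k => Qk.
    by field; rewrite Qk /= gt_eqF // subr_gt0.
  move: T2; rewrite mulrC -ler_pdivlMr ?exprn_gt0 // => T2.
  have /andP[_ akA] := aA k.
  apply: le_trans (ler_pM (ltW (a_gt0 k)) (cmod_ge0 _) akA T2) _.
  by rewrite /cA le_eqVlt; apply/orP; left; apply/eqP; ring.
have sumE : cmod (Ph - P - Pd * h) <= 2 * (cA rho / rho ^+ 2) * cmod h ^+ 2.
  rewrite /Ph /P /Pd mulr_suml -!sumrB; apply: le_trans (cmod_sum_le _ _ _) _.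
  apply: le_trans (ler_sum _ (fun k _ => E k)) _.
  rewrite -mulr_suml -mulr_sumr ler_wpM2r ?sqr_ge0 // mulrC.
  have iQ : 0 <= Q^-1 <= 2^-1.
    by rewrite invr_ge0 (ltW Q0) /= lef_pV2 ?posrE // ler_nat.
  rewrite ler_wpM2r ?sum_geometric_le // divr_ge0 ?exprn_ge0 ?(ltW r0) //.
  by rewrite mulr_ge0 // divr_ge0 ?(ltW dc0) // exprn_ge0 // subr_ge0 ltW.
have -> : lacunary (z + h) - lacunary z - dlacunary z * h =
   (lacunary (z + h) - Ph) - (lacunary z - P) - (dlacunary z - Pd) * h + (Ph - P - Pd * h) by ring.
apply: le_trans (cmodD_le _ _) _; rewrite addrC lerD //.
apply: le_trans nP.
apply: le_trans (cmodB_le _ _) _; rewrite cmodM.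
apply: le_trans (lerD (cmodB_le _ _) (ler_wpM2r h0 t3)) _.
rewrite -/Ph -/P in t1 t2 *.
have -> : 4 * cA rho * (2 + cmod h) * Q ^- 2 ^+ n =
  4 * cA rho * Q ^- 2 ^+ n + 4 * cA rho * Q ^- 2 ^+ n + 4 * cA rho * Q ^- 2 ^+ n * cmod h by ring.
by rewrite lerD2r; exact: lerD t2 t1.
Qed.

(** The termwise Taylor remainders are dominated by a geometric series, so
    they can be summed. *)
Lemma lacunary_cdiff (z : C) : cmod z < 1 -> cdiff_at lacunary z (dlacunary z).
Proof.
move=> z1 e e0; have z0 := cmod_ge0 z; pose rho := (1 + cmod z) / 2.
have r0 : 0 < rho by rewrite /rho; lra.
have r1 : rho < 1 by rewrite /rho; lra.
have zr : cmod z <= rho by rewrite /rho; lra.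
pose M := 2 * (cA rho / rho ^+ 2).
have M0 : 0 <= M.
  rewrite mulr_ge0 // divr_ge0 ?exprn_ge0 ?(ltW r0) //.
  by rewrite mulr_ge0 // divr_ge0 ?(ltW dc0) // exprn_ge0 // subr_ge0 ltW.
have M1 : 0 < M + 1 by rewrite ltr_wpDl.
exists (Num.min (rho - cmod z) (e / (M + 1))).
  rewrite lt_min divr_gt0 // andbT subr_gt0 /rho; lra.
move=> h; rewrite lt_min => /andP[h1 h2].
have zh : cmod (z + h) <= rho by have := cmodD_le z h; lra.
apply: le_trans (lacunary_taylor r0 r1 zr zh) _; rewrite -/M expr2 mulrA.
rewrite ler_wpM2r ?cmod_ge0 //; move: h2; rewrite ltr_pdivlMr // => h2.
have := cmod_ge0 h; lra.
Qed.

Lemma lacunary_analytic : analytic (lacunary : cplane R -> cplane R).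
Proof. by move=> z z1; have [] := cdiff_derivable (lacunary_cdiff z1). Qed.

Lemma cderiv_lacunary (z : C) : cmod z < 1 ->
  cderiv (lacunary : cplane R -> cplane R) z = dlacunary z.
Proof. by move=> z1; have [] := cdiff_derivable (lacunary_cdiff z1). Qed.

Variables (s : nat) (K : R).
Hypothesis s2 : (1 < s)%N.
Hypothesis qs : (q = s ^ 2)%N.
Hypothesis K1 : 1 <= K.
Hypothesis a_lo : forall j k, (j <= k)%N -> a j <= K * s%:R ^+ (k - j) * a k.
Hypothesis a_hi : forall j k, (j <= k)%N -> a k <= K * a j.

(** The coefficients vary by at most a factor [s] at each step while the
    exponents grow by [q = s^2], so the head is dominated by a geometric
    series of ratio about [1 / s] ending with its last term. *)
Lemma lacunary_head (z : C) k : cmod z <= 1 ->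
  s%:R * cmod (\sum_(0 <= j < k) dlterm z j) <= 2 * K * a k * Q ^+ k.
Proof.
move=> z1; have K0 : 0 <= K by apply: le_trans K1.
pose U k : R := \sum_(0 <= j < k) s%:R ^+ (k - j) * Q ^+ j.
have sQ : 2 * s%:R <= Q by rewrite qs -natrM ler_nat; nia.
have sU m : s%:R * U m <= 2 * Q ^+ m.
  elim: m => [|m IH]; first by rewrite /U big_geq // mulr0 expr0 mulr1.
  have -> : U m.+1 = s%:R * U m + s%:R * Q ^+ m.
    rewrite /U big_nat_recr //= subSnn expr1; congr (_ + _).
    rewrite mulr_sumr; apply: eq_big_nat => j /andP[_ jm].
    by rewrite mulrA -exprS subSn // ltnW.
  have h1 : s%:R * (s%:R * U m) <= s%:R * (2 * Q ^+ m) by rewrite ler_wpM2l.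
  have h2 : 2 * s%:R * Q ^+ m <= Q * Q ^+ m by rewrite ler_wpM2r // exprn_ge0 // ltW.
  have h3 : s%:R * (s%:R * Q ^+ m) = Q * Q ^+ m by rewrite qs natrX; ring.
  by rewrite exprS; lra.
have hd : cmod (\sum_(0 <= j < k) dlterm z j) <= K * a k * U k.
  apply: le_trans (cmod_sum_le _ _ _) _; rewrite /U mulr_sumr.
  rewrite !big_nat; apply: ler_sum => j /andP[_ jk].
  rewrite cmod_dlterm; apply: le_trans (_ : a j * Q ^+ j <= _).
    rewrite ler_piMr ?exprn_ile1 ?cmod_ge0 // mulr_ge0 ?exprn_ge0 ?(ltW Q0) //.
    exact: ltW.
  rewrite mulrA ler_wpM2r ?exprn_ge0 ?(ltW Q0) //.
  by rewrite mulrAC; apply: a_lo; exact: ltnW.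
have Kak : 0 <= K * a k by rewrite mulr_ge0 // ltW.
have h1 : s%:R * cmod (\sum_(0 <= j < k) dlterm z j) <= s%:R * (K * a k * U k) by rewrite ler_wpM2l.
apply: (le_trans h1).
have -> : s%:R * (K * a k * U k) = K * a k * (s%:R * U k) by ring.
have -> : 2 * K * a k * Q ^+ k = K * a k * (2 * Q ^+ k) by ring.
by rewrite ler_wpM2l.
Qed.

Lemma dlacunary_upper (z : C) m : cmod z < 1 -> Q ^- m.+1 <= 1 - cmod z ->
  cmod (dlacunary z) <= (2 * K + 1 + 4 * K * dc * Q) * (a m * Q ^+ m).
Proof.
move=> z1 zm; have K0 : 0 <= K by apply: le_trans K1.
have tl := @dlacunary_tail z (cmod z) K (a m) m.+1 (lexx _) z1 (fun k mk => a_hi (ltnW mk)).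
have hd := lacunary_head m (ltW z1).
have am := a_gt0 m.
have tl' : 4 * (K * a m * (dc / (1 - cmod z) ^+ 3)) * Q ^- 2 ^+ m.+1 <= 4 * K * dc * Q * (a m * Q ^+ m).
  have i3 : (1 - cmod z) ^- 3 <= Q ^+ m.+1 ^+ 3.
    rewrite -[leRHS]invrK lef_pV2 ?posrE ?invr_gt0 ?exprn_gt0 ?subr_gt0 //.
    by rewrite -exprVn lerXn2r ?nnegrE ?invr_ge0 ?exprn_ge0 ?subr_ge0 ?(ltW Q0) ?(ltW z1).
  have Qm : Q ^+ m.+1 != 0 by rewrite expf_neq0 // gt_eqF.
  have -> : Q ^- 2 ^+ m.+1 = (Q ^+ m.+1) ^- 2 by rewrite !exprVn -!exprM mulnC.
  have -> : 4 * K * dc * Q * (a m * Q ^+ m) = 4 * (K * a m * (dc * Q ^+ m.+1 ^+ 3)) * (Q ^+ m.+1) ^- 2.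
    have -> : 4 * K * dc * Q * (a m * Q ^+ m) = 4 * K * dc * a m * Q ^+ m.+1 by rewrite exprS; ring.
    by move: Qm; move: (Q ^+ m.+1) => y y0; field.
  rewrite ler_wpM2r ?invr_ge0 ?sqr_ge0 // ler_wpM2l // ler_wpM2l ?mulr_ge0 ?(ltW am) //.
  by rewrite ler_wpM2l // ltW.
have main : cmod (dlterm z m) <= a m * Q ^+ m.
  rewrite cmod_dlterm ler_piMr ?exprn_ile1 ?cmod_ge0 ?(ltW z1) //.
  by rewrite mulr_ge0 ?exprn_ge0 ?(ltW Q0) // ltW.
have hd' : cmod (\sum_(0 <= j < m) dlterm z j) <= 2 * K * (a m * Q ^+ m).
  apply: le_trans (_ : s%:R * cmod (\sum_(0 <= j < m) dlterm z j) <= _).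
    by rewrite ler_peMl ?cmod_ge0 // ler1n ltnW.
  by rewrite mulrA.
have := cmodD_le (dlacunary z - \sum_(0 <= k < m.+1) dlterm z k) (\sum_(0 <= k < m.+1) dlterm z k).
rewrite subrK big_nat_recr //= => h1.
have h2 := cmodD_le (\sum_(0 <= k < m) dlterm z k) (dlterm z m).
rewrite big_nat_recr //= in tl.
have -> : (2 * K + 1 + 4 * K * dc * Q) * (a m * Q ^+ m) =
  2 * K * (a m * Q ^+ m) + a m * Q ^+ m + 4 * K * dc * Q * (a m * Q ^+ m) by ring.
lra.
Qed.

Hypothesis s_large : 2 * (2 * K + 32 * K * dc) <= expR (- 2) * s%:R.

(** On the annulus where [|z|^(q^m)] is of the order of 1 while [|z|^(q^(m +
    1))] is small, a single term dominates: head and tail are smaller by a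
    factor [1 / s]. *)
Lemma dlacunary_lower (z : C) m : (0 < m)%N ->
  1 - Q ^- m <= cmod z <= 1 - Q ^- m / 2 ->
  expR (- 2) / 2 * (a m * Q ^+ m) <= cmod (dlacunary z).
Proof.
move=> m0 /andP[zlo zhi]; have K0 : 0 <= K by apply: le_trans K1.
have Qm0 : 0 < Q ^- m by rewrite invr_gt0 exprn_gt0.
have z1 : cmod z < 1 by lra.
have s0 : 0 < s%:R :> R by rewrite ltr0n ltnW.
have am := a_gt0 m.
set X := a m * Q ^+ m; have X0 : 0 < X by rewrite mulr_gt0 // exprn_gt0.
have tl := @dlacunary_tail z (cmod z) K (a m) m.+1 (lexx _) z1 (fun k mk => a_hi (ltnW mk)).
have hd := lacunary_head m (ltW z1).
have tl' : s%:R * (4 * (K * a m * (dc / (1 - cmod z) ^+ 3)) * Q ^- 2 ^+ m.+1) <= 32 * K * dc * X.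
  have i3 : (1 - cmod z) ^- 3 <= 8 * Q ^+ m ^+ 3.
    have -> : 8 * Q ^+ m ^+ 3 = (2 * Q ^+ m) ^+ 3 by rewrite exprMn -[2 ^+ 3]natrX.
    have Q20 : 0 < 2 * Q ^+ m by rewrite mulr_gt0 // exprn_gt0.
    rewrite -[leRHS]invrK lef_pV2 ?posrE ?invr_gt0 ?exprn_gt0 ?subr_gt0 //.
    rewrite -exprVn lerXn2r ?nnegrE ?invr_ge0 ?(ltW Q20) ?subr_ge0 ?(ltW z1) //.
    by rewrite invfM; lra.
  have Qm : Q ^+ m != 0 by rewrite expf_neq0 // gt_eqF.
  have Qn : Q != 0 by rewrite gt_eqF.
  have -> : Q ^- 2 ^+ m.+1 = (Q ^+ m) ^- 2 * Q ^- 2.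
    by rewrite exprSr !exprVn -!exprM [(2 * m)%N]mulnC.
  apply: le_trans (_ : s%:R * (4 * (K * a m * (dc * (8 * Q ^+ m ^+ 3))) * ((Q ^+ m) ^- 2 * Q ^- 2)) <= _).
    rewrite ler_wpM2l ?(ltW s0) // ler_wpM2r ?mulr_ge0 ?invr_ge0 ?sqr_ge0 //.
    rewrite ler_wpM2l // ler_wpM2l ?mulr_ge0 ?(ltW am) //.
    by rewrite ler_wpM2l // ltW.
  have -> : s%:R * (4 * (K * a m * (dc * (8 * Q ^+ m ^+ 3))) * ((Q ^+ m) ^- 2 * Q ^- 2)) =
     32 * K * dc * X * (s%:R / Q ^+ 2).
    by rewrite /X; move: Qm; move: (Q ^+ m) => y y0; field; rewrite ?y0 ?Qn.
  rewrite ler_piMr //.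
    by rewrite mulr_ge0 ?(ltW X0) // mulr_ge0 ?(ltW dc0) // mulr_ge0.
  rewrite ler_pdivrMr ?exprn_gt0 // mul1r -natrX ler_nat qs -expnM.
  by rewrite -[leqLHS]expn1 leq_exp2l.
have main : expR (- 2) * X <= cmod (dlterm z m).
  rewrite cmod_dlterm mulrC -/X ler_pM2l //.
  have nm : (1 < q ^ m)%N by rewrite -(expn0 q) ltn_exp2l.
  have n0 : (0 : R) < (q ^ m)%:R by rewrite ltr0n ltnW.
  apply: le_trans (_ : cmod z ^+ (q ^ m) <= _); last first.
    by rewrite -[in leLHS](prednK (ltnW nm)) exprS ler_piMl ?exprn_ge0 ?cmod_ge0 // ltW.
  have -> : - 2 = (q ^ m)%:R * (- (2 * Q ^- m)) :> R.
    by rewrite natrX; field; rewrite expf_neq0 // gt_eqF.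
  rewrite expR_natM lerXn2r ?nnegrE ?expR_ge0 ?cmod_ge0 //.
  apply: le_trans zlo; apply: sub1_ge_expR; rewrite (ltW Qm0) /=.
  by rewrite lef_pV2 ?posrE ?exprn_gt0 // -natrX ler_nat.
have h1 := cmodD_le (dlacunary z) (- (dlacunary z - \sum_(0 <= k < m.+1) dlterm z k)).
rewrite opprB addrC subrK cmodB in h1.
rewrite big_nat_recr // in h1 tl.
have h2 := cmodB_le (\sum_(0 <= k < m) dlterm z k + dlterm z m) (\sum_(0 <= k < m) dlterm z k).
rewrite addrAC subrr add0r in h2.
rewrite -mulrA -/X in hd.
rewrite -(ler_pM2l s0).
have tls := le_trans (ler_wpM2l (ltW s0) tl) tl'.
have sl : 2 * (2 * K + 32 * K * dc) * X <= expR (- 2) * s%:R * X by rewrite ler_pM2r.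
have mm : s%:R * (expR (- 2) * X) <= s%:R * cmod (dlterm z m) by rewrite ler_pM2l.
have h1s := ler_wpM2l (ltW s0) (le_trans h2 (lerD h1 (lexx _))).
rewrite !mulrDr in h1s.
move: h1s mm sl tls hd.
move: (cmod (dlterm z m)) (cmod (dlacunary z)) (cmod (dlacunary z - _)) (cmod (\sum_(_ <= _ < _) _)) (expR _).
move=> u v t1 t2 e.
have -> : s%:R * (e / 2 * X) = (e * s%:R * X) / 2 by ring.
have -> : s%:R * (e * X) = e * s%:R * X by ring.
have -> : 2 * (2 * K + 32 * K * dc) * X = 2 * (2 * K * X) + 2 * (32 * K * dc * X) by ring.
lra.
Qed.

End Lacunary.

(** * Lacunary series against a weight *)

Section LacunaryWeights.
Variable R : realType.
Local Notation C := R[i].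
Notation mu := (@lebesgue_measure R).
Variable omega : cplane R -> R.
Local Notation w := (profile omega).
Local Notation W := (tail omega).
Local Notation S := (star_profile omega).
Hypothesis omega_crw : continuous_radial_weight omega.
Variable D : R.
Hypothesis D1 : 1 <= D.
Hypothesis dbl : forall r : R, 0 <= r < 1 -> W r <= D * W ((1 + r) / 2).
Variables (dc : R) (s : nat) (a : nat -> R) (A K : R).
Hypothesis dc0 : 0 < dc.
Hypothesis dcP : forall (r : R) (n : nat), 0 <= r <= 1 -> (0 < n)%N ->
  r ^+ n.-1 * (n%:R * (1 - r)) ^+ 3 <= dc.
Hypothesis s2 : (1 < s)%N.
Hypothesis aA : forall k, 0 < a k <= A.
Hypothesis K1 : 1 <= K.
Hypothesis a_lo : forall j k, (j <= k)%N -> a j <= K * s%:R ^+ (k - j) * a k.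
Hypothesis a_hi : forall j k, (j <= k)%N -> a k <= K * a j.
Hypothesis s_large : 2 * (2 * K + 32 * K * dc) <= expR (- 2) * s%:R.

Local Notation q := (s ^ 2)%N.
Local Notation Q := ((s ^ 2)%:R : R).
Local Notation g := (lacunary (s ^ 2)%N a : cplane R -> cplane R).
Local Notation x k := (1 - Q ^- k).

Let q2 : (1 < q)%N. Proof. by rewrite -(expn0 s) ltn_exp2l. Qed.
Let Q0 : 0 < Q. Proof. by rewrite ltr0n ltnW. Qed.
Let Q2 : 2 <= Q. Proof. by rewrite ler_nat. Qed.
Let Qk0 k : 0 < Q ^- k. Proof. by rewrite invr_gt0 exprn_gt0. Qed.
Let Qk1 k : Q ^- k <= 1. Proof. by rewrite invf_le1 ?exprn_gt0 // exprn_ege1 // ler1n ltnW. Qed.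
Let QkS k : Q ^- k.+1 <= Q ^- k / 2.
Proof.
by rewrite exprSr invfM ler_pM2l // lef_pV2 ?posrE.
Qed.
Let iQ : 0 <= Q^-1 <= 2^-1. Proof. by rewrite invr_ge0 (ltW Q0) lef_pV2 ?posrE. Qed.

Let ga : analytic g. Proof. exact: (lacunary_analytic dc0 dcP q2 aA). Qed.

Lemma level_small (e : R) : 0 < e -> exists2 m, (0 < m)%N & Q ^- m <= e.
Proof.
move=> e0; have [n] := geometric_small 1 iQ e0; rewrite mul1r exprVn => h.
exists n.+1 => //; apply: le_trans h; have := QkS n; have := Qk0 n; lra.
Qed.

Lemma level_mono j k : (j <= k)%N -> Q ^- k <= Q ^- j.
Proof.
move=> jk; rewrite lef_pV2 ?posrE ?exprn_gt0 //.
by rewrite ler_weXn2l // ler1n ltnW.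
Qed.

Lemma find_level (r : R) : 0 <= r < 1 -> exists m, Q ^- m.+1 <= 1 - r <= Q ^- m.
Proof.
move=> /andP[r0 r1].
have ex : exists n, Q ^- n.+1 <= 1 - r.
  have [|n _ h] := @level_small (1 - r); first by rewrite subr_gt0.
  by exists n; apply: le_trans h; exact: level_mono.
have [m mP mmin] := ex_minnP ex; exists m; rewrite mP /=.
case: m mP mmin => [|m] _ mmin; first by rewrite expr0 invr1; lra.
by rewrite leNgt; apply/negP => /ltW/mmin; rewrite ltnn.
Qed.

Lemma lacunary_upper (z : C) m : cmod z < 1 -> Q ^- m.+1 <= 1 - cmod z ->
  cmod (cderiv g z) <= (2 * K + 1 + 4 * K * dc * Q) * (a m * Q ^+ m).
Proof.
move=> z1 zm; rewrite (cderiv_lacunary dc0 dcP q2 aA z1).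
exact: (@dlacunary_upper R dc q a A dc0 dcP q2 aA s K).
Qed.

Lemma lacunary_lower (z : C) m : (0 < m)%N -> x m <= cmod z <= 1 - Q ^- m / 2 ->
  expR (- 2) / 2 * (a m * Q ^+ m) <= cmod (cderiv g z).
Proof.
move=> m0 zm; have z1 : cmod z < 1 by have := Qk0 m; lra.
rewrite (cderiv_lacunary dc0 dcP q2 aA z1).
exact: (@dlacunary_lower R dc q a A dc0 dcP q2 aA s K).
Qed.

(** Only the annuli [1 - q^(-k) <= r <= 1 - q^(-k) / 2], where one term of
    the lacunary series dominates, are kept; they are disjoint. *)
Lemma polar_box_annuli I (F : R -> R -> R) (c : nat -> R) m N : is_arc I -> arc_radius I = x m ->
  (forall t, measurable_fun (`[0, 1[%classic : set R) (F^~ t)) ->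
  (forall r t : R, 0 <= r < 1 -> 0 <= F r t) -> (forall k, 0 <= c k) ->
  (forall k (r t : R), (m <= k)%N -> x k <= r <= 1 - Q ^- k / 2 -> c k <= F r t) ->
  (((\sum_(m <= k < m + N) c k * (Q ^- k / 2)) * arc_length I)%:E <= polar_box I F)%E.
Proof.
move=> Ia rI mF F0 c0 cF.
have x0 k : 0 <= x k by have := Qk1 k; lra.
have in01 (b : itv_bound R) (y : R) : 0 <= y -> (b <= BLeft (1 : R))%O ->
    [set` Interval (BLeft y) b] `<=` (`[0, 1[%classic : set R).
  by move=> y0 b1; apply: subset_itv => //; rewrite bnd_simp.
have inner t : ((\sum_(m <= k < m + N) c k * (Q ^- k / 2))%:E <=
    \int[mu]_(r in `[x m, 1%R[) (F r t)%:E)%E.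
  elim: N m cF {Ia rI} => [|N IH] m cF.
    rewrite addn0 big_geq //; apply: integral_ge0 => r /=; rewrite in_itv /= => /andP[r0 r1].
    by rewrite lee_fin F0 // r1 andbT (le_trans (x0 m)).
  have xx : x m <= x m.+1 by have := QkS m; have := Qk0 m; lra.
  have x1 : x m.+1 <= 1 by have := Qk0 m.+1; lra.
  have E : (`[x m, 1[%classic : set R) = (`[x m, x m.+1[%classic : set R) `|` (`[x m.+1, 1[%classic : set R).
    by rewrite -(@itv_bndbnd_setU _ _ (BLeft (x m)) (BLeft (x m.+1)) (BLeft 1)) ?bnd_simp.
  rewrite E ge0_integral_setU //=; first last.
  - rewrite disj_set2E; apply/eqP/seteqP; split => // r [] /=; rewrite !in_itv /=.
    by move=> /andP[_ tb] /andP[/le_lt_trans/(_ tb)]; rewrite ltxx.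
  - move=> r; rewrite !in_itv /= => rb; rewrite lee_fin F0 //; move: (x0 m) (x0 m.+1) => h1 h2.
    by case: rb => /andP[ra rc]; apply/andP; split; lra.
  - rewrite -E; apply/measurable_EFinP; apply: measurable_funS (mF t) => //.
    by apply: in01 => //; rewrite bnd_simp.
  rewrite big_ltn; last by rewrite addnS ltnS leq_addr.
  rewrite EFinD; apply: leeD; last first.
    rewrite addnS -addSn; apply: IH => k r u mk; apply: cF; exact: ltnW.
  have ym : x m <= 1 - Q ^- m / 2 by have := Qk0 m; lra.
  have -> : (c m * (Q ^- m / 2))%:E = (\int[mu]_(r in `[x m, (1 - Q ^- m / 2)%R[) (c m)%:E)%E.
    by rewrite integral_itv_cst //; congr EFin; congr (_ * _); field; rewrite gt_eqF // exprn_gt0.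
  apply: ge0_le_integral_sub.
  - by apply: subset_itvl; rewrite bnd_simp; have := QkS m; lra.
  - move=> r /=; rewrite in_itv /= => /andP[r0 r1].
    by rewrite lee_fin F0 // (le_trans (x0 m) r0) (lt_le_trans r1).
  move=> r /=; rewrite in_itv /= => /andP[r0 r1].
  by rewrite !lee_fin c0 cF // r0 ltW.
rewrite EFinM muleC -EFinM mulrC.
have /andP[I12 _] := Ia.
have -> : ((\sum_(m <= k < m + N) c k * (Q ^- k / 2)) * arc_length I)%:E =
    (\int[mu]_(t in `[I.1, I.2]) (\sum_(m <= k < m + N) c k * (Q ^- k / 2))%:E)%E.
  by rewrite integral_itv_cst // ltW.
apply: ge0_le_integral_same => t _; rewrite rI inner andbT lee_fin.
apply: sumr_ge0 => k _; rewrite mulr_ge0 // divr_ge0 //; exact: ltW.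
Qed.

Lemma measurable_radius (f : C -> C) (v : R -> R) t : analytic (f : cplane R -> cplane R) ->
  measurable_fun (`[0, 1[%classic : set R) v ->
  measurable_fun (`[0, 1[%classic : set R) (fun r => cmod (f (cpolar r t)) ^+ 2 * v r * r).
Proof.
move=> fa mv; apply: measurable_funM => //; apply: measurable_funM => //.
apply: (@measurable_funS _ _ _ _ (`]- 1, 1[%classic : set R)) => //.
  by move=> r /=; rewrite !in_itv /= => /andP[r0 ->]; rewrite andbT (lt_le_trans _ r0) // oppr_lt0.
apply: open_continuous_measurable_fun; first exact: itv_open.
move=> r; rewrite inE /= in_itv /= => /andP[r0 r1].
have rd : cmod (cpolar r t) < 1 by rewrite cmod_cpolar_norm ltr_norml r0.
have cf : {for cpolar r t, continuous (f : cplane R -> cplane R)}.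
  exact: cdiff_continuous (analytic_cdiff fa rd).
have -> : (fun r => cmod (f (cpolar r t)) ^+ 2) =
    (fun r => Re (f (cpolar r t)) * Re (f (cpolar r t)) + Im (f (cpolar r t)) * Im (f (cpolar r t))).
  by apply/funext => u; rewrite cmod_sqr !expr2.
have c1 := @cts_pair1 R (fun p => Re (f (cpolar p.1 p.2))) r t (cts2_Re cf).
have c2 := @cts_pair1 R (fun p => Im (f (cpolar p.1 p.2))) r t (cts2_Im cf).
exact: (continuousD (continuousM c1 c1) (continuousM c2 c2)).
Qed.

(** One step costs at most the factor [1 / (1 - Q b)], which is at most
    [e^(2 Q b)] as [Q b <= 1/2]; the factors multiply. *)
Lemma tail_chain (b : nat -> R) m N :
  (forall k, (m <= k)%N -> 0 <= b k /\ Q * b k <= 2^-1) ->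
  (forall k (u : R), (m <= k)%N -> x k <= u <= x k.+1 -> w u * (1 - u) <= b k * W u) ->
  W (x m) <= W (x (m + N)%N) * expR (2 * Q * \sum_(m <= k < m + N) b k).
Proof.
move=> bQ bW; elim: N => [|N IH]; first by rewrite addn0 big_geq // mulr0 expR0 mulr1.
rewrite addnS big_nat_recr ?leq_addr //= mulrDr expRD.
apply: (le_trans IH); rewrite [expR _ * expR _]mulrC mulrA ler_wpM2r ?expR_ge0 //.
set k := (m + N)%N; have mk : (m <= k)%N by exact: leq_addr.
have [b0 Qb] := bQ k mk.
have xk0 : 0 <= x k by have := Qk1 k; lra.
have xx : x k <= x k.+1 by have := QkS k; have := Qk0 k; lra.
have x1 : x k.+1 < 1 by have := Qk0 k.+1; lra.
have := tail_drop omega_crw b0 xk0 xx x1 (fun u => bW k u mk).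
have -> : 1 - x k.+1 = Q ^- k.+1 by ring.
have -> : x k.+1 - x k = Q ^- k.+1 * (Q - 1).
  have Qn : Q != 0 by rewrite gt_eqF.
  rewrite exprSr; move: (expf_neq0 k Qn); move: (Q ^+ k) => y y0; move: Q Qn => v v0.
  by field; rewrite ?y0 ?v0.
rewrite mulrCA [leLHS]mulrC ler_pM2l // => h.
have Wk := tail_gt0 omega_crw xk0 (le_lt_trans xx x1).
have h1 : (1 - Q * b k) * W (x k) <= W (x k.+1).
  have : 0 <= b k * W (x k) by rewrite mulr_ge0 // ltW.
  by lra.
have Qb0 : 0 <= Q * b k <= 2^-1 by rewrite Qb mulr_ge0 // ltW.
have h2 := sub1_ge_expR Qb0.
have h3 : expR (- (2 * (Q * b k))) * W (x k) <= W (x k.+1).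
  by apply: le_trans h1; rewrite ler_pM2r.
rewrite mulrA in h3; rewrite -ler_pdivrMr ?expR_gt0 // -expRN mulrC.
exact: h3.
Qed.

End LacunaryWeights.

(** * Strictness of the inclusions *)

Section StrictInclusions.
Variable R : realType.
Local Notation C := R[i].
Notation mu := (@lebesgue_measure R).
Variable omega : cplane R -> R.
Local Notation w := (profile omega).
Local Notation W := (tail omega).
Local Notation S := (star_profile omega).
Hypothesis rapid : rapidly_increasing_weight omega.

Let omega_crw : continuous_radial_weight omega. Proof. by have [] := rapid. Qed.

Lemma lacunary_ratio (K dc : R) : exists2 s : nat, (1 < s)%N &
  2 * (2 * K + 32 * K * dc) <= expR (- 2) * s%:R.
Proof.
set v := 2 * (2 * K + 32 * K * dc).
exists (Num.truncn (v / expR (- 2))).+2 => //.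
rewrite mulrC -ler_pdivrMr ?expR_gt0 //; apply: ltW.
apply: lt_trans (truncnS_gt _) _; by rewrite ltr_nat.
Qed.

(** The lacunary series with all coefficients equal to 1 is a Bloch
    function. Over a square of side [q^(-m)] its Carleson integral is at
    least of the order of the sum of [W (1 - q^(-k))], [k >= m]; for a
    rapidly increasing weight these terms decrease so slowly that the sum is
    not [O(W (1 - q^(-m)))]. *)
Lemma rapid_bloch_not_C1star : exists2 g, @bloch R g & ~ C1star omega g.
Proof.
have [KK KK1 wK] := profile_le_tail (or_introl rapid : (_ `|` @regular_weight R) omega).
have [D D1 dbl] := tail_doubling omega_crw KK1 wK.
have [dc dc0 dcP] := @pow_decay R.
have [s s2 sl] := lacunary_ratio 1 dc.
pose a (_ : nat) : R := 1.
have aA k : 0 < a k <= 1 by rewrite /a ltr01 lexx.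
have s1 n : 1 <= s%:R ^+ n :> R by rewrite exprn_ege1 // ler1n ltnW.
have a_lo j k : (j <= k)%N -> a j <= 1 * s%:R ^+ (k - j) * a k by rewrite /a mul1r mulr1.
have a_hi j k : (j <= k)%N -> a k <= 1 * a j by rewrite /a mul1r.
have q2 : (1 < s ^ 2)%N by rewrite -(expn0 s) ltn_exp2l.
set Q : R := (s ^ 2)%:R; have Q0 : 0 < Q by rewrite ltr0n ltnW.
have Q2 : 2 <= Q by rewrite ler_nat.
have Qk0 k : 0 < Q ^- k by rewrite invr_gt0 exprn_gt0.
have Qk1 k : Q ^- k <= 1 by rewrite invf_le1 ?exprn_gt0 // exprn_ege1 // ler1n ltnW.
set g : cplane R -> cplane R := lacunary (s ^ 2) a.
have ga : analytic g := lacunary_analytic dc0 dcP q2 aA.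
have up (z : C) m : cmod z < 1 -> Q ^- m.+1 <= 1 - cmod z -> _ :=
  @lacunary_upper R dc s a 1 1 dc0 dcP s2 aA (lexx 1) a_lo a_hi z m.
have lo (z : C) m : (0 < m)%N -> 1 - Q ^- m <= cmod z <= 1 - Q ^- m / 2 -> _ :=
  @lacunary_lower R dc s a 1 1 dc0 dcP s2 aA (lexx 1) a_lo a_hi sl z m.
exists g.
  split => //; set B := 2 * 1 + 1 + 4 * 1 * dc * Q.
  have B0 : 0 <= B by rewrite addr_ge0 // mulr_ge0 ?(ltW Q0) // mulr_ge0 ?(ltW dc0).
  exists (2 * B) => _ [z zd <-].
  have z1 : cmod z < 1 by exact: zd. have z0 := cmod_ge0 z.
  have [|m /andP[m1 m2]] := find_level s2 (_ : 0 <= cmod z < 1); first by rewrite z0.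
  have h := up z m z1 m1; rewrite /a mul1r -/Q -/B in h.
  have -> : 1 - cmod z ^+ 2 = (1 - cmod z) * (1 + cmod z) by ring.
  have h1 : (1 - cmod z) * (1 + cmod z) <= Q ^- m * 2 by apply: ler_pM => //; lra.
  apply: le_trans (ler_pM (cmod_ge0 _) _ h h1) _; first by rewrite mulr_ge0 //; lra.
  have Qm : Q ^+ m != 0 by rewrite expf_neq0 // gt_eqF.
  by rewrite le_eqVlt; apply/orP; left; apply/eqP; move: Qm; move: (Q ^+ m) => y y0; field.
move=> /(C1starP omega_crw g D1 dbl)[_ [M M0 HM]].
have D0 : 0 < D by apply: lt_le_trans D1.
pose e2 : R := expR (- 2) / 2; have e20 : 0 < e2 by rewrite divr_gt0 // expR_gt0.
pose kappa := e2 ^+ 2 / (D ^+ 2 * 16).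
have D20 : 0 < D ^+ 2 by rewrite exprn_gt0.
have kappa0 : 0 < kappa by rewrite divr_gt0 ?exprn_gt0 // mulr_gt0.
have [N NP] : exists N : nat, M * expR 1 / kappa < N%:R.
  by exists (Num.truncn (M * expR 1 / kappa)).+1; exact: truncnS_gt.
pose b : R := (4 * Q * N.+1%:R)^-1.
have b0 : 0 < b by rewrite invr_gt0 !mulr_gt0.
have [r0 /andP[r00 r01] Hr] := rapid_profile b^-1 rapid.
have [|m m0 mr] := @level_small R s s2 (1 - r0); first by rewrite subr_gt0.
rewrite -/Q in mr.
pose I : R * R := (0, Q ^- m).
have LI : arc_length I = Q ^- m by rewrite /arc_length /= subr0.
have Ia : is_arc I.
  by rewrite /is_arc /= Qk0 add0r; have := Qk1 m; have := pi_ge2 R; lra.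
have rI : arc_radius I = 1 - Q ^- m.
  by rewrite /arc_radius LI; apply/max_idPr; rewrite subr_ge0.
have x0 k : 0 <= 1 - Q ^- k by rewrite subr_ge0.
have x1 k : 1 - Q ^- k < 1 by have := Qk0 k; lra.
have W0 k : 0 < W (1 - Q ^- k) by apply: tail_gt0.
have DW0 k : 0 <= D ^- 2 * W (1 - Q ^- k) by rewrite mulr_ge0 ?invr_ge0 ?(ltW D20) ?(ltW (W0 k)).
pose c k := (e2 * Q ^+ k) ^+ 2 * (Q ^- k / 4 * (D ^- 2 * W (1 - Q ^- k))) * 2^-1.
have c0 k : 0 <= c k.
  by rewrite mulr_ge0 ?invr_ge0 // mulr_ge0 ?sqr_ge0 // mulr_ge0 // divr_ge0 // ltW.
have cF k (r t : R) : (m <= k)%N -> 1 - Q ^- k <= r <= 1 - Q ^- k / 2 ->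
    c k <= cmod (cderiv g (cpolar r t)) ^+ 2 * S r * r.
  move=> mk /andP[ra rb]; have k0 := leq_trans m0 mk.
  have Qk2 : Q ^- k <= 2^-1.
    apply: le_trans (level_mono _ s2 k0) _; rewrite expr1 lef_pV2 ?posrE //.
  have rp : 0 < r by have := Qk0 k; lra.
  have r1 : r < 1 by have := Qk0 k; lra.
  have hg : e2 * Q ^+ k <= cmod (cderiv g (cpolar r t)).
    have := lo (cpolar r t) k k0; rewrite cmod_cpolar ?(ltW rp) // ra rb => /(_ isT).
    by rewrite /a mul1r.
  have eQ0 : 0 <= e2 * Q ^+ k by rewrite mulr_ge0 ?exprn_ge0 // ltW.
  have hS : Q ^- k / 4 * (D ^- 2 * W (1 - Q ^- k)) <= S r.
    apply: le_trans (star_ge omega_crw rp r1).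
    have WW : D ^- 2 * W (1 - Q ^- k) <= W ((1 + r) / 2).
      rewrite ler_pdivrMl //.
      have /dbl h1 : 0 <= 1 - Q ^- k < 1 by rewrite x0 x1.
      have q0 := Qk0 k; have q1 := Qk1 k.
      have /dbl h2 : 0 <= 1 - Q ^- k / 2 < 1 by apply/andP; split; lra.
      rewrite (_ : (1 + (1 - Q ^- k)) / 2 = 1 - Q ^- k / 2) in h1; last by field; rewrite expf_neq0 // gt_eqF.
      apply: le_trans h1 _; rewrite expr2 -mulrA ler_pM2l //; apply: le_trans h2 _.
      by rewrite ler_pM2l //; apply: tail_mono => //; lra.
    by apply: ler_pM => //; have := Qk0 k; lra.
  have r2 : 2^-1 <= r by lra.
  have f1 : (e2 * Q ^+ k) ^+ 2 <= cmod (cderiv g (cpolar r t)) ^+ 2 by rewrite lerXn2r ?nnegrE ?cmod_ge0.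
  apply: ler_pM => //; first by rewrite mulr_ge0 ?sqr_ge0 // mulr_ge0 // divr_ge0 // ltW.
  by apply: ler_pM; rewrite ?sqr_ge0 // mulr_ge0 // divr_ge0 // ltW.
have low := @polar_box_annuli R s s2 I (fun r t => cmod (cderiv g (cpolar r t)) ^+ 2 * S r * r) c m N Ia rI _ _ c0 cF.
have {low} low := le_trans (low _ _) (HM I Ia).
have {low} : \sum_(m <= k < m + N) c k * (Q ^- k / 2) <= M * W (1 - Q ^- m).
  rewrite -(ler_pM2r (Qk0 m)); have := low; rewrite LI rI lee_fin mulrA; apply.
  - by move=> t; apply: measurable_radius; [exact: analytic_cderiv|exact: measurable_star_profile].
  - move=> r t /andP[ra rb]; rewrite mulr_ge0 // mulr_ge0 ?star_ge0 //.
    by rewrite exprn_ge0 // cmod_ge0.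
have each k : (m <= k < m + N)%N -> kappa * (W (1 - Q ^- m) / expR 1) <= c k * (Q ^- k / 2).
  move=> /andP[mk kN].
  have -> : c k * (Q ^- k / 2) = kappa * W (1 - Q ^- k).
    have Qk : Q ^+ k != 0 by rewrite expf_neq0 // gt_eqF.
    rewrite /c /kappa; move: (W _) => y; move: Qk; move: (Q ^+ k) => u u0.
    by field; rewrite ?u0 ?gt_eqF.
  rewrite ler_pM2l // ler_pdivrMr ?expR_gt0 //.
  have := @tail_chain R omega omega_crw s s2 (fun=> b) m (k - m).
  rewrite subnKC //; move=> /(_ _ _)-T; apply: le_trans (T _ _) _.
  - move=> j _; split; first exact: ltW.
    rewrite -/Q /b invfM invfM mulrA mulrCA mulfV ?gt_eqF // mulr1.
    have N1 : N.+1%:R^-1 <= 1 :> R by rewrite invf_le1 // ler1n.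
    by apply: le_trans (ler_wpM2l _ N1) _; rewrite ?mulr1 ?invr_ge0 // lef_pV2 ?posrE // ler_nat.
  - move=> j u mj; rewrite -/Q => /andP[ua ub].
    have mjQ : Q ^- j <= Q ^- m := level_mono _ s2 mj.
    rewrite -ler_pdivrMl //; apply: Hr.
    by apply/andP; split; [lra|exact: le_lt_trans ub (x1 _)].
  - rewrite -/Q sumr_const_nat ler_pM2l // ler_expR -[b *+ _]mulr_natr.
    have kmN : (k - m)%:R <= N.+1%:R :> R by rewrite ler_nat leq_subLR (leq_trans (ltnW kN)) // leq_add2l.
    have Eb : 2 * Q * (b * (k - m)%:R) = (k - m)%:R / N.+1%:R / 2.
      have fld (v u y : R) : v != 0 -> u != 0 -> 2 * v * ((4 * v * u)^-1 * y) = y / u / 2.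
        by move=> v0 u0; field; rewrite ?u0 ?v0.
      by apply: fld; rewrite ?gt_eqF ?pnatr_eq0.
    apply: (@le_trans _ _ (2 * Q * (b * (k - m)%:R))); first exact: lexx.
    rewrite Eb.
    have : (k - m)%:R / N.+1%:R <= 1 :> R by rewrite ler_pdivrMr ?mul1r.
    by move=> h; rewrite ler_pdivrMr // (le_trans h) // mul1r ler1n.
have : \sum_(m <= k < m + N) kappa * (W (1 - Q ^- m) / expR 1) <= \sum_(m <= k < m + N) c k * (Q ^- k / 2).
  by rewrite !big_nat; apply: ler_sum => k; exact: each.
rewrite sumr_const_nat addKn -[_ *+ N]mulr_natr => h1 h2.
have := le_trans h1 h2; rewrite leNgt => /negP; apply.
have e1 : 0 < expR 1 :> R by exact: expR_gt0.
rewrite ltr_pdivrMr // in NP.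
have -> : kappa * (W (1 - Q ^- m) / expR 1) * N%:R = N%:R * kappa * W (1 - Q ^- m) / expR 1 by ring.
by rewrite ltr_pdivlMr // mulrAC ltr_pM2r.
Qed.

Local Notation Psi r := (psi omega r / (1 - r)).

Lemma Psi_gt0 (r : R) : 0 <= r < 1 -> 0 < Psi r.
Proof.
move=> rb; have /andP[r0 r1] := rb; rewrite divr_gt0 ?subr_gt0 //.
by rewrite -[psi omega r]/((w r)^-1 * W r) mulr_gt0 ?invr_gt0 ?profile_gt0 ?tail_gt0.
Qed.

Lemma tail_Psi (r : R) : 0 <= r < 1 -> W r = Psi r * ((1 - r) * w r).
Proof.
move=> rb; have /andP[r0 r1] := rb; have w0 := profile_gt0 omega_crw rb.
by rewrite -[psi omega r]/((w r)^-1 * W r); field; rewrite !gt_eqF ?subr_gt0.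
Qed.

(** With [a k ^ 2 = 1 / Psi (1 - q^(-k))] the lacunary series satisfies
    [|g'|^2 S <= M w], so that it belongs to the Carleson class; but the sum
    of the [a k ^ 2] diverges, as otherwise the tail of the weight would not
    tend to 0. The essential monotonicity of the weight and of [Psi]
    provides the two regularity conditions on the coefficients. *)
Lemma rapid_C1star_not_BMOA :
  essentially_increasing (fun r => omega (creal r)) -> essentially_increasing (fun r => Psi r) ->
  exists2 g, C1star omega g & ~ @BMOA R g.
Proof.
move=> [K1 K10 H1] [K2 K20 H2].
have [KK KK1 wK] := profile_le_tail (or_introl rapid : (_ `|` @regular_weight R) omega).
have [D D1 dbl] := tail_doubling omega_crw KK1 wK.
pose K := Num.max 1 (Num.max K1 K2).
have Kge1 : 1 <= K by rewrite le_max lexx.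
have K0 : 0 < K by apply: lt_le_trans Kge1.
have P1 (r t : R) : 0 <= r -> r <= t -> t < 1 -> Psi r <= K * Psi t.
  move=> r0 rt t1; apply: (le_trans (H2 r t r0 rt t1)).
  have Pt : 0 < Psi t by apply: Psi_gt0; rewrite t1 (le_trans r0).
  by rewrite ler_wpM2r ?(ltW Pt) // !le_max lexx !orbT.
have P2 (r t : R) : 0 <= r -> r <= t -> t < 1 -> (1 - t) * Psi t <= K * ((1 - r) * Psi r).
  move=> r0 rt t1; have t0 := le_trans r0 rt; have r1 := le_lt_trans rt t1.
  have rb : 0 <= r < 1 by rewrite r0. have tb : 0 <= t < 1 by rewrite t0.
  rewrite ![(1 - _) * _]mulrC !divfK ?gt_eqF ?subr_gt0 //.
  rewrite -[psi omega r]/((w r)^-1 * W r) -[psi omega t]/((w t)^-1 * W t) mulrA.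
  have wr := profile_gt0 omega_crw rb; have wt := profile_gt0 omega_crw tb.
  apply: ler_pM; rewrite ?invr_ge0 ?(ltW wt) ?tail_ge0 ?tail_mono //.
  rewrite ler_pdivlMr // ler_pdivrMl // mulrC; apply: (le_trans (H1 r t r0 rt t1)).
  by rewrite ler_wpM2r ?(ltW wt) // !le_max lexx !orbT.
clearbody K.
have [dc dc0 dcP] := @pow_decay R.
have [s s2 sl] := lacunary_ratio K dc.
have q2 : (1 < s ^ 2)%N by rewrite -(expn0 s) ltn_exp2l.
set Q : R := (s ^ 2)%:R; have Q0 : 0 < Q by rewrite ltr0n ltnW.
have Q2 : 2 <= Q by rewrite ler_nat.
have Qk0 k : 0 < Q ^- k by rewrite invr_gt0 exprn_gt0.
have Qk1 k : Q ^- k <= 1 by rewrite invf_le1 ?exprn_gt0 // exprn_ege1 // ler1n ltnW.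
have x0 k : 0 <= 1 - Q ^- k by rewrite subr_ge0.
have x1 k : 1 - Q ^- k < 1 by have := Qk0 k; lra.
have xb k : 0 <= 1 - Q ^- k < 1 by rewrite x0 x1.
have xm j k : (j <= k)%N -> 1 - Q ^- j <= 1 - Q ^- k.
  by move=> jk; have := level_mono R s2 jk; rewrite -/Q; lra.
have Px k : 0 < Psi (1 - Q ^- k) by exact: Psi_gt0.
pose P k := Psi (1 - Q ^- k).
have P0 k : 0 < P k by exact: Px.
pose a k := Num.sqrt (P k)^-1.
have a2 k : a k ^+ 2 = (P k)^-1 by rewrite sqr_sqrtr // invr_ge0 ltW.
have a0 k : 0 < a k by rewrite sqrtr_gt0 invr_gt0.
have s0 : 0 < s%:R :> R by rewrite ltr0n ltnW.
have a_lo j k : (j <= k)%N -> a j <= K * s%:R ^+ (k - j) * a k.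
  move=> jk; have sk : 0 < s%:R ^+ (k - j) :> R by rewrite exprn_gt0.
  rewrite -(@ler_pXn2r _ 2) ?nnegrE ?(ltW (a0 _)) ?mulr_ge0 ?(ltW K0) ?(ltW sk) ?(ltW (a0 k)) //.
  rewrite !exprMn !a2 ler_pdivlMr // ler_pdivrMl //.
  have h : Q ^- k * P k <= K * (Q ^- j * P j).
    by have := P2 _ _ (x0 j) (xm _ _ jk) (x1 k); rewrite /P !subKr.
  have Qj : Q ^+ k = Q ^+ j * Q ^+ (k - j) by rewrite -exprD subnKC.
  have -> : s%:R ^+ (k - j) ^+ 2 = Q ^+ (k - j) by rewrite /Q natrX -!exprM mulnC.
  move: (P j) (P k) (P0 j) (P0 k) h => pj pk pj0 pk0; rewrite Qj invfM -[Q ^- j * _ * _]mulrA [K * _]mulrCA ler_pM2l // => h.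
  rewrite ler_pdivrMl ?exprn_gt0 // in h; apply: (le_trans h).
  have -> : Q ^+ (k - j) * (K * pj) = pj * (K * Q ^+ (k - j)) by ring.
  rewrite ler_pM2l // ler_wpM2r ?exprn_ge0 ?(ltW Q0) //.
  by rewrite expr2 ler_peMl // ltW.
have a_hi j k : (j <= k)%N -> a k <= K * a j.
  move=> jk; rewrite -(@ler_pXn2r _ 2) ?nnegrE ?(ltW (a0 _)) ?mulr_ge0 ?(ltW K0) ?(ltW (a0 _)) //.
  rewrite exprMn !a2 ler_pdivlMr // ler_pdivrMl //.
  have h := P1 _ _ (x0 j) (xm _ _ jk) (x1 k); rewrite -/(P j) -/(P k) in h.
  by apply: (le_trans h); rewrite mulrC ler_pM2l // expr2 ler_peMl // ltW.
have aA k : 0 < a k <= K * a 0%N by rewrite a0 a_hi.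
set g : cplane R -> cplane R := lacunary (s ^ 2) a.
have ga : analytic g := lacunary_analytic dc0 dcP q2 aA.
have up (z : C) m : cmod z < 1 -> Q ^- m.+1 <= 1 - cmod z -> _ :=
  @lacunary_upper R dc s a _ K dc0 dcP s2 aA Kge1 a_lo a_hi z m.
have lo (z : C) m : (0 < m)%N -> 1 - Q ^- m <= cmod z <= 1 - Q ^- m / 2 -> _ :=
  @lacunary_lower R dc s a _ K dc0 dcP s2 aA Kge1 a_lo a_hi sl z m.
exists g.
  set B := 2 * K + 1 + 4 * K * dc * Q in up.
  apply: (C1star_of_radial_bound omega_crw D1 dbl ga (_ : 0 <= B ^+ 2 * (K * Q))).
    by rewrite mulr_ge0 ?sqr_ge0 // mulr_ge0 // ltW.
  move=> r t rb; have /andP[r0 r1] := rb.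
  have [m /andP[m1 m2]] := find_level s2 rb; rewrite -/Q in m1 m2.
  have h := up (cpolar r t) m; rewrite cmod_cpolar // in h; have {h} h := h r1 m1.
  have B0 : 0 <= B.
    by rewrite addr_ge0 ?addr_ge0 ?mulr_ge0 ?(ltW K0) ?(ltW dc0) ?(ltW Q0).
  have w0 := profile_gt0 omega_crw rb.
  have d0 : 0 < 1 - r by rewrite subr_gt0.
  have y0 : 0 <= a m * Q ^+ m by rewrite mulr_ge0 ?exprn_ge0 ?(ltW Q0) // ltW.
  have g2 : cmod (cderiv g (cpolar r t)) ^+ 2 <= (B * (a m * Q ^+ m)) ^+ 2.
    by rewrite lerXn2r ?nnegrE ?cmod_ge0 // mulr_ge0.
  have hS := star_le0 omega_crw rb.
  rewrite -mulrA [S r * r]mulrC.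
  apply: le_trans (ler_pM _ _ g2 hS) _; rewrite ?exprn_ge0 ?cmod_ge0 //.
    by rewrite mulr_ge0 ?star_ge0.
  have PP : Psi r <= K * Q * P m.
    have xr : 1 - Q ^- m <= r by lra.
    have h2 : (1 - r) * Psi r <= K * (Q ^- m * P m).
      by have := P2 _ _ (x0 m) xr r1; rewrite /P !subKr.
    have Pr := Psi_gt0 rb.
    have h3 : Q ^- m.+1 * Psi r <= K * (Q ^- m * P m).
      by apply: le_trans h2; rewrite ler_pM2r.
    rewrite ler_pdivrMl ?exprn_gt0 // in h3; apply: (le_trans h3).
    have Qm : Q ^+ m != 0 by rewrite expf_neq0 // gt_eqF.
    rewrite le_eqVlt; apply/orP; left; apply/eqP; rewrite exprS.
    by move: (P m) Qm => pm; move: (Q ^+ m) => u u0; field.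
  rewrite (tail_Psi rb) !exprMn a2.
  have dQ : ((1 - r) * Q ^+ m) ^+ 2 <= 1.
    rewrite exprn_ile1 //; first by rewrite mulr_ge0 ?exprn_ge0 ?(ltW Q0) // ltW.
    by rewrite -ler_pdivlMr ?exprn_gt0 // mul1r.
  have -> : B ^+ 2 * ((P m)^-1 * Q ^+ m ^+ 2) * ((1 - r) * (Psi r * ((1 - r) * w r))) =
     B ^+ 2 * ((Psi r / P m) * ((1 - r) * Q ^+ m) ^+ 2) * w r by ring.
  rewrite ler_wpM2r ?(ltW w0) // ler_wpM2l ?sqr_ge0 //.
  have PPm : Psi r / P m <= K * Q by rewrite [leLHS]mulrC ler_pdivrMl // [leRHS]mulrC.
  rewrite -[leRHS]mulr1; apply: ler_pM PPm dQ; last exact: sqr_ge0.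
  by rewrite divr_ge0 ?(ltW (P0 m)) // ltW // Psi_gt0.
move=> /BMOAP[_ [M M0 HM]].
pose e2 : R := expR (- 2) / 2; have e20 : 0 < e2 by rewrite divr_gt0 // expR_gt0.
pose I : R * R := (0, Q ^- 1).
have LI : arc_length I = Q ^- 1 by rewrite /arc_length /= subr0.
have Ia : is_arc I.
  by rewrite /is_arc /= Qk0 add0r; have := Qk1 1%N; have := pi_ge2 R; lra.
have rI : arc_radius I = 1 - Q ^- 1.
  by rewrite /arc_radius LI; apply/max_idPr.
pose c k := (e2 * (a k * Q ^+ k)) ^+ 2 * (Q ^- k / 2) * 2^-1.
have c0 k : 0 <= c k.
  by rewrite mulr_ge0 ?invr_ge0 // mulr_ge0 ?sqr_ge0 // divr_ge0 // ltW.
have cF k (r t : R) : (1 <= k)%N -> 1 - Q ^- k <= r <= 1 - Q ^- k / 2 ->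
    c k <= cmod (cderiv g (cpolar r t)) ^+ 2 * (1 - r ^+ 2) * r.
  move=> k0 /andP[ra rb]; have q0 := Qk0 k.
  have Qk2 : Q ^- k <= 2^-1.
    by apply: le_trans (level_mono _ s2 k0) _; rewrite expr1 lef_pV2 ?posrE.
  have r2 : 2^-1 <= r by lra.
  have rp : 0 < r by lra.
  have r1 : r < 1 by lra.
  have hg : e2 * (a k * Q ^+ k) <= cmod (cderiv g (cpolar r t)).
    by have := lo (cpolar r t) k k0; rewrite cmod_cpolar ?(ltW rp) // ra rb => /(_ isT).
  have eQ0 : 0 <= e2 * (a k * Q ^+ k).
    by rewrite mulr_ge0 ?(ltW e20) // mulr_ge0 ?exprn_ge0 ?(ltW Q0) // ltW.
  have f1 : (e2 * (a k * Q ^+ k)) ^+ 2 <= cmod (cderiv g (cpolar r t)) ^+ 2 by rewrite lerXn2r ?nnegrE ?cmod_ge0.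
  have f2 : Q ^- k / 2 <= 1 - r ^+ 2.
    have h : r ^+ 2 <= r by rewrite expr2 ler_piMl // ltW.
    by move: h; move: (r ^+ 2) => y h; lra.
  have q2' : 0 <= Q ^- k / 2 by lra.
  by apply: ler_pM => //; [rewrite mulr_ge0 ?sqr_ge0|apply: ler_pM; rewrite ?sqr_ge0].
have sumA N : \sum_(1 <= k < 1 + N) a k ^+ 2 <= 8 * M / e2 ^+ 2.
  have low := @polar_box_annuli R s s2 I (fun r t => cmod (cderiv g (cpolar r t)) ^+ 2 * (1 - r ^+ 2) * r) c 1 N Ia rI _ _ c0 cF.
  have {low} low := le_trans (low _ _) (HM I Ia).
  have {low} low : \sum_(1 <= k < 1 + N) c k * (Q ^- k / 2) <= M.
    rewrite -(ler_pM2r (Qk0 1%N)); have := low; rewrite LI lee_fin; apply.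
    - move=> t; apply: (@measurable_radius _ _ (fun r => 1 - r ^+ 2)); first exact: analytic_cderiv.
      by apply: measurable_funB => //; exact: measurable_funX.
    - move=> r t /andP[ra rb]; rewrite mulr_ge0 // mulr_ge0 ?exprn_ge0 ?cmod_ge0 //.
      by rewrite subr_ge0 exprn_ile1 // ltW.
  rewrite ler_pdivlMr ?exprn_gt0 // mulrC -ler_pdivrMl //; apply: le_trans low.
  rewrite mulr_sumr mulr_sumr le_eqVlt; apply/orP; left; apply/eqP; apply: eq_bigr => k _.
  have Qk : Q ^+ k != 0 by rewrite expf_neq0 // gt_eqF.
  by rewrite /c; move: Qk; move: (Q ^+ k) => u u0; field.
set M' := 8 * M / e2 ^+ 2 in sumA.
have [r0 /andP[r00 r01] Hr] := rapid_profile (2 * Q * K) rapid.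
have [|m m0 mr] := @level_small R s s2 (1 - r0); first by rewrite subr_gt0.
rewrite -/Q in mr.
have chain N : W (1 - Q ^- m) <= W (1 - Q ^- (m + N)) * expR (2 * Q * (K * M')).
  apply: le_trans (@tail_chain R omega omega_crw s s2 (fun k => K * a k ^+ 2) m N _ _) _.
  - move=> k mk; split; first by rewrite mulr_ge0 ?sqr_ge0 // ltW.
    rewrite -/Q a2 mulrA ler_pdivrMr // ler_pdivlMl //.
    have rk : r0 <= 1 - Q ^- k < 1 by rewrite x1 andbT; have := xm _ _ mk; lra.
    have wk := profile_gt0 omega_crw (xb k).
    have := Hr _ rk; rewrite (tail_Psi (xb k)) -/(P k) [w _ * _]mulrC ler_pM2r ?mulrA //.
    by rewrite mulr_gt0 // subr_gt0.
  - move=> k u mk; rewrite -/Q => /andP[ua ub].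
    have u1 : u < 1 := le_lt_trans ub (x1 _); have ubb : 0 <= u < 1 by rewrite u1 (le_trans (x0 k)).
    have h := P1 _ _ (x0 k) ua u1; rewrite -/(P k) in h.
    rewrite (tail_Psi ubb) [w u * _]mulrC mulrA ler_peMl //.
      by rewrite mulr_ge0 ?subr_ge0 ?(ltW u1) // ltW // profile_gt0.
    by rewrite a2 mulrAC ler_pdivlMr // mul1r.
  - rewrite -/Q ler_wpM2l ?tail_ge0 // ler_expR -mulr_sumr ler_wpM2l ?mulr_ge0 ?(ltW Q0) //.
    rewrite ler_pM2l //; apply: le_trans (sumA (m + N)%N).
    rewrite (@big_cat_nat _ _ _ m 1) //=; last by rewrite (leq_trans (leq_addr N m)) // add1n.
    rewrite ler_wpDl //; first by apply: sumr_ge0 => k _; exact: sqr_ge0.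
    rewrite add1n big_nat_recr ?leq_addr //= ler_wpDr // sqr_ge0 //.
have E0 : 0 < expR (2 * Q * (K * M')) :> R by exact: expR_gt0.
have Wm := tail_gt0 omega_crw (x0 m) (x1 m).
have [|r /andP[rr0 rr1] Htail] := @tail_cvg0 _ omega omega_crw (W (1 - Q ^- m) / (2 * expR (2 * Q * (K * M')))).
  by rewrite divr_gt0 // mulr_gt0.
have [|n n0 nr] := @level_small R s s2 (1 - r); first by rewrite subr_gt0.
rewrite -/Q in nr.
have := Htail (1 - Q ^- (m + n)); rewrite x1 andbT.
have -> : r <= 1 - Q ^- (m + n) by have := xm _ _ (leq_addl m n); lra.
move=> /(_ isT); rewrite ler_pdivlMr ?mulr_gt0 // => h1.
have := chain n; lra.
Qed.

End StrictInclusions.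

(** * Polar derivatives of Bloch functions *)

Section PolarDerivatives.
Variable R : realType.
Local Notation C := R[i].

(** In polar coordinates this operator is [r d/dr = - i d/dt], so one
    operator serves for both polar derivatives. *)
Definition euler (f : C -> C) (z : C) : C := z * cderiv (f : cplane R -> cplane R) z.

Lemma analytic_euler f : analytic (f : cplane R -> cplane R) ->
  analytic (euler f : cplane R -> cplane R).
Proof.
move=> fa z z1; have f'a := analytic_cderiv fa.
by have [] := cdiff_derivable (cdiffM (cdiff_id z) (analytic_cdiff f'a z1)).
Qed.

Lemma polar_derives f (r t : R) : analytic (f : cplane R -> cplane R) -> 0 < r < 1 ->
  [/\ is_derive r (1 : R) (fun r => Re (f (cpolar r t))) (Re (euler f (cpolar r t)) / r),
      is_derive r (1 : R) (fun r => Im (f (cpolar r t))) (Im (euler f (cpolar r t)) / r),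
      is_derive t (1 : R) (fun t => Re (f (cpolar r t))) (- Im (euler f (cpolar r t)))
    & is_derive t (1 : R) (fun t => Im (f (cpolar r t))) (Re (euler f (cpolar r t)))].
Proof.
move=> fa /andP[r0 r1]; have z1 : cmod (cpolar r t) < 1 by rewrite cmod_cpolar // ltW.
have D := crdiff2_comp (crdiff2_cpolar r t) (analytic_cdiff fa z1).
set d := cderiv f (cpolar r t) in D.
have E : euler f (cpolar r t) = r%:C%C * (d * cis t).
  by rewrite /euler -/d cpolarE; ring.
have rn : r != 0 by rewrite gt_eqF.
have E1 : Re (d * cis t) = Re (euler f (cpolar r t)) / r.
  by rewrite E; move: (d * cis t) => v; rewrite cReM /= mul0r subr0; field.
have E2 : Im (d * cis t) = Im (euler f (cpolar r t)) / r.
  by rewrite E; move: (d * cis t) => v; rewrite cImM /= mul0r addr0; field.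
have E3 : d * ('i%C * (r%:C%C * cis t)) = 'i%C * euler f (cpolar r t) by rewrite E; ring.
have E4 : Re (d * ('i%C * (r%:C%C * cis t))) = - Im (euler f (cpolar r t)).
  by rewrite E3; move: (euler _ _) => v; rewrite cReM /=; ring.
have E5 : Im (d * ('i%C * (r%:C%C * cis t))) = Re (euler f (cpolar r t)).
  by rewrite E3; move: (euler _ _) => v; rewrite cImM /=; ring.
have DR := crdiff2_Re D; have DI := crdiff2_Im D.
rewrite -E1 -E2 -E4 -E5; split.
- exact: rdiff2_derive1 DR.
- exact: rdiff2_derive1 DI.
- exact: rdiff2_derive2 DR.
- exact: rdiff2_derive2 DI.
Qed.

Lemma polar_cts f (r t : R) : analytic (f : cplane R -> cplane R) -> 0 <= r < 1 ->
  {for (r, t), continuous (fun p : R * R => Re (f (cpolar p.1 p.2)))} /\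
  {for (r, t), continuous (fun p : R * R => Im (f (cpolar p.1 p.2)))}.
Proof.
move=> fa /andP[r0 r1]; have z1 : cmod (cpolar r t) < 1 by rewrite cmod_cpolar.
have cf : {for cpolar r t, continuous (f : cplane R -> cplane R)}.
  exact: cdiff_continuous (analytic_cdiff fa z1).
by split; [exact: cts2_Re|exact: cts2_Im].
Qed.

Lemma mvt_bound (f df : R -> R) (a b k : R) : a <= b ->
  (forall x, a <= x <= b -> is_derive x (1 : R) f (df x)) ->
  (forall x, a <= x <= b -> `|df x| <= k) -> `|f b - f a| <= k * (b - a).
Proof.
move=> ab D K.
have cf : {within `[a, b], continuous f}.
  by apply: cts_on_within => x xb; exact: is_derive_cts (D x xb).
have D' x : x \in `]a, b[ -> is_derive x (1 : R) f (df x).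
  by rewrite in_itv /= => /andP[/ltW xa /ltW xb]; apply: D; rewrite xa.
have [c] := MVT_segment ab D' cf.
rewrite in_itv /= => cb ->.
by rewrite normrM [`|b - a|]ger0_norm ?subr_ge0 // ler_wpM2r ?subr_ge0 // K.
Qed.

Variables (g : C -> C) (B : R).
Hypothesis ga : analytic (g : cplane R -> cplane R).
Hypothesis gB : forall z : C, cmod z < 1 ->
  cmod (cderiv (g : cplane R -> cplane R) z) * (1 - cmod z) <= B.

Lemma bloch_euler (r t : R) : 0 <= r < 1 -> cmod (euler g (cpolar r t)) <= r * (B / (1 - r)).
Proof.
move=> /andP[r0 r1]; rewrite cmodM cmod_cpolar // ler_wpM2l // ler_pdivlMr ?subr_gt0 //.
by have := gB (_ : cmod (cpolar r t) < 1); rewrite cmod_cpolar //; apply.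
Qed.

Lemma bloch_ge0 : 0 <= B.
Proof.
have := gB (_ : cmod (0 : C) < 1); rewrite cmod0 subr0 mulr1 => /(_ ltr01).
by apply: le_trans; exact: cmod_ge0.
Qed.

Lemma bloch_radial (r0 r1 t : R) : 0 < r0 -> r0 <= r1 -> r1 < 1 ->
  cmod (g (cpolar r1 t) - g (cpolar r0 t)) <= 2 * (B * ((r1 - r0) / (1 - r1))).
Proof.
move=> r00 r01 r11; have B0 := bloch_ge0.
have bd x : r0 <= x <= r1 -> cmod (euler g (cpolar x t)) / x <= B / (1 - r1).
  move=> /andP[xa xb]; have x0 : 0 < x by apply: lt_le_trans xa.
  have x1 : x < 1 := le_lt_trans xb r11.
  have xx : 0 <= x < 1 by rewrite x1 ltW.
  rewrite ler_pdivrMr // mulrC; apply: le_trans (bloch_euler t xx) _.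
  by rewrite ler_pM2l // ler_wpM2l // lef_pV2 ?posrE ?subr_gt0 //; lra.
have in01 x : r0 <= x <= r1 -> 0 < x < 1.
  by move=> /andP[xa xb]; rewrite (lt_le_trans r00 xa) (le_lt_trans xb).
apply: le_trans (cmod_le_ReIm _) _; rewrite cReB cImB.
have hr : `|Re (g (cpolar r1 t)) - Re (g (cpolar r0 t))| <= B / (1 - r1) * (r1 - r0).
  apply: (@mvt_bound (fun x => Re (g (cpolar x t))) (fun x => Re (euler g (cpolar x t)) / x) _ _ _ r01) => x xb.
    by have [] := polar_derives t ga (in01 x xb).
  have /andP[x0 _] := in01 x xb; apply: le_trans (bd x xb).
  by rewrite normrM normfV (gtr0_norm x0) ler_pM2r ?invr_gt0 // norm_Re_cmod.
have hi : `|Im (g (cpolar r1 t)) - Im (g (cpolar r0 t))| <= B / (1 - r1) * (r1 - r0).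
  apply: (@mvt_bound (fun x => Im (g (cpolar x t))) (fun x => Im (euler g (cpolar x t)) / x) _ _ _ r01) => x xb.
    by have [] := polar_derives t ga (in01 x xb).
  have /andP[x0 _] := in01 x xb; apply: le_trans (bd x xb).
  by rewrite normrM normfV (gtr0_norm x0) ler_pM2r ?invr_gt0 // norm_Im_cmod.
have -> : B * ((r1 - r0) / (1 - r1)) = B / (1 - r1) * (r1 - r0) by ring.
lra.
Qed.

Lemma bloch_angular (r t0 t1 : R) : 0 < r -> r < 1 -> t0 <= t1 ->
  cmod (g (cpolar r t1) - g (cpolar r t0)) <= 2 * (B * ((t1 - t0) / (1 - r))).
Proof.
move=> r0 r1 t01; have B0 := bloch_ge0.
have rb : 0 < r < 1 by rewrite r0.
have bd x : cmod (euler g (cpolar r x)) <= B / (1 - r).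
  have rr : 0 <= r < 1 by rewrite r1 ltW.
  apply: le_trans (bloch_euler x rr) _; rewrite ler_piMl ?(ltW r1) //.
  by rewrite divr_ge0 // subr_ge0 ltW.
apply: le_trans (cmod_le_ReIm _) _; rewrite cReB cImB.
have hr : `|Re (g (cpolar r t1)) - Re (g (cpolar r t0))| <= B / (1 - r) * (t1 - t0).
  apply: (@mvt_bound (fun x => Re (g (cpolar r x))) (fun x => - Im (euler g (cpolar r x))) _ _ _ t01) => x _.
    by have [] := polar_derives x ga rb.
  by rewrite normrN; apply: le_trans (bd x); exact: norm_Im_cmod.
have hi : `|Im (g (cpolar r t1)) - Im (g (cpolar r t0))| <= B / (1 - r) * (t1 - t0).
  apply: (@mvt_bound (fun x => Im (g (cpolar r x))) (fun x => Re (euler g (cpolar r x))) _ _ _ t01) => x _.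
    by have [] := polar_derives x ga rb.
  by apply: le_trans (bd x); exact: norm_Re_cmod.
have -> : B * ((t1 - t0) / (1 - r)) = B / (1 - r) * (t1 - t0) by ring.
lra.
Qed.

End PolarDerivatives.

(** * A local Green formula *)

Section LocalGreen.
Variable R : realType.
Local Notation C := R[i].

Lemma isd_cst (c x : R) : is_derive x (1 : R) (fun=> c) 0.
Proof. exact: is_derive_cst. Qed.

Lemma isdD (f g : R -> R) (x a b : R) : is_derive x (1 : R) f a -> is_derive x (1 : R) g b ->
  is_derive x (1 : R) (fun y => f y + g y) (a + b).
Proof. by move=> df dg; exact: is_deriveD. Qed.

Lemma isdM (f g : R -> R) (x a b : R) : is_derive x (1 : R) f a -> is_derive x (1 : R) g b ->
  is_derive x (1 : R) (fun y => f y * g y) (a * g x + f x * b).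
Proof.
move=> df dg; have D := is_deriveM df dg.
by apply: is_derive_eq D _; rewrite addrC; congr (_ + _); exact: mulrC.
Qed.

Lemma isdZ (f : R -> R) (k x a : R) : is_derive x (1 : R) f a ->
  is_derive x (1 : R) (fun y => k * f y) (k * a).
Proof. by move=> df; have := isdM (isd_cst k x) df; rewrite mul0r add0r. Qed.

Lemma isdB (f g : R -> R) (x a b : R) : is_derive x (1 : R) f a -> is_derive x (1 : R) g b ->
  is_derive x (1 : R) (fun y => f y - g y) (a - b).
Proof. by move=> df dg; exact: is_deriveB. Qed.

Lemma sqr_le_le (a b : R) : 0 <= b -> a ^+ 2 <= b ^+ 2 -> a <= b.
Proof.
by move=> b0 h; rewrite leNgt; apply/negP => ba; have := ltW ba; nra.
Qed.

Lemma green_alg (r p q p1 q1 p2 q2 : R) : r != 0 ->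
  2 * ((p1 / r - 0) * p1 + p * (p2 / r) + ((q1 / r - 0) * q1 + q * (q2 / r))) =
  2 * (p1 * p1 + q1 * q1 + (p * p2 + q * q2)) / r.
Proof. by move=> r0; field. Qed.

Lemma green_alg2 (p q p1 q1 p2 q2 : R) :
  2 * ((p1 - 0) * p1 + q * - q2 - ((- q1 - 0) * q1 + p * p2)) =
  2 * (p1 * p1 + q1 * q1 - (p * p2 + q * q2)).
Proof. by ring. Qed.

Lemma green_alg0 (u v x y : R) : u = 0 -> v = 0 -> u * x - v * y = 0.
Proof. by move=> -> ->; rewrite !mul0r subrr. Qed.

Lemma green_alg3 (k T P2 V : R) : k * (2 * (V + P2)) + (T + k * (2 * (V - P2))) = 4 * (k * V) + T.
Proof. by ring. Qed.

(** The coefficient [1 / 16] leaves the energy with a factor small enough to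
    be absorbed in the local Green formula. *)
Lemma green_amgm (d k T U V e : R) : 0 < e -> 0 <= k -> 0 <= U -> 0 <= V ->
  d ^+ 2 <= 16 / e * k -> T ^+ 2 <= 4 * (U * V) ->
  d * T <= 256 * V + (16 * e)^-1 * (k * U).
Proof.
move=> e0 k0 U0 V0 kd TU.
have w0 : 0 <= (16 * e)^-1 * (k * U) by rewrite mulr_ge0 ?invr_ge0 ?mulr_ge0 // ltW.
apply: sqr_le_le; first by apply: addr_ge0 w0; apply: mulr_ge0 V0; exact: ler0n.
apply: le_trans (_ : 64 / e * (k * (U * V)) <= _).
  rewrite exprMn; apply: le_trans (ler_pM (sqr_ge0 _) (sqr_ge0 _) kd TU) _.
  by rewrite le_eqVlt; apply/orP; left; apply/eqP; ring.
have -> : 64 / e * (k * (U * V)) = 4 * ((256 * V) * ((16 * e)^-1 * (k * U))).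
  by field; rewrite gt_eqF.
move: (256 * V) ((16 * e)^-1 * _) => x y.
by have := sqr_ge0 (x - y); rewrite !expr2; lra.
Qed.

Lemma green_cauchy (p q p1 q1 : R) : (2 * (q * p1 - p * q1)) ^+ 2 <=
  4 * ((p * p + q * q) * (p1 * p1 + q1 * q1)).
Proof.
have : 0 <= (p * p1 + q * q1) ^+ 2 by exact: sqr_ge0.
by rewrite !expr2; lra.
Qed.

Lemma green_cauchy2 (p q p1 q1 : R) : (2 * (p * p1 + q * q1)) ^+ 2 <=
  4 * ((p * p + q * q) * (p1 * p1 + q1 * q1)).
Proof.
have : 0 <= (q * p1 - p * q1) ^+ 2 by exact: sqr_ge0.
by rewrite !expr2; lra.
Qed.

Lemma green_sum (e0 e1 d f I k1 k2 h : R) : e1 <= 2 * (e0 + 2 * d * f + 1040 * I) ->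
  e0 <= k1 ^+ 2 * (2 * h) -> d * f <= h * (2 * (k1 * k2) * (2 * h)) ->
  2 * e1 <= 8 * h * k1 ^+ 2 + 32 * h ^+ 2 * (k1 * k2) + 4 * 1040 * I.
Proof. by rewrite !expr2; lra. Qed.

Lemma green_weight (L r s K m h N : R) : 0 < h -> 2^-1 <= r -> r <= s -> s <= 1 -> s - r <= h ->
  0 <= L <= 2 * (s - r) -> 0 <= K -> 0 <= m -> N <= 260 * K + m / (16 * h ^+ 2) ->
  L * (N / r) <= 1040 * ((1 - r) * K) + m / (4 * h).
Proof.
move=> h0 r2 rs s1 sh /andP[l0 l1] K0 m0 gs; have rp : 0 < r by lra.
have hh : 0 < h ^+ 2 by rewrite exprn_gt0.
have Z0 : 0 <= 260 * K + m / (16 * h ^+ 2).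
  apply: addr_ge0; first by apply: mulr_ge0 K0; exact: ler0n.
  by apply: divr_ge0 m0 _; apply: mulr_ge0 (ltW hh); exact: ler0n.
have lr : L / r <= 4 * (s - r).
  rewrite ler_pdivrMr //; apply: (le_trans l1).
  have : 0 <= (s - r) * (2 * r - 1) by rewrite mulr_ge0; lra.
  lra.
have lr0 : 0 <= L / r by rewrite divr_ge0 // ltW.
have -> : L * (N / r) = L / r * N by ring.
apply: le_trans (ler_wpM2l lr0 gs) _.
apply: le_trans (ler_wpM2r Z0 lr) _.
rewrite mulrDr; apply: lerD.
  have -> : 4 * (s - r) * (260 * K) = 1040 * ((s - r) * K) by ring.
  by apply: ler_wpM2l; [exact: ler0n|rewrite ler_wpM2r //; lra].
have -> : 4 * (s - r) * (m / (16 * h ^+ 2)) = (s - r) / h * (m / (4 * h)) by field; rewrite gt_eqF.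
rewrite ler_piMl ?divr_ge0 ?mulr_ge0 ?(ltW h0) //.
by rewrite ler_pdivrMr // mul1r.
Qed.

Lemma green_final (e m X : R) : 0 <= X -> m <= X + m / 4 -> e <= m -> e <= 2 * X.
Proof. lra. Qed.

Lemma green_collect (e0 f i j x y m : R) : f <= x -> i <= j -> j <= y + m -> e0 + f + i <= e0 + x + y + m.
Proof. lra. Qed.

Lemma green_scale (d m h : R) : 0 < h -> d <= h -> 0 <= m -> m / (4 * h) * d <= m / 4.
Proof.
move=> h0 dh m0; have -> : m / (4 * h) * d = d / h * (m / 4) by field; rewrite gt_eqF.
by rewrite ler_piMl ?divr_ge0 // ler_pdivrMr // mul1r.
Qed.

Variables (g : C -> C) (c : C) (th h : R).
Hypothesis ga : analytic (g : cplane R -> cplane R).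
Hypothesis h0 : 0 < h.

(** The square of a parabola vanishing at both ends: its derivative is
    bounded by a multiple of its own square root, which is what lets the
    tangential term be absorbed. *)
Definition cutoff (t : R) : R := (1 - ((t - th) / h) * ((t - th) / h)) * (1 - ((t - th) / h) * ((t - th) / h)).
Definition dcutoff (t : R) : R := - (4 / h * ((t - th) / h) * (1 - ((t - th) / h) * ((t - th) / h))).

Let P r t := Re (g (cpolar r t)) - Re c.
Let Q r t := Im (g (cpolar r t)) - Im c.
Let P1 r t := Re (euler g (cpolar r t)).
Let Q1 r t := Im (euler g (cpolar r t)).
Let P2 r t := Re (euler (euler g) (cpolar r t)).
Let Q2 r t := Im (euler (euler g) (cpolar r t)).
Let U r t := P r t * P r t + Q r t * Q r t.
Let V r t := P1 r t * P1 r t + Q1 r t * Q1 r t.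
Let D r t := 2 * (P r t * P1 r t + Q r t * Q1 r t).
Let DD r t := 2 * (V r t + (P r t * P2 r t + Q r t * Q2 r t)).
Let T r t := 2 * (Q r t * P1 r t - P r t * Q1 r t).
Let TT r t := 2 * (V r t - (P r t * P2 r t + Q r t * Q2 r t)).

Let chi := cutoff.
Let dchi := dcutoff.
Local Notation a := (th - h).
Local Notation b := (th + h).

Lemma is_derive_cutoff t : is_derive t (1 : R) chi (dchi t).
Proof.
have l : is_derive t (1 : R) (fun u => (u - th) / h) h^-1.
  have := isdM (isdB (is_derive_id t (1 : R)) (isd_cst th t)) (isd_cst h^-1 t).
  by rewrite mulr0 addr0 subr0 mul1r.
have o := isdB (isd_cst 1 t) (isdM l l).
apply: is_derive_eq (isdM o o) _; rewrite /dchi /dcutoff; field.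
by rewrite gt_eqF.
Qed.

Lemma cutoff_bounds t : a <= t <= b -> 0 <= chi t <= 1 /\ dchi t ^+ 2 <= 16 / h ^+ 2 * chi t.
Proof.
move=> /andP[ta tb]; rewrite /chi /dchi /cutoff /dcutoff; set x := (t - th) / h.
have xx : x * x <= 1.
  have x1 : x <= 1 by rewrite ler_pdivrMr // mul1r; lra.
  have x2 : -1 <= x by rewrite ler_pdivlMr // mulN1r; lra.
  by nra.
have x0 : 0 <= x * x by rewrite -expr2 sqr_ge0.
move: xx x0; set y := x * x => y1 y0.
split; first by apply/andP; split; nra.
have -> : (- (4 / h * x * (1 - y))) ^+ 2 = 16 / h ^+ 2 * ((1 - y) * (1 - y)) * y.
  by rewrite /y; field; rewrite gt_eqF.
rewrite ler_piMr // mulr_ge0 //; last by rewrite -expr2 sqr_ge0.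
by rewrite divr_ge0 ?exprn_ge0 ?(ltW h0).
Qed.

Lemma cutoff_inner t : th - h / 2 <= t <= th + h / 2 -> 2^-1 <= chi t.
Proof.
move=> /andP[ta tb]; rewrite /chi /cutoff; set x := (t - th) / h.
have x1 : x <= 2^-1 by rewrite ler_pdivrMr //; lra.
have x2 : - 2^-1 <= x by rewrite ler_pdivlMr //; lra.
have xx : x * x <= 4^-1 by nra.
by move: xx; move: (x * x) => y hy; nra.
Qed.

Let d1 (r t : R) (rb : 0 < r < 1) := polar_derives t ga rb.
Let d2 (r t : R) (rb : 0 < r < 1) := polar_derives t (analytic_euler ga) rb.

Lemma green_radial (r t : R) : 0 < r < 1 ->
  is_derive r (1 : R) (U^~ t) (D r t / r) /\ is_derive r (1 : R) (D^~ t) (DD r t / r).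
Proof.
move=> rb; have /andP[r0 _] := rb; have rn : r != 0 by rewrite gt_eqF.
have [dP dQ _ _] := d1 t rb; have [dP1 dQ1 _ _] := d2 t rb.
have {}dP := isdB dP (isd_cst (Re c) r); have {}dQ := isdB dQ (isd_cst (Im c) r).
split.
- apply: is_derive_eq (isdD (isdM dP dP) (isdM dQ dQ)) _.
  by rewrite /D /P /Q /P1 /Q1; move: (Re (g (cpolar r t))) (Im (g (cpolar r t))) (Re (euler g (cpolar r t))) (Im (euler g (cpolar r t))) (Re c) (Im c) => u1 u2 u3 u4 u5 u6; field.
- apply: is_derive_eq (isdZ 2 (isdD (isdM dP dP1) (isdM dQ dQ1))) _.
  exact: green_alg.
Qed.

Lemma green_angular (r t : R) : 0 < r < 1 -> is_derive t (1 : R) (T r) (TT r t).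
Proof.
move=> rb.
have [_ _ dP dQ] := d1 t rb; have [_ _ dP1 dQ1] := d2 t rb.
have {}dP := isdB dP (isd_cst (Re c) t); have {}dQ := isdB dQ (isd_cst (Im c) t).
apply: is_derive_eq (isdZ 2 (isdB (isdM dQ dP1) (isdM dP dQ1))) _.
exact: green_alg2.
Qed.

Let ctsF f (p : R * R) (fa : analytic (f : cplane R -> cplane R)) : 0 <= p.1 < 1 ->
  {for p, continuous (fun p : R * R => Re (f (cpolar p.1 p.2)))} /\
  {for p, continuous (fun p : R * R => Im (f (cpolar p.1 p.2)))}.
Proof. by case: p => r t; exact: polar_cts. Qed.

Let ctsC (p : R * R) : {for p, continuous (fun p : R * R => chi p.2)}.
Proof.
apply: (@continuous_comp _ _ _ (@snd R R) chi); first exact: cvg_snd.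
exact: is_derive_cts (is_derive_cutoff p.2).
Qed.

Let ctsK (k : R) (p : R * R) : {for p, continuous (fun _ : R * R => k)}.
Proof. exact: cst_continuous. Qed.

Let ctsAll (p : R * R) : 0 <= p.1 < 1 ->
  [/\ {for p, continuous (fun p => U p.1 p.2)}, {for p, continuous (fun p => V p.1 p.2)},
      {for p, continuous (fun p => D p.1 p.2)}, {for p, continuous (fun p => DD p.1 p.2)}
    & {for p, continuous (fun p => T p.1 p.2)} /\ {for p, continuous (fun p => TT p.1 p.2)} ].
Proof.
move=> pb; have [c1 c2] := ctsF ga pb; have [c3 c4] := ctsF (analytic_euler ga) pb.
have [c5 c6] := ctsF (analytic_euler (analytic_euler ga)) pb.
have cP := continuousB c1 (@ctsK (Re c) p); have cQ := continuousB c2 (@ctsK (Im c) p).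
have k2 := @ctsK 2 p.
have cV := continuousD (continuousM c3 c3) (continuousM c4 c4).
have cX := continuousD (continuousM cP c5) (continuousM cQ c6).
split.
- exact: (continuousD (continuousM cP cP) (continuousM cQ cQ)).
- exact: cV.
- exact: (continuousM k2 (continuousD (continuousM cP c3) (continuousM cQ c4))).
- exact: (continuousM k2 (continuousD cV cX)).
split.
- exact: (continuousM k2 (continuousB (continuousM cQ c3) (continuousM cP c4))).
- exact: (continuousM k2 (continuousB cV cX)).
Qed.

Let ab : a <= b.
Proof. by rewrite lerBlDr -addrA lerDl addr_ge0 ?ltW. Qed.

(** The radial profile of a localised square mean of [|g - c|]; its second
    derivative in [log r] is what Green's formula estimates. *)
Definition green_energy (r : R) := rint a b (fun t => chi t * U r t).
Definition green_flux (r : R) := rint a b (fun t => chi t * D r t).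
Local Notation En := green_energy.
Local Notation Fl := green_flux.

Lemma is_derive_green (r : R) : 0 < r < 1 ->
  is_derive r (1 : R) En (Fl r / r) /\
  is_derive r (1 : R) Fl (rint a b (fun t => chi t * DD r t) / r).
Proof.
move=> /andP[r0 r1]; set u := r / 2; set v := (1 + r) / 2.
have uv : u < r < v by apply/andP; split; rewrite /u /v; lra.
have ib y : u <= y <= v -> 0 < y < 1 by move=> /andP[uy yv]; apply/andP; split; rewrite /u /v in uy yv; lra.
have ib' y : u <= y <= v -> 0 <= y < 1 by move=> /ib/andP[/ltW -> ->].
have cy : forall p : R * R, u <= p.1 <= v -> {for p, continuous (fun p : R * R => p.1^-1)}.
  move=> p /ib/andP[p0 _]; apply: (@continuous_comp _ _ _ (@fst R R) GRing.inv); first exact: cvg_fst.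
  by apply: inv_continuous; rewrite gt_eqF.
have pull (G : R -> R -> R) : (forall p : R * R, u <= p.1 <= v -> {for p, continuous (fun p : R * R => G p.1 p.2)}) ->
    rint a b (fun t => chi t * (G r t / r)) = rint a b (fun t => chi t * G r t) / r.
  move=> cG; rewrite mulrC -rintZ.
    by apply: eq_rint => t _; ring.
  have rr : u <= r <= v by case/andP: uv => /ltW -> /ltW ->.
  move=> t _; have := @cts_pair2 R (fun p : R * R => chi p.2 * G p.1 p.2) r t; apply.
  exact: (continuousM (@ctsC (r, t)) (cG (r, t) rr)).
split.
- rewrite -pull; last by move=> p /ib'/ctsAll[].
  apply: (@rint_param_derive R (fun p => chi p.2 * U p.1 p.2) (fun p => chi p.2 * (D p.1 p.2 / p.1)) u v a b r uv ab).
  + by move=> p /ib'/ctsAll[cU _ _ _ _] _; exact: (continuousM (@ctsC p) cU).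
  + by move=> p pb _; have [_ _ cD _ _] := ctsAll (ib' _ pb); exact: (continuousM (@ctsC p) (continuousM cD (cy p pb))).
  + by move=> y t yb _; have [dU _] := green_radial t (ib _ yb); exact: (isdZ (chi t) dU).
- rewrite -pull; last by move=> p /ib'/ctsAll[].
  apply: (@rint_param_derive R (fun p => chi p.2 * D p.1 p.2) (fun p => chi p.2 * (DD p.1 p.2 / p.1)) u v a b r uv ab).
  + by move=> p /ib'/ctsAll[_ _ cD _ _] _; exact: (continuousM (@ctsC p) cD).
  + by move=> p pb _; have [_ _ _ cD _] := ctsAll (ib' _ pb); exact: (continuousM (@ctsC p) (continuousM cD (cy p pb))).
  + by move=> y t yb _; have [_ dU] := green_radial t (ib _ yb); exact: (isdZ (chi t) dU).
Qed.

Let ctsT (G : R -> R -> R) (r : R) : 0 <= r < 1 -> (forall p : R * R, 0 <= p.1 < 1 -> {for p, continuous (fun p : R * R => G p.1 p.2)}) ->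
  cts_on (G r) a b.
Proof. by move=> rb cG t _; exact: (@cts_pair2 R (fun p => G p.1 p.2) r t (cG (r, t) rb)). Qed.

Let cchi : cts_on chi a b. Proof. by move=> t _; exact: is_derive_cts (is_derive_cutoff t). Qed.

Let cdchi : cts_on dchi a b.
Proof.
move=> t _; have l : is_derive t (1 : R) (fun u => (u - th) / h) h^-1.
  have := isdM (isdB (is_derive_id t (1 : R)) (isd_cst th t)) (isd_cst h^-1 t).
  by rewrite mulr0 addr0 subr0 mul1r.
have o := isdB (isd_cst 1 t) (isdM l l).
rewrite (_ : dchi = (fun y : R => -1 * (4 / h * ((y - th) / h) * (1 - ((y - th) / h) * ((y - th) / h))))).
  exact: is_derive_cts (isdZ (-1) (isdM (isdZ (4 / h) l) o)).
by apply/funext => y; rewrite mulN1r.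
Qed.

(** The Laplacian of [|g - c|^2] is [4 |g'|^2]; the tangential second
    derivative is integrated by parts onto the cut-off and then split by the
    arithmetic-geometric inequality. *)
Lemma green_second (r : R) : 0 < r < 1 ->
  rint a b (fun t => chi t * DD r t) <= 260 * rint a b (V r) + En r / (16 * h ^+ 2).
Proof.
move=> rb; have rb' : 0 <= r < 1 by case/andP: rb => /ltW -> ->.
have cU := @ctsT U r rb' (fun p pb => let: And5 x _ _ _ _ := ctsAll pb in x).
have cV := @ctsT V r rb' (fun p pb => let: And5 _ x _ _ _ := ctsAll pb in x).
have cDD := @ctsT DD r rb' (fun p pb => let: And5 _ _ _ x _ := ctsAll pb in x).
have cT := @ctsT T r rb' (fun p pb => let: And5 _ _ _ _ x := ctsAll pb in x.1).
have cTT := @ctsT TT r rb' (fun p pb => let: And5 _ _ _ _ x := ctsAll pb in x.2).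
have parts : rint a b (fun t => dchi t * T r t + chi t * TT r t) = 0.
  have cS := cts_onD (cts_onM cdchi cT) (cts_onM cchi cTT).
  have dS t : a <= t <= b -> is_derive t (1 : R) (fun t => chi t * T r t) (dchi t * T r t + chi t * TT r t).
    by move=> _; exact: isdM (is_derive_cutoff t) (green_angular t rb).
  rewrite (rint_FTC ab cS dS); have hn : h != 0 by rewrite gt_eqF.
  have cut0 (x : R) : x * x = h * h -> chi (th + x) = 0.
    move=> xx; rewrite /chi /cutoff [th + x]addrC addrK.
    have -> : x / h * (x / h) = 1 by rewrite mulrACA xx mulrACA mulfV // mulr1.
    by rewrite subrr mul0r.
  have cb : chi b = 0 := cut0 h erefl.
  have ca : chi a = 0 := cut0 (- h) (mulrNN h h).
  exact: (green_alg0 _ _ cb ca).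
have -> : rint a b (fun t => chi t * DD r t) = rint a b (fun t => 4 * (chi t * V r t) + dchi t * T r t).
  rewrite -[LHS]addr0 -parts -rintD; first by apply: eq_rint => t _; exact: green_alg3.
    exact: cts_onM.
  by apply: cts_onD; exact: cts_onM.
have cCU0 := cts_onM cchi cU.
have cCU : cts_on (fun t => (16 * h ^+ 2)^-1 * (chi t * U r t)) a b.
  exact: cts_onM (@cts_on_cst R a b _) cCU0.
have cV2 : cts_on (fun t => 260 * V r t) a b by exact: cts_onM (@cts_on_cst R a b _) cV.
have -> : 260 * rint a b (V r) + En r / (16 * h ^+ 2) =
    rint a b (fun t => 260 * V r t + (16 * h ^+ 2)^-1 * (chi t * U r t)).
  by rewrite (rintD cV2 cCU) (rintZ 260 cV) (rintZ _ cCU0); congr (_ + _); exact: mulrC.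
have c4 : cts_on (fun t => 4 * (chi t * V r t) + dchi t * T r t) a b.
  exact: cts_onD (cts_onM (@cts_on_cst R a b _) (cts_onM cchi cV)) (cts_onM cdchi cT).
apply: le_rint c4 (cts_onD cV2 cCU) _.
move=> t tb; have [/andP[k0 k1] kd] := cutoff_bounds tb.
have V0 : 0 <= V r t by rewrite addr_ge0 // -expr2 sqr_ge0.
have U0 : 0 <= U r t by rewrite addr_ge0 // -expr2 sqr_ge0.
have h2 : 0 < h ^+ 2 by rewrite exprn_gt0.
have key : dchi t * T r t <= 256 * V r t + (16 * h ^+ 2)^-1 * (chi t * U r t).
  exact: green_amgm h2 k0 U0 V0 kd (green_cauchy _ _ _ _).
have kV : chi t * V r t <= V r t by rewrite ler_piMl.
move: kV key; move: (chi t * V r t) (dchi t * T r t) (_^-1 * _) (V r t) => y1 y2 y3 y4; lra.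
Qed.

Lemma ln_sub_le (r s : R) : 2^-1 <= r -> r <= s -> 0 <= ln s - ln r <= 2 * (s - r).
Proof.
move=> r2 rs; have r0 : 0 < r by lra.
have s0 : 0 < s by lra.
rewrite subr_ge0 ler_ln ?posrE // rs /= -ln_div ?posrE //.
have := @le_ln1Dx R (s / r - 1); rewrite addrCA subrr addr0 ltrDr divr_gt0 // => /(_ isT) H.
apply: (le_trans H).
have -> : s / r - 1 = (s - r) / r by field; rewrite gt_eqF.
rewrite mulrC ler_wpM2r ?subr_ge0 // -[leRHS]invrK lef_pV2 ?posrE ?invr_gt0 //.
Qed.

(** The second derivative in [log r] is integrated against the kernel [ln (s
    / r)], which is bounded both by a multiple of [1 - r] and by a multiple
    of [r1 - r0 <= h]; by the latter the energy on the right, bounded by its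
    maximum over the radii, is absorbed. *)
Lemma local_green (r0 r1 : R) : 2^-1 <= r0 -> r0 <= r1 -> r1 < 1 -> r1 - r0 <= h ->
  En r1 <= 2 * (En r0 + 2 * (r1 - r0) * `|Fl r0| +
    1040 * rint r0 r1 (fun r => (1 - r) * rint a b (V r))).
Proof.
move=> r02 r01 r11 rh.
have ib r : r0 <= r <= r1 -> 0 < r < 1 by move=> /andP[x y]; apply/andP; split; lra.
have cV : forall r, r0 <= r <= r1 -> {for r, continuous (fun r => rint a b (V r))}.
  move=> r /ib/andP[x y]; apply: (@rint_param_cts R (fun p => V p.1 p.2) (r / 2) ((1 + r) / 2)).
    by apply/andP; split; lra.
  by move=> p /andP[pa pb] _; have [] : [/\ _, _, _, _ & _] := @ctsAll p (_ : 0 <= p.1 < 1); first by apply/andP; split; lra.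
have cDD : forall r, r0 <= r <= r1 -> {for r, continuous (fun r => rint a b (fun t => chi t * DD r t))}.
  move=> r /ib/andP[x y]; apply: (@rint_param_cts R (fun p => chi p.2 * DD p.1 p.2) (r / 2) ((1 + r) / 2)).
    by apply/andP; split; lra.
  move=> p /andP[pa pb] _; have pp : 0 <= p.1 < 1 by apply/andP; split; lra.
  by have [_ _ _ cc _] := ctsAll pp; exact: (continuousM (@ctsC p) cc).
have dE r : r0 <= r <= r1 -> is_derive r (1 : R) En (Fl r / r) by move=> /ib/is_derive_green[].
have dF r : r0 <= r <= r1 -> is_derive r (1 : R) Fl (rint a b (fun t => chi t * DD r t) / r).
  by move=> /ib/is_derive_green[].
have cE : cts_on En r0 r1 by move=> r /dE; exact: is_derive_cts.
have [rm rm_in rmP] := EVT_max r01 (cts_on_within cE).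
rewrite in_itv /= in rm_in; have {}rmP r : r0 <= r <= r1 -> En r <= En rm by move=> rr; apply: rmP; rewrite in_itv.
set m := En rm in rmP *.
have m0 : 0 <= m.
  apply: rint_ge0 => t tb; have [/andP[k0 _] _] := cutoff_bounds tb.
  by rewrite mulr_ge0 // addr_ge0 // -expr2 sqr_ge0.
have V0 r : 0 <= rint a b (V r) by apply: rint_ge0 => t _; rewrite addr_ge0 // -expr2 sqr_ge0.
have cI : cts_on (fun r => (1 - r) * rint a b (V r)) r0 r1.
  by apply: cts_onM => //; apply: cts_onB; [exact: cts_on_cst|move=> x _; exact: cvg_id].
have bound s : r0 <= s <= r1 -> En s <= En r0 + 2 * (r1 - r0) * `|Fl r0| +
    1040 * rint r0 r1 (fun r => (1 - r) * rint a b (V r)) + m / 4.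
  move=> /andP[s0 s1].
  have sub r : r0 <= r <= s -> r0 <= r <= r1 by move=> /andP[-> /le_trans ->].
  pose L r := ln s - ln r.
  have cL : cts_on (fun r => L r * (rint a b (fun t => chi t * DD r t) / r)) r0 s.
    apply: cts_onM.
      apply: cts_onB; first exact: cts_on_cst.
      by move=> r /sub/ib/andP[r_gt0 _]; exact: continuous_ln.
    apply: cts_onM; first by move=> r /sub; exact: cDD.
    by move=> r /sub/ib/andP[r_gt0 _]; apply: inv_continuous; rewrite gt_eqF.
  have dH r : r0 <= r <= s -> is_derive r (1 : R) (fun r => L r * Fl r + En r)
      (L r * (rint a b (fun t => chi t * DD r t) / r)).
    move=> rr; have /andP[r_gt0 _] := ib r (sub r rr).
    have dL : is_derive r (1 : R) L (0 - r^-1).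
      exact: isdB (isd_cst (ln s) r) (is_derive1_ln r_gt0).
    apply: is_derive_eq (isdD (isdM dL (dF r (sub r rr))) (dE r (sub r rr))) _.
    by rewrite sub0r; field; rewrite gt_eqF.
  have E1 := rint_FTC s0 cL dH.
  have Es : En s = En r0 + L r0 * Fl r0 + rint r0 s (fun r => L r * (rint a b (fun t => chi t * DD r t) / r)).
    by rewrite E1 /L subrr mul0r; ring.
  have /andP[L0 L1] := ln_sub_le r02 s0.
  have hh : 0 < h ^+ 2 by rewrite exprn_gt0.
  have b1 : L r0 * Fl r0 <= 2 * (r1 - r0) * `|Fl r0|.
    apply: le_trans (ler_norm _) _; rewrite normrM [`|L r0|]ger0_norm // ler_wpM2r //.
    by apply: (le_trans L1); rewrite ler_pM2l // lerD2r.
  have b2 : rint r0 s (fun r => L r * (rint a b (fun t => chi t * DD r t) / r)) <=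
      rint r0 s (fun r => 1040 * ((1 - r) * rint a b (V r)) + m / (4 * h)).
    apply: le_rint => //.
      apply: cts_onD; last exact: cts_on_cst.
      by apply: cts_onM; [exact: cts_on_cst|exact: cts_on_sub cI (lexx _) s1].
    move=> r rr; have /andP[ra rs] := rr; have rr1 := sub r rr; have r2 := le_trans r02 ra.
    apply: (@green_weight (L r) r s) => //.
    + exact: le_trans s1 (ltW r11).
    + by apply: le_trans rh; apply: lerB.
    + exact: ln_sub_le.
    + apply: le_trans (green_second (ib r rr1)) _.
      by rewrite lerD2l ler_wpM2r ?rmP // invr_ge0 mulr_ge0 // ltW.
  have b3 : rint r0 s (fun r => 1040 * ((1 - r) * rint a b (V r)) + m / (4 * h)) <=
      1040 * rint r0 r1 (fun r => (1 - r) * rint a b (V r)) + m / 4.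
    have cIs := cts_on_sub cI (lexx _) s1.
    rewrite rintD; [|by apply: cts_onM; [exact: cts_on_cst|]|exact: cts_on_cst].
    rewrite (rintZ 1040 cIs) (rint_cst _ s0); apply: lerD.
      apply: ler_wpM2l; first exact: ler0n.
      rewrite (@rint_split _ _ r0 r1 s cI) ?s0 // lerDl; apply: rint_ge0 => r /andP[ra rb].
      by apply: mulr_ge0 (V0 r); rewrite subr_ge0; exact: le_trans rb (ltW r11).
    by apply: green_scale => //; apply: le_trans rh; rewrite lerD2r.
  rewrite Es; exact: green_collect b1 b2 b3.
have X0 : 0 <= En r0 + 2 * (r1 - r0) * `|Fl r0| + 1040 * rint r0 r1 (fun r => (1 - r) * rint a b (V r)).
  apply: addr_ge0; first apply: addr_ge0.
  - apply: rint_ge0 => t tb; have [/andP[k0 _] _] := cutoff_bounds tb.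
    by rewrite mulr_ge0 // addr_ge0 // -expr2 sqr_ge0.
  - by rewrite mulr_ge0 // mulr_ge0 // subr_ge0.
  - apply: mulr_ge0; first exact: ler0n.
    apply: rint_ge0 => r /andP[ra rb].
    by apply: mulr_ge0 (V0 r); rewrite subr_ge0; exact: le_trans rb (ltW r11).
apply: green_final X0 (bound rm rm_in) (rmP r1 _).
by rewrite r01 lexx.
Qed.

Definition green_const : R := 4 * 1040.

Lemma green_const_ge0 : 0 <= green_const.
Proof. by apply: mulr_ge0; exact: ler0n. Qed.

(** The cut-off is bounded below on the inner half of the arc, and the
    energy and flux at the starting radius are controlled by the bounds for
    [g - c] and its Euler derivative there. *)
Lemma local_oscillation (r0 r1 k1 k2 : R) : 2^-1 <= r0 -> r0 <= r1 -> r1 < 1 -> r1 - r0 <= h ->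
  (forall t, a <= t <= b -> cmod (g (cpolar r0 t) - c) <= k1) ->
  (forall t, a <= t <= b -> cmod (euler g (cpolar r0 t)) <= k2) ->
  rint (th - h / 2) (th + h / 2) (fun t => cmod (g (cpolar r1 t) - c) ^+ 2) <=
  8 * h * k1 ^+ 2 + 32 * h ^+ 2 * (k1 * k2) +
  green_const * rint r0 r1 (fun r => (1 - r) * rint a b (fun t => cmod (euler g (cpolar r t)) ^+ 2)).
Proof.
move=> r02 r01 r11 rh K1 K2.
have UE r t : cmod (g (cpolar r t) - c) ^+ 2 = U r t.
  by rewrite cmod_sqr cReB cImB !expr2.
have VE r t : cmod (euler g (cpolar r t)) ^+ 2 = V r t by rewrite cmod_sqr !expr2.
have r0b : 0 <= r0 < 1 by apply/andP; split; [exact: le_trans r02|exact: le_lt_trans r11].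
have r1b : 0 <= r1 < 1 by rewrite r11 andbT; apply: le_trans r01; case/andP: r0b.
have cU r : 0 <= r < 1 -> cts_on (U r) a b.
  by move=> rb; exact: (@ctsT U r rb (fun p pb => let: And5 x _ _ _ _ := ctsAll pb in x)).
have k10 : 0 <= k1 by apply: le_trans (K1 a _); [exact: cmod_ge0|rewrite lexx ab].
have k20 : 0 <= k2 by apply: le_trans (K2 a _); [exact: cmod_ge0|rewrite lexx ab].
have ba : b - a = 2 * h by rewrite opprB addrC addrA subrK -mulr2n mulr_natl.
have bE : En r0 <= k1 ^+ 2 * (2 * h).
  rewrite -ba; apply: rint_le_cst ab (cts_onM cchi (cU _ r0b)) _ => t tb.
  have [/andP[c0 c1] _] := cutoff_bounds tb.
  have u1 : U r0 t <= k1 ^+ 2 by rewrite -UE lerXn2r ?nnegrE ?cmod_ge0 // K1.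
  have u0 : 0 <= U r0 t by rewrite -UE sqr_ge0.
  by apply: le_trans u1; rewrite ler_piMl.
have bF : `|Fl r0| <= 2 * (k1 * k2) * (2 * h).
  have cD : cts_on (D r0) a b by exact: (@ctsT D r0 r0b (fun p pb => let: And5 _ _ x _ _ := ctsAll pb in x)).
  have kk : 0 <= 2 * (k1 * k2) by rewrite mulr_ge0 // mulr_ge0.
  have := @rint_approx R (fun t => chi t * D r0 t) a b 0 (2 * (k1 * k2)) ab (cts_onM cchi cD).
  rewrite mul0r subr0 ba; apply => t tb; rewrite subr0.
  have [/andP[c0 c1] _] := cutoff_bounds tb.
  rewrite normrM (ger0_norm c0); apply: le_trans (_ : 1 * `|D r0 t| <= _); first by rewrite ler_wpM2r.
  rewrite mul1r; apply: sqr_le_le => //; rewrite -normrX ger0_norm ?sqr_ge0 //.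
  apply: le_trans (_ : 4 * (U r0 t * V r0 t) <= _).
    exact: green_cauchy2.
  rewrite -UE -VE exprMn -natrX; apply: ler_wpM2l => //; rewrite exprMn.
  by apply: ler_pM; rewrite ?sqr_ge0 // lerXn2r ?nnegrE ?cmod_ge0 ?K1 ?K2.
have LG := local_green r02 r01 r11 rh.
have inner : rint (th - h / 2) (th + h / 2) (fun t => cmod (g (cpolar r1 t) - c) ^+ 2) <= 2 * En r1.
  have hh : h / 2 <= h by rewrite ler_pdivrMr // ler_peMr ?(ltW h0) // ler1n.
  have aa : a <= th - h / 2 by rewrite lerD2l lerN2.
  have bb : th + h / 2 <= b by rewrite lerD2l.
  have mm : th - h / 2 <= th + h / 2.
    by rewrite lerBlDr -addrA lerDl addr_ge0 // divr_ge0 // ltW.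
  have cX := cts_onM cchi (cU _ r1b).
  have pos t : a <= t <= b -> 0 <= chi t * U r1 t.
    by move=> /cutoff_bounds[/andP[c0 _] _]; rewrite mulr_ge0 // -UE sqr_ge0.
  have s1 := @rint_split R _ a b (th - h / 2) cX.
  have cX2 : cts_on (fun t => chi t * U r1 t) (th - h / 2) b by exact: cts_on_sub cX aa (lexx _).
  have s2 := @rint_split R _ (th - h / 2) b (th + h / 2) cX2.
  rewrite /green_energy s1 ?aa ?(le_trans mm bb) // s2 ?mm ?bb //.
  have p1 : 0 <= rint a (th - h / 2) (fun t => chi t * U r1 t).
    by apply: rint_ge0 => t /andP[ta tb]; apply: pos; rewrite ta (le_trans tb (le_trans mm bb)).
  have p2 : 0 <= rint (th + h / 2) b (fun t => chi t * U r1 t).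
    by apply: rint_ge0 => t /andP[ta tb]; apply: pos; rewrite tb andbT (le_trans aa (le_trans mm ta)).
  have cXm := cts_on_sub cX2 (lexx _) bb.
  apply: le_trans (_ : 2 * rint (th - h / 2) (th + h / 2) (fun t => chi t * U r1 t) <= _); last first.
    by rewrite ler_pM2l // addrCA lerDl addr_ge0.
  rewrite -(rintZ 2 cXm); apply: le_rint.
  - move=> t tb; have := cU _ r1b t.
    rewrite (_ : U r1 = (fun t => cmod (g (cpolar r1 t) - c) ^+ 2)); last by apply/funext => u; rewrite UE.
    apply; case/andP: tb => ta tb; rewrite (le_trans aa ta) (le_trans tb bb) //.
  - exact: cts_onM (@cts_on_cst R _ _ _) cXm.
  - move=> t tb; have c2 := cutoff_inner tb.
    rewrite UE mulrA ler_peMl -?UE ?sqr_ge0 //.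
    by rewrite -ler_pdivrMl // mulr1.
apply: (le_trans inner).
have EV : rint r0 r1 (fun r => (1 - r) * rint a b (fun t => cmod (euler g (cpolar r t)) ^+ 2)) =
    rint r0 r1 (fun r => (1 - r) * rint a b (V r)).
  by apply: eq_rint => r _; congr (_ * _); apply: eq_rint => t _; exact: VE.
rewrite EV; have d0 : 0 <= r1 - r0 by rewrite subr_ge0.
have bF2 : (r1 - r0) * `|Fl r0| <= h * (2 * (k1 * k2) * (2 * h)) by exact: ler_pM.
exact: green_sum LG bE bF2.
Qed.

End LocalGreen.

(** * Oscillation on circles of functions in the Carleson class *)

Section UpperDerivative.
Variable R : realType.

(** The fundamental theorem at an interior point, in the two-sided form that
    the product rule needs. *)
Lemma rint_upper_derive (f : R -> R) (u x v : R) : u < x -> x < v -> cts_on f u v ->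
  is_derive x (1 : R) (fun y => rint u y f) (f x).
Proof.
move=> ux xv cf; apply/is_derive_epsP => e e0.
have xin : u <= x <= v by rewrite !ltW.
have /cvgrPdist_le/(_ e e0)/nbhs_normP[k /= k0 kP] : f y @[y --> x] --> f x by exact: cf.
exists (Num.min k (Num.min (x - u) (v - x))); first by rewrite !lt_min k0 !subr_gt0 ux.
move=> h; rewrite !lt_min => /andP[hk /andP[hu hv]].
have near y : `|y - x| <= `|h| -> `|f y - f x| <= e.
  move=> yh; rewrite distrC; apply: kP; rewrite /ball_ /= distrC; exact: le_lt_trans yh hk.
have [h0|h0] := leP 0 h.
  rewrite ger0_norm // in hk hu hv *.
  have cs : cts_on f u (x + h) by apply: cts_on_sub cf _ _; lra.
  rewrite (@rint_split _ _ u (x + h) x cs); last by apply/andP; split; lra.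
  rewrite [rint u x f + _]addrC addrK.
  have -> : e * h = e * (x + h - x) by congr (_ * _); ring.
  have -> : f x * h = f x * (x + h - x) by congr (_ * _); ring.
  apply: rint_approx; [lra|by apply: cts_on_sub cf _ _; lra|].
  move=> y /andP[y1 y2]; apply: near; rewrite ger0_norm ?subr_ge0 // ger0_norm //; lra.
rewrite ltr0_norm // in hk hu hv *.
have cs : cts_on f u x by apply: cts_on_sub cf _ _; lra.
rewrite [X in _ - X - _](@rint_split _ _ u x (x + h) cs); last by apply/andP; split; lra.
rewrite opprD addrA subrr sub0r -opprD normrN.
have -> : e * - h = e * (x - (x + h)) by congr (_ * _); ring.
have -> : rint (x + h) x f + f x * h = rint (x + h) x f - f x * (x - (x + h)) by ring.
apply: rint_approx; [lra|by apply: cts_on_sub cf _ _; lra|].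
move=> y /andP[y1 y2]; apply: near; rewrite ler0_norm ?subr_le0 // ltr0_norm //; lra.
Qed.

Notation mu := (@lebesgue_measure R).

Lemma tonelli_box (A B : set R) (F : R -> R -> R) : measurable A -> measurable B ->
  measurable_fun (A `*` B) (fun p : R * R => F p.1 p.2) ->
  (forall x y, A x -> B y -> 0 <= F x y) ->
  (\int[mu]_(x in A) \int[mu]_(y in B) (F x y)%:E = \int[mu]_(y in B) \int[mu]_(x in A) (F x y)%:E)%E.
Proof.
move=> mA mB mF F0.
have mAB : measurable (A `*` B) by exact: measurableX.
pose G : R * R -> \bar R := (fun p => (F p.1 p.2)%:E) \_ (A `*` B).
have mG : measurable_fun setT G.
  by apply/(measurable_restrict _ mAB measurableT); rewrite setTI; exact/measurable_EFinP.
have G0 p : (0 <= G p)%E by apply: erestrict_ge0 => -[x y] [/= Ax By]; rewrite lee_fin F0.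
have GE (x y : R) : G (x, y) = ((fun x => ((fun y => (F x y)%:E) \_ B) y) \_ A) x.
  by rewrite /G !patchE in_setX; case: (x \in A); case: (y \in B).
transitivity (\int[mu]_x \int[mu]_y G (x, y))%E.
  rewrite [LHS]integral_mkcond; apply: eq_integral => x _.
  rewrite patchE; case: ifPn => Ax.
    rewrite [LHS]integral_mkcond; apply: eq_integral => y _.
    by rewrite GE !patchE Ax.
  by rewrite integral0_eq // => y _; rewrite GE patchE (negbTE Ax).
transitivity (\int[mu]_y \int[mu]_x G (x, y))%E; first exact: fubini_tonelli.
rewrite [RHS]integral_mkcond; apply: eq_integral => y _.
rewrite patchE; case: ifPn => By.
  rewrite [RHS]integral_mkcond; apply: eq_integral => x _.
  by rewrite GE !patchE By.
rewrite integral0_eq // => x _; rewrite GE !patchE (negbTE By).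
by case: ifP.
Qed.

End UpperDerivative.

Section CircleSquareMeans.
Variable R : realType.
Variable F : cplane R -> cplane R.
Hypothesis Fa : analytic F.

Lemma cts_polar_sqr (r t : R) : 0 <= r < 1 ->
  {for (r, t), continuous (fun p : R * R => cmod (F (cpolar p.1 p.2)) ^+ 2)}.
Proof.
move=> rb; have [c1 c2] := polar_cts t Fa rb.
have -> : (fun p : R * R => cmod (F (cpolar p.1 p.2)) ^+ 2) =
   (fun p => Re (F (cpolar p.1 p.2)) * Re (F (cpolar p.1 p.2)) +
             Im (F (cpolar p.1 p.2)) * Im (F (cpolar p.1 p.2))).
  by apply/funext => p; rewrite cmod_sqr !expr2.
exact: continuousD (continuousM c1 c1) (continuousM c2 c2).
Qed.

Lemma cts_circle_sqr (c d r : R) : 0 <= r < 1 ->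
  cts_on (fun t => cmod (F (cpolar r t)) ^+ 2) c d.
Proof.
move=> rb t _.
exact: (@cts_pair2 R (fun p : R * R => cmod (F (cpolar p.1 p.2)) ^+ 2) r t (@cts_polar_sqr r t rb)).
Qed.

Definition sqr_mean (c d r : R) := rint c d (fun t => cmod (F (cpolar r t)) ^+ 2).

Lemma cts_sqr_mean (c d a b : R) : 0 < a -> b < 1 -> cts_on (sqr_mean c d) a b.
Proof.
move=> a0 b1 r /andP[ra rb].
apply: (@rint_param_cts R (fun p : R * R => cmod (F (cpolar p.1 p.2)) ^+ 2) (r / 2) ((1 + r) / 2)).
  by apply/andP; split; lra.
by case=> x t /andP[/= pa pb] _; apply: cts_polar_sqr; apply/andP; split; lra.
Qed.

Lemma sqr_mean_ge0 (c d r : R) : 0 <= sqr_mean c d r.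
Proof. by apply: rint_ge0 => t _; rewrite exprn_ge0 ?cmod_ge0. Qed.

End CircleSquareMeans.

Section CarlesonLog.
Variable R : realType.
Local Notation C := R[i].
Notation mu := (@lebesgue_measure R).
Variable omega : cplane R -> R.
Local Notation w := (profile omega).
Local Notation W := (tail omega).
Local Notation S := (star_profile omega).
Hypothesis omega_crw : continuous_radial_weight omega.
Variable D : R.
Hypothesis D1 : 1 <= D.
Hypothesis dbl : forall r : R, 0 <= r < 1 -> W r <= D * W ((1 + r) / 2).
Variables (g : cplane R -> cplane R) (M : R).
Hypothesis ga : analytic g.
Hypothesis M0 : 0 <= M.
Hypothesis HM : forall I : R * R, is_arc I ->
  (polar_box I (fun r t => cmod (cderiv g (cpolar r t)) ^+ 2 * S r * r)%R
    <= (M * (W (arc_radius I) * arc_length I))%:E)%E.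

Let D0 : 0 < D. Proof. exact: lt_le_trans D1. Qed.

Lemma is_derive_tail (r : R) : 0 < r < 1 -> is_derive r (1 : R) W (- w r).
Proof.
move=> /andP[r0 r1]; set v := (1 + r) / 2.
have rv : r < v by rewrite /v; lra.
have v1 : v < 1 by rewrite /v; lra.
have cw : cts_on w 0 v by exact: profile_cts_on.
have dW := isdB (isd_cst (W 0) r) (rint_upper_derive r0 rv cw).
move: dW; rewrite sub0r => /is_derive_epsP dW; apply/is_derive_epsP => e /dW[k k0 kP].
exists (Num.min k (Num.min r (1 - r))); first by rewrite !lt_min k0 r0 subr_gt0.
move=> h; rewrite !lt_min => /andP[hk /andP[hr h1]].
have WE y : 0 <= y < 1 -> W y = W 0 - rint 0 y w.
  by move=> /andP[y0 y1]; rewrite (tail_split omega_crw (lexx 0) y0 y1) [_ + W y]addrC addrK.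
have [ha hb] : - `|h| <= h /\ h <= `|h| by split; [rewrite lerNl -normrN ler_norm|exact: ler_norm].
rewrite (WE (r + h)) 1?(WE r); first exact: kP.
  by rewrite (ltW r0).
by apply/andP; split; lra.
Qed.

Lemma cts_tail (a b : R) : 0 < a -> b < 1 -> cts_on W a b.
Proof.
move=> a0 b1 x /andP[xa xb]; apply: is_derive_cts (is_derive_tail _).
by rewrite (lt_le_trans a0) //= (le_lt_trans xb).
Qed.

Local Notation G := (sqr_mean (cderiv g)).
Let g'a := analytic_cderiv ga.

(** The density of the Carleson measure on circles, with the star weight
    replaced by its equivalent [(1 - r) W]. *)
Definition carleson_density (c d r : R) := (1 - r) * W r * G c d r.
Local Notation gam := carleson_density.

Lemma cts_gam (c d a b : R) : 0 < a -> b < 1 -> cts_on (gam c d) a b.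
Proof.
move=> a0 b1; apply: cts_onM; last exact: (cts_sqr_mean g'a).
apply: cts_onM; last exact: cts_tail.
by apply: cts_onB; [exact: cts_on_cst|move=> x _; exact: cvg_id].
Qed.

(** The square over [[c, c + l]] reaches down to the radius [1 - l]; on it
    the star weight is at least [(1 - r) W / (2 D)] and [r >= 1/2]. *)
Lemma carleson_box (c l rho : R) : 0 < l <= 2^-1 -> 1 - l <= rho -> rho < 1 ->
  rint (1 - l) rho (gam c (c + l)) <= 4 * D * M * l * W (1 - l).
Proof.
move=> /andP[l0 l2] lr r1; pose I : R * R := (c, c + l).
have LI : arc_length I = l by rewrite /arc_length /= addrC addKr.
have Ia : is_arc I.
  by rewrite /is_arc /=; apply/andP; split; [lra|have := pi_ge2 R; lra].
have rI : arc_radius I = 1 - l by rewrite /arc_radius LI; apply/max_idPr; lra.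
have s0 : 0 < 1 - l by lra.
have cg := @cts_gam c (c + l) _ _ s0 r1.
have k0 : 0 < (4 * D)^-1 by rewrite invr_gt0 mulr_gt0.
have D4 : 0 < 4 * D by rewrite mulr_gt0.
have HI := HM Ia; rewrite rI LI /polar_box rI /= in HI.
suff H : rint (1 - l) rho (fun r => (4 * D)^-1 * gam c (c + l) r) <= M * (W (1 - l) * l).
  move: H; rewrite rintZ // ler_pdivrMl // => H; apply: (le_trans H).
  by rewrite le_eqVlt; apply/orP; left; apply/eqP; ring.
rewrite -lee_fin; apply: le_trans HI.
have ck : cts_on (fun r => (4 * D)^-1 * gam c (c + l) r) (1 - l) rho.
  by apply: cts_onM => //; exact: cts_on_cst.
rewrite -rint_EFin //.
pose F (r t : R) := cmod (cderiv g (cpolar r t)) ^+ 2 * S r * r.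
have mF : measurable_fun ((`[1 - l, 1[%classic : set R) `*` (`[c, c + l]%classic : set R))
    (fun p : R * R => F p.1 p.2).
  pose E : set (R * R) := [set p | 0 < p.1 < 1].
  have oE : open E.
    rewrite openE => -[x y] /= /andP[x0 x1].
    exists (ball x (Num.min x (1 - x)), setT) => /=.
      split; last exact: filterT.
      by apply: nbhsx_ballx; rewrite lt_min x0 subr_gt0.
    move=> [x' y'] /= [+ _]; rewrite /ball /= lt_min ltr_norml => /andP[/andP[a1 a2] a3].
    move: a3; rewrite ltr_norml => /andP[a3 a4].
    by rewrite /E /=; apply/andP; split; lra.
  have sE : (`[1 - l, 1[%classic : set R) `*` (`[c, c + l]%classic : set R) `<=` E.
    by move=> [r t] /= []; rewrite in_itv /= => /andP[ra rb] _; rewrite /E /= rb andbT; lra.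
  have mS : measurable_fun E (fun p : R * R => S p.1).
    apply: (@measurable_comp _ _ _ _ _ _ (`[0, 1[%classic : set R) S _ (fun p : R * R => p.1)) => //.
    - move=> _ [[r t] /andP[ra rb] <-] /=; suff : 0 <= r < 1 by [].
      by rewrite ltW.
    - exact: measurable_star_profile.
    - by apply: measurable_funTS; exact: measurable_fst.
  apply: (@measurable_funS _ _ _ _ E) => //; first exact: open_measurable_plane.
  apply: measurable_funM; last by apply: measurable_funTS; exact: measurable_fst.
  apply: measurable_funM => //; apply: cts_measurable_plane => // -[r t] /andP[/= ra rb].
  by apply: (cts_polar_sqr g'a); rewrite ltW.
have F0 (r t : R) : 0 <= r -> 0 <= F r t.
  by move=> r0; rewrite /F mulr_ge0 // mulr_ge0 ?exprn_ge0 ?cmod_ge0 ?star_ge0.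
have mI1 : measurable (`[1 - l, 1[%classic : set R) by [].
have mI2 : measurable (`[c, c + l]%classic : set R) by [].
have F0' (r t : R) : (`[1 - l, 1[%classic : set R) r -> (`[c, c + l]%classic : set R) t -> 0 <= F r t.
  by move=> /= + _; rewrite in_itv /= => /andP[ra _]; apply: F0; apply: le_trans ra; exact: ltW.
have TB := tonelli_box mI1 mI2 mF F0'.
rewrite -[X in (_ <= X)%E]TB.
apply: ge0_le_integral_sub.
- by apply: subset_itvl; rewrite bnd_simp.
- move=> r rb; apply: integral_ge0 => t tb; rewrite lee_fin; exact: F0'.
move=> r /=; rewrite in_itv /= => /andP[ra rb].
have rp : 0 < r by lra.
have rlt : r < 1 by exact: le_lt_trans r1.
have rr : 0 <= r < 1 by rewrite rlt ltW.
have Wr := tail_gt0 omega_crw (ltW rp) rlt.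
apply/andP; split.
  rewrite lee_fin mulr_ge0 ?(ltW k0) // mulr_ge0 ?sqr_mean_ge0 // mulr_ge0 ?(ltW Wr) //.
  by rewrite subr_ge0 ltW.
have key : (4 * D)^-1 * ((1 - r) * W r) <= S r * r.
  rewrite ler_pdivrMl //; have h1 := star_ge omega_crw rp rlt; have h2 := dbl rr.
  have r2 : 2^-1 <= r by lra.
  have h3 : (1 - r) * W r <= (1 - r) * (D * W ((1 + r) / 2)) by rewrite ler_wpM2l // subr_ge0 ltW.
  have h4 : D * ((1 - r) / 2 * W ((1 + r) / 2)) <= D * S r by rewrite ler_pM2l.
  have h5 : D * S r * 2^-1 <= D * S r * r.
    by rewrite ler_wpM2l // mulr_ge0 ?star_ge0 // ltW.
  apply: (le_trans h3); move: h4 h5; move: (W _) (S r) => y z; lra.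
rewrite /gam mulrA /sqr_mean -rintZ; last exact: (cts_circle_sqr g'a).
have cc : cts_on (fun t => (4 * D)^-1 * ((1 - r) * W r) * cmod (cderiv g (cpolar r t)) ^+ 2) c (c + l).
  by apply: cts_onM; [exact: cts_on_cst|exact: (cts_circle_sqr g'a)].
rewrite -rint_EFin //.
apply: ge0_le_integral_same => t _; rewrite !lee_fin.
have X0 : 0 <= cmod (cderiv g (cpolar r t)) ^+ 2 by rewrite exprn_ge0 ?cmod_ge0.
apply/andP; split.
  by rewrite mulr_ge0 // mulr_ge0 ?(ltW k0) // mulr_ge0 ?(ltW Wr) // subr_ge0 ltW.
by rewrite /F -mulrA [leRHS]mulrC ler_wpM2r.
Qed.

Lemma carleson_boxes (c l rho : R) N : 0 < l <= 2^-1 -> 1 - l <= rho -> rho < 1 ->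
  rint (1 - l) rho (gam c (c + N%:R * l)) <= N%:R * (4 * D * M * l * W (1 - l)).
Proof.
move=> lb lr r1; have /andP[l0 l2] := lb; have s0 : 0 < 1 - l by lra.
have in01 r : 1 - l <= r <= rho -> 0 <= r < 1 by move=> /andP[ra rb]; apply/andP; split; lra.
elim: N => [|N IH].
  rewrite mul0r addr0 mul0r le_eqVlt; apply/orP; left; apply/eqP.
  rewrite (@eq_rint _ _ (fun=> 0)) ?rint_cst ?mul0r // => r _.
  by rewrite /gam /sqr_mean /rint set_itv1 Rintegral_set1 mulr0.
have -> : c + N.+1%:R * l = c + N%:R * l + l by rewrite -natr1; ring.
rewrite -natr1 mulrDl mul1r.
have cg u v := @cts_gam u v _ _ s0 r1.
have -> : rint (1 - l) rho (gam c (c + N%:R * l + l)) =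
   rint (1 - l) rho (gam c (c + N%:R * l)) + rint (1 - l) rho (gam (c + N%:R * l) (c + N%:R * l + l)).
  rewrite -rintD //; apply: eq_rint => r rb; rewrite /gam -mulrDr; congr (_ * _).
  apply: rint_split; first exact: (@cts_circle_sqr R _ g'a _ _ r (in01 r rb)).
  by rewrite lerDl mulr_ge0 ?(ltW l0) //= lerDl ltW.
by apply: lerD => //; exact: carleson_box.
Qed.

(** At the radius [s] the arc is covered by about [h / (1 - s)] arcs of
    length [1 - s], each carrying a Carleson square; the lengths add up to
    at most [3 h]. *)
Lemma carleson_wide (a b h s rho : R) : 0 < h <= 2^-1 -> a <= b -> b - a <= 2 * h ->
  1 - h <= s -> s <= rho -> rho < 1 ->
  rint s rho (gam a b) <= 12 * D * M * h * W s.
Proof.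
move=> /andP[h0 h2] ab bah hs sr r1; pose l := 1 - s.
have l0 : 0 < l by rewrite /l; lra.
have lh : l <= h by rewrite /l; lra.
have sE : s = 1 - l by rewrite /l; ring.
have x0 : 0 <= 2 * h / l by rewrite divr_ge0 // ?(ltW l0) // mulr_ge0 // ltW.
have /andP[t1 t2] := truncn_itv x0; pose N := (Num.truncn (2 * h / l)).+1.
have N1 : 2 * h <= N%:R * l by rewrite -ler_pdivrMr // ltW.
have N2 : N%:R * l <= 3 * h.
  rewrite /N -natr1 mulrDl mul1r; move: t1; rewrite ler_pdivlMr //.
  move: (_ * l) => z; lra.
have in01 r : s <= r <= rho -> 0 <= r < 1 by move=> /andP[ra rb]; apply/andP; split; lra.
have s0 : 0 < s by lra.
have cg u v := @cts_gam u v _ _ s0 r1.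
have Ws : 0 <= W s by apply: ltW; apply: (tail_gt0 omega_crw); lra.
apply: (@le_trans _ _ (rint s rho (gam a (a + N%:R * l)))).
  apply: le_rint => // r rb; have /andP[r0 r1'] := in01 r rb.
  rewrite /gam; apply: ler_wpM2l.
    by apply: mulr_ge0; [rewrite subr_ge0 ltW|apply: ltW; exact: (tail_gt0 omega_crw)].
  have bN : b <= a + N%:R * l by move: N1; move: (_ * l) => z; lra.
  have cc u v := @cts_circle_sqr R _ g'a u v r (in01 r rb).
  rewrite /sqr_mean (@rint_split R _ a (a + N%:R * l) b); last by rewrite ab.
    by rewrite lerDl; exact: sqr_mean_ge0.
  exact: cc.
have lb : 0 < l <= 2^-1 by rewrite l0; lra.
have sr' : 1 - l <= rho by rewrite -sE.
have := carleson_boxes a N lb sr' r1; rewrite -sE => H; apply: (le_trans H).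
have -> : N%:R * (4 * D * M * l * W s) = 4 * D * M * W s * (N%:R * l) by ring.
have -> : 12 * D * M * h * W s = 4 * D * M * W s * (3 * h) by ring.
apply: ler_wpM2l => //; apply: mulr_ge0 => //; apply: mulr_ge0 => //.
by apply: mulr_ge0; [exact: ler0n|exact: ltW].
Qed.

Lemma is_derive_carleson_mass (a b k s0 s : R) : 0 < s0 -> s0 < s -> s < 1 ->
  is_derive s (1 : R) (fun s => k - rint s0 s (gam a b)) (- gam a b s).
Proof.
move=> p0 p1 p2; have p3 : s < (1 + s) / 2 by lra.
have v1 : (1 + s) / 2 < 1 by lra.
have cg := @cts_gam a b _ _ p0 v1.
by have d := isdB (isd_cst k s) (rint_upper_derive p1 p3 cg); rewrite sub0r in d.
Qed.

Lemma is_derive_ln_tail (s : R) : 0 < s < 1 ->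
  is_derive s (1 : R) (fun s => - ln (W s)) (w s / W s).
Proof.
move=> sb; have /andP[s0 s1] := sb.
have Ws := tail_gt0 omega_crw (ltW s0) s1.
have dW := is_derive_tail sb.
have dl := is_derive1_comp (f := @ln R) (g := W) (x := s) (is_derive1_ln Ws) dW.
have d := is_deriveN dl.
by apply: is_derive_eq; rewrite /GRing.scale /=; ring.
Qed.

Lemma is_derive_inv_tail (s : R) : 0 < s < 1 ->
  is_derive s (1 : R) (fun s => (W s)^-1) (w s / W s / W s).
Proof.
move=> sb; have /andP[s0 s1] := sb.
have Ws := tail_gt0 omega_crw (ltW s0) s1.
have dW := is_derive_tail sb.
have d := is_deriveV (lt0r_neq0 Ws) dW.
apply: is_derive_eq; rewrite /GRing.scale /=; field; exact: lt0r_neq0.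
Qed.

(** Dividing the density by [W] costs an integration by parts: with [P] the
    mass beyond a radius, [P <= k W], the boundary term is at most [k] and
    the integral term is at most [k] times the integral of [w / W = (- ln
    W)']. This is where the logarithm of the tail enters. *)
Lemma carleson_log (a b h rho : R) : 0 < h <= 2^-1 -> a <= b -> b - a <= 2 * h ->
  1 - h <= rho -> rho < 1 ->
  rint (1 - h) rho (fun r => (1 - r) * G a b r) <=
  12 * D * M * h * (1 + (ln (W (1 - h)) - ln (W rho))).
Proof.
move=> hb ab bah hr r1; have /andP[h0 h2] := hb; set k := 12 * D * M * h.
have k0 : 0 <= k.
  by apply: mulr_ge0; [apply: mulr_ge0 => //; apply: mulr_ge0; [exact: ler0n|exact: ltW]|exact: ltW].
pose a0 := 1 - h; rewrite -/a0.
have a02 : 2^-1 <= a0 by rewrite /a0; lra.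
have u0 : 0 < 4^-1 :> R by rewrite invr_gt0 ltr0n.
pose K := rint 4^-1 rho (gam a b); pose P s := K - rint 4^-1 s (gam a b).
have in01 r : a0 <= r <= rho -> 0 < r < 1 by move=> /andP[ra rb]; apply/andP; split; lra.
have Wp r : a0 <= r <= rho -> 0 < W r.
  by move=> /in01/andP[r0 rr]; apply: (tail_gt0 omega_crw) => //; exact: ltW.
have dP r : a0 <= r <= rho -> is_derive r (1 : R) P (- gam a b r).
  move=> rb; have /andP[r0 rr] := in01 _ rb.
  by apply: is_derive_carleson_mass => //; move: rb => /andP[ra _]; lra.
have PE r : a0 <= r <= rho -> P r = rint r rho (gam a b).
  move=> rb; have cg := @cts_gam a b _ _ u0 r1.
  rewrite /P /K (@rint_split R _ 4^-1 rho r cg); first by rewrite addrAC subrr add0r.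
  by move: rb => /andP[ra rb]; apply/andP; split; lra.
have a00 : a0 <= a0 <= rho by rewrite lexx.
have rr0 : a0 <= rho <= rho by rewrite lexx andbT.
have P0 : P rho = 0 by rewrite /P /K subrr.
have Pk r : a0 <= r <= rho -> P r <= k * W r.
  by move=> rb; rewrite PE //; move: rb => /andP[ra rb]; exact: carleson_wide.
have cV : cts_on (fun r => (W r)^-1) a0 rho.
  by move=> r rb; exact: is_derive_cts (is_derive_inv_tail (in01 _ rb)).
have cw : cts_on w a0 rho by apply: (profile_cts_on omega_crw) => //; lra.
have cP : cts_on P a0 rho by move=> r rb; exact: is_derive_cts (dP _ rb).
have cG : cts_on (fun r => (1 - r) * G a b r) a0 rho.
  apply: cts_onM; last by apply: (cts_sqr_mean g'a) => //; lra.
  by apply: cts_onB; [exact: cts_on_cst|move=> x _; exact: cvg_id].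
have cwV : cts_on (fun r => w r * (W r)^-1) a0 rho by exact: cts_onM.
have cQ : cts_on (fun r => P r * (w r * (W r)^-1 * (W r)^-1)) a0 rho.
  by apply: cts_onM => //; exact: cts_onM.
have cT : cts_on (fun r => P r * (w r * (W r)^-1 * (W r)^-1) - (1 - r) * G a b r) a0 rho.
  exact: cts_onB.
have dH r : a0 <= r <= rho -> is_derive r (1 : R) (fun r => P r * (W r)^-1)
    (P r * (w r * (W r)^-1 * (W r)^-1) - (1 - r) * G a b r).
  move=> rb; have d := isdM (dP _ rb) (is_derive_inv_tail (in01 _ rb)).
  apply: is_derive_eq; rewrite /gam; move: (Wp _ rb) => Wr.
  by move: (P r) (w r) (G a b r) (W r) Wr => p q s v v0; field; exact: lt0r_neq0.
(* [P / W] vanishes at [rho], so only the boundary term at [1 - h] remains. *)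
have E := rint_FTC hr cT dH.
rewrite rintB // P0 mul0r sub0r in E.
have -> : rint a0 rho (fun r => (1 - r) * G a b r) =
   P a0 * (W a0)^-1 + rint a0 rho (fun r => P r * (w r * (W r)^-1 * (W r)^-1)).
  by move: E; move: (rint _ _ _) (rint _ _ _) (P a0 * _) => x y z; lra.
have L : rint a0 rho (fun r => w r * (W r)^-1) = ln (W a0) - ln (W rho).
  have dL r : a0 <= r <= rho -> is_derive r (1 : R) (fun r => - ln (W r)) (w r * (W r)^-1).
    by move=> rb; exact: is_derive_ln_tail (in01 _ rb).
  by rewrite (rint_FTC hr cwV dL) opprK addrC.
rewrite mulrDr mulr1 -L -rintZ //; apply: lerD.
  by rewrite ler_pdivrMr ?Pk //; exact: Wp.
apply: le_rint => //; first by apply: cts_onM => //; exact: cts_on_cst.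
move=> r rb; have Wr := Wp _ rb; have /andP[r0 rr] := in01 _ rb.
have wr : 0 <= w r * (W r)^-1.
  apply: mulr_ge0; last by rewrite invr_ge0 ltW.
  by apply: ltW; apply: (profile_gt0 omega_crw); rewrite (ltW r0) rr.
have -> : P r * (w r * (W r)^-1 * (W r)^-1) = (P r * (W r)^-1) * (w r * (W r)^-1) by ring.
by apply: ler_wpM2r => //; rewrite ler_pdivrMr // Pk.
Qed.

Variable B : R.
Hypothesis gB : forall z : cplane R, cmod z < 1 -> cmod (cderiv g z) * (1 - cmod z) <= B.

Lemma cmod_euler_le (r t : R) : 0 <= r < 1 ->
  cmod (euler g (cpolar r t)) <= cmod (cderiv g (cpolar r t)).
Proof.
move=> /andP[r0 r1]; rewrite /euler cmodM cmod_cpolar // ler_piMl ?cmod_ge0 //; exact: ltW.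
Qed.

Definition osc_const := 96 * B ^+ 2 + green_const R * (12 * D * M).
(** Normalised to be at least 1, so that constants can be absorbed into it. *)
Definition log_growth (r : R) := 1 + (ln (W 0) - ln (W r)).

Lemma osc_const_ge0 : 0 <= osc_const.
Proof.
apply: addr_ge0; first by apply: mulr_ge0; [exact: ler0n|exact: sqr_ge0].
apply: mulr_ge0; first exact: green_const_ge0.
by apply: mulr_ge0 => //; apply: mulr_ge0; [exact: ler0n|exact: ltW].
Qed.

Lemma log_growth_ge1 (r : R) : 0 <= r < 1 -> 1 <= log_growth r.
Proof.
move=> /andP[r0 r1]; rewrite /log_growth lerDl subr_ge0 ler_ln ?posrE.
- exact: (tail_mono omega_crw (lexx 0) r0 r1).
- exact: (tail_gt0 omega_crw).
- by apply: (tail_gt0 omega_crw) => //; exact: ltr01.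
Qed.

(** The local Green formula is started at the radius [1 - h], where by the
    Bloch estimate [g] is nearly constant on the arc at scale [h]; the area
    term is the logarithmic Carleson bound. *)
Lemma circle_oscillation (h th rho : R) : 0 < h <= 2^-1 -> 1 - h <= rho -> rho < 1 ->
  rint (th - h / 2) (th + h / 2)
    (fun t => cmod (g (cpolar rho t) - g (cpolar (1 - h) th)) ^+ 2) <=
  osc_const * h * log_growth rho.
Proof.
move=> hb hr r1; have /andP[h0 h2] := hb.
have B0 : 0 <= B := bloch_ge0 gB.
have p1 : 2^-1 <= 1 - h by lra.
have p2 : rho - (1 - h) <= h by lra.
have q0 : 0 < 1 - h by lra.
have q1 : 1 - h < 1 by lra.
have hE : 1 - (1 - h) = h by ring.
have hh : h / h = 1 by rewrite divff ?lt0r_neq0.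
have K1 t : th - h <= t <= th + h ->
    cmod (g (cpolar (1 - h) t) - g (cpolar (1 - h) th)) <= 2 * B.
  move=> /andP[ta tb].
  have bnd x : x <= h -> 2 * (B * (x / (1 - (1 - h)))) <= 2 * B.
    move=> xh; rewrite hE ler_pM2l ?ltr0n // ler_piMr // ler_pdivrMr // mul1r //.
  have [tt|tt] := leP th t.
    by apply: (le_trans (bloch_angular ga gB q0 q1 tt)); apply: bnd; lra.
  rewrite -cmodN opprB; apply: (le_trans (bloch_angular ga gB q0 q1 (ltW tt))).
  by apply: bnd; lra.
have K2 t : th - h <= t <= th + h -> cmod (euler g (cpolar (1 - h) t)) <= B / h.
  move=> _; have rb : 0 <= 1 - h < 1 by rewrite q1 ltW.
  apply: (le_trans (cmod_euler_le t rb)); rewrite ler_pdivlMr //.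
  have z1 : cmod (cpolar (1 - h) t) < 1 by rewrite cmod_cpolar ?(ltW q0).
  by have := gB z1; rewrite cmod_cpolar ?(ltW q0) // hE.
have L := local_oscillation ga h0 p1 hr r1 p2 K1 K2.
apply: (le_trans L).
have ab : th - h <= th + h by lra.
have abh : th + h - (th - h) <= 2 * h by lra.
have in01 r : 1 - h <= r <= rho -> 0 <= r < 1 by move=> /andP[ra rb]; apply/andP; split; lra.
have T : rint (1 - h) rho (fun r => (1 - r) *
      rint (th - h) (th + h) (fun t => cmod (euler g (cpolar r t)) ^+ 2)) <=
    12 * D * M * h * log_growth rho.
  have H1 := carleson_log hb ab abh hr r1.
  apply: (@le_trans _ _ (rint (1 - h) rho (fun r => (1 - r) * G (th - h) (th + h) r))).
    have cl : cts_on (fun r : R => 1 - r) (1 - h) rho.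
      by apply: cts_onB; [exact: cts_on_cst|move=> x _; exact: cvg_id].
    apply: le_rint.
    - apply: cts_onM => //; exact: (cts_sqr_mean (analytic_euler ga)).
    - apply: cts_onM => //; exact: (cts_sqr_mean g'a).
    move=> r rb; have rb' := in01 r rb; apply: ler_wpM2l; first by case/andP: rb' => _ rr; rewrite subr_ge0 ltW.
    apply: le_rint => [||t _].
    - exact: (cts_circle_sqr (analytic_euler ga)).
    - exact: (cts_circle_sqr g'a).
    by rewrite lerXn2r ?nnegrE ?cmod_ge0 // cmod_euler_le.
  apply: (le_trans H1); apply: ler_wpM2l.
    by apply: mulr_ge0; [apply: mulr_ge0 => //; apply: mulr_ge0; [exact: ler0n|exact: ltW]|exact: ltW].
  rewrite lerD2l lerD2r ler_ln ?posrE.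
  - exact: (tail_mono omega_crw (lexx 0) (ltW q0) q1).
  - exact: (tail_gt0 omega_crw (ltW q0)).
  - by apply: (tail_gt0 omega_crw) => //; exact: ltr01.
have g0 := green_const_ge0 R.
have Y1 : 1 <= log_growth rho by apply: log_growth_ge1; apply: in01; rewrite lexx hr.
have T' := ler_wpM2l g0 T.
have -> : 8 * h * (2 * B) ^+ 2 + 32 * h ^+ 2 * (2 * B * (B / h)) = 96 * B ^+ 2 * h.
  by field; exact: lt0r_neq0.
have X0 : 0 <= 96 * B ^+ 2 * h.
  by apply: mulr_ge0; [apply: mulr_ge0; [exact: ler0n|exact: sqr_ge0]|exact: ltW].
have X1 := ler_wpM2l X0 Y1; rewrite mulr1 in X1.
have -> : osc_const * h * log_growth rho = 96 * B ^+ 2 * h * log_growth rho +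
   green_const R * (12 * D * M * h * log_growth rho) by rewrite /osc_const; ring.
exact: lerD.
Qed.

End CarlesonLog.

(** * A dyadic John-Nirenberg inequality *)

Section DyadicJohnNirenberg.
Variable R : realType.
Local Notation C := (cplane R).

Lemma sqr_triangle (x y z : C) :
  cmod (x - z) ^+ 2 <= 2 * cmod (x - y) ^+ 2 + 2 * cmod (y - z) ^+ 2.
Proof.
have -> : x - z = (x - y) + (y - z) by rewrite addrA subrK.
have H := cmodD_le (x - y) (y - z); have H0 := cmod_ge0 ((x - y) + (y - z)).
apply: (@le_trans _ _ ((cmod (x - y) + cmod (y - z)) ^+ 2)).
  by rewrite lerXn2r ?nnegrE // addr_ge0 ?cmod_ge0.
move: (cmod _) (cmod _) => v u; rewrite -subr_ge0.
have -> : 2 * u ^+ 2 + 2 * v ^+ 2 - (u + v) ^+ 2 = (u - v) ^+ 2 by ring.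
exact: sqr_ge0.
Qed.

Lemma power_sum_le (s u v : R) n : 0 <= s -> 0 <= u -> 0 <= v -> s <= 2 * u + 2 * v ->
  s ^+ n <= 4 ^+ n * (u ^+ n + v ^+ n).
Proof.
move=> s0 u0 v0 H; rewrite mulrDr -!exprMn.
have [uv|/ltW uv] := leP u v.
  apply: (@le_trans _ _ ((4 * v) ^+ n)); last first.
    by rewrite lerDr exprn_ge0 // mulr_ge0.
  by rewrite lerXn2r ?nnegrE ?mulr_ge0 //; lra.
apply: (@le_trans _ _ ((4 * u) ^+ n)); last first.
  by rewrite lerDl exprn_ge0 // mulr_ge0.
by rewrite lerXn2r ?nnegrE ?mulr_ge0 //; lra.
Qed.

Let alg1 (A a b V : R) : 0 < A -> b * (8 * A * V) <= 4 * A * (2 * a) -> b * V <= a.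
Proof.
move=> A0 H; rewrite -(ler_pM2l (_ : 0 < 8 * A)) ?mulr_gt0 //.
have -> : 8 * A * (b * V) = b * (8 * A * V) by ring.
by have -> : 8 * A * a = 4 * A * (2 * a) by ring.
Qed.

Let alg2 (u v w : R) : v <= 2 * w + 2 * u -> 4 * u <= v -> v <= 4 * w.
Proof. lra. Qed.

Let alg3 (s t k Lam : R) : s <= k -> t <= Lam -> 2 * s + 2 * t <= 2 * Lam + 2 * k.
Proof. lra. Qed.

Let alg4 (z : R) : 1 <= z -> 4 <= 8 * z.
Proof. lra. Qed.

Variables (f : R -> C) (cc : nat -> R -> C) (l0 k V Lam : R) (n N : nat).
Definition dyadic_length (d : nat) : R := 2 ^+ d * l0.
Local Notation len := dyadic_length.
Local Notation q c := (fun t => cmod (f t - c) ^+ 2).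
Hypothesis l00 : 0 < l0.
Hypothesis k0 : 0 <= k.
Hypothesis V0 : 0 <= V.
Hypothesis Lam0 : 0 < Lam.
Hypothesis LamV : 8 * 4 ^+ n * V <= Lam.
Hypothesis cf : forall c a b, cts_on (q c) a b.
Hypothesis osc : forall d x, (d <= N)%N -> rint x (x + len d) (q (cc d x)) <= V * len d.
Hypothesis leaf : forall x t, x <= t <= x + len 0 -> cmod (f t - cc 0 x) ^+ 2 <= k.
Hypothesis child : forall d x, (d < N)%N ->
  cmod (cc d x - cc d.+1 x) ^+ 2 <= k /\ cmod (cc d (x + len d) - cc d.+1 x) ^+ 2 <= k.

Let A : R := 4 ^+ n.
Let K : R := 2 * Lam + 2 * k.
Let a : R := A * K ^+ n.
Let X : R := 2 * a.
Let b : R := 4 * A * X / Lam.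

Let A1 : 1 <= A. Proof. by apply: exprn_ege1; rewrite ler1n. Qed.
Let K0 : 0 <= K. Proof. by apply: addr_ge0; apply: mulr_ge0 => //; exact: ltW. Qed.
Let a0 : 0 <= a. Proof. by rewrite /a mulr_ge0 ?exprn_ge0 // (le_trans _ A1). Qed.
Let X0 : 0 <= X. Proof. by rewrite /X mulr_ge0. Qed.
Let b0 : 0 <= b.
Proof.
apply: divr_ge0; last exact: ltW.
by apply: mulr_ge0 => //; apply: mulr_ge0 => //; exact: le_trans A1.
Qed.
Let bLam : b * Lam = 4 * A * X. Proof. by rewrite /b divfK // gt_eqF. Qed.

Let len0 d : 0 < len d. Proof. by rewrite /len mulr_gt0 // exprn_gt0. Qed.

Let cfn c x y : cts_on (fun t => q c t ^+ n) x y.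
Proof. by apply: cts_onX; exact: cf. Qed.

Let q0 c t : 0 <= q c t. Proof. by rewrite exprn_ge0 ?cmod_ge0. Qed.

(** The term with [b] is not bounded a priori but additive over children;
    this is what keeps the constants from growing with the depth. *)
Definition moment_bound d := forall x c, cmod (cc d x - c) ^+ 2 <= Lam ->
  rint x (x + len d) (fun t => q c t ^+ n) <= a * len d + b * rint x (x + len d) (q c).

Lemma moment_of_bound d x : (d <= N)%N -> moment_bound d ->
  rint x (x + len d) (fun t => q (cc d x) t ^+ n) <= X * len d.
Proof.
move=> dN /(_ x (cc d x)); rewrite subrr cmod0 expr0n /= => /(_ (ltW Lam0)) H.
apply: (le_trans H); have O := ler_wpM2l b0 (osc x dN).
have bV : b * V <= a.
  have h1 : b * (8 * A * V) <= b * Lam by exact: ler_wpM2l.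
  rewrite bLam in h1; have Ap : 0 < A := lt_le_trans ltr01 A1.
  exact: alg1 Ap h1.
have h2 : b * (V * len d) <= a * len d by rewrite mulrA ler_wpM2r // ltW.
have -> : X * len d = a * len d + a * len d by rewrite /X; ring.
by rewrite lerD2l; exact: le_trans O h2.
Qed.

(** The second alternative is the stopping case: as the centre moved by more
    than [Lam] (squared) and the oscillation around it is at most [V], the
    square mean of [f - c] is at least [Lam / 4]. *)
Lemma moment_child d y c : (d <= N)%N -> moment_bound d -> cmod (cc d y - c) ^+ 2 <= K ->
  rint y (y + len d) (fun t => q c t ^+ n) <= a * len d + b * rint y (y + len d) (q c).
Proof.
move=> dN U cK; have ll := len0 d; have yl : y <= y + len d by rewrite lerDl ltW.
have [cL|cL] := leP (cmod (cc d y - c) ^+ 2) Lam; first exact: U.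
have T := moment_of_bound y dN U.
have cX : cts_on (fun t => A * (q (cc d y) t ^+ n + K ^+ n)) y (y + len d).
  by apply: cts_onM; [exact: cts_on_cst|apply: cts_onD => //; exact: cts_on_cst].
have h1 : rint y (y + len d) (fun t => q c t ^+ n) <= A * (X * len d) + a * len d.
  apply: (@le_trans _ _ (rint y (y + len d) (fun t => A * (q (cc d y) t ^+ n + K ^+ n)))).
    apply: le_rint => // t _; apply: power_sum_le => //.
    apply: (le_trans (sqr_triangle (f t) (cc d y) c)).
    by rewrite lerD2l; apply: ler_wpM2l => //; exact: ler0n.
  rewrite rintZ; last by apply: cts_onD => //; exact: cts_on_cst.
  rewrite rintD //; last exact: cts_on_cst.
  have ly : y + len d - y = len d by rewrite addrAC subrr add0r.
  rewrite rint_cst // ly mulrDr [A * (K ^+ n * _)]mulrA lerD2r.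
  by apply: ler_wpM2l => //; exact: le_trans A1.
have h2 : Lam * len d <= 2 * rint y (y + len d) (q c) + 2 * (V * len d).
  have O := osc y dN.
  have E : rint y (y + len d) (fun t => 2 * q c t + 2 * q (cc d y) t) =
     2 * rint y (y + len d) (q c) + 2 * rint y (y + len d) (q (cc d y)).
    rewrite rintD; last 2 first.
    - by apply: cts_onM => //; exact: cts_on_cst.
    - by apply: cts_onM => //; exact: cts_on_cst.
    by rewrite !rintZ.
  apply: (@le_trans _ _ (rint y (y + len d) (fun t => 2 * q c t + 2 * q (cc d y) t))); last first.
    by rewrite E lerD2l; apply: ler_wpM2l => //; exact: ler0n.
  have -> : Lam * len d = Lam * (y + len d - y) by rewrite addrAC subrr add0r.
  apply: rint_ge_cst => //.
    by apply: cts_onD; apply: cts_onM => //; exact: cts_on_cst.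
  move=> t _; apply: (le_trans (ltW cL)).
  have := sqr_triangle (cc d y) (f t) c.
  have -> : cmod (cc d y - f t) = cmod (f t - cc d y) by rewrite -cmodN opprB.
  by rewrite [X in _ <= X -> _]addrC.
have V4 : 4 * V <= Lam.
  by apply: le_trans LamV; apply: ler_wpM2r => //; exact: alg4.
have h3 : Lam * len d <= 4 * rint y (y + len d) (q c).
  have := ler_wpM2r (ltW ll) V4; move: h2.
  have -> : 4 * V * len d = 4 * (V * len d) by ring.
  exact: alg2.
have h4 := ler_wpM2l b0 h3.
have h5 : A * (X * len d) <= b * rint y (y + len d) (q c).
  move: h4; rewrite [b * (Lam * _)]mulrA bLam.
  have -> : 4 * A * X * len d = 4 * (A * (X * len d)) by ring.
  have -> : b * (4 * rint y (y + len d) (q c)) = 4 * (b * rint y (y + len d) (q c)) by ring.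
  by rewrite ler_pM2l.
by apply: (le_trans h1); rewrite addrC lerD2l.
Qed.

Lemma moment_bound_all d : (d <= N)%N -> moment_bound d.
Proof.
elim: d => [_|d IH dN] x c cL.
  have l0' := len0 0; have xl : x <= x + len 0 by rewrite lerDl ltW.
  apply: (@le_trans _ _ (a * len 0)); last first.
    by rewrite lerDl mulr_ge0 //; apply: rint_ge0 => t _; exact: q0.
  have -> : a * len 0 = a * (x + len 0 - x) by rewrite addrAC subrr add0r.
  apply: rint_le_cst => // t tb; apply: (@le_trans _ _ (K ^+ n)).
    rewrite lerXn2r ?nnegrE //; apply: (le_trans (sqr_triangle (f t) (cc 0 x) c)).
    exact: alg3 (leaf tb) cL.
  by rewrite /a ler_peMl // exprn_ge0.
have [c1 c2] := child x dN; have dN' : (d <= N)%N := ltnW dN.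
have tr z : cmod (z - cc d.+1 x) ^+ 2 <= k -> cmod (z - c) ^+ 2 <= K.
  move=> zk; apply: (le_trans (sqr_triangle z (cc d.+1 x) c)).
  exact: alg3 zk cL.
have lE : len d.+1 = len d + len d by rewrite /len exprS; ring.
have M1 := moment_child dN' (IH dN') (tr _ c1).
have M2 := moment_child dN' (IH dN') (tr _ c2).
have mid : x <= x + len d <= x + len d.+1.
  by rewrite lE addrA !lerDl andbb ltW.
have S1 := rint_split (@cfn c x (x + len d.+1)) mid.
have S2 := rint_split (@cf c x (x + len d.+1)) mid.
rewrite S1 S2 lE mulrDr mulrDr.
have eqx : x + (len d + len d) = x + len d + len d by rewrite addrA.
rewrite eqx.
by rewrite addrACA; exact: lerD.
Qed.

(** A good-lambda argument by induction on the depth, of which the leaves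
    are arcs on which [f] is within bounded distance of its centre. For a
    constant [c] close to the centre of the parent, either the centre of a
    child is still close to [c] and the induction applies with the same [c],
    or it has moved by more than [sqrt Lam]; such children carry a large
    part of the square oscillation, which pays for the crude bound of their
    higher moment. The term with [b] is that payment, and [Lam >= 8 4^n V]
    closes the induction. *)
Lemma dyadic_moment d x : (d <= N)%N ->
  rint x (x + len d) (fun t => q (cc d x) t ^+ n) <= 2 * (4 ^+ n * (2 * Lam + 2 * k) ^+ n) * len d.
Proof. by move=> dN; apply: moment_of_bound => //; exact: moment_bound_all. Qed.

End DyadicJohnNirenberg.

Lemma dyadic_scale (R : realType) (y : R) : 0 < y <= 2^-1 ->
  exists N, y <= 2^-1 / 2 ^+ N <= 2 * y.
Proof.
move=> /andP[y0 y2].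
have [m mP] : exists m, 2^-1 / 2 ^+ m < y.
  exists (Num.truncn y^-1).+1; have yi : 0 <= y^-1 by rewrite invr_ge0 ltW.
  have /andP[_ t2] := truncn_itv yi; set m := (Num.truncn _).+1 in t2 *.
  have h : (m%:R : R) <= 2 ^+ m by rewrite -natrX ler_nat ltnW // ltn_expl.
  have p0 : 0 < 2 ^+ m :> R by rewrite exprn_gt0.
  rewrite ltr_pdivrMr //; have h2 : y^-1 < 2 ^+ m by exact: lt_le_trans h.
  have : y * y^-1 < y * 2 ^+ m by rewrite ltr_pM2l.
  by rewrite divff ?gt_eqF //; move: (y * _) => z; lra.
elim: m mP => [|m IH mP]; first by rewrite expr0 divr1; lra.
have [H|H] := leP y (2^-1 / 2 ^+ m); last exact: IH.
exists m; rewrite H /=; move: mP; rewrite exprS invfM mulrCA.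
by move: (2^-1 / _) => z; lra.
Qed.

(** * Moments on circles *)

Section CircleMoments.
Variable R : realType.
Local Notation C := R[i].
Notation mu := (@lebesgue_measure R).
Variable omega : cplane R -> R.
Local Notation w := (profile omega).
Local Notation W := (tail omega).
Local Notation S := (star_profile omega).
Local Notation Y := (log_growth omega).
Hypothesis omega_crw : continuous_radial_weight omega.
Variable D : R.
Hypothesis D1 : 1 <= D.
Hypothesis dbl : forall r : R, 0 <= r < 1 -> W r <= D * W ((1 + r) / 2).
Variables (g : cplane R -> cplane R) (M B : R).
Hypothesis ga : analytic g.
Hypothesis M0 : 0 <= M.
Hypothesis HM : forall I : R * R, is_arc I ->
  (polar_box I (fun r t => cmod (cderiv g (cpolar r t)) ^+ 2 * S r * r)%R
    <= (M * (W (arc_radius I) * arc_length I))%:E)%E.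
Hypothesis gB : forall z : cplane R, cmod z < 1 -> cmod (cderiv g z) * (1 - cmod z) <= B.

Local Notation C1 := (osc_const D M B + 1).
Local Notation q r := (fun t => cmod (g (cpolar r t)) ^+ 2).

Let B0 : 0 <= B := bloch_ge0 gB.
Let C10 : 0 < C1.
Proof. by apply: ltr_wpDl => //; exact: osc_const_ge0. Qed.

(** The two points lie in a common hyperbolic disc of bounded radius: move
    along the radius first, then along the inner circle. *)
Lemma bloch_near (r0 r1 t0 t1 : R) : 0 < r0 -> r0 <= r1 -> r1 < 1 ->
  r1 - r0 <= 1 - r1 -> `|t1 - t0| <= (1 - r0) / 2 ->
  cmod (g (cpolar r1 t1) - g (cpolar r0 t0)) ^+ 2 <= 9 * B ^+ 2.
Proof.
move=> r00 r01 r11 rr tt; have r0l : r0 < 1 := le_lt_trans r01 r11.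
have n1 : 0 < 1 - r1 by rewrite subr_gt0.
have n0 : 0 < 1 - r0 by rewrite subr_gt0.
have h1 : cmod (g (cpolar r1 t1) - g (cpolar r0 t1)) <= 2 * B.
  apply: (le_trans (bloch_radial ga gB t1 r00 r01 r11)).
  apply: ler_wpM2l; first exact: ler0n.
  by rewrite ler_piMr // ler_pdivrMr // mul1r.
have small x : x <= (1 - r0) / 2 -> 2 * (B * (x / (1 - r0))) <= B.
  move=> xs; have -> : 2 * (B * (x / (1 - r0))) = B * (2 * x / (1 - r0)) by ring.
  rewrite ler_piMr // ler_pdivrMr // mul1r; move: xs; lra.
have h2 : cmod (g (cpolar r0 t1) - g (cpolar r0 t0)) <= B.
  move: tt; rewrite ler_norml => /andP[ta tb].
  have [t01|t10] := leP t0 t1.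
    by apply: (le_trans (bloch_angular ga gB r00 r0l t01)); exact: small.
  rewrite cmodB; apply: (le_trans (bloch_angular ga gB r00 r0l (ltW t10))).
  by apply: small; lra.
have h3 : cmod (g (cpolar r1 t1) - g (cpolar r0 t0)) <= 3 * B.
  have -> : g (cpolar r1 t1) - g (cpolar r0 t0) =
    (g (cpolar r1 t1) - g (cpolar r0 t1)) + (g (cpolar r0 t1) - g (cpolar r0 t0)).
    by rewrite addrA subrK.
  apply: (le_trans (cmodD_le _ _)); move: h1 h2; move: (cmod _) (cmod _) => x y; lra.
have -> : 9 * B ^+ 2 = (3 * B) ^+ 2 by ring.
by rewrite lerXn2r ?nnegrE ?cmod_ge0 // mulr_ge0.
Qed.

Lemma cts_shift_sqr (rho : R) (c : cplane R) (a b : R) : 0 <= rho < 1 ->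
  cts_on (fun t => cmod (g (cpolar rho t) - c) ^+ 2) a b.
Proof.
move=> rb; have ga' : analytic (fun z => g z - c).
  by move=> z z1; apply: derivableB => //; exact: ga.
exact: (@cts_circle_sqr R _ ga' a b rho rb).
Qed.

(** The dyadic inequality on arcs of length [2^(-j)], the centre of an arc
    of length [l] being the value of [g] at the hyperbolic centre [(1 - l)
    e^(i t)] of its Carleson square; the leaves have length comparable to [1
    - rho]. *)
Lemma arc_oscillation_moment (n : nat) (rho x : R) : 2^-1 <= rho < 1 ->
  rint x (x + 2^-1) (fun t => (cmod (g (cpolar rho t) - g (cpolar 2^-1 (x + 4^-1))) ^+ 2) ^+ n) <=
  4 ^+ n * (16 * 4 ^+ n * C1 * Y rho + 18 * B ^+ 2) ^+ n.
Proof.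
move=> /andP[r2 r1]; have rb : 0 <= rho < 1 by rewrite r1 andbT; lra.
have y12 : 0 < 1 - rho <= 2^-1 by rewrite subr_gt0 r1 /=; lra.
have [N /andP[y1 y2]] := dyadic_scale y12; set l0 : R := 2^-1 / 2 ^+ N in y1 y2.
have p0 d : 0 < 2 ^+ d :> R by rewrite exprn_gt0.
have l00 : 0 < l0 by rewrite /l0 divr_gt0.
pose len := dyadic_length l0.
have lenN : len N = 2^-1 by rewrite /len /dyadic_length /l0 mulrC divfK // gt_eqF.
have len0 : len 0%N = l0 by rewrite /len /dyadic_length expr0 mul1r.
have lenS d : len d.+1 = 2 * len d by rewrite /len /dyadic_length exprS mulrA.
have lenb d : (d <= N)%N -> l0 <= len d <= 2^-1.
  move=> dN; apply/andP; split.
    by rewrite /len /dyadic_length ler_peMl ?(ltW l00) // exprn_ege1 // ler1n.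
  by rewrite -lenN /len /dyadic_length ler_wpM2r ?(ltW l00) // ler_eXn2l // ltr1n.
have Y1 := log_growth_ge1 omega_crw rb.
have Y0 : 0 < Y rho := lt_le_trans ltr01 Y1.
(* The summand 1 in the constant makes the threshold [Lam] positive. *)
pose V := C1 * Y rho; have V0 : 0 < V by rewrite /V mulr_gt0.
pose Lam := 8 * 4 ^+ n * V.
have A0 : 0 < 4 ^+ n :> R by rewrite exprn_gt0.
have Lam0 : 0 < Lam by rewrite /Lam mulr_gt0 // mulr_gt0.
pose cc d x := g (cpolar (1 - len d) (x + len d / 2)).
have kk0 : 0 <= 9 * B ^+ 2 by apply: mulr_ge0; [exact: ler0n|exact: sqr_ge0].
have cf c a b : cts_on (fun t => cmod (g (cpolar rho t) - c) ^+ 2) a b by exact: cts_shift_sqr.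
have osc d y : (d <= N)%N ->
    rint y (y + len d) (fun t => cmod (g (cpolar rho t) - cc d y) ^+ 2) <= V * len d.
  move=> dN; have /andP[d1 d2] := lenb d dN; have ld0 : 0 < len d := lt_le_trans l00 d1.
  have hb : 0 < len d <= 2^-1 by rewrite ld0.
  have hr : 1 - len d <= rho by lra.
  have H := circle_oscillation omega_crw D1 dbl ga M0 HM gB (y + len d / 2) hb hr r1.
  have e1 : y + len d / 2 - len d / 2 = y by rewrite addrK.
  have e2 : y + len d / 2 + len d / 2 = y + len d by rewrite -addrA -mulrDr -{1}(mulr1 (len d)) ; congr (_ + _); field.
  rewrite e1 e2 in H; apply: (le_trans H).
  have -> : V * len d = osc_const D M B * len d * Y rho + len d * Y rho by rewrite /V; ring.
  by rewrite lerDl mulr_ge0 // ltW.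
have leaf y t : y <= t <= y + len 0%N -> cmod (g (cpolar rho t) - cc 0%N y) ^+ 2 <= 9 * B ^+ 2.
  move=> /andP[ta tb]; have /andP[d1 d2] := lenb 0%N (leq0n N).
  rewrite len0 in d1 d2 tb *; rewrite /cc len0.
  have q1 : 0 < 1 - l0 by lra.
  have q2 : 1 - l0 <= rho by lra.
  have q3 : rho - (1 - l0) <= 1 - rho by lra.
  apply: bloch_near => //; rewrite ler_norml; apply/andP; split; lra.
have child d y : (d < N)%N ->
    cmod (cc d y - cc d.+1 y) ^+ 2 <= 9 * B ^+ 2 /\
    cmod (cc d (y + len d) - cc d.+1 y) ^+ 2 <= 9 * B ^+ 2.
  move=> dN; have /andP[d1 d2] := lenb d.+1 dN; rewrite lenS in d1 d2.
  have /andP[d3 d4] := lenb d (ltnW dN).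
  rewrite /cc lenS.
  have q1 : 0 < 1 - 2 * len d by lra.
  have q2 : 1 - 2 * len d <= 1 - len d by lra.
  have q3 : 1 - len d < 1 by lra.
  have q4 : 1 - len d - (1 - 2 * len d) <= 1 - (1 - len d) by lra.
  by split; apply: bloch_near => //; rewrite ler_norml; apply/andP; split; lra.
have T := dyadic_moment l00 kk0 (ltW V0) Lam0 (lexx _) cf osc leaf child x (leqnn N).
rewrite -/len lenN in T.
have ccN : cc N x = g (cpolar 2^-1 (x + 4^-1)).
  by rewrite /cc lenN; congr (g (cpolar _ (x + _))); field.
rewrite ccN in T; apply: (le_trans T).
have -> : 2 * Lam + 2 * (9 * B ^+ 2) = 16 * 4 ^+ n * C1 * Y rho + 18 * B ^+ 2 by rewrite /Lam /V; ring.
by rewrite le_eqVlt; apply/orP; left; apply/eqP; field.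
Qed.

Lemma arc_moment (n : nat) : exists2 c : R, 0 <= c & forall rho x : R, 2^-1 <= rho < 1 ->
  rint x (x + 2^-1) (fun t => q rho t ^+ n) <= c * Y rho ^+ n.
Proof.
have [|K0 K00 HK] := @analytic_bounded R g 2^-1 ga; first by lra.
pose E := 16 * 4 ^+ n * C1 + 18 * B ^+ 2.
have A0 : 0 < 4 ^+ n :> R by rewrite exprn_gt0.
have BB : 0 <= 18 * B ^+ 2 by apply: mulr_ge0; [exact: ler0n|exact: sqr_ge0].
have E1 : 0 <= 16 * 4 ^+ n * C1.
  by apply: mulr_ge0; [apply: mulr_ge0; [exact: ler0n|exact: ltW]|exact: ltW].
have E0 : 0 <= E by exact: addr_ge0.
have F0 : 0 <= (K0 ^+ 2) ^+ n by rewrite exprn_ge0 // exprn_ge0 // ltW.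
have G0 : 0 <= 4 ^+ n * E ^+ n by rewrite mulr_ge0 ?(ltW A0) // exprn_ge0.
exists (4 ^+ n * (4 ^+ n * E ^+ n + (K0 ^+ 2) ^+ n)).
  by rewrite mulr_ge0 ?(ltW A0) // addr_ge0.
move=> rho x rb; have /andP[r2 r1] := rb.
have rb' : 0 <= rho < 1 by rewrite r1 andbT; lra.
have Y1 := log_growth_ge1 omega_crw rb'; have Yn1 : 1 <= Y rho ^+ n by exact: exprn_ege1.
set c0 := g (cpolar 2^-1 (x + 4^-1)).
have c0K : cmod c0 ^+ 2 <= K0 ^+ 2.
  rewrite lerXn2r ?nnegrE ?cmod_ge0 ?(ltW K00) //; apply: HK.
  by rewrite cmod_cpolar // invr_ge0 ler0n.
have xx : x <= x + 2^-1 by lra.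
have cq c : cts_on (fun t => (cmod (g (cpolar rho t) - c) ^+ 2) ^+ n) x (x + 2^-1).
  by apply: cts_onX; exact: cts_shift_sqr.
have cq0 : cts_on (fun t => q rho t ^+ n) x (x + 2^-1).
  by apply: cts_onX; exact: (@cts_circle_sqr R _ ga x _ rho rb').
have cs : cts_on (fun t => (cmod (g (cpolar rho t) - c0) ^+ 2) ^+ n + (K0 ^+ 2) ^+ n) x (x + 2^-1).
  by apply: cts_onD; [exact: cq|exact: cts_on_cst].
apply: (@le_trans _ _ (rint x (x + 2^-1) (fun t =>
    4 ^+ n * ((cmod (g (cpolar rho t) - c0) ^+ 2) ^+ n + (K0 ^+ 2) ^+ n)))).
  apply: le_rint => [||t _]; first exact: cq0.
    by apply: cts_onM; [exact: cts_on_cst|exact: cs].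
  apply: power_sum_le; [exact: sqr_ge0|exact: sqr_ge0|exact: sqr_ge0|].
  have := sqr_triangle (g (cpolar rho t)) c0 0; rewrite !subr0 => H; apply: (le_trans H).
  by rewrite lerD2l; apply: ler_wpM2l => //; exact: ler0n.
rewrite rintZ // -mulrA; apply: ler_wpM2l; first exact: ltW.
rewrite rintD //; last exact: cts_on_cst.
rewrite rint_cst // mulrDl; apply: lerD.
  apply: (le_trans (arc_oscillation_moment n x rb)).
  rewrite -[X in _ <= X]mulrA -[X in _ <= _ * X]exprMn.
  apply: ler_wpM2l; first exact: ltW.
  have YY : 0 <= Y rho by exact: le_trans Y1.
  have L0 : 0 <= 16 * 4 ^+ n * C1 * Y rho + 18 * B ^+ 2.
    by apply: addr_ge0 => //; apply: mulr_ge0.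
  have R0 : 0 <= E * Y rho by exact: mulr_ge0.
  have LR : 16 * 4 ^+ n * C1 * Y rho + 18 * B ^+ 2 <= E * Y rho.
    by rewrite [E * _]mulrDl lerD2l ler_peMr.
  by rewrite lerXn2r ?nnegrE.
have -> : x + 2^-1 - x = 2^-1 by ring.
by apply: ler_wpM2l => //; apply: le_trans Yn1; lra.
Qed.

Lemma circle_moment (n : nat) : exists2 c : R, 0 <= c & forall rho : R, 2^-1 <= rho < 1 ->
  rint 0 8 (fun t => q rho t ^+ n) <= c * Y rho ^+ n.
Proof.
have [c c0 H] := arc_moment n; exists (16 * c); first by apply: mulr_ge0 => //; exact: ler0n.
move=> rho rb; have /andP[r2 r1] := rb.
have rb' : 0 <= rho < 1 by rewrite r1 andbT; lra.
have cq a b : cts_on (fun t => q rho t ^+ n) a b.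
  by apply: cts_onX; exact: (@cts_circle_sqr R _ ga a b rho rb').
suff L N : rint 0 (N%:R * 2^-1) (fun t => q rho t ^+ n) <= N%:R * (c * Y rho ^+ n).
  have := L 16%N; have -> : 16%:R * 2^-1 = 8 :> R by field.
  by rewrite mulrA.
elim: N => [|N IH]; first by rewrite !mul0r /rint set_itv1 Rintegral_set1.
have e : N.+1%:R * 2^-1 = N%:R * 2^-1 + 2^-1 :> R by rewrite -natr1 mulrDl mul1r.
have nn : 0 <= N%:R * 2^-1 :> R by rewrite mulr_ge0 ?ler0n ?invr_ge0 ?ler0n.
have nm : N%:R * 2^-1 <= N.+1%:R * 2^-1 :> R by rewrite e lerDl invr_ge0 ler0n.
have mid : 0 <= (N%:R * 2^-1 : R) <= N.+1%:R * 2^-1 by rewrite nn.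
have Sp := rint_split (@cq 0 (N.+1%:R * 2^-1)) mid.
have Ne : N.+1%:R * (c * Y rho ^+ n) = N%:R * (c * Y rho ^+ n) + c * Y rho ^+ n.
  by rewrite -[N.+1%:R]natr1 mulrDl mul1r.
rewrite Sp e Ne.
by apply: lerD => //; exact: H.
Qed.

End CircleMoments.

(** * Membership in the Bergman spaces *)

Section BergmanMembership.
Variable R : realType.
Local Notation C := R[i].
Notation mu := (@lebesgue_measure R).
Variable omega : cplane R -> R.
Local Notation w := (profile omega).
Local Notation W := (tail omega).
Local Notation Y := (log_growth omega).
Hypothesis omega_crw : continuous_radial_weight omega.

(** This is [sqrt (W 0 / W r)]. *)
Definition half_growth (r : R) := expR (2^-1 * (ln (W 0) - ln (W r))).
Local Notation H := half_growth.

Let W00 : 0 < W 0. Proof. by apply: (tail_gt0 omega_crw) => //; exact: ltr01. Qed.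

Lemma half_growth_ge1 (r : R) : 0 <= r < 1 -> 1 <= H r.
Proof.
move=> rb; have := log_growth_ge1 omega_crw rb; rewrite /log_growth lerDl => h.
by rewrite -expR0 ler_expR mulr_ge0 // invr_ge0 ler0n.
Qed.

(** From [1 + y / (2 n) <= e^(y / (2 n))]: any power of the logarithm of the
    tail is absorbed by half a power of the tail. *)
Lemma log_growth_power (r : R) (n : nat) : 0 <= r < 1 -> Y r ^+ n.+1 <= (2 * n.+1%:R) ^+ n.+1 * H r.
Proof.
move=> rb; have Y1 := log_growth_ge1 omega_crw rb; set y := ln (W 0) - ln (W r).
have y0 : 0 <= y by move: Y1; rewrite /log_growth lerDl.
set m := n.+1; have m1 : 1 <= m%:R :> R by rewrite ler1n.
have m0 : 0 < m%:R :> R by rewrite ltr0n.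
have m20 : 0 < 2 * m%:R :> R by rewrite mulr_gt0.
have -> : H r = expR (y / (2 * m%:R)) ^+ m.
  rewrite -expRM_natl /H -/y; congr expR; field; exact: lt0r_neq0.
have YY : 0 <= Y r by exact: le_trans Y1.
have EE : 0 <= 2 * m%:R * expR (y / (2 * m%:R)) by rewrite mulr_ge0 ?expR_ge0 // ltW.
rewrite -exprMn; apply: lerXn2r; rewrite ?nnegrE //.
have h := expR_ge1Dx (y / (2 * m%:R)).
apply: (@le_trans _ _ (2 * m%:R * (1 + y / (2 * m%:R)))); last by rewrite ler_pM2l.
have -> : 2 * m%:R * (1 + y / (2 * m%:R)) = 2 * m%:R + y by field; exact: lt0r_neq0.
by rewrite /log_growth -/y lerD2r; lra.
Qed.

(** The function [- 2 sqrt (W 0 W)] is a primitive of [w sqrt (W 0 / W)];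
    that it is bounded is the reason for the Bergman integrals to converge. *)
Lemma is_derive_sqrt_tail (r : R) : 0 < r < 1 ->
  is_derive r (1 : R) (fun s => - 2 * expR (2^-1 * ln (W 0)) * expR (2^-1 * - - ln (W s))) (w r * H r).
Proof.
move=> rb; have /andP[r0 r1] := rb; have Wr := tail_gt0 omega_crw (ltW r0) r1.
have dl := isdZ (-1) (is_derive_ln_tail omega_crw rb).
have dl2 := isdZ 2^-1 dl.
have de := @is_derive1_comp R expR (fun y => 2^-1 * (-1 * - ln (W y))) r _ _ (is_derive_expR _) dl2.
have d := isdZ (- 2 * expR (2^-1 * ln (W 0))) de.
have -> : (fun s => - 2 * expR (2^-1 * ln (W 0)) * expR (2^-1 * - - ln (W s))) =
   (fun s => - 2 * expR (2^-1 * ln (W 0)) * (expR \o (fun y => 2^-1 * (-1 * - ln (W y)))) s).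
  by apply/funext => s /=; rewrite mulN1r.
apply: is_derive_eq.
rewrite /H mulrBr expRB mulN1r opprK.
have E : expR (2^-1 * ln (W r)) * expR (2^-1 * ln (W r)) = W r.
  by rewrite -expRD -mulrDl (_ : 2^-1 + 2^-1 = 1) ?mul1r ?lnK ?posrE //; field.
have e0 := expR_gt0 (2^-1 * ln (W r)).
rewrite -[in w r / W r]E; move: (expR _) (expR _) e0 (w r) => a b b0 v.
by field; exact: lt0r_neq0.
Qed.

Lemma cts_weighted_growth (a b : R) : 0 < a -> b < 1 -> cts_on (fun r => w r * H r) a b.
Proof.
move=> a0 b1; apply: cts_onM; first by apply: (profile_cts_on omega_crw) => //; exact: ltW.
move=> r /andP[ra rb]; have rr : 0 < r < 1 by rewrite (lt_le_trans a0) //= (le_lt_trans rb).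
have d := isdZ 2^-1 (isdD (isd_cst (ln (W 0)) r) (is_derive_ln_tail omega_crw rr)).
have de := @is_derive1_comp R expR (fun y => 2^-1 * (ln (W 0) + - ln (W y))) r _ _ (is_derive_expR _) d.
exact: (is_derive_cts de).
Qed.

Lemma primitive_drop (u v z W0 : R) : u * u = W0 -> 0 < u -> v <= u -> 0 <= z ->
  - 2 * u * z - - 2 * u * v <= 2 * W0.
Proof.
move=> <- u0 vu z0; have h1 := ler_wpM2l (ltW u0) vu; have h2 := mulr_ge0 (ltW u0) z0.
have -> : - 2 * u * z - - 2 * u * v = 2 * (u * v) - 2 * (u * z) by ring.
by move: h1 h2; move: (u * v) (u * z) (u * u) => x y t; lra.
Qed.

Lemma weighted_growth_mass (a b : R) : 0 < a -> a <= b -> b < 1 ->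
  rint a b (fun r => w r * H r) <= 2 * W 0.
Proof.
move=> a0 ab b1; have in01 r : a <= r <= b -> 0 < r < 1.
  by move=> /andP[ra rb]; rewrite (lt_le_trans a0) //= (le_lt_trans rb).
have dd r : a <= r <= b -> is_derive r (1 : R)
    (fun s => - 2 * expR (2^-1 * ln (W 0)) * expR (2^-1 * - - ln (W s))) (w r * H r).
  by move=> /in01; exact: is_derive_sqrt_tail.
rewrite (rint_FTC ab (cts_weighted_growth a0 b1) dd) !opprK.
have E : expR (2^-1 * ln (W 0)) * expR (2^-1 * ln (W 0)) = W 0.
  by rewrite -expRD -mulrDl (_ : 2^-1 + 2^-1 = 1) ?mul1r ?lnK ?posrE //; field.
have a1 : a < 1 := le_lt_trans ab b1.
have Wa : 0 < W a := tail_gt0 omega_crw (ltW a0) a1.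
have h : expR (2^-1 * ln (W a)) <= expR (2^-1 * ln (W 0)).
  rewrite ler_expR ler_wpM2l ?invr_ge0 ?ler0n // ler_ln ?posrE //.
  exact: (tail_mono omega_crw (lexx 0) (ltW a0) a1).
have e0 := expR_ge0 (2^-1 * ln (W b)); have e1 := expR_gt0 (2^-1 * ln (W 0)).
exact: primitive_drop E e1 h e0.
Qed.

(** Monotone convergence from the compact intervals [[1 / (n + 2), 1 - 1 /
    (n + 2)]], on which the primitive is available. *)
Lemma weighted_growth_integral :
  (\int[mu]_(r in `]0%R, 1%R[) (w r * H r)%:E <= (2 * W 0)%:E)%E.
Proof.
pose e n : R := (n.+2%:R)^-1.
have e0 n : 0 < e n by rewrite invr_gt0 ltr0n.
have e2 n : e n <= 2^-1 by rewrite lef_pV2 ?posrE ?ltr0n // ler_nat.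
pose F n : set R := `[e n, 1 - e n]%classic.
have wp (r : R) : 0 < r < 1 -> 0 <= w r * H r.
  move=> /andP[r0 r1]; rewrite mulr_ge0 ?expR_ge0 //; apply: ltW.
  by apply: (profile_gt0 omega_crw); rewrite (ltW r0).
have inF n r : F n r -> 0 < r < 1.
  rewrite /F /= in_itv /= => /andP[ra rb]; rewrite (lt_le_trans (e0 n) ra) /=.
  by apply: (le_lt_trans rb); rewrite gtrBl.
have cw n : cts_on (fun r => w r * H r) (e n) (1 - e n).
  by apply: cts_weighted_growth => //; rewrite gtrBl.
have ndF : nondecreasing_seq F.
  apply/nondecreasing_seqP => n; apply/subsetPset => r.
  rewrite /F /= !in_itv /= => /andP[ra rb].
  have ee : e n.+1 <= e n by rewrite lef_pV2 ?posrE ?ltr0n // ler_nat.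
  by rewrite (le_trans ee ra) (le_trans rb) // lerD2l lerN2.
have mF n : measurable (F n) by exact: measurable_itv.
have mf n : measurable_fun (F n) (fun r => (w r * H r)%:E).
  have := rint_integrable (cw n) => /integrableP[+ _]; exact.
have f0 n r : F n r -> (0 <= (w r * H r)%:E)%E by move=> /inF/wp; rewrite lee_fin.
have U : \bigcup_n F n = `]0%R, 1%R[%classic.
  apply/seteqP; split => r.
    by move=> [n _ /inF rb] /=; rewrite in_itv.
  rewrite /= in_itv /= => /andP[r0 r1].
  pose d := Num.min r (1 - r); have d0 : 0 < d by rewrite lt_min r0 subr_gt0.
  have di : 0 <= d^-1 by rewrite invr_ge0 ltW.
  have /andP[_ t2] := truncn_itv di.
  exists (Num.truncn d^-1) => //; rewrite /F /= in_itv /=.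
  have ed : e (Num.truncn d^-1) <= d.
    rewrite /e -[leRHS]invrK lef_pV2 ?posrE ?invr_gt0 ?ltr0n //.
    by apply: (le_trans (ltW t2)); rewrite ler_nat.
  have := ed; rewrite /d le_min => /andP[x1 x2]; rewrite x1 /=; move: x2.
  by move: (e _) => z; lra.
have CV : ((\int[mu]_(r in F n) (w r * H r)%:E)%E @[n --> \oo] -->
    (\int[mu]_(r in \bigcup_i F i) (w r * H r)%:E)%E).
  by apply: ge0_nondecreasing_set_cvg_integral.
rewrite U in CV; rewrite -(cvg_lim _ CV) //.
apply: lime_le; first by apply/cvg_ex; eexists; exact: CV.
apply: nearW => n; rewrite rint_EFin; last exact: cw.
rewrite lee_fin; apply: weighted_growth_mass => //; last by rewrite gtrBl.
by have := e2 n; lra.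
Qed.

Variables (g : cplane R -> cplane R).
Hypothesis ga : analytic g.
Local Notation q r := (fun t => cmod (g (cpolar r t)) ^+ 2).

Lemma powR_le_moment (x p : R) (n : nat) : 0 <= x -> 0 < p -> p <= n.*2%:R ->
  x `^ p <= 1 + (x ^+ 2) ^+ n.
Proof.
move=> x0 p0 pn; have s0 : 0 <= (x ^+ 2) ^+ n by rewrite exprn_ge0 // exprn_ge0.
have [x1|/ltW x1] := leP x 1.
  apply: (@le_trans _ _ 1); last by rewrite lerDl.
  have := ge0_ler_powR (ltW p0) (_ : x \in Num.nneg) (_ : 1 \in Num.nneg) x1.
  by rewrite powR1; apply; rewrite nnegrE.
apply: (@le_trans _ _ ((x ^+ 2) ^+ n)); last by rewrite lerDr.
by rewrite -exprM mul2n -powR_mulrn //; exact: ler_powR.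
Qed.

(** A power [p] is dominated by 1 plus an even power, whose circular means
    grow at most like a power of the logarithm of the tail; this is
    integrable against the weight. *)
Lemma bergman_of_moments (p : R) : 0 < p ->
  (forall n, exists2 c : R, 0 <= c & forall rho : R, 2^-1 <= rho < 1 ->
     rint 0 8 (fun t => q rho t ^+ n) <= c * Y rho ^+ n) ->
  bergman p omega g.
Proof.
move=> p0 HC; split => //.
pose n := (Num.truncn p).+1.
have /andP[_ pt] := truncn_itv (ltW p0).
have pn : p <= n.*2%:R by apply: (le_trans (ltW pt)); rewrite ler_nat -addnn leq_addr.
have [c c0 Hc] := HC n.
have [|K0 K00 HK] := @analytic_bounded R g 2^-1 ga; first by lra.
have F0 : 0 <= (K0 ^+ 2) ^+ n by rewrite exprn_ge0 // exprn_ge0 // ltW.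
have N0 : 0 <= (2 * n%:R) ^+ n :> R by rewrite exprn_ge0 // mulr_ge0.
pose E := 8 + c * (2 * n%:R) ^+ n + 8 * (K0 ^+ 2) ^+ n.
have E0 : 0 <= E by rewrite /E !addr_ge0 ?mulr_ge0.
have cq (r a b : R) : 0 <= r < 1 -> cts_on (fun t => q r t ^+ n) a b.
  by move=> rb; apply: cts_onX; exact: (@cts_circle_sqr R _ ga a b r rb).
have mean (r : R) : 0 < r < 1 -> rint 0 8 (fun t => 1 + q r t ^+ n) <= E * H r.
  move=> /andP[r0 r1]; have rb : 0 <= r < 1 by rewrite (ltW r0).
  have H1 := half_growth_ge1 rb; have H0 : 0 <= H r by exact: le_trans H1.
  rewrite rintD; [|exact: cts_on_cst|exact: cq].
  rewrite rint_cst ?ler0n // mul1r subr0.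
  have -> : E * H r = 8 * H r + c * (2 * n%:R) ^+ n * H r + 8 * (K0 ^+ 2) ^+ n * H r.
    by rewrite /E; move: (_ ^+ n) (_ ^+ n) (H r) => x y z; ring.
  have h8 : 8 <= 8 * H r by rewrite ler_peMr // ler0n.
  have [r2|r2] := leP 2^-1 r.
    have rr2 : 2^-1 <= r < 1 by rewrite r2.
    have h := Hc r rr2.
    have h2 := ler_wpM2l c0 (log_growth_power (Num.truncn p) rb); rewrite -/n mulrA in h2.
    have h3 : 0 <= 8 * (K0 ^+ 2) ^+ n * H r by rewrite mulr_ge0 // mulr_ge0.
    apply: (@le_trans _ _ (8 * H r + c * (2 * n%:R) ^+ n * H r)); last by rewrite lerDl.
    by apply: lerD => //; exact: le_trans h2.
  have h3 : 0 <= c * (2 * n%:R) ^+ n * H r by rewrite mulr_ge0 // mulr_ge0.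
  have h4 : rint 0 8 (fun t => q r t ^+ n) <= 8 * (K0 ^+ 2) ^+ n * H r.
    apply: (@le_trans _ _ ((K0 ^+ 2) ^+ n * (8 - 0))).
      apply: rint_le_cst; [exact: ler0n|exact: cq|move=> t _].
      rewrite lerXn2r ?nnegrE ?sqr_ge0 // lerXn2r ?nnegrE ?cmod_ge0 ?(ltW K00) //.
      by apply: HK; rewrite cmod_cpolar ?ltW.
    by rewrite subr0 mulrC ler_peMr // mulr_ge0.
  by apply: lerD => //; apply: (le_trans h8); rewrite lerDl.
pose G (z : cplane R) := cmod (g z) `^ p * omega z.
have mG : measurable_fun (@plane_disc R) (fun x => G (of_plane x)).
  apply: measurable_funM; last exact: measurable_omega.
  have -> : (fun x : R * R => cmod (g (of_plane x)) `^ p) =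
     (fun y => y `^ (p / 2)) \o (fun x => cmod (g (of_plane x)) ^+ 2).
    apply/funext => x /=; rewrite -powR_mulrn ?cmod_ge0 // -powRrM.
    by congr (_ `^ _); field.
  by apply: measurableT_comp; [exact: measurable_powR|exact: measurable_cmod_sqr].
have G0 z : disc z -> 0 <= G z.
  by move=> zd; rewrite mulr_ge0 ?powR_ge0 //; exact: (omega_ge0 omega_crw).
rewrite (area_disc mG G0).
have pi8 : 2 * pi <= 8 :> R by have := pihalf_lt2 R; lra.
have bound : (\int[mu]_(r in `]0%R, 1%R[) \int[mu]_(t in `[0%R, (2 * pi)%R[) (G (cpolar r t) * r)%:E
   <= (E * (2 * W 0))%:E)%E.
  apply: (@le_trans _ _ (\int[mu]_(r in `]0%R, 1%R[) (E * (w r * H r))%:E)%E).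
    apply: ge0_le_integral_same => r /=; rewrite in_itv /= => rr; have /andP[r0 r1] := rr.
    have rb : 0 <= r < 1 by rewrite (ltW r0).
    have dp t : disc (cpolar r t : cplane R) by apply/disc_polar => //; exact: ltW.
    have wr : 0 < w r := profile_gt0 omega_crw rb.
    apply/andP; split.
      by apply: integral_ge0 => t _; rewrite lee_fin mulr_ge0 ?(ltW r0) // G0.
    have cc : cts_on (fun t => w r * (1 + q r t ^+ n)) 0 8.
      by apply: cts_onM; [exact: cts_on_cst|apply: cts_onD; [exact: cts_on_cst|exact: cq]].
    apply: (@le_trans _ _ (\int[mu]_(t in `[0%R, 8%R]) (w r * (1 + q r t ^+ n))%:E)%E).
      apply: ge0_le_integral_sub.
      - move=> t /=; rewrite !in_itv /= => /andP[-> t2] /=.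
        exact: (le_trans (ltW t2)).
      - move=> t _; rewrite lee_fin mulr_ge0 ?(ltW wr) // addr_ge0 // exprn_ge0 //; exact: sqr_ge0.
      move=> t _; rewrite !lee_fin mulr_ge0 ?(ltW r0) ?G0 //= /G.
      have -> : omega (cpolar r t) = w r by rewrite (profileE omega_crw) ?cmod_cpolar ?(ltW r0).
      have P := powR_le_moment (cmod_ge0 (g (cpolar r t))) p0 pn.
      apply: (@le_trans _ _ (cmod (g (cpolar r t)) `^ p * w r)).
        by rewrite ler_piMr ?(ltW r1) // mulr_ge0 ?powR_ge0 ?(ltW wr).
      by rewrite mulrC ler_pM2l.
    rewrite rint_EFin // lee_fin rintZ; last by apply: cts_onD; [exact: cts_on_cst|exact: cq].
    rewrite mulrCA; apply: ler_wpM2l; [exact: ltW|exact: mean].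
  have mw : measurable_fun (`]0%R, 1%R[%classic : set R) (fun r => (w r * H r)%:E).
    apply/measurable_EFinP; apply: open_continuous_measurable_fun; first exact: interval_open.
    move=> r; rewrite inE /= in_itv /= => /andP[r0 r1].
    have c1 : cts_on (fun r => w r * H r) r r by exact: cts_weighted_growth.
    by apply: c1; rewrite lexx.
  have -> : (\int[mu]_(r in `]0%R, 1%R[) (E * (w r * H r))%:E =
     E%:E * \int[mu]_(r in `]0%R, 1%R[) (w r * H r)%:E)%E.
    rewrite -ge0_integralZl //.
    move=> r /=; rewrite in_itv /= => /andP[r0 r1]; rewrite lee_fin mulr_ge0 ?expR_ge0 //.
    by apply: ltW; apply: (profile_gt0 omega_crw); rewrite (ltW r0).
  rewrite EFinM; apply: lee_wpmul2l; [by rewrite lee_fin|exact: weighted_growth_integral].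
apply: (@le_lt_trans _ _ ((pi^-1)%:E * (E * (2 * W 0))%:E)%E).
  by apply: lee_wpmul2l => //; rewrite lee_fin invr_ge0 pi_ge0.
by rewrite -EFinM ltry.
Qed.

End BergmanMembership.

(** * The theorem *)

Section Inclusions.
Variable R : realType.
Variable omega : cplane R -> R.
Hypothesis omega_class : (@rapidly_increasing_weight R `|` @regular_weight R) omega.

Lemma class_crw : continuous_radial_weight omega.
Proof. by case: omega_class => -[]. Qed.

Lemma class_doubling : exists2 D : R, 1 <= D &
  forall r : R, 0 <= r < 1 -> tail omega r <= D * tail omega ((1 + r) / 2).
Proof.
have [K K1 wK] := profile_le_tail omega_class.
exact: (tail_doubling class_crw K1 wK).
Qed.

Lemma C1star_bergman (p : R) : 0 < p -> C1star omega `<=` bergman p omega.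
Proof.
move=> p0 g gC; have crw := class_crw; have [D D1 dbl] := class_doubling.
have [_ [B HB]] := C1star_bloch crw D1 dbl gC.
have [ga [M M0 HM]] := (C1starP crw g D1 dbl).1 gC.
have gB (z : cplane R) : cmod z < 1 -> cmod (cderiv g z) * (1 - cmod z) <= B.
  move=> z1; apply: (@le_trans _ _ (cmod (cderiv g z) * (1 - cmod z ^+ 2))).
    apply: ler_wpM2l; first exact: cmod_ge0.
    by rewrite lerD2l lerN2 expr2 ler_piMl ?cmod_ge0 // ltW.
  by apply: HB; exists z.
by apply: bergman_of_moments => // n; exact: (circle_moment crw D1 dbl ga M0 HM gB).
Qed.

Lemma BMOA_sub_C1star : @BMOA R `<=` C1star omega.
Proof. by have [D D1 dbl] := class_doubling; exact: (BMOA_C1star class_crw D1 dbl). Qed.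

Lemma C1star_sub_bloch : C1star omega `<=` @bloch R.
Proof. by have [D D1 dbl] := class_doubling; exact: (C1star_bloch class_crw D1 dbl). Qed.

End Inclusions.

Theorem proposition5p1 (R : realType) (omega : cplane R -> R) :
  [/\ (@rapidly_increasing_weight R `|` @regular_weight R) omega ->
        C1star omega `<=` \bigcap_(p in [set p : R | 0 < p]) bergman p omega,
      (@rapidly_increasing_weight R `|` @regular_weight R) omega ->
        @BMOA R `<=` C1star omega /\ C1star omega `<=` @bloch R,
      @regular_weight R omega -> C1star omega = @bloch R,
      @rapidly_increasing_weight R omega -> C1star omega `<` @bloch R
    & @rapidly_increasing_weight R omega ->
      essentially_increasing (fun r => omega (creal r)) ->
      essentially_increasing (fun r => psi omega r / (1 - r)) ->
        @BMOA R `<` C1star omega].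
Proof.
split.
- by move=> cls g gC p p0; exact: (C1star_bergman cls p0 gC).
- by move=> cls; split; [exact: (BMOA_sub_C1star cls)|exact: (C1star_sub_bloch cls)].
- move=> reg; have cls : (@rapidly_increasing_weight R `|` @regular_weight R) omega by right.
  apply/seteqP; split; first exact: (C1star_sub_bloch cls).
  have [K K1 HK] := regular_profile reg.
  have [D D1 dbl] := class_doubling cls.
  apply: (regular_bloch_C1star (class_crw cls) D1 dbl (le_trans ler01 K1)) => r rb.
  by have [] := HK r rb.
- move=> rap; have cls : (@rapidly_increasing_weight R `|` @regular_weight R) omega by left.
  split; first exact: (C1star_sub_bloch cls).
  by have [g gB gC] := rapid_bloch_not_C1star rap; move=> sub; exact: gC (sub g gB).
move=> rap h1 h2; have cls : (@rapidly_increasing_weight R `|` @regular_weight R) omega by left.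
split; first exact: (BMOA_sub_C1star cls).
by have [g gC gB] := rapid_C1star_not_BMOA rap h1 h2; move=> sub; exact: gB (sub g gC).
Qed.
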